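(* Assume that the path $t\mapsto\mathcal A_t$, $t\in[0,1]$, is admissible, i.e. $\ker\mathcal A_0=\ker\mathcal A_1=\{0\}$. Then $$\operatorname{sf}(\mathcal A_t,\ t\in[0,1])=\deg(\rho,\Omega,0),$$ that is, the spectral index $\iota_{\mathrm{SP}}(\mathcal A):=\operatorname{sf}(\mathcal A_t,t\in[0,1])$ equals the degree index $\iota_{\mathrm{PW}}(\psi,R):=\deg(\rho,\Omega,0)$.
   Context: Setting. $N\in\mathbb N$, $\operatorname{Sym}(N)$ is the space of real symmetric $N\times N$ matrices and $\Omega=\{t+is : t\in[0,1],\ s\in[-1,1]\}\subset\mathbb C$. Let $P,G\in C^1([0,1],\operatorname{Sym}(N))$ and $Q\in C^1([0,1],\operatorname{Mat}(N,\mathbb R))$, with $P(x)$ invertible for every $x\in[0,1]$. For every $t\in[0,1]$ let $C_t\in C^1([0,1],\operatorname{Sym}(N))$, with $C_0=0$ and $(t,x)\mapsto C_t(x)$ continuous. Boundary conditions. Let $R_0,R_1\in\operatorname{Mat}(2N,\mathbb R)$ and, for $u\in H^2([0,1],\mathbb C^N)$, $$\mathcal R(u)=R_0\begin{bmatrix}P(0)u'(0)+Q(0)u(0)\\ u(0)\end{bmatrix}+R_1\begin{bmatrix}P(1)u'(1)+Q(1)u(1)\\ u(1)\end{bmatrix},\qquad \mathcal D=\{u\in H^2([0,1],\mathbb C^N):\mathcal R(u)=0\}.$$ Operators. $\mathcal A_0$ is the operator on $L^2([0,1],\mathbb C^N)$ with domain $\mathcal D$ given by $\mathcal A_0u=-(Pu'+Qu)'+Q^{\mathsf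 T}u'+Gu$. It is a standing assumption that $R_0,R_1$ are such that $\mathcal A_0$ is self-adjoint. For $z=t+is\in\Omega$ put $C_z(x)=C_t(x)+is\,I$ and $\mathcal A_zu=\mathcal A_0u+C_zu$ with domain $\mathcal D$; in particular $\mathcal A_t=\mathcal A_0+C_t$ is self-adjoint for $t\in[0,1]$. Determinant map. With $w=(Pu'+Qu,u)^{\mathsf T}$ the equation $\mathcal A_zu=0$ (without boundary conditions) becomes $w'=JB_z(x)w$, where $$J=\begin{bmatrix}0&-I\\ I&0\end{bmatrix},\qquad B_z=\begin{bmatrix}P^{-1}&-P^{-1}Q\\-Q^{\mathsf T}P^{-1}&Q^{\mathsf T}P^{-1}Q-G-C_z\end{bmatrix}.$$ Let $\psi_z$ be the fundamental solution: $\psi_z'=JB_z\psi_z$, $\psi_z(0)=I_{2N}$. Define $\rho:\Omega\to\mathbb C$ by $\rho(z)=\det(R_0+R_1\psi_z(1))$. When $0\notin\rho(\partial\Omega)$ (which holds if $\ker\mathcal A_0=\ker\mathcal A_1=\{0\}$), $\deg(\rho,\Omega,0)$ is the Brouwer degree of $\rho$ on (the interior of) $\Omega$ with respect to $0$, where $\mathbb C\cong\mathbb R^2$; equivalently it is the winding number of $\rho|_{\partial\Omega}$ (counterclockwise) around $0$. Spectral flow. For a (gap-)continuous path $\mathcal A:[a,b]\to\{\text{closed self-adjoint Fredholm operators}\}$ choose a partition $a=t_0<\dots<t_n=b$ and $a_i>0$ such that, for $t\in[t_{i-1},t_i]$, $\pm a_i\notin\sigma(\mathcal A_t)$ and the spectral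 subspace $E_{[-a_i,a_i]}(\mathcal A_t)$ has finite dimension independent of $t$; then $\operatorname{sf}(\mathcal A,[a,b])=\sum_{i=1}^n\big(\dim E_{[0,a_i]}(\mathcal A_{t_i})-\dim E_{[0,a_i]}(\mathcal A_{t_{i-1}})\big)$, which is independent of the choices. Here $E_{[c,d]}$ is the direct sum of the eigenspaces with eigenvalue in $[c,d]$. *)

(* Defs.v *)
From HB Require Import structures.
From mathcomp Require Import all_boot all_order all_algebra.
From mathcomp Require Import complex.
From mathcomp Require Import all_classical all_reals all_analysis.

Set Implicit Arguments.
Unset Strict Implicit.
Unset Printing Implicit Defensive.

Import Order.TTheory GRing.Theory Num.Theory.
Import numFieldNormedType.Exports.

Local Open Scope classical_set_scope.
Local Open Scope ring_scope.
Local Open Scope complex_scope.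

Section Calculus.
Variable R : realType.
Local Notation mu := (@lebesgue_measure R).
Implicit Types f : R -> R.

(* Functions on [0,1] are total functions on R whose values outside [0,1] are
   never used. In particular the difference quotient at x only uses points
   x + h of [0,1], so that the derivative is one-sided at 0 and 1. *)
Definition diffquot01 f (x : R) : set_system R :=
  (h^-1 * (f (x + h) - f x)) @[h --> within [set h | 0 <= x + h <= 1] 0^'].

Definition derivable01 f (x : R) : Prop := cvg (diffquot01 f x).

Definition D01 f (x : R) : R := lim (diffquot01 f x).

Definition C1 f : Prop :=
  (forall x, 0 <= x <= 1 -> derivable01 f x) /\
  {within `[0, 1], continuous (D01 f)}.

Definition L2r f : Prop :=
  measurable_fun (`[0, 1] : set R) f /\ mu.-integrable `[0, 1] (fun x => (f x ^+ 2)%:E).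

(* H^1([0,1]): the primitives of square-integrable functions, i.e. the
   absolutely continuous functions with derivative in L^2. *)
Definition H1r f : Prop :=
  exists2 g, L2r g &
    forall x, 0 <= x <= 1 -> f x = f 0 + Rintegral mu `[0, x] g.

Definition H2r f : Prop := C1 f /\ H1r (D01 f).

Definition C1mx m n (F : R -> 'M[R]_(m, n)) : Prop :=
  forall i j, C1 (fun x => F x i j).

Definition cderivable01 (f : R -> R[i]) (x : R) : Prop :=
  derivable01 (fun y => complex.Re (f y)) x /\
  derivable01 (fun y => complex.Im (f y)) x.

Definition cD01 (f : R -> R[i]) (x : R) : R[i] :=
  D01 (fun y => complex.Re (f y)) x +i* D01 (fun y => complex.Im (f y)) x.

Definition derivable01mx m n (F : R -> 'M[R[i]]_(m, n)) (x : R) : Prop :=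
  forall i j, cderivable01 (fun y => F y i j) x.

Definition D01mx m n (F : R -> 'M[R[i]]_(m, n)) (x : R) : 'M[R[i]]_(m, n) :=
  \matrix_(i, j) cD01 (fun y => F y i j) x.

Definition cmx m n (M : 'M[R]_(m, n)) : 'M[R[i]]_(m, n) :=
  map_mx (real_complex R) M.

End Calculus.

(* L^2([0,1], C^N), and H^2([0,1], C^N), whose elements are represented by
   functions; two functions are the same element of L^2 when they satisfy
   aeeq. *)
Section HilbertSpace.
Variables (R : realType) (N : nat).
Local Notation mu := (@lebesgue_measure R).
Local Notation vfun := (R -> 'cV[R[i]]_N).
Implicit Types u v f g : vfun.

Definition aeeq u v : Prop := {ae mu, forall x, 0 <= x <= 1 -> u x = v x}.

Definition L2 u : Prop := forall i,
  L2r (fun x => complex.Re (u x i 0)) /\ L2r (fun x => complex.Im (u x i 0)).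

Definition H2 u : Prop := forall i,
  H2r (fun x => complex.Re (u x i 0)) /\ H2r (fun x => complex.Im (u x i 0)).

Definition inner u v : R[i] :=
  let dot x := \sum_i u x i 0 * (v x i 0)^* in
  Rintegral mu `[0, 1] (fun x => complex.Re (dot x)) +i*
  Rintegral mu `[0, 1] (fun x => complex.Im (dot x)).

Definition norm2 u : R := Num.sqrt (complex.Re (inner u u)).

End HilbertSpace.

Section Operators.
Variables (R : realType) (N : nat).
Local Notation vfun := (R -> 'cV[R[i]]_N).

(* Unbounded operators on L^2 are given by their graphs: A u f means that u is
   in the domain of A and A u = f. *)
Definition operator := vfun -> vfun -> Prop.
Implicit Types A : operator.

Definition densely_defined A : Prop :=
  forall f, L2 f -> forall e : R, 0 < e ->
    exists u g, A u g /\ norm2 (fun x => f x - u x) < e.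

Definition adjoint A : operator := fun v w =>
  [/\ L2 v, L2 w & forall u f, A u f -> inner f v = inner u w].

Definition self_adjoint A : Prop :=
  densely_defined A /\ forall v w, adjoint A v w <-> A v w.

Definition ker_trivial A : Prop :=
  forall u, A u (fun=> 0) -> aeeq u (fun=> 0).

(* The graph of A - lambda. *)
Definition shift_op A (lambda : R[i]) : operator := fun u f =>
  exists2 g, A u g & aeeq f (fun x => g x - lambda *: u x).

(* A - lambda is a bijection from its domain onto L^2 with bounded inverse. *)
Definition resolvent_set A : set R[i] := [set lambda |
  exists M : R, forall f, L2 f ->
    exists u, [/\ shift_op A lambda u f,
                  forall v, shift_op A lambda v f -> aeeq v u
                & norm2 u <= M * norm2 f]].

Definition spectrum A : set R[i] := ~` resolvent_set A.

Definition eigenspace A (lambda : R) : set vfun :=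
  [set u | shift_op A lambda%:C u (fun=> 0)].

(* E_[c,d](A): finite sums of elements of the eigenspaces with eigenvalue in
   [c,d]. *)
Definition spectral_subspace A (c d : R) : set vfun := [set u |
  exists m (lambda : 'I_m -> R) (v : 'I_m -> vfun),
    (forall j, c <= lambda j <= d /\ eigenspace A (lambda j) (v j)) /\
    aeeq u (fun x => \sum_j v j x)].

(* n is the complex dimension of (the image in L^2 of) E. *)
Definition has_dim (E : set vfun) (n : nat) : Prop :=
  exists b : 'I_n -> vfun,
    [/\ forall j, E (b j),
        forall k : 'I_n -> R[i],
          aeeq (fun x => \sum_j k j *: b j x) (fun=> 0) -> forall j, k j = 0
      & forall u, E u ->
          exists k : 'I_n -> R[i], aeeq u (fun x => \sum_j k j *: b j x)].

(* Junk value 0 in infinite dimension. *)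
Definition dim (E : set vfun) : nat := xget 0%N [set n | has_dim E n].

(* On the interval [t i, t i.+1] of the partition t 0 < ... < t n, the spectral
   window is [- c i, c i]. *)
Definition sf_partition (A : R -> operator) (a b : R)
    (n : nat) (t : nat -> R) (c : nat -> R) : Prop :=
  [/\ t 0%N = a, t n = b &
      forall i, (i < n)%N ->
        [/\ t i < t i.+1, 0 < c i,
            forall s, t i <= s <= t i.+1 ->
              ~ spectrum (A s) (c i)%:C /\ ~ spectrum (A s) (- c i)%:C
          & exists m, forall s, t i <= s <= t i.+1 ->
              has_dim (spectral_subspace (A s) (- c i) (c i)) m]].

Definition is_spectral_flow (A : R -> operator) (a b : R) (k : int) : Prop :=
  exists n t c, sf_partition A a b n t c /\
    k = \sum_(i < n)
          ((dim (spectral_subspace (A (t i.+1)) 0 (c i)))%:Z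
           - (dim (spectral_subspace (A (t i)) 0 (c i)))%:Z).

Definition spectral_flow (A : R -> operator) (a b : R) : int :=
  xget 0 [set k | is_spectral_flow A a b k].

End Operators.

(* Brouwer degree in the plane R * R. *)
Section Degree.
Variable R : realType.
Implicit Types (f g : R * R -> R * R) (U : set (R * R)).

Definition C1_on U g : Prop := forall p, U p ->
  [/\ derivable g p (1, 0), derivable g p (0, 1),
      {for p, continuous (fun q => 'D_(1, 0) g q)}
    & {for p, continuous (fun q => 'D_(0, 1) g q)}].

Definition jac g (p : R * R) : R :=
  ('D_(1, 0) g p).1 * ('D_(0, 1) g p).2 - ('D_(0, 1) g p).1 * ('D_(1, 0) g p).2.

(* deg(f, U, y), for a bounded open set U, a map f continuous on closure U and a
   point y outside f(boundary of U), is the sum of the signs of the Jacobian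
   over the (finitely many) preimages of y in U, for any map g, continuous on
   closure U and C^1 in U, having y as a regular value and with
   sup |g - f| < dist(y, f(boundary of U)). By compactness this inequality
   amounts to the pointwise one used here. *)
Definition is_brouwer_degree f U (y : R * R) (k : int) : Prop :=
  exists g (s : seq (R * R)),
    [/\ {within closure U, continuous g} /\ C1_on U g,
        forall p q, closure U p -> (closure U `\` U) q ->
          `|g p - f p| < `|f q - y|,
        forall p, U p -> g p = y -> jac g p != 0,
        uniq s /\ (forall p, p \in s <-> U p /\ g p = y)
      & k = \sum_(p <- s) sgz (jac g p)].

Definition brouwer_degree f U (y : R * R) : int :=
  xget 0 [set k | is_brouwer_degree f U y k].

(* C is identified with R * R by z = x + i y. *)
Definition plane_map (rho : R[i] -> R[i]) (p : R * R) : R * R :=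
  let w := rho (p.1 +i* p.2) in (complex.Re w, complex.Im w).

Definition plane_set (W : set R[i]) : set (R * R) :=
  [set p | W (p.1 +i* p.2)].

(* Degree of rho on the interior of W with respect to 0. *)
Definition degC (rho : R[i] -> R[i]) (W : set R[i]) : int :=
  brouwer_degree (plane_map rho) (plane_set W)° (0, 0).

End Degree.

Section SturmLiouville.
Variables (R : realType) (N : nat).
Local Notation mu := (@lebesgue_measure R).
Local Notation vfun := (R -> 'cV[R[i]]_N).
Implicit Types (P Q G : R -> 'M[R]_N) (C : R -> R -> 'M[R]_N)
  (u f : vfun).

Definition Omega : set R[i] :=
  [set z | 0 <= complex.Re z <= 1 /\ -1 <= complex.Im z <= 1].

(* P u' + Q u *)
Definition quasi_deriv P Q u : vfun :=
  fun x => cmx (P x) *m D01mx u x + cmx (Q x) *m u x.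

Definition bc P Q (R0 R1 : 'M[R]_(N + N)) u : 'cV[R[i]]_(N + N) :=
  cmx R0 *m col_mx (quasi_deriv P Q u 0) (u 0) +
  cmx R1 *m col_mx (quasi_deriv P Q u 1) (u 1).

Definition domain P Q (R0 R1 : 'M[R]_(N + N)) u : Prop :=
  H2 u /\ bc P Q R0 R1 u = 0.

(* u is the representative in H^2 of the element v of L^2; P u' + Q u is
   absolutely continuous, hence differentiable almost everywhere. *)
Definition opA0 P Q G (R0 R1 : 'M[R]_(N + N)) : operator R N := fun v f =>
  [/\ L2 v, L2 f &
      exists u, [/\ domain P Q R0 R1 u, aeeq v u &
        aeeq f (fun x => - D01mx (quasi_deriv P Q u) x
                         + (cmx (Q x))^T *m D01mx u x + cmx (G x) *m u x)]].

Definition Cz C (z : R[i]) (x : R) : 'M[R[i]]_N :=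
  cmx (C (complex.Re z) x) + (0 +i* complex.Im z)%:M.

Definition opA P Q G C (R0 R1 : 'M[R]_(N + N)) (z : R[i]) : operator R N :=
  fun v f =>
  L2 f /\ exists2 g, opA0 P Q G R0 R1 v g &
    aeeq f (fun x => g x + Cz C z x *m v x).

Definition J : 'M[R[i]]_(N + N) := block_mx 0 (- 1%:M) 1%:M 0.

Definition B P Q G C (z : R[i]) (x : R) : 'M[R[i]]_(N + N) :=
  let p := cmx (invmx (P x)) in
  let q := cmx (Q x) in
  block_mx p              (- (p *m q))
           (- (q^T *m p)) (q^T *m p *m q - cmx (G x) - Cz C z x).

Definition fundamental_solution P Q G C (z : R[i])
    (psi : R -> 'M[R[i]]_(N + N)) : Prop :=
  psi 0 = 1%:M /\
  forall x, 0 <= x <= 1 ->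
    derivable01mx psi x /\ D01mx psi x = J *m B P Q G C z x *m psi x.

Definition rho (R0 R1 : 'M[R]_(N + N))
    (psi : R[i] -> R -> 'M[R[i]]_(N + N)) (z : R[i]) : R[i] :=
  \det (cmx R0 + cmx R1 *m psi z 1).

End SturmLiouville.

(* Main.v *)
Require Import Defs.
From HB Require Import structures.
From mathcomp Require Import all_boot all_order all_algebra.
From mathcomp Require Import complex ring lra.
From mathcomp Require Import all_classical all_reals all_analysis measurable_realfun.
Set Implicit Arguments.
Unset Strict Implicit.
Unset Printing Implicit Defensive.
Import Order.TTheory GRing.Theory Num.Theory.
Import numFieldNormedType.Exports.
Local Open Scope classical_set_scope.
Local Open Scope ring_scope.
Local Open Scope complex_scope.

(** Let Y be the fundamental matrix of the first-order system attached to
A_t + lambda, and put chi t r s = det (R0 + R1 Y(1)) for lambda = r + i s. Then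
chi is continuous in (t, r, s), rho (t + i s) = chi t 0 s ([rho_chi]), and
chi t r s vanishes exactly when - (r + i s) is an eigenvalue of A_t. Both sides
of the theorem turn out to be the variation of the argument of
(t, s) |-> chi t 0 s around the boundary of [0,1] x [-1,1], divided by 2 pi.

Spectral side. Green's formula ([green]) and the symmetry of A_0 show that
chi t r s <> 0 for s <> 0 ([chi_neq0]). They also exclude Jordan blocks: if u
solves the homogeneous problem at a real r and y solves the problem with
right-hand side u, then (u, u) = 0, so u = 0 ([nondegen_sysmx]). A determinant
det (M0 + mu M1) whose first-order part satisfies this non-degeneracy vanishes to
the exact order dim ker M0 ([det_order]). Therefore the zero of chi t at (r, 0)
is isolated and its local index is the multiplicity of the eigenvalue - r, and
the winding of chi t around [a,b] x [-1,1] is 2 pi times the dimension of the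
spectral subspace of A_t for [-b,-a] ([winding_zeros], [has_dim_spectral]).

Consider now the box [t_i, t_i+1] x [-c, e] x [-1, 1] in (t, r, s)-space, where
[-c, c] is a spectral window of A_t for all t in [t_i, t_i+1], and e > 0 is
small. The windings around its six faces, with signs, add up to zero because each
edge belongs to two faces ([winding_box]). The faces s = 1 and s = -1 contribute
nothing since chi has no zeros there, and neither does the face r = - c, since c
is not an eigenvalue. What is left says that the i-th summand of the spectral
flow is the winding of (t, s) |-> chi t e s around [t_i, t_i+1] x [-1,1]. Summing
over i gives the winding around [0,1] x [-1,1], and e can be replaced by 0 by one
more box, as A_0 and A_1 are injective ([sf_value]). A partition with the required
windows exists by a compactness argument, the constancy of the dimension being
another instance of the box identity ([sf_exists]).

Degree side. If g is a C1 map that computes the degree of rho, then g is closer to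
rho on the boundary than rho is to 0, so both have the same winding ([winding_rouche]).
The winding of g is the sum of its local indices ([winding_sum]), and at a regular
zero the index is the sign of the Jacobian ([local_index_regular]); hence the degree
is the winding ([degree_winding]). Such a g exists: approximate rho
uniformly by a tensor product of quadratic splines ([approx]) and subtract a
small regular value, which Sard's lemma provides ([sard], [degree_exists]).

The analytic input is the theory of linear Volterra equations: existence,
uniqueness and dependence on parameters ([volterra_exists], [volterra_uniq],
[volterra_param]) yield Y, its continuity and its expansion in lambda; and
the translation of the operator into integral equations ([opA0_fwd], [opA0_bwd])
lets the spectrum be read off from chi ([resolvent_chi], [chi_resolvent]). *)

(** * Complex-valued functions and limits *)

Section Basics.
Variable R : realType.
Implicit Types (z w : R[i]).

Lemma near_ball1 (x : R) (Q : R -> Prop) : (\forall y \near x, Q y) ->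
  exists2 d : R, 0 < d & forall y, `|y - x| < d -> Q y.
Proof.
move=> /nbhs_ballP[d /= d0 H]; exists d => // y yx; apply: H.
by rewrite /ball /= distrC.
Qed.

Lemma near_ball2 (x : R * R) (Q : R * R -> Prop) : (\forall y \near x, Q y) ->
  exists2 d : R, 0 < d & forall y1 y2, `|y1 - x.1| < d -> `|y2 - x.2| < d -> Q (y1, y2).
Proof.
move=> /nbhs_ballP[d /= d0 H]; exists d => // y1 y2 h1 h2; apply: H.
by split; rewrite /ball /= distrC.
Qed.

(** Equivalent to the modulus and submultiplicative, without a square root, so
    that estimates in it are linear arithmetic. *)
Definition norm1 z : R := `|complex.Re z| + `|complex.Im z|.

Lemma norm1_ge0 z : 0 <= norm1 z. Proof. by rewrite addr_ge0. Qed.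

Lemma norm1_0 : norm1 0 = 0. Proof. by rewrite /norm1 /= !normr0 addr0. Qed.

Lemma norm1_eq0 z : (norm1 z == 0) = (z == 0).
Proof.
by rewrite /norm1 paddr_eq0// !normr_eq0 eq_complex.
Qed.

Lemma norm1D z w : norm1 (z + w) <= norm1 z + norm1 w.
Proof.
case: z w => [a b] [c d]; rewrite /norm1 /=.
have := ler_normD a c; have := ler_normD b d; lra.
Qed.

Lemma norm1N z : norm1 (- z) = norm1 z.
Proof. by case: z => a b; rewrite /norm1 /= !normrN. Qed.

Lemma norm1M z w : norm1 (z * w) <= norm1 z * norm1 w.
Proof.
case: z w => [a b] [c d]; rewrite /norm1 /=.
have := ler_normB (a * c) (b * d); have := ler_normD (a * d) (b * c).
rewrite !normrM; lra.
Qed.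

Lemma norm1_sum (I : Type) (r : seq I) (P : pred I) (f : I -> R[i]) :
  norm1 (\sum_(i <- r | P i) f i) <= \sum_(i <- r | P i) norm1 (f i).
Proof.
elim/big_ind2: _ => [|u p v q hu hv|//]; first by rewrite norm1_0.
by apply: (le_trans (norm1D _ _)); exact: lerD.
Qed.

Lemma cReM z w : complex.Re (z * w) =
  complex.Re z * complex.Re w - complex.Im z * complex.Im w.
Proof. by case: z w => [a b] [c d]. Qed.

Lemma cImM z w : complex.Im (z * w) =
  complex.Re z * complex.Im w + complex.Im z * complex.Re w.
Proof. by case: z w => [a b] [c d]. Qed.

Lemma cReD z w : complex.Re (z + w) = complex.Re z + complex.Re w.
Proof. by case: z w => [a b] [c d]. Qed.

Lemma cImD z w : complex.Im (z + w) = complex.Im z + complex.Im w.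
Proof. by case: z w => [a b] [c d]. Qed.

Lemma cReN z : complex.Re (- z) = - complex.Re z.
Proof. by case: z. Qed.

Lemma cImN z : complex.Im (- z) = - complex.Im z.
Proof. by case: z. Qed.

Lemma complexP z w : complex.Re z = complex.Re w -> complex.Im z = complex.Im w -> z = w.
Proof. by case: z w => [a b] [c d] /= -> ->. Qed.

Lemma cRe_sum (I : Type) (r : seq I) (P : pred I) (f : I -> R[i]) :
  complex.Re (\sum_(i <- r | P i) f i) = \sum_(i <- r | P i) complex.Re (f i).
Proof. by elim/big_rec2: _ => // i u v _ <-; rewrite cReD. Qed.

Lemma cIm_sum (I : Type) (r : seq I) (P : pred I) (f : I -> R[i]) :
  complex.Im (\sum_(i <- r | P i) f i) = \sum_(i <- r | P i) complex.Im (f i).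
Proof. by elim/big_rec2: _ => // i u v _ <-; rewrite cImD. Qed.

Section CCvg.
Context {T : Type} (F : set_system T) {FF : Filter F}.
Implicit Types f g : T -> R[i].

(** Convergence is taken componentwise, which reduces every limit in the
    complex numbers to limits of real functions. *)
Definition ccvg f (l : R[i]) :=
  (fun x => complex.Re (f x)) @ F --> complex.Re l /\
  (fun x => complex.Im (f x)) @ F --> complex.Im l.

Lemma ccvg_cst z : ccvg (fun=> z) z.
Proof. by split; apply: cvg_cst. Qed.

Lemma ccvgD f g l m : ccvg f l -> ccvg g m -> ccvg (fun x => f x + g x) (l + m).
Proof.
move=> [f1 f2] [g1 g2]; split.
  rewrite cReD (_ : (fun x => _) = (fun x => complex.Re (f x) + complex.Re (g x))).
    exact: cvgD.
  by apply/funext => x; rewrite cReD.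
rewrite cImD (_ : (fun x => _) = (fun x => complex.Im (f x) + complex.Im (g x))).
  exact: cvgD.
by apply/funext => x; rewrite cImD.
Qed.

Lemma ccvgN f l : ccvg f l -> ccvg (fun x => - f x) (- l).
Proof.
move=> [f1 f2]; split.
  rewrite cReN (_ : (fun x => _) = (fun x => - complex.Re (f x))); first exact: cvgN.
  by apply/funext => x; rewrite cReN.
rewrite cImN (_ : (fun x => _) = (fun x => - complex.Im (f x))); first exact: cvgN.
by apply/funext => x; rewrite cImN.
Qed.

Lemma ccvgM f g l m : ccvg f l -> ccvg g m -> ccvg (fun x => f x * g x) (l * m).
Proof.
move=> [f1 f2] [g1 g2]; split.
  rewrite cReM (_ : (fun x => _) = (fun x => complex.Re (f x) * complex.Re (g x)
     - complex.Im (f x) * complex.Im (g x))).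
    by apply: cvgB; apply: cvgM.
  by apply/funext => x; rewrite cReM.
rewrite cImM (_ : (fun x => _) = (fun x => complex.Re (f x) * complex.Im (g x)
     + complex.Im (f x) * complex.Re (g x))).
  by apply: cvgD; apply: cvgM.
by apply/funext => x; rewrite cImM.
Qed.

Lemma ccvg_sum (I : Type) (r : seq I) (P : pred I) (f : I -> T -> R[i]) (l : I -> R[i]) :
  (forall i, P i -> ccvg (f i) (l i)) ->
  ccvg (fun x => \sum_(i <- r | P i) f i x) (\sum_(i <- r | P i) l i).
Proof.
move=> H; elim: r => [|i r IH].
  rewrite big_nil (_ : (fun x => _) = fun=> 0); first exact: ccvg_cst.
  by apply/funext => x; rewrite big_nil.
rewrite big_cons (_ : (fun x => _) = fun x => if P i then f i x + \sum_(j <- r | P j) f j x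
   else \sum_(j <- r | P j) f j x); last by apply/funext => x; rewrite big_cons.
by case: ifP => // Pi; apply: ccvgD => //; apply: H.
Qed.

Lemma ccvg_prod (I : Type) (r : seq I) (P : pred I) (f : I -> T -> R[i]) (l : I -> R[i]) :
  (forall i, P i -> ccvg (f i) (l i)) ->
  ccvg (fun x => \prod_(i <- r | P i) f i x) (\prod_(i <- r | P i) l i).
Proof.
move=> H; elim: r => [|i r IH].
  rewrite big_nil (_ : (fun x => _) = fun=> 1); first exact: ccvg_cst.
  by apply/funext => x; rewrite big_nil.
rewrite big_cons (_ : (fun x => _) = fun x => if P i then f i x * \prod_(j <- r | P j) f j x
   else \prod_(j <- r | P j) f j x); last by apply/funext => x; rewrite big_cons.
by case: ifP => // Pi; apply: ccvgM => //; apply: H.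
Qed.

Lemma ccvg_det n (M : T -> 'M[R[i]]_n) (L : 'M[R[i]]_n) :
  (forall i j, ccvg (fun x => M x i j) (L i j)) -> ccvg (fun x => \det (M x)) (\det L).
Proof.
move=> H; rewrite /determinant; apply: ccvg_sum => s _; apply: ccvgM.
  exact: ccvg_cst.
by apply: ccvg_prod => i _; apply: H.
Qed.

Lemma cReV z : complex.Re z^-1 = complex.Re z / (complex.Re z ^+ 2 + complex.Im z ^+ 2).
Proof. by case: z. Qed.

Lemma cImV z : complex.Im z^-1 = - (complex.Im z / (complex.Re z ^+ 2 + complex.Im z ^+ 2)).
Proof. by case: z. Qed.

Lemma sqr_ReIm_gt0 z : z != 0 -> 0 < complex.Re z ^+ 2 + complex.Im z ^+ 2.
Proof.
case: z => a b; rewrite eq_complex /= negb_and => h.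
rewrite lt_neqAle addr_ge0 ?sqr_ge0// andbT eq_sym paddr_eq0 ?sqr_ge0//.
by rewrite !sqrf_eq0 negb_and.
Qed.

Lemma ccvgV f l : l != 0 -> ccvg f l -> ccvg (fun x => (f x)^-1) l^-1.
Proof.
move=> l0 [f1 f2]; have h := sqr_ReIm_gt0 l0.
have h2 : (fun x => complex.Re (f x) ^+ 2 + complex.Im (f x) ^+ 2) @ F -->
   complex.Re l ^+ 2 + complex.Im l ^+ 2.
  by apply: cvgD; apply: cvgM.
split.
  rewrite cReV (_ : (fun x => _) = fun x => complex.Re (f x)
    * (complex.Re (f x) ^+ 2 + complex.Im (f x) ^+ 2)^-1).
    by apply: cvgM => //; apply: cvgV => //; rewrite gt_eqF.
  by apply/funext => x; rewrite cReV.
rewrite cImV (_ : (fun x => _) = fun x => - (complex.Im (f x)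
    * (complex.Re (f x) ^+ 2 + complex.Im (f x) ^+ 2)^-1)).
  by apply: cvgN; apply: cvgM => //; apply: cvgV => //; rewrite gt_eqF.
by apply/funext => x; rewrite cImV.
Qed.

Lemma ccvg_norm1 f l e : ccvg f l -> 0 < e -> \forall x \near F, norm1 (f x - l) < e.
Proof.
move=> [f1 f2] e0.
have e2 : 0 < e / 2 by rewrite divr_gt0.
near=> x.
rewrite /norm1 cReD cImD cReN cImN.
have h1 : `|complex.Re l - complex.Re (f x)| < e / 2.
  by near: x; move/cvgrPdist_lt : f1; exact.
have h2 : `|complex.Im l - complex.Im (f x)| < e / 2.
  by near: x; move/cvgrPdist_lt : f2; exact.
rewrite [X in X + _]distrC [X in _ + X]distrC; lra.
Unshelve. all: by end_near. Qed.

Lemma norm1_ccvg f l : (forall e, 0 < e -> \forall x \near F, norm1 (f x - l) < e) -> ccvg f l.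
Proof.
move=> H; split; apply/cvgrPdist_lt => e e0; have := H e e0; apply: filterS => x;
  rewrite /norm1 cReD cImD cReN cImN => h.
  by rewrite distrC; apply: le_lt_trans h; rewrite lerDl.
by rewrite distrC; apply: le_lt_trans h; rewrite lerDr.
Qed.

Lemma ccvg_ext f g l : f =1 g -> ccvg f l -> ccvg g l.
Proof. by move/funext => ->. Qed.

End CCvg.

Lemma ccvg_comp {T U : Type} (F : set_system T) (G : set_system U) (h : T -> U)
  (f : U -> R[i]) l : h @ F --> G -> ccvg G f l -> ccvg F (fun x => f (h x)) l.
Proof. by move=> hF [f1 f2]; split; [apply: cvg_comp f1|apply: cvg_comp f2]. Qed.

Definition ccont {T : topologicalType} (f : T -> R[i]) := forall x : T, ccvg (nbhs x) f (f x).

Lemma ccont_comp {T U : topologicalType} (h : T -> U) (f : U -> R[i]) :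
  continuous h -> ccont f -> ccont (fun x => f (h x)).
Proof. by move=> ch cf x; apply: ccvg_comp (cf (h x)); apply: ch. Qed.

Section CCont.
Context {T : topologicalType}.
Implicit Types f g : T -> R[i].
Lemma ccont_cst z : ccont (fun _ : T => z).
Proof. by move=> x; apply: ccvg_cst. Qed.
Lemma ccontD f g : ccont f -> ccont g -> ccont (fun x => f x + g x).
Proof. by move=> cf cg x; apply: ccvgD. Qed.
Lemma ccontN f : ccont f -> ccont (fun x => - f x).
Proof. by move=> cf x; apply: ccvgN. Qed.
Lemma ccontM f g : ccont f -> ccont g -> ccont (fun x => f x * g x).
Proof. by move=> cf cg x; apply: ccvgM. Qed.
Lemma ccont_sum (I : Type) (r : seq I) (P : pred I) (f : I -> T -> R[i]) :
  (forall i, P i -> ccont (f i)) -> ccont (fun x => \sum_(i <- r | P i) f i x).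
Proof. by move=> H x; apply: ccvg_sum => i Pi; apply: H. Qed.
Lemma ccont_det n (M : T -> 'M[R[i]]_n) :
  (forall i j, ccont (fun x => M x i j)) -> ccont (fun x => \det (M x)).
Proof. by move=> H x; apply: ccvg_det => i j; apply: H. Qed.
Lemma ccont_ext f g : f =1 g -> ccont f -> ccont g.
Proof. by move/funext => ->. Qed.
Lemma ccontRe f : ccont f -> continuous (fun x => complex.Re (f x)).
Proof. by move=> cf x; case: (cf x). Qed.
Lemma ccontIm f : ccont f -> continuous (fun x => complex.Im (f x)).
Proof. by move=> cf x; case: (cf x). Qed.
Lemma ccont_ReIm (f g : T -> R) : continuous f -> continuous g -> ccont (fun x => f x +i* g x).
Proof. by move=> cf cg x; split; [exact: cf|exact: cg]. Qed.
End CCont.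

(** Cousin's lemma: a property of intervals that is additive, and true of all
    sufficiently short intervals around each tag, is true of the whole interval.
    The supremum of the points that can be reached from a can be reached and,
    by the local property at that supremum, cannot be smaller than b. *)
Lemma additive_tagged (P : R -> R -> Prop) (a b : R) : a <= b ->
  (forall x y z : R, a <= x -> x <= y -> y <= z -> z <= b -> P x y -> P y z -> P x z) ->
  (forall x, a <= x <= b -> exists2 d : R, 0 < d & forall y z : R, a <= y -> y <= x -> x <= z -> z <= b ->
     `|y - x| < d -> `|z - x| < d -> P y z) ->
  P a b.
Proof.
move=> ab Padd Ploc.
pose S := [set y | a <= y <= b /\ P a y].
have Sa : S a.
  split; first by rewrite lexx.
  have [d d0 Hd] := Ploc a ltac:(by rewrite lexx).
  by apply: Hd => //; rewrite subrr normr0.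
have Sb : has_sup S by split; [exists a|exists b => y [/andP[]]].
have Sle y : S y -> y <= sup S by move=> Sy; apply: sup_upper_bound.
have aS : a <= sup S := Sle a Sa.
have Sb' : sup S <= b by apply: sup_le_ub => [|y [/andP[]]//]; exists a.
have [d d0 Hd] := Ploc (sup S) ltac:(by rewrite aS Sb').
have [y [/andP[ay yb] Py] ySd] := sup_adherent d0 Sb.
have yS := Sle y (conj (introT andP (conj ay yb)) Py).
pose z := Num.min b (sup S + d / 2).
have Sz : sup S <= z by rewrite le_min Sb' lerDl divr_ge0// ltW.
have zb : z <= b by rewrite ge_min lexx.
have zS2 : z <= sup S + d / 2 by rewrite ge_min lexx orbT.
have Pz : P a z.
  apply: (Padd a y z) => //; first exact: le_trans Sz.
  apply: Hd => //.
    by rewrite ler0_norm ?subr_le0//; lra.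
  by rewrite ger0_norm ?subr_ge0//; lra.
have : z <= sup S by apply: Sle; split => //; rewrite zb (le_trans aS).
rewrite /z ge_min => /orP[bS|]; last by rewrite gerDl leNgt divr_gt0.
by move: Pz; rewrite (_ : z = b)//; apply/eqP; rewrite eq_le zb (le_trans bS).
Qed.

(** The same for short intervals near x that do not have to contain x. *)
Lemma additive_interval (P : R -> R -> Prop) (a b : R) : a <= b ->
  (forall x y z : R, a <= x -> x <= y -> y <= z -> z <= b -> P x y -> P y z -> P x z) ->
  (forall x, a <= x <= b -> exists2 d : R, 0 < d & forall y z : R, a <= y -> y <= z -> z <= b ->
     `|y - x| < d -> `|z - x| < d -> P y z) ->
  P a b.
Proof.
move=> ab Padd Ploc; apply: additive_tagged => // x hx; have [d d0 H] := Ploc x hx.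
by exists d => // y z ay yx xz zb; apply: H => //; exact: le_trans xz.
Qed.

(** Composing with the clamp extends a function from [a,b] to the line
    without losing continuity. *)
Definition clamp (a b : R) (x : R) : R := Num.max a (Num.min x b).

Lemma clamp_cont (a b : R) : continuous (clamp a b).
Proof.
move=> x; apply: (@continuous_max R R (cst a) (fun x => Num.min x b) x).
  exact: cvg_cst.
by apply: (@continuous_min R R id (cst b) x); [exact: cvg_id|exact: cvg_cst].
Qed.

Lemma clampP (a b x : R) : a <= b -> a <= clamp a b x <= b.
Proof. by move=> ab; rewrite /clamp le_max lexx ge_max ab ge_min lexx orbT. Qed.

Lemma clamp_id (a b x : R) : a <= x <= b -> clamp a b x = x.
Proof. by case/andP => ax xb; rewrite /clamp min_l// max_r. Qed.

Lemma clamp_in (a b x : R) : a <= b -> (`[a, b]%classic : set R) (clamp a b x).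
Proof. by move=> ab; rewrite /= in_itv /= clampP. Qed.

Lemma within_comp {T U V : topologicalType} (A : set U) (h : T -> U) (f : U -> V) :
  continuous h -> (forall x, A (h x)) -> {within A, continuous f} ->
  continuous (fun x => f (h x)).
Proof.
move=> ch Ah cf x.
apply: (@cvg_comp _ _ _ h f (nbhs x) (nbhs (h x : subspace A))); last exact: (cf (h x)).
apply/(subspace_cvgP _ (Ah x)) => P hP.
have h1 : nbhs x (fun y => A (h y) -> P (h y)) := ch x _ hP.
have h2 : nbhs x (fun y => P (h y)) by apply: filterS h1 => y; apply; exact: Ah.
exact: h2.
Qed.

Lemma within_clamp (T : topologicalType) (a b : R) (f : R -> T) : a <= b ->
  {within `[a, b], continuous f} -> continuous (fun x => f (clamp a b x)).
Proof.
by move=> ab; apply: within_comp => [|x]; [exact: clamp_cont|exact: clamp_in].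
Qed.

End Basics.

(** * Variation of the argument along a path *)

Section Winding.
Variable R : realType.
Implicit Types (z w : R[i]) (g f : R -> R[i]).

Definition polar z (t : R) := exists2 rho : R, 0 < rho & z = (rho * cos t) +i* (rho * sin t).

Lemma polar_neq0 z t : polar z t -> z != 0.
Proof.
case=> rho rho0 ->; rewrite eq_complex /= !mulf_eq0 !(gt_eqF rho0) /=.
apply/negP => /andP[/eqP c0 /eqP s0]; have := cos2Dsin2 t.
by rewrite c0 s0 expr0n /= addr0 => /esym/eqP; rewrite oner_eq0.
Qed.

Lemma polarM z w t u : polar z t -> polar w u -> polar (z * w) (t + u).
Proof.
case=> r r0 -> [s s0 ->]; exists (r * s); first exact: mulr_gt0.
by apply: complexP; rewrite ?cReM ?cImM /= ?cosD ?sinD; ring.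
Qed.

Lemma polarV z t : polar z t -> polar z^-1 (- t).
Proof.
move=> pz; have z0 := polar_neq0 pz; case: pz z0 => r r0 -> z0.
exists r^-1; first by rewrite invr_gt0.
have r0' : r != 0 by rewrite gt_eqF.
apply: (mulfI z0); rewrite mulfV//; apply: complexP;
  rewrite ?cReM ?cImM /= cosN sinN; have := cos2Dsin2 t; move: (cos t) (sin t) => c s h.
  by transitivity (c ^+ 2 + s ^+ 2); [rewrite h|field].
by field.
Qed.

Lemma polar_conj z t : polar z t -> polar (z^*) (- t).
Proof.
case=> r r0 ->; exists r => //; apply: complexP; rewrite /= ?cosN ?sinN //.
by rewrite mulrN.
Qed.

(** Two arguments of the same number differ by a multiple of 2 pi, recorded
    as the cosine of the difference being 1: this is a closed condition on
    continuous functions and needs no integers. *)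
Lemma polar_uniq z t u : polar z t -> polar z u -> cos (t - u) = 1.
Proof.
move=> pz pz'; have := polarM pz (polarV pz'); rewrite mulfV ?(polar_neq0 pz)//.
case=> r r0 [h1 h2]; have := cos2Dsin2 (t - u).
have -> : sin (t - u) = 0.
  by apply/eqP; move/esym/eqP: h2; rewrite mulf_eq0 (gt_eqF r0).
rewrite expr0n addr0 => /eqP; rewrite sqrf_eq1 => /orP[/eqP//|/eqP h].
by move: h1; rewrite h; lra.
Qed.

(** The sum |z| + Re z vanishes exactly on the closed negative half-line, so
    this is the domain of the principal argument. *)
Definition slit z := 0 < Num.sqrt (complex.Re z ^+ 2 + complex.Im z ^+ 2) + complex.Re z.

(** The half-angle formula tan (t / 2) = sin t / (1 + cos t) gives the
    principal argument by a single expression, hence its continuity. *)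
Definition arg z := 2 * atan (complex.Im z /
  (Num.sqrt (complex.Re z ^+ 2 + complex.Im z ^+ 2) + complex.Re z)).

Lemma slitP z : (complex.Im z = 0 -> 0 < complex.Re z) -> slit z.
Proof.
case: z => x y /= h; rewrite /slit /=.
have [x0|x0] := ltP 0 x; first by rewrite ltr_wpDl// sqrtr_ge0.
have y0 : y != 0 by apply/eqP => /h; rewrite ltNge x0.
rewrite -ltrBlDr add0r -[X in X < _](@ger0_norm _ (- x)) ?oppr_ge0//.
rewrite -sqrtr_sqr sqrrN ltr_sqrt; last by rewrite ltr_wpDl ?sqr_ge0// exprn_even_gt0.
by rewrite ltrDl exprn_even_gt0.
Qed.

Lemma polar_arg z : slit z -> polar z (arg z).
Proof.
case: z => x y; rewrite /slit /arg /=.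
set r := Num.sqrt _ => rx.
have xy0 : 0 <= x ^+ 2 + y ^+ 2 by rewrite addr_ge0 ?sqr_ge0.
have r2 : r ^+ 2 = x ^+ 2 + y ^+ 2 by rewrite sqr_sqrtr.
have r0 : 0 < r.
  rewrite lt_neqAle sqrtr_ge0 andbT; apply/eqP => rr.
  move: r2 rx; rewrite -rr expr0n /= => /esym/eqP.
  by rewrite paddr_eq0 ?sqr_ge0// !sqrf_eq0 => /andP[/eqP-> _]; rewrite addr0 ltxx.
exists r => //.
set u := y / (r + x).
have u1 : 0 < 1 + u ^+ 2 by rewrite ltr_pwDl// sqr_ge0.
have c2 : cos (atan u) ^+ 2 = (1 + u ^+ 2)^-1.
  by rewrite cos_atan exprVn sqr_sqrtr// ltW.
have cn0 : cos (atan u) != 0.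
  by rewrite cos_atan invr_neq0// gt_eqF// sqrtr_gt0.
have sc : sin (atan u) = u * cos (atan u).
  by rewrite -[u in u * _]atanK /tan divfK.
have -> : cos (2 * atan u) = 2 * cos (atan u) ^+ 2 - 1.
  by rewrite mulr_natl cos_mulr2n mulr_natl.
have -> : sin (2 * atan u) = 2 * u * cos (atan u) ^+ 2.
  by rewrite mulr_natl sin_mulr2n sc -mulr_natl; ring.
rewrite c2; have rx0 : r + x != 0 by rewrite gt_eqF.
have rn0 : r != 0 by rewrite gt_eqF.
(* As y^2 = (r - x) (r + x), the squared cosine of half the angle is
   (r + x) / (2 r). *)
have E : (1 + u ^+ 2)^-1 = (r + x) / (2 * r).
  rewrite /u; apply: (mulfI (lt0r_neq0 u1)); rewrite mulfV ?lt0r_neq0// /u.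
  rewrite expr_div_n (_ : y ^+ 2 = (r - x) * (r + x)); last first.
    by rewrite -[y ^+ 2](addrK (x ^+ 2)) [y ^+ 2 + _]addrC -r2; ring.
  by field; rewrite rx0 rn0.
rewrite E; apply: complexP => /=; first by field.
by rewrite /u; field; rewrite rx0 rn0.
Qed.

Lemma arg_cvg (T : Type) (F : set_system T) {FF : Filter F} (f : T -> R[i]) l :
  slit l -> ccvg F f l -> (fun x => arg (f x)) @ F --> arg l.
Proof.
move=> sl [f1 f2]; apply: cvgM; first exact: cvg_cst.
have fs : (fun x => Num.sqrt (complex.Re (f x) ^+ 2 + complex.Im (f x) ^+ 2)
    + complex.Re (f x)) @ F -->
   Num.sqrt (complex.Re l ^+ 2 + complex.Im l ^+ 2) + complex.Re l.
  apply: cvgD => //.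
  apply: (@cvg_comp _ _ _ (fun x => complex.Re (f x) ^+ 2 + complex.Im (f x) ^+ 2)
    Num.sqrt); last exact: sqrt_continuous.
  by apply: cvgD; apply: cvgM.
apply: (@cvg_comp _ _ _ (fun x => complex.Im (f x) / (Num.sqrt (complex.Re (f x) ^+ 2 +
  complex.Im (f x) ^+ 2) + complex.Re (f x))) atan); last exact: continuous_atan.
by apply: cvgM => //; apply: cvgV => //; rewrite gt_eqF.
Qed.

Definition is_angle_var f (a b d : R) := exists th : R -> R,
  [/\ continuous th, forall x, a <= x <= b -> polar (f x) (th x) & d = th b - th a].

(** The difference of two continuous arguments takes only values of cosine 1.
    If it took two values, it would take all values between them, among them
    some whose distance from the first is at most pi, and the cosine is
    injective on [0, pi]. *)
Lemma is_angle_var_uniq f a b d1 d2 : a <= b -> is_angle_var f a b d1 -> is_angle_var f a b d2 -> d1 = d2.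
Proof.
move=> ab [t1 [c1 p1 ->]] [t2 [c2 p2 ->]].
wlog le12 : t1 t2 c1 p1 c2 p2 / t1 a - t2 a <= t1 b - t2 b.
  move=> H; have [h|/ltW h] := leP (t1 a - t2 a) (t1 b - t2 b); first exact: H.
  by apply/esym; apply: H => //; lra.
pose D x := t1 x - t2 x.
have D1 x : a <= x <= b -> cos (D x) = 1.
  by move=> hx; apply: polar_uniq (p1 x hx) (p2 x hx).
have cD : continuous D by move=> x; apply: cvgB; [exact: c1|exact: c2].
apply/eqP; apply/contraT => ne.
have lt12 : D a < D b by rewrite lt_neqAle le12 andbT; apply: contra ne => /eqP; rewrite /D => ?; apply/eqP; lra.
pose e := Num.min (D b - D a) pi.
have e0 : 0 < e by rewrite lt_min subr_gt0 lt12 pi_gt0.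
have epi : e <= pi by rewrite ge_min lexx orbT.
have eD : e <= D b - D a by rewrite ge_min lexx.
have [||c cin Dc] := @IVT R D a b (D a + e) ab.
- by apply: continuous_subspaceT => x; exact: cD.
- by rewrite min_l ?max_r ?(ltW lt12)//; apply/andP; split; lra.
have ca := D1 a ltac:(by rewrite lexx ab).
have := D1 c; move: cin; rewrite in_itv /= => cin /(_ cin); rewrite Dc cosD ca mul1r.
have -> : sin (D a) = 0.
  by apply/eqP; rewrite -sqrf_eq0 sin2cos2 ca expr1n subrr.
rewrite mul0r subr0 -cos0 => h.
have := @ltr_cos R 0 e; rewrite !in_itv /= lexx pi_ge0 (ltW e0) epi h ltxx.
by move=> /(_ isT isT); rewrite e0.
Qed.

Lemma is_angle_var_ext f g a b d : (forall x, a <= x <= b -> f x = g x) ->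
  is_angle_var f a b d -> is_angle_var g a b d.
Proof.
by move=> fg [t [c p ->]]; exists t; split => // x hx; rewrite -fg //; apply: p.
Qed.

Lemma is_angle_var_cat f a b c d1 d2 : a <= b -> b <= c ->
  is_angle_var f a b d1 -> is_angle_var f b c d2 -> is_angle_var f a c (d1 + d2).
Proof.
move=> ab bc [t1 [c1 p1 ->]] [t2 [c2 p2 ->]].
exists (fun x => t1 (Num.min x b) + (t2 (Num.max x b) - t2 b)); split.
- move=> x; apply: cvgD.
    apply: (@cvg_comp _ _ _ (fun x => Num.min x b) t1); last exact: c1.
    by apply: (@continuous_min R R id (cst b) x); [exact: cvg_id|exact: cvg_cst].
  apply: cvgB; last exact: cvg_cst.
  apply: (@cvg_comp _ _ _ (fun x => Num.max x b) t2); last exact: c2.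
  by apply: (@continuous_max R R id (cst b) x); [exact: cvg_id|exact: cvg_cst].
- move=> x /andP[ax xc]; have [xb|bx] := leP x b.
    by rewrite subrr addr0; apply: p1; rewrite ax.
  have pb1 : polar (f b) (t1 b) by apply: p1; rewrite lexx ab.
  have pb2 : polar (f b) (t2 b) by apply: p2; rewrite lexx bc.
  have p2x : polar (f x) (t2 x) by apply: p2; rewrite (ltW bx) xc.
  rewrite (_ : _ + _ = t2 x + (t1 b - t2 b)); last by ring.
  rewrite -[f x]mulr1 -(mulfV (polar_neq0 pb1)); apply: polarM => //.
  by apply: polarM => //; apply: polarV.
- by rewrite (min_r bc) (max_l bc) (min_l ab) (max_r ab); ring.
Qed.

Lemma is_angle_varM f g a b d e : is_angle_var f a b d -> is_angle_var g a b e ->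
  is_angle_var (fun x => f x * g x) a b (d + e).
Proof.
move=> [t [c p ->]] [u [k q ->]]; exists (fun x => t x + u x); split.
- by move=> x; apply: cvgD; [exact: c|exact: k].
- by move=> x hx; apply: polarM; [exact: p|exact: q].
- ring.
Qed.

Lemma is_angle_var_conj f a b d : is_angle_var f a b d -> is_angle_var (fun x => (f x)^*) a b (- d).
Proof.
move=> [t [c p ->]]; exists (fun x => - t x); split.
- by move=> x; apply: cvgN; exact: c.
- by move=> x hx; apply: polar_conj; exact: p.
- ring.
Qed.

Lemma is_angle_var_cst z a b : z != 0 -> is_angle_var (fun=> z) a b 0.
Proof.
move=> z0.
have [t pt] : exists t, polar z t.
  have [h|h] := pselect (complex.Im z = 0 /\ complex.Re z <= 0); last first.
    exists (arg z); apply: polar_arg; apply: slitP => iz.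
    by rewrite ltNge; apply/negP => h'; apply: h.
  exists pi; case: z z0 h => x y /= z0 [y0 x0]; exists (- x).
    rewrite oppr_gt0 lt_neqAle x0 andbT; apply: contra z0 => /eqP ->.
    by rewrite y0.
  by rewrite y0 cospi sinpi; apply: complexP => /=; ring.
by exists (fun=> t); split => //; [move=> x; exact: cvg_cst|rewrite subrr].
Qed.

(** The principal argument is itself a continuous choice as long as f avoids
    the negative half-line. *)
Lemma is_angle_var_slit f a b : a <= b -> ccont (fun x => f (clamp a b x)) ->
  (forall x, a <= x <= b -> slit (f x)) -> is_angle_var f a b (arg (f b) - arg (f a)).
Proof.
move=> ab cf sf; exists (fun x => arg (f (clamp a b x))); split.
- by move=> x; apply: arg_cvg (cf x); apply: sf; exact: clampP.
- by move=> x hx; rewrite clamp_id//; apply: polar_arg; exact: sf.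
- by rewrite !clamp_id ?lexx ?ab.
Qed.

End Winding.

(** * Winding numbers of rectangles *)

Section Winding2.
Variable R : realType.
Implicit Types (z w : R[i]) (g f : R -> R[i]) (G H : R -> R -> R[i]).

Lemma slit_near1 z : norm1 (z - 1) < 1 -> slit z.
Proof.
rewrite /norm1 cReD /= => h; apply: slitP => _.
have := ler_norm (- (complex.Re z - 1)); rewrite normrN.
have := normr_ge0 (complex.Im (z - 1)); move: h; rewrite /=; lra.
Qed.

(** Near x the quotient f / f x is close to 1, where the principal argument is
    continuous; the local choices are glued by additivity. *)
Lemma is_angle_var_exists f a b : a <= b -> ccont f -> (forall x, a <= x <= b -> f x != 0) ->
  exists d, is_angle_var f a b d.
Proof.
move=> ab cf f0; pose P (y z : R) := exists d, is_angle_var f y z d.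
apply: (@additive_interval R P) => //.
  by move=> x y z ax xy yz zb [d hd] [e he]; exists (d + e); exact: is_angle_var_cat hd he.
move=> x hx; have fx0 := f0 x hx.
have hc : ccvg (nbhs x) (fun y => f y / f x) 1.
  by rewrite -(mulfV fx0); apply: ccvgM => //; exact: ccvg_cst.
have [d d0 Hd] := near_ball1 (ccvg_norm1 hc ltr01).
exists d => // y z ay yz zb yd zd.
have hs u : y <= u <= z -> slit (f u / f x).
  move=> /andP[yu uz]; apply: slit_near1; apply: Hd.
  by move: yd zd; rewrite !ltr_norml => /andP[? ?] /andP[? ?]; apply/andP; split; lra.
have hv := @is_angle_var_slit R (fun u => f u / f x) y z yz _ hs.
eexists; apply: (@is_angle_var_ext R (fun u => f u / f x * f x)).
  by move=> u _; rewrite divfK.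
apply: is_angle_varM; last exact: is_angle_var_cst.
apply: hv; apply: ccontM; last exact: ccont_cst.
by apply: ccont_comp => //; exact: clamp_cont.
Qed.

Definition angle_var f (a b : R) : R := xget 0 [set d | is_angle_var f a b d].

Lemma angle_varE f a b d : a <= b -> is_angle_var f a b d -> angle_var f a b = d.
Proof.
move=> ab h; apply: (is_angle_var_uniq ab _ h).
exact: (@xgetPex _ 0 [set d | is_angle_var f a b d] (ex_intro _ d h)).
Qed.

Lemma angle_varP f a b : a <= b -> ccont f -> (forall x, a <= x <= b -> f x != 0) ->
  is_angle_var f a b (angle_var f a b).
Proof. by move=> ab cf f0; have [d hd] := is_angle_var_exists ab cf f0; rewrite (angle_varE ab hd). Qed.

Lemma angle_var_cat f a b c : a <= b -> b <= c -> ccont f ->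
  (forall x, a <= x <= c -> f x != 0) -> angle_var f a c = angle_var f a b + angle_var f b c.
Proof.
move=> ab bc cf f0; apply: angle_varE; first exact: le_trans bc.
apply: (is_angle_var_cat ab bc); apply: angle_varP => // x /andP[h1 h2]; apply: f0.
  by rewrite h1 (le_trans h2).
by rewrite h2 (le_trans ab).
Qed.

Lemma slit_neq0 z : slit z -> z != 0.
Proof. by move/polar_arg/polar_neq0. Qed.

(** When f / g avoids the negative half-line, the variation of its argument
    depends on the endpoints only; around a closed path such terms cancel. *)
Lemma angle_var_quot f g a b : a <= b -> ccont f -> ccont g ->
  (forall x, a <= x <= b -> g x != 0) -> (forall x, a <= x <= b -> slit (f x / g x)) ->
  angle_var f a b = angle_var g a b + (arg (f b / g b) - arg (f a / g a)).
Proof.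
move=> ab cf cg g0 sl; apply: angle_varE => //.
have hq : is_angle_var (fun x => f x / g x) a b (arg (f b / g b) - arg (f a / g a)).
  have cf' : ccont (fun x => f (clamp a b x)) by apply: ccont_comp => //; exact: clamp_cont.
  have cg' : ccont (fun x => g (clamp a b x)) by apply: ccont_comp => //; exact: clamp_cont.
  apply: (@is_angle_var_slit R (fun x => f x / g x)) => // x; apply: ccvgM; first exact: (cf' x).
  by apply: ccvgV; [apply: g0; exact: clampP|exact: (cg' x)].
apply: (is_angle_var_ext _ (is_angle_varM (angle_varP ab cg g0) hq)) => x hx.
by rewrite mulrC divfK// g0.
Qed.

Lemma angle_var_cst z a b : a <= b -> z != 0 -> angle_var (fun=> z) a b = 0.
Proof. by move=> ab z0; apply: angle_varE => //; exact: is_angle_var_cst. Qed.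

(** The variation of the argument of G around the boundary of
    [x0,x1] x [y0,y1], counterclockwise; this is 2 pi times the usual winding
    number. *)
Definition winding G (x0 x1 y0 y1 : R) : R :=
  angle_var (G ^~ y0) x0 x1 + angle_var (G x1) y0 y1 - angle_var (G ^~ y1) x0 x1 - angle_var (G x0) y0 y1.

Definition ccont2 G := ccont (fun p : R * R => G p.1 p.2).

Lemma ccont2l G y : ccont2 G -> ccont (G ^~ y).
Proof.
move=> cG x; apply: (@ccvg_comp R _ _ (nbhs x) (nbhs (x, y)) (fun x => (x, y))
  (fun p => G p.1 p.2)); last exact: (cG (x, y)).
by apply: (cvg_pair (F:=nbhs x) (G:=nbhs x) (H:=nbhs y)); [exact: cvg_id|exact: cvg_cst].
Qed.

Lemma ccont2r G x : ccont2 G -> ccont (G x).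
Proof.
move=> cG y; apply: (@ccvg_comp R _ _ (nbhs y) (nbhs (x, y)) (fun y => (x, y))
  (fun p => G p.1 p.2)); last exact: (cG (x, y)).
by apply: (cvg_pair (F:=nbhs y) (G:=nbhs x) (H:=nbhs y)); [exact: cvg_cst|exact: cvg_id].
Qed.

Definition on_bd (P : R -> R -> Prop) (x0 x1 y0 y1 : R) :=
  (forall x, x0 <= x <= x1 -> P x y0 /\ P x y1) /\
  (forall y, y0 <= y <= y1 -> P x0 y /\ P x1 y).

Lemma winding_splitx G x0 x1 x2 y0 y1 : x0 <= x1 -> x1 <= x2 -> ccont2 G ->
  (forall x, x0 <= x <= x2 -> G x y0 != 0 /\ G x y1 != 0) ->
  winding G x0 x2 y0 y1 = winding G x0 x1 y0 y1 + winding G x1 x2 y0 y1.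
Proof.
move=> h1 h2 cG G0; rewrite /winding.
rewrite (@angle_var_cat (G ^~ y0) x0 x1 x2)// ?(@angle_var_cat (G ^~ y1) x0 x1 x2)//; first ring.
- exact: ccont2l.
- by move=> x /G0[].
- exact: ccont2l.
- by move=> x /G0[].
Qed.

Lemma winding_splity G x0 x1 y0 y1 y2 : y0 <= y1 -> y1 <= y2 -> ccont2 G ->
  (forall y, y0 <= y <= y2 -> G x0 y != 0 /\ G x1 y != 0) ->
  winding G x0 x1 y0 y2 = winding G x0 x1 y0 y1 + winding G x0 x1 y1 y2.
Proof.
move=> h1 h2 cG G0; rewrite /winding.
rewrite (@angle_var_cat (G x0) y0 y1 y2)// ?(@angle_var_cat (G x1) y0 y1 y2)//; first ring.
- exact: ccont2r.
- by move=> y /G0[].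
- exact: ccont2r.
- by move=> y /G0[].
Qed.

(** Rouche's theorem: on each edge the two variations differ by values of
    arg (G / H) at the corners, and each corner occurs twice with opposite
    signs. *)
Lemma winding_rouche G H x0 x1 y0 y1 : x0 <= x1 -> y0 <= y1 -> ccont2 G -> ccont2 H ->
  on_bd (fun x y => H x y != 0 /\ slit (G x y / H x y)) x0 x1 y0 y1 ->
  winding G x0 x1 y0 y1 = winding H x0 x1 y0 y1.
Proof.
move=> hx hy cG cH [b1 b2]; rewrite /winding.
rewrite (@angle_var_quot (G ^~ y0) (H ^~ y0)) //; try exact: ccont2l;
  try by move=> x /b1[[? ?] [? ?]].
rewrite (@angle_var_quot (G ^~ y1) (H ^~ y1)) //; try exact: ccont2l;
  try by move=> x /b1[[? ?] [? ?]].
rewrite (@angle_var_quot (G x0) (H x0)) //; try exact: ccont2r;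
  try by move=> x /b2[[? ?] [? ?]].
rewrite (@angle_var_quot (G x1) (H x1)) //; try exact: ccont2r;
  try by move=> x /b2[[? ?] [? ?]].
ring.
Qed.

Lemma winding_cst z x0 x1 y0 y1 : x0 <= x1 -> y0 <= y1 -> z != 0 ->
  winding (fun _ _ => z) x0 x1 y0 y1 = 0.
Proof. by move=> hx hy z0; rewrite /winding !angle_var_cst//; ring. Qed.

(** Additivity, first in x and then in y, reduces the claim to small
    rectangles, where Rouche's theorem compares G with the constant G x y. *)
Lemma winding_nonvan G x0 x1 y0 y1 : x0 <= x1 -> y0 <= y1 -> ccont2 G ->
  (forall x y, x0 <= x <= x1 -> y0 <= y <= y1 -> G x y != 0) ->
  winding G x0 x1 y0 y1 = 0.
Proof.
move=> hx hy cG G0.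
pose P a b := winding G a b y0 y1 = 0.
apply: (@additive_interval R P) => //.
  move=> a b c xa ab bc cx Pab Pbc; rewrite /P (@winding_splitx _ a b c)// ?Pab ?Pbc ?addr0//.
  move=> x /andP[ax xc]; split; apply: G0; rewrite ?lexx ?hy ?(le_trans xa)// (le_trans xc)//.
move=> x hxx.
pose P' (a b : R) := exists2 d : R, 0 < d & forall y z : R, x0 <= y -> y <= z -> z <= x1 ->
     `|y - x| < d -> `|z - x| < d -> winding G y z a b = 0.
suff : P' y0 y1 by [].
apply: (@additive_interval R P') => //.
  move=> a b c ya ab bc cy [d d0 Hd] [e e0 He]; exists (Num.min d e).
    by rewrite lt_min d0 e0.
  move=> y z hy' yz zx; rewrite !lt_min => /andP[yd ye] /andP[zd ze].
  rewrite (@winding_splity _ _ _ a b c)// ?Hd ?He ?addr0//.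
  by move=> u /andP[au uc]; split; apply: G0; apply/andP; split; lra.
move=> y hyy; have c0 := G0 x y hxx hyy.
have hc : ccvg (nbhs (x, y)) (fun p : R * R => G p.1 p.2 / G x y) 1.
  by rewrite -(mulfV c0); apply: ccvgM; [exact: (cG (x, y))|exact: ccvg_cst].
have [d d0 /= Hd] := near_ball2 (ccvg_norm1 hc ltr01).
exists d => // a b ya ab by1 ad bd; exists d => // u v xu uv vx ud vd.
rewrite -(@winding_cst (G x y) u v a b uv ab c0); apply: winding_rouche => //.
  exact: ccont_cst.
have hs p q : u <= p <= v -> a <= q <= b -> slit (G p q / G x y).
  move=> /andP[? ?] /andP[? ?]; apply: slit_near1; apply: Hd.
    by move: ud vd; rewrite !ltr_norml => /andP[? ?] /andP[? ?]; apply/andP; split; lra.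
  by move: ad bd; rewrite !ltr_norml => /andP[? ?] /andP[? ?]; apply/andP; split; lra.
by rewrite /on_bd; split => p hp; split; split => //; apply: hs => //; rewrite ?lexx ?ab ?uv.
Qed.

(** Each of the twelve edges of the box belongs to two faces, which induce
    opposite orientations on it. *)
Lemma winding_box (F : R -> R -> R -> R[i]) t0 t1 r0 r1 s0 s1 :
  winding (fun t s => F t r1 s) t0 t1 s0 s1 - winding (fun t s => F t r0 s) t0 t1 s0 s1 =
  winding (F t1) r0 r1 s0 s1 - winding (F t0) r0 r1 s0 s1 +
  (winding (fun t r => F t r s1) t0 t1 r0 r1 - winding (fun t r => F t r s0) t0 t1 r0 r1).
Proof. by rewrite /winding; ring. Qed.

Definition local_index G (p : R * R) (k : int) := exists2 r : R, 0 < r &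
  forall e : R, 0 < e < r -> winding G (p.1 - e) (p.1 + e) (p.2 - e) (p.2 + e) = k%:~R * (2 * pi).

Lemma avoid_seq (l : seq R) a b : a < b -> exists2 c, a < c < b & c \notin l.
Proof.
move=> ab.
suff [a' [b' [h1 h2 h3 h4]]] : exists a' b', [/\ a <= a', a' < b', b' <= b &
    forall x, x \in l -> ~ a' < x < b'].
  have h : a' < (a' + b') / 2 < b' by apply/andP; split; lra.
  exists ((a' + b') / 2); first by case/andP: h => ? ?; apply/andP; split; lra.
  by apply/negP => /h4.
elim: l => [|x l [a' [b' [h1 h2 h3 h4]]]]; first by exists a, b; split.
have [/andP[ax xb]|nx] := boolP (a' < x < b').
  exists a', x; split => //; first exact: ltW (lt_le_trans xb h3).
  move=> y; rewrite inE => /orP[/eqP->|yl]; first by rewrite ltxx andbF.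
  by move=> /andP[ay yx]; apply: (h4 y yl); rewrite ay (lt_trans yx).
exists a', b'; split => // y; rewrite inE => /orP[/eqP->|yl]; first exact/negP.
exact: h4.
Qed.

Lemma winding_shrink G x0 x1 y0 y1 a0 a1 b0 b1 : ccont2 G ->
  x0 <= a0 -> a0 <= a1 -> a1 <= x1 -> y0 <= b0 -> b0 <= b1 -> b1 <= y1 ->
  (forall x y, x0 <= x <= x1 -> y0 <= y <= y1 ->
    x <= a0 \/ a1 <= x \/ y <= b0 \/ b1 <= y -> G x y != 0) ->
  winding G x0 x1 y0 y1 = winding G a0 a1 b0 b1.
Proof.
move=> cG xa aa ax yb bb by1 nv.
rewrite (@winding_splitx _ x0 a0 x1)//; [|lra|]; last first.
  by move=> x hx; split; apply: nv => //; (apply/andP; split; lra) || lra.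
rewrite [winding G x0 _ _ _]winding_nonvan ?add0r//; [|lra|]; last first.
  by move=> x y /andP[? ?] ?; apply: nv => //; [apply/andP; split; lra|lra].
rewrite (@winding_splitx _ a0 a1 x1)//; last first.
  by move=> x /andP[? ?]; split; apply: nv => //; (apply/andP; split; lra) || lra.
rewrite [winding G a1 _ _ _]winding_nonvan ?addr0//; [|lra|]; last first.
  by move=> x y /andP[? ?] ?; apply: nv => //; [apply/andP; split; lra|lra].
rewrite (@winding_splity _ _ _ y0 b0 y1)//; [|lra|]; last first.
  by move=> y /andP[? ?]; split; apply: nv => //; (apply/andP; split; lra) || lra.
rewrite [winding G _ _ y0 _]winding_nonvan ?add0r//; last first.
  by move=> x y /andP[? ?] /andP[? ?]; apply: nv => //; [apply/andP; split; lra|apply/andP; split; lra|lra].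
rewrite (@winding_splity _ _ _ b0 b1 y1)//; last first.
  by move=> y /andP[? ?]; split; apply: nv => //; (apply/andP; split; lra) || lra.
rewrite [winding G _ _ b1 _]winding_nonvan ?addr0//.
by move=> x y /andP[? ?] /andP[? ?]; apply: nv => //; [apply/andP; split; lra|apply/andP; split; lra|lra].
Qed.

(** The argument principle. Two different zeros are separated by a vertical or
    horizontal line that meets no zero, so an induction on the number of zeros
    reduces to at most one zero, and then the rectangle shrinks to a small square. *)
Lemma winding_sum G (k : R * R -> int) (s : seq (R * R)) x0 x1 y0 y1 :
  ccont2 G -> uniq s -> x0 < x1 -> y0 < y1 ->
  (forall p, p \in s -> x0 < p.1 < x1 /\ y0 < p.2 < y1) ->
  (forall x y, x0 <= x <= x1 -> y0 <= y <= y1 -> G x y = 0 -> (x, y) \in s) ->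
  (forall p, p \in s -> local_index G p (k p)) ->
  winding G x0 x1 y0 y1 = (\sum_(p <- s) k p)%:~R * (2 * pi).
Proof.
move=> cG; move: {2}(size s) (leqnn (size s)) => n.
elim: n s x0 x1 y0 y1 => [|n IH] s x0 x1 y0 y1.
  rewrite leqn0 size_eq0 => /eqP -> _ hx hy _ Gs _; rewrite big_nil mul0r.
  apply: winding_nonvan => //; try exact: ltW.
  by move=> x y h1 h2; apply/eqP => /(Gs x y h1 h2).
move=> sn us hx hy ins Gs ks.
have cutx c p q : p \in s -> q \in s -> p.1 < c -> c < q.1 -> c \notin [seq u.1 | u <- s] ->
    winding G x0 x1 y0 y1 = (\sum_(p <- s) k p)%:~R * (2 * pi).
  move=> ps qs pc cq cs.
  have [/andP[x0p _] _] := ins p ps; have [/andP[_ qx1] _] := ins q qs.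
  have x0c := lt_trans x0p pc; have cx1 := lt_trans cq qx1.
  have cne u : u \in s -> u.1 != c.
    by move=> us'; apply: contra cs => /eqP <-; apply: map_f.
  rewrite (@winding_splitx _ x0 c x1)//; try exact: ltW; last first.
    move=> x hxx; split; apply/eqP => /Gs-/(_ hxx); rewrite lexx (ltW hy) => /(_ isT)/ins[_];
    by rewrite ltxx ?andbF.
  rewrite (IH [seq u <- s | u.1 < c] x0 c y0 y1) ?filter_uniq//; first last.
  - by move=> u; rewrite mem_filter => /andP[_ /ks].
  - move=> x y hxx hyy Gxy; have us' : (x, y) \in s.
      by apply: Gs => //; case/andP: hxx => -> /le_trans -> //; exact: ltW.
    rewrite mem_filter us' andbT /= lt_neqAle (cne (x, y))//=.
    by case/andP: hxx.
  - by move=> u; rewrite mem_filter => /andP[uc /ins[/andP[-> _] ->]].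
  - rewrite -ltnS; apply: leq_trans sn; rewrite size_filter -(count_predC (fun u => u.1 < c) s).
    rewrite -[X in (X < _)%N]addn0 ltn_add2l -has_count; apply/hasP; exists q => //=.
    by rewrite -leNgt ltW.
  rewrite (IH [seq u <- s | c < u.1] c x1 y0 y1) ?filter_uniq//; first last.
  - by move=> u; rewrite mem_filter => /andP[_ /ks].
  - move=> x y hxx hyy Gxy; have us' : (x, y) \in s.
      by apply: Gs => //; case/andP: hxx => h ->; rewrite andbT (le_trans (ltW x0c)).
    rewrite mem_filter us' andbT /= lt_neqAle eq_sym (cne (x, y))//=.
    by case/andP: hxx.
  - by move=> u; rewrite mem_filter => /andP[uc /ins[/andP[_ ->] ->]]; rewrite uc.
  - rewrite -ltnS; apply: leq_trans sn; rewrite size_filter -(count_predC (fun u => c < u.1) s).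
    rewrite -[X in (X < _)%N]addn0 ltn_add2l -has_count; apply/hasP; exists p => //=.
    by rewrite -leNgt ltW.
  rewrite -mulrDl -rmorphD /= !big_filter; congr (_%:~R * _).
  rewrite [RHS](bigID (fun u : R * R => u.1 < c))/=; congr (_ + _).
  rewrite big_seq_cond [RHS]big_seq_cond; apply: eq_bigl => u.
  case us' : (u \in s) => //=; rewrite -leNgt lt_neqAle eq_sym (cne u)//.
have cuty c p q : p \in s -> q \in s -> p.2 < c -> c < q.2 -> c \notin [seq u.2 | u <- s] ->
    winding G x0 x1 y0 y1 = (\sum_(p <- s) k p)%:~R * (2 * pi).
  move=> ps qs pc cq cs.
  have [_ /andP[x0p _]] := ins p ps; have [_ /andP[_ qx1]] := ins q qs.
  have x0c := lt_trans x0p pc; have cx1 := lt_trans cq qx1.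
  have cne u : u \in s -> u.2 != c.
    by move=> us'; apply: contra cs => /eqP <-; apply: map_f.
  rewrite (@winding_splity _ _ _ y0 c y1)//; try exact: ltW; last first.
    move=> y hyy; split; apply/eqP => /Gs; rewrite lexx (ltW hx) => /(_ isT hyy)/ins[];
    by rewrite ltxx ?andbF.
  rewrite (IH [seq u <- s | u.2 < c] x0 x1 y0 c) ?filter_uniq//; first last.
  - by move=> u; rewrite mem_filter => /andP[_ /ks].
  - move=> x y hxx hyy Gxy; have us' : (x, y) \in s.
      by apply: Gs => //; case/andP: hyy => -> /le_trans -> //; exact: ltW.
    rewrite mem_filter us' andbT /= lt_neqAle (cne (x, y))//=.
    by case/andP: hyy.
  - by move=> u; rewrite mem_filter => /andP[uc /ins[-> /andP[-> _]]].
  - rewrite -ltnS; apply: leq_trans sn; rewrite size_filter -(count_predC (fun u => u.2 < c) s).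
    rewrite -[X in (X < _)%N]addn0 ltn_add2l -has_count; apply/hasP; exists q => //=.
    by rewrite -leNgt ltW.
  rewrite (IH [seq u <- s | c < u.2] x0 x1 c y1) ?filter_uniq//; first last.
  - by move=> u; rewrite mem_filter => /andP[_ /ks].
  - move=> x y hxx hyy Gxy; have us' : (x, y) \in s.
      by apply: Gs => //; case/andP: hyy => h ->; rewrite andbT (le_trans (ltW x0c)).
    rewrite mem_filter us' andbT /= lt_neqAle eq_sym (cne (x, y))//=.
    by case/andP: hyy.
  - by move=> u; rewrite mem_filter => /andP[uc /ins[-> /andP[_ ->]]]; rewrite uc.
  - rewrite -ltnS; apply: leq_trans sn; rewrite size_filter -(count_predC (fun u => c < u.2) s).
    rewrite -[X in (X < _)%N]addn0 ltn_add2l -has_count; apply/hasP; exists p => //=.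
    by rewrite -leNgt ltW.
  rewrite -mulrDl -rmorphD /= !big_filter; congr (_%:~R * _).
  rewrite [RHS](bigID (fun u : R * R => u.2 < c))/=; congr (_ + _).
  rewrite big_seq_cond [RHS]big_seq_cond; apply: eq_bigl => u.
  case us' : (u \in s) => //=; rewrite -leNgt lt_neqAle eq_sym (cne u)//.
have cut p q : p \in s -> q \in s -> p != q ->
    winding G x0 x1 y0 y1 = (\sum_(p <- s) k p)%:~R * (2 * pi).
  case: p q => [p1 p2] [q1 q2] ps qs; rewrite xpair_eqE negb_and.
  move=> /orP[] ne.
    wlog lt : p1 p2 q1 q2 ps qs ne / p1 < q1.
      move=> h; have [lt|lt|e] := ltrgtP p1 q1; [exact: (h p1 p2 q1 q2)|
        by apply: (h q1 q2 p1 p2) => //; rewrite eq_sym|by rewrite e eqxx in ne].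
    have [c /andP[pc cq] cs] := avoid_seq [seq u.1 | u <- s] lt.
    exact: (cutx c (p1, p2) (q1, q2)).
  wlog lt : p1 p2 q1 q2 ps qs ne / p2 < q2.
    move=> h; have [lt|lt|e] := ltrgtP p2 q2; [exact: (h p1 p2 q1 q2)|
      by apply: (h q1 q2 p1 p2) => //; rewrite eq_sym|by rewrite e eqxx in ne].
  have [c /andP[pc cq] cs] := avoid_seq [seq u.2 | u <- s] lt.
  exact: (cuty c (p1, p2) (q1, q2)).
case: s us sn ins Gs ks cut {cutx cuty} => [|p [|q s]] us sn ins Gs ks cut; last first.
- apply: (cut p q); rewrite ?inE ?eqxx ?orbT//.
  by move: us; rewrite /= inE negb_or => /andP[/andP[]].
- rewrite big_seq1; have [r r0 Hr] := ks p (mem_head _ _).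
  have [/andP[a1 a2] /andP[b1 b2]] := ins p (mem_head _ _).
  pose e := Num.min (Num.min (r / 2) (Num.min ((p.1 - x0) / 2) ((x1 - p.1) / 2)))
                    (Num.min ((p.2 - y0) / 2) ((y1 - p.2) / 2)).
  have e0 : 0 < e by rewrite !lt_min !divr_gt0 ?subr_gt0.
  have e1 : e <= r / 2 by rewrite !ge_min lexx.
  have e2 : e <= (p.1 - x0) / 2 by rewrite !ge_min lexx ?orbT.
  have e3 : e <= (x1 - p.1) / 2 by rewrite !ge_min lexx ?orbT.
  have e4 : e <= (p.2 - y0) / 2 by rewrite !ge_min lexx ?orbT.
  have e5 : e <= (y1 - p.2) / 2 by rewrite !ge_min lexx ?orbT.
  rewrite -(Hr e); last by apply/andP; split; lra.
  have nv x y : x0 <= x <= x1 -> y0 <= y <= y1 -> x != p.1 \/ y != p.2 -> G x y != 0.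
    move=> h1 h2 h3; apply/eqP => /(Gs x y h1 h2); rewrite inE => /eqP pe.
    by move: h3; rewrite -pe /= !eqxx => -[].
  apply: winding_shrink => //; try (apply/andP; split); try lra.
  move=> x y h1 h2 h3; apply: nv => //.
  have [exx|] := eqVneq x p.1; last by left.
  have [ey|] := eqVneq y p.2; last by right.
  by move: h3; rewrite exx ey => -[|[|[]]]; lra.
- rewrite big_nil mul0r; apply: winding_nonvan => //; try exact: ltW.
  by move=> x y h1 h2; apply/eqP => /(Gs x y h1 h2).
Qed.

End Winding2.

(** * Local indices of zeros *)

Section LocalIndex.
Variable R : realType.
Implicit Types (z w : R[i]) (G H : R -> R -> R[i]).

(** Each side of a square is seen from the centre under a right angle. The
    four sides are obtained from c = 1, i, -1, -i and the two orientations sg. *)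
Lemma is_angle_var_edge (c : R[i]) (sg : bool) (q e : R) : c != 0 -> 0 < e ->
  is_angle_var (fun y => c * (e +i* ((-1) ^+ sg * (y - q)))) (q - e) (q + e)
    ((-1) ^+ sg * (pi / 2)).
Proof.
move=> c0 e0; rewrite -[X in is_angle_var _ _ _ X]add0r.
apply: is_angle_varM; first exact: is_angle_var_cst.
have en : e != 0 by rewrite gt_eqF.
exists (fun y => atan ((-1) ^+ sg * (y - q) / e)); split.
- move=> y; apply: (@cvg_comp _ _ _ (fun y => (-1) ^+ sg * (y - q) / e) atan);
    last exact: continuous_atan.
  apply: cvgM; last exact: cvg_cst.
  apply: cvgM; first exact: cvg_cst.
  by apply: cvgB; [exact: cvg_id|exact: cvg_cst].
- move=> y _; set v := (-1) ^+ sg * (y - q).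
  have h0 : 0 < 1 + (v / e) ^+ 2 by rewrite ltr_pwDl// sqr_ge0.
  have s0 : 0 < Num.sqrt (1 + (v / e) ^+ 2) by rewrite sqrtr_gt0.
  have cn0 : cos (atan (v / e)) != 0.
    by rewrite cos_atan invr_neq0// gt_eqF.
  have sc : sin (atan (v / e)) = v / e * cos (atan (v / e)).
    by have := atanK (v / e); rewrite /tan => h; rewrite -[LHS](divfK cn0) h.
  exists (e * Num.sqrt (1 + (v / e) ^+ 2)); first exact: mulr_gt0.
  rewrite sc cos_atan; move: s0; set u := Num.sqrt _ => s0.
  have un : u != 0 by rewrite gt_eqF.
  by apply: complexP => /=; field; rewrite ?un ?en.
- have -> : (-1) ^+ sg * (q + e - q) / e = (-1) ^+ sg by field.
  have -> : (-1) ^+ sg * (q - e - q) / e = - (-1) ^+ sg by field.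
  by rewrite atanN; case: sg; rewrite ?expr1 ?expr0 ?atanN atan1; field.
Qed.

(** The complex coordinate centred at p. *)
Definition Zc (p : R * R) (x y : R) : R[i] := (x - p.1) +i* (y - p.2).

Lemma Zc_cont p : ccont2 (Zc p).
Proof.
apply: ccont_ReIm => x /=; apply: cvgB; try exact: cvg_cst.
  exact: cvg_fst.
exact: cvg_snd.
Qed.

Lemma Zc_neq0 p e x y : 0 < e -> x = p.1 - e \/ x = p.1 + e \/ y = p.2 - e \/ y = p.2 + e ->
  Zc p x y != 0.
Proof.
move=> e0 h; rewrite /Zc eq_complex /= !subr_eq0 negb_and.
by case: h => [|[|[]]] ->; apply/orP; [left|left|right|right]; apply/eqP; lra.
Qed.

Lemma winding_Zc p e : 0 < e -> winding (Zc p) (p.1 - e) (p.1 + e) (p.2 - e) (p.2 + e) = 2 * pi.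
Proof.
move=> e0; have le q : q - e <= q + e by lra.
have i0 : 0 +i* 1 != 0 :> R[i] by rewrite eq_complex /= oner_eq0 andbF.
have n0 : 0 +i* (-1) != 0 :> R[i] by rewrite eq_complex /= oppr_eq0 oner_eq0 andbF.
have m0 : -1 != 0 :> R[i] by rewrite oppr_eq0 oner_eq0.
rewrite /winding.
rewrite (angle_varE (le _) (is_angle_var_ext _ (is_angle_var_edge false p.1 n0 e0))); last first.
  by move=> x _; rewrite /Zc; apply: complexP; rewrite ?cReM ?cImM /= expr0; ring.
rewrite (angle_varE (le _) (is_angle_var_ext _ (is_angle_var_edge false p.2 (oner_neq0 _) e0))); last first.
  by move=> x _; rewrite /Zc; apply: complexP; rewrite ?cReM ?cImM /= expr0; ring.
rewrite (angle_varE (le _) (is_angle_var_ext _ (is_angle_var_edge true p.1 i0 e0))); last first.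
  by move=> x _; rewrite /Zc; apply: complexP; rewrite ?cReM ?cImM /= expr1; ring.
rewrite (angle_varE (le _) (is_angle_var_ext _ (is_angle_var_edge true p.2 m0 e0))); last first.
  by move=> x _; rewrite /Zc; apply: complexP; rewrite ?cReM ?cImM /= expr1; ring.
by rewrite expr0 expr1; field.
Qed.

Lemma angle_var_mul (f g : R -> R[i]) a b : a <= b -> ccont f -> ccont g ->
  (forall x, a <= x <= b -> f x != 0) -> (forall x, a <= x <= b -> g x != 0) ->
  angle_var (fun x => f x * g x) a b = angle_var f a b + angle_var g a b.
Proof. by move=> ab cf cg f0 g0; apply: angle_varE => //; apply: is_angle_varM; exact: angle_varP. Qed.

Lemma winding_mul G H x0 x1 y0 y1 : x0 <= x1 -> y0 <= y1 -> ccont2 G -> ccont2 H ->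
  on_bd (fun x y => G x y != 0 /\ H x y != 0) x0 x1 y0 y1 ->
  winding (fun x y => G x y * H x y) x0 x1 y0 y1 = winding G x0 x1 y0 y1 + winding H x0 x1 y0 y1.
Proof.
move=> hx hy cG cH [b1 b2]; rewrite /winding.
rewrite (@angle_var_mul (G ^~ y0) (H ^~ y0)) //; try exact: ccont2l;
  try by move=> x /b1[[? ?] [? ?]].
rewrite (@angle_var_mul (G ^~ y1) (H ^~ y1)) //; try exact: ccont2l;
  try by move=> x /b1[[? ?] [? ?]].
rewrite (@angle_var_mul (G x0) (H x0)) //; try exact: ccont2r;
  try by move=> x /b2[[? ?] [? ?]].
rewrite (@angle_var_mul (G x1) (H x1)) //; try exact: ccont2r;
  try by move=> x /b2[[? ?] [? ?]].
ring.
Qed.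

Lemma winding_conj G x0 x1 y0 y1 : x0 <= x1 -> y0 <= y1 -> ccont2 G ->
  on_bd (fun x y => G x y != 0) x0 x1 y0 y1 ->
  winding (fun x y => (G x y)^*) x0 x1 y0 y1 = - winding G x0 x1 y0 y1.
Proof.
move=> hx hy cG [b1 b2]; rewrite /winding.
rewrite (angle_varE hx (is_angle_var_conj (angle_varP hx (ccont2l y0 cG) _))); last by move=> x /b1[].
rewrite (angle_varE hx (is_angle_var_conj (angle_varP hx (ccont2l y1 cG) _))); last by move=> x /b1[].
rewrite (angle_varE hy (is_angle_var_conj (angle_varP hy (ccont2r x0 cG) _))); last by move=> x /b2[].
rewrite (angle_varE hy (is_angle_var_conj (angle_varP hy (ccont2r x1 cG) _))); last by move=> x /b2[].
ring.
Qed.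

Lemma square_bd (Q : R -> R -> Prop) p e : 0 < e ->
  (forall x y, `|x - p.1| <= e -> `|y - p.2| <= e ->
     x = p.1 - e \/ x = p.1 + e \/ y = p.2 - e \/ y = p.2 + e -> Q x y) ->
  on_bd Q (p.1 - e) (p.1 + e) (p.2 - e) (p.2 + e).
Proof.
move=> e0 H.
have h q x : q - e <= x <= q + e -> `|x - q| <= e.
  by move=> /andP[? ?]; rewrite ler_norml; apply/andP; split; lra.
have h1 q : `|q - e - q| <= e by rewrite addrAC subrr add0r normrN gtr0_norm.
have h2 q : `|q + e - q| <= e by rewrite addrAC subrr add0r gtr0_norm.
by split => u hu; split; apply: H => //; try exact: h; tauto.
Qed.

Lemma ccvg_slit (T : Type) (F : set_system T) {FF : Filter F} (h : T -> R[i]) a :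
  a != 0 -> ccvg F h a -> \forall x \near F, slit (h x / a).
Proof.
move=> a0 ha; have hc : ccvg F (fun x => h x / a) 1.
  by rewrite -(mulfV a0); apply: ccvgM => //; exact: ccvg_cst.
by apply: filterS (ccvg_norm1 hc ltr01) => x; exact: slit_near1.
Qed.

Lemma winding_Zcn p e n : 0 < e ->
  winding (fun x y => Zc p x y ^+ n) (p.1 - e) (p.1 + e) (p.2 - e) (p.2 + e) = n%:R * (2 * pi).
Proof.
move=> e0; have le q : q - e <= q + e by lra.
have cZ k : ccont2 (fun x y => Zc p x y ^+ k).
  elim: k => [|k IH].
    apply: (@ccont_ext _ _ (fun=> 1)); first by move=> x; rewrite expr0.
    exact: ccont_cst.
  apply: (@ccont_ext _ _ (fun q => Zc p q.1 q.2 * Zc p q.1 q.2 ^+ k)).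
    by move=> x; rewrite exprS.
  by apply: ccontM => //; exact: Zc_cont.
elim: n => [|n IH].
  rewrite mul0r (_ : (fun x y : R => _) = fun _ _ => 1); last first.
    by apply/funext => x; apply/funext => y; rewrite expr0.
  by rewrite winding_cst// oner_neq0.
rewrite (_ : (fun x y : R => _) = fun x y => Zc p x y * Zc p x y ^+ n); last first.
  by apply/funext => x; apply/funext => y; rewrite exprS.
rewrite winding_mul//; first by rewrite winding_Zc// IH -natr1; ring.
  exact: Zc_cont.
apply: square_bd => // x y _ _ /(Zc_neq0 e0) h; split => //; exact: expf_neq0.
Qed.

(** Near p the function is dominated by a Zc^n, whose winding is that of the
    n-th power. *)
Lemma local_index_order G p n (h : R -> R -> R[i]) a : ccont2 G -> a != 0 ->
  ccvg (nbhs p) (fun q => h q.1 q.2) a ->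
  (forall x y, G x y = Zc p x y ^+ n * h x y) -> local_index G p n%:Z.
Proof.
move=> cG a0 ha Gh; have [d d0 Hd] := near_ball2 (ccvg_slit a0 ha).
exists d => // e /andP[e0 ed].
have le q : q - e <= q + e by lra.
have cZ : ccont2 (fun x y => Zc p x y ^+ n).
  elim: (n) => [|k IH].
    apply: (@ccont_ext _ _ (fun=> 1)); first by move=> x; rewrite expr0.
    exact: ccont_cst.
  apply: (@ccont_ext _ _ (fun q => Zc p q.1 q.2 * Zc p q.1 q.2 ^+ k)).
    by move=> x; rewrite exprS.
  by apply: ccontM => //; exact: Zc_cont.
rewrite (@winding_rouche _ _ (fun x y => a * Zc p x y ^+ n))//.
- rewrite winding_mul//; last 2 first.
  + exact: ccont_cst.
  + apply: square_bd => // x y _ _ /(Zc_neq0 e0) hz; split => //; exact: expf_neq0.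
  by rewrite winding_cst// add0r winding_Zcn.
- by apply: ccontM => //; exact: ccont_cst.
- apply: square_bd => // x y hx hy /(Zc_neq0 e0) hz.
  have z0 := expf_neq0 n hz; split; first by rewrite mulf_neq0.
  have -> : G x y / (a * Zc p x y ^+ n) = h x y / a.
    by rewrite Gh; move: z0; set u := Zc p x y ^+ n => u0; field; rewrite a0 u0.
  exact: (Hd x y (le_lt_trans hx ed) (le_lt_trans hy ed)).
Qed.

Definition nrm z : R := Num.sqrt (complex.Re z ^+ 2 + complex.Im z ^+ 2).

Lemma nrmM z w : nrm (z * w) = nrm z * nrm w.
Proof.
rewrite /nrm -sqrtrM ?addr_ge0 ?sqr_ge0// cReM cImM; congr Num.sqrt; ring.
Qed.

Lemma nrm_ge0 z : 0 <= nrm z. Proof. exact: sqrtr_ge0. Qed.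

Lemma nrm_sqr z : nrm z ^+ 2 = complex.Re z ^+ 2 + complex.Im z ^+ 2.
Proof. by rewrite sqr_sqrtr// addr_ge0// sqr_ge0. Qed.

Lemma nrm_gt0 z : z != 0 -> 0 < nrm z.
Proof. by move=> z0; rewrite sqrtr_gt0; exact: sqr_ReIm_gt0. Qed.

Lemma nrm_le_norm1 z : nrm z <= norm1 z.
Proof.
rewrite -(@ler_pXn2r _ 2)// ?nnegrE ?nrm_ge0 ?norm1_ge0// nrm_sqr /norm1.
rewrite sqrrD !real_normK ?num_real// lerD2r lerDl mulrn_wge0// mulr_ge0//.
Qed.

Lemma Re_le_nrm z : `|complex.Re z| <= nrm z.
Proof.
by rewrite -(@ler_pXn2r _ 2)// ?nnegrE ?nrm_ge0// nrm_sqr real_normK ?num_real// lerDl sqr_ge0.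
Qed.

Lemma Im_le_nrm z : `|complex.Im z| <= nrm z.
Proof.
by rewrite -(@ler_pXn2r _ 2)// ?nnegrE ?nrm_ge0// nrm_sqr real_normK ?num_real// lerDr sqr_ge0.
Qed.

Lemma nrmD z w : nrm (z + w) <= nrm z + nrm w.
Proof.
rewrite -(@ler_pXn2r _ 2)// ?nnegrE ?nrm_ge0 ?addr_ge0 ?nrm_ge0//.
rewrite sqrrD !nrm_sqr cReD cImD.
suff : complex.Re z * complex.Re w + complex.Im z * complex.Im w <= nrm z * nrm w by lra.
apply: (le_trans (ler_norm _)).
rewrite -(@ler_pXn2r _ 2)// ?nnegrE ?mulr_ge0 ?nrm_ge0// exprMn !nrm_sqr real_normK ?num_real//.
by rewrite -subr_ge0 (_ : _ - _ = (complex.Re z * complex.Im w - complex.Im z * complex.Re w) ^+ 2)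
  ?sqr_ge0//; ring.
Qed.

Lemma nrm_conj z : nrm (z^*) = nrm z.
Proof. by case: z => x y; rewrite /nrm /= sqrrN. Qed.

Lemma nrm_slit z : nrm (z - 1) < 1 -> slit z.
Proof.
move=> h; apply: slitP => _; have := le_lt_trans (Re_le_nrm _) h.
by rewrite cReD /= ltr_norml; lra.
Qed.

Lemma slit_close z w : nrm (w - z) < nrm z -> slit (w / z).
Proof.
move=> h; have z0 : z != 0.
  by apply/eqP => z0; move: h; rewrite z0 /nrm /= !expr0n addr0 sqrtr0 ltNge sqrtr_ge0.
apply: nrm_slit; rewrite -(@ltr_pM2r _ (nrm z)) ?nrm_gt0// mul1r -nrmM.
by rewrite mulrBl divfK// mul1r.
Qed.

(** G has at p the value 0 and the real differential with columns a and b. *)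
Definition diff_at G (p : R * R) (a b : R[i]) := forall e : R, 0 < e ->
  exists2 d : R, 0 < d & forall x y : R, `|x - p.1| < d -> `|y - p.2| < d ->
    norm1 (G x y - (a * (x - p.1)%:C + b * (y - p.2)%:C)) <= e * (`|x - p.1| + `|y - p.2|).

(** In complex notation the differential is al z + be z^*, and its determinant
    is |al|^2 - |be|^2. According to its sign one of the two terms dominates the
    other and the remainder, and by Rouche's theorem G winds like z or like z^*. *)
Lemma local_index_regular G p a b : ccont2 G -> diff_at G p a b ->
  complex.Re a * complex.Im b - complex.Im a * complex.Re b != 0 ->
  local_index G p (sgz (complex.Re a * complex.Im b - complex.Im a * complex.Re b)).
Proof.
move=> cG dG; set D := _ - _ => D0.
(* al and be are the coefficients of z and z^* in the differential. *)
pose al : R[i] := ((complex.Re a + complex.Im b) / 2) +i* ((complex.Im a - complex.Re b) / 2).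
pose be : R[i] := ((complex.Re a - complex.Im b) / 2) +i* ((complex.Im a + complex.Re b) / 2).
have lin x y : a * (x - p.1)%:C + b * (y - p.2)%:C = al * Zc p x y + be * (Zc p x y)^*.
  by rewrite /al /be /Zc; case: (a) => a1 a2; case: (b) => b1 b2; apply: complexP => /=; field.
have DE : D = nrm al ^+ 2 - nrm be ^+ 2 by rewrite !nrm_sqr /= /D; field.
have Zle x y : `|x - p.1| + `|y - p.2| <= 2 * nrm (Zc p x y).
  by have := Re_le_nrm (Zc p x y); have := Im_le_nrm (Zc p x y); rewrite /=; lra.
have cc : ccont2 (fun x y => (Zc p x y)^*).
  apply: ccont_ReIm => x /=; first exact: (ccontRe (Zc_cont p)).
  by apply: cvgN; exact: (ccontIm (Zc_cont p)).
(* The dominant term c0 Y0, with Y0 one of z and z^*, determines the index. *)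
have main (c0 c1 : R[i]) (Y0 Y1 : R -> R -> R[i]) (k : int) :
    (forall x y, a * (x - p.1)%:C + b * (y - p.2)%:C = c0 * Y0 x y + c1 * Y1 x y) ->
    (forall x y, nrm (Y0 x y) = nrm (Zc p x y)) -> (forall x y, nrm (Y1 x y) = nrm (Zc p x y)) ->
    nrm c1 < nrm c0 -> ccont2 Y0 -> (forall e, 0 < e ->
      winding Y0 (p.1 - e) (p.1 + e) (p.2 - e) (p.2 + e) = k%:~R * (2 * pi)) -> local_index G p k.
  move=> lin' n0 nn1 c01 cY WY.
  pose e := (nrm c0 - nrm c1) / 4.
  have e0 : 0 < e by rewrite divr_gt0// subr_gt0.
  have [d d0 Hd] := dG e e0; exists d => // r /andP[r0 rd].
  have le q : q - r <= q + r by lra.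
  have c00 : c0 != 0.
    by apply/eqP => z; move: c01; rewrite z {2}/nrm /= !expr0n addr0 sqrtr0 ltNge nrm_ge0.
  have Y0n x y : Zc p x y != 0 -> Y0 x y != 0.
    move=> /nrm_gt0; rewrite -n0 => h; apply/eqP => z.
    by move: h; rewrite z /nrm /= !expr0n addr0 sqrtr0 ltxx.
  rewrite (@winding_rouche _ _ (fun x y => c0 * Y0 x y))//.
  + rewrite winding_mul//; last 2 first.
    * exact: ccont_cst.
    * by apply: square_bd => // x y _ _ /(Zc_neq0 r0) hz; split => //; exact: Y0n.
    by rewrite winding_cst// add0r WY.
  + by apply: ccontM => //; exact: ccont_cst.
  + apply: square_bd => // x y hx hy /(Zc_neq0 r0) hz.
    have zp := nrm_gt0 hz.
    split; first by rewrite mulf_neq0// Y0n.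
    apply: slit_close; rewrite nrmM n0.
    have -> : G x y - c0 * Y0 x y = (G x y - (a * (x - p.1)%:C + b * (y - p.2)%:C)) + c1 * Y1 x y.
      by rewrite lin'; ring.
    apply: le_lt_trans (nrmD _ _) _; rewrite nrmM nn1.
    have := Hd x y (le_lt_trans hx rd) (le_lt_trans hy rd).
    move=> /(le_trans (nrm_le_norm1 _)) h1.
    have h2 : e * (`|x - p.1| + `|y - p.2|) <= e * (2 * nrm (Zc p x y)) by rewrite ler_pM2l.
    have h3 : e * (2 * nrm (Zc p x y)) < (nrm c0 - nrm c1) * nrm (Zc p x y).
      by rewrite mulrA ltr_pM2r// /e; have : 0 < nrm c0 - nrm c1 by [rewrite subr_gt0]; lra.
    have := le_lt_trans (le_trans h1 h2) h3; rewrite mulrBl; lra.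
have [Dp|Dn|De] := ltrgtP D 0; last by rewrite De eqxx in D0.
- rewrite ltr0_sgz//.
  apply: (main be al (fun x y => (Zc p x y)^*) (Zc p)) => //.
  + by move=> x y; rewrite lin addrC.
  + by move=> x y; rewrite nrm_conj.
  + by rewrite -(@ltr_pXn2r _ 2)// ?nnegrE ?nrm_ge0// -subr_lt0 -DE.
  + move=> e e0; rewrite winding_conj.
    * by rewrite winding_Zc// mulrN1z mulN1r.
    * lra.
    * lra.
    * exact: Zc_cont.
    * by apply: square_bd => // x y _ _ /(Zc_neq0 e0).
- rewrite gtr0_sgz//.
  apply: (main al be (Zc p) (fun x y => (Zc p x y)^*)) => //.
  + by move=> x y; rewrite nrm_conj.
  + by rewrite -(@ltr_pXn2r _ 2)// ?nnegrE ?nrm_ge0// -subr_gt0 -DE.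
  + exact: Zc_cont.
  + by move=> e e0; rewrite winding_Zc// mul1r.
Qed.

(** If w / z lay on the negative half-line, then w would be at distance at
    least that of 0 from z, in any norm; here it is the maximum norm of the plane. *)
Lemma slit_maxnorm z w :
  Num.max `|complex.Re (w - z)| `|complex.Im (w - z)| < Num.max `|complex.Re z| `|complex.Im z| ->
  z != 0 /\ slit (w / z).
Proof.
move=> h; have z0 : z != 0.
  apply/eqP => z0; move: h; rewrite z0 /= !normr0 maxxx gt_max => /andP[].
  by rewrite ltNge normr_ge0.
split => //; apply: slitP => iq; rewrite ltNge; apply/negP => rq.
set k := complex.Re (w / z) in rq.
have wk : w = k%:C * z.
  by rewrite -[LHS](divfK z0); congr (_ * _); apply: complexP.
move: h; rewrite wk -[X in _ - X]mul1r -mulrBl cReM cImM /= subr0 !mul0r subr0 addr0.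
rewrite !normrM -maxr_pMr// ltNge.
have k1 : 1 <= `|k - 1| by rewrite ler0_norm; lra.
by apply/negP; rewrite negbK ler_peMl// le_max normr_ge0.
Qed.

End LocalIndex.

(** * Order of vanishing of a determinant *)

Section DetOrder.
Variable R : realType.
Local Notation K := R[i].

Lemma unitmx_inj (F : fieldType) n (A : 'M[F]_n) :
  (forall v : 'cV_n, A *m v = 0 -> v = 0) -> A \in unitmx.
Proof.
move=> H; rewrite -unitmx_tr -row_free_unit -kermx_eq0; apply/eqP/row_matrixP => i.
rewrite row0; apply: trmx_inj; rewrite trmx0; apply: H.
apply: trmx_inj; rewrite trmx0 trmx_mul trmxK.
by rewrite -row_mul mulmx_ker row0.
Qed.

(** After a change of bases M0 is the projection on the first r coordinates, r its
    rank. Then the last n - r rows of M0 + mu M1 are divisible by mu, which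
    gives the factor mu^(n - r); the remaining determinant tends to that of a
    matrix made of the first rows of the projection and the last rows of L1. The non-degeneracy
    assumption says exactly that this limit matrix is injective. *)
Lemma det_order n (M0 L1 : 'M[K]_n) (T : Type) (F : set_system T) (FF : Filter F)
    (mu : T -> K) (M1 : T -> 'M[K]_n) :
  ccvg F mu 0 ->
  (forall i j, ccvg F (fun x => M1 x i j) (L1 i j)) ->
  (forall v w : 'cV_n, M0 *m v = 0 -> L1 *m v = M0 *m w -> v = 0) ->
  exists h : T -> K, exists2 a, a != 0 & ccvg F h a /\
    forall x, \det (M0 + mu x *: M1 x) = mu x ^+ (n - \rank M0) * h x.
Proof.
move=> mu0 cM1 H; move: (mulmx_ebase M0) (col_ebase_unit M0) (row_ebase_unit M0).
move: (rank_leq_row M0).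
move: (col_ebase M0) (row_ebase M0) (\rank M0) => L U r rn M0E uL uU.
have [N NE] : exists N : T -> 'M[K]_n, forall x, N x = invmx L *m M1 x *m invmx U by eexists.
have [N1 N1E] : exists N1 : 'M[K]_n, N1 = invmx L *m L1 *m invmx U by eexists.
(* Tx is the transformed matrix with mu divided out of its last n - r rows,
   and T0 is its limit. *)
have [Tx TxE] : exists Tx : T -> 'M[K]_n, forall x i j,
    Tx x i j = if (i < r)%N then (i == j)%:R + mu x * N x i j else N x i j.
  exists (fun x => \matrix_(i, j) (if (i < r)%N then (i == j)%:R + mu x * N x i j else N x i j)).
  by move=> x i j; rewrite mxE.
have [T0 T0E] : exists T0 : 'M[K]_n, forall i j,
    T0 i j = if (i < r)%N then (i == j)%:R else N1 i j.
  exists (\matrix_(i, j) (if (i < r)%N then (i == j)%:R else N1 i j)).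
  by move=> i j; rewrite mxE.
have cN i j : ccvg F (fun x => N x i j) (N1 i j).
  rewrite N1E mxE; apply: (@ccvg_ext _ _ _ (fun x => \sum_k (invmx L *m M1 x) i k * invmx U k j)).
    by move=> x; rewrite NE mxE.
  apply: ccvg_sum => k _; apply: ccvgM; last exact: ccvg_cst.
  rewrite mxE; apply: (@ccvg_ext _ _ _ (fun x => \sum_l invmx L i l * M1 x l k)).
    by move=> x; rewrite mxE.
  by apply: ccvg_sum => l _; apply: ccvgM; [exact: ccvg_cst|exact: cM1].
have cT : ccvg F (fun x => \det (Tx x)) (\det T0).
  apply: ccvg_det => i j; rewrite T0E.
  apply: (@ccvg_ext _ _ _ (fun x => if (i < r)%N then (i == j)%:R + mu x * N x i j else N x i j)).
    by move=> x; rewrite TxE.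
  case: ifP => _; last exact: cN.
  rewrite -[X in ccvg _ _ X]addr0; apply: ccvgD; first exact: ccvg_cst.
  by rewrite -(mul0r (N1 i j)); apply: ccvgM.
exists (fun x => \det L * \det (Tx x) * \det U), (\det L * \det T0 * \det U).
  rewrite !mulf_neq0// -?unitfE -?unitmxE//.
  apply: unitmx_inj => v T0v.
  have vi (i : 'I_n) : (i < r)%N -> v i 0 = 0.
    move=> ir; have /matrixP/(_ i 0) := T0v; rewrite !mxE (bigD1 i)//= T0E ir eqxx mul1r.
    by rewrite big1 ?addr0// => j ji; rewrite T0E ir eq_sym (negbTE ji) mul0r.
  have pv : pid_mx r *m v = 0 :> 'cV_n.
    apply/matrixP => i j; rewrite !mxE big1// => k _; rewrite mxE ord1.
    case: eqP => [ik|]; last by rewrite mul0r.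
    by case: ltnP => [ir|]; rewrite ?andbF ?mul0r// vi ?mulr0//; move: ir; rewrite ik.
  (* The last rows of T0 v = 0 say that N1 v is in the range of the projection. *)
  have N1v : N1 *m v = pid_mx r *m (N1 *m v).
    apply/matrixP => i j; rewrite [RHS]mxE (bigD1 i)//= big1 ?addr0; last first.
      by move=> k ki; rewrite mxE eq_sym (_ : (_ == _ :> nat) = false) ?mul0r//; apply/negbTE.
    rewrite [pid_mx _ _ _]mxE eqxx /=; case: ltnP => ir; first by rewrite mul1r.
    rewrite mul0r; transitivity ((T0 *m v) i j); last by rewrite T0v mxE.
    by rewrite !mxE; apply: eq_bigr => k _; rewrite T0E ltnNge ir.
  have := H (invmx U *m v) (invmx U *m (N1 *m v)).
  have M0U (y : 'cV_n) : M0 *m (invmx U *m y) = L *m (pid_mx r *m y).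
    by rewrite -M0E -!mulmxA mulKVmx.
  rewrite !M0U pv mulmx0 => /(_ erefl).
  have -> : L1 *m (invmx U *m v) = L *m (pid_mx r *m (N1 *m v)).
    by rewrite -N1v N1E !mulmxA mulmxV// mul1mx.
  by move=> /(_ erefl) h; rewrite -[v]mul1mx -(mulmxV uU) -mulmxA h mulmx0.
split.
  by apply: ccvgM; [apply: ccvgM => //|]; exact: ccvg_cst.
move=> x; have -> : M0 + mu x *: M1 x = L *m (pid_mx r + mu x *: N x) *m U.
  rewrite mulmxDr mulmxDl M0E -scalemxAr -scalemxAl NE !mulmxA mulmxV// mul1mx.
  by rewrite mulmxKV.
have -> : pid_mx r + mu x *: N x =
    diag_mx (\row_i (if (i < r)%N then 1 else mu x)) *m Tx x.
  apply/matrixP => i j; rewrite mul_diag_mx !mxE TxE; case: ltnP => ir.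
    by rewrite mul1r andbT.
  by rewrite andbF add0r.
rewrite !det_mulmx det_diag; under eq_bigr do rewrite mxE.
have -> : \prod_(i < n) (if (i < r)%N then 1 else mu x) = mu x ^+ (n - r).
  rewrite -(@big_mkord K 1 *%R n xpredT (fun i => if (i < r)%N then 1 else mu x)).
  rewrite (@big_cat_nat _ _ _ r)//= big_nat big1 ?mul1r; last by move=> i /andP[_ ->].
  rewrite big_nat (eq_bigr (fun=> mu x)); last by move=> i /andP[ri _]; rewrite ltnNge ri.
  by rewrite -big_nat prodr_const_nat.
ring.
Qed.

End DetOrder.

(** * Integrals over subintervals of the unit interval *)

Section Integral.
Variable R : realType.
Local Notation mu := (@lebesgue_measure R).
Implicit Types (f g h : R -> R).

Definition intg f := mu.-integrable (`[0, 1]%classic : set R) (EFin \o f).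
Definition integ f (x y : R) : R := Rintegral mu (`[x, y]%classic) f.

Lemma intg_cont f : {within `[0, 1], continuous f} -> intg f.
Proof. by move=> cf; apply: continuous_compact_integrable => //; exact: segment_compact. Qed.

Lemma intg_contT f : continuous f -> intg f.
Proof. by move=> cf; apply: intg_cont; apply: continuous_subspaceT => x; exact: cf. Qed.

Lemma intg_sub f x y : 0 <= x -> y <= 1 -> intg f ->
  mu.-integrable (`[x, y]%classic : set R) (EFin \o f).
Proof.
move=> x0 y1; apply: integrableS => //; try exact: measurable_itv.
by move=> z /=; rewrite !in_itv /= => /andP[? ?]; apply/andP; split; lra.
Qed.

Lemma intgD f g : intg f -> intg g -> intg (fun x => f x + g x).
Proof.
move=> fi gi; have := @integrableD _ _ _ mu _ (measurable_itv _) _ _ fi gi.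
exact: eq_integrable.
Qed.

Lemma intgN f : intg f -> intg (fun x => - f x).
Proof. by move=> fi; have := @integrableN _ _ _ mu _ _ fi; exact: eq_integrable. Qed.

Lemma intgZ k f : intg f -> intg (fun x => k * f x).
Proof.
move=> fi; have := @integrableZl _ _ _ mu _ (measurable_itv _) k _ fi.
exact: eq_integrable.
Qed.

Lemma intg_norm f : intg f -> intg (fun x => `|f x|).
Proof. by move=> fi; have := @integrable_abse _ _ _ mu _ _ fi; exact: eq_integrable. Qed.

Lemma intg_meas f : intg f -> measurable_fun (`[0, 1]%classic : set R) f.
Proof. by move=> fi; apply/measurable_EFinP; exact: measurable_int fi. Qed.

Lemma intg_ext f g : (forall x, 0 <= x <= 1 -> f x = g x) -> intg f -> intg g.
Proof.
move=> fg; apply: eq_integrable => // x; rewrite inE /= in_itv /= => hx.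
by rewrite fg.
Qed.

Lemma intg_sum (I : Type) (r : seq I) (P : pred I) (F : I -> R -> R) :
  (forall i, P i -> intg (F i)) -> intg (fun x => \sum_(i <- r | P i) F i x).
Proof.
move=> H; elim: r => [|i r IH].
  apply: (@intg_ext (fun=> 0)); first by move=> x _; rewrite big_nil.
  by apply: intg_contT => x; exact: cvg_cst.
case Pi : (P i); last by apply: intg_ext IH => x _; rewrite big_cons Pi.
apply: (@intg_ext (fun x => F i x + \sum_(j <- r | P j) F j x)).
  by move=> x _; rewrite big_cons Pi.
by apply: intgD => //; exact: H.
Qed.

Lemma intg_le f g : measurable_fun (`[0, 1]%classic : set R) f -> intg g ->
  (forall x, 0 <= x <= 1 -> `|f x| <= g x) -> intg f.
Proof.
move=> mf ig fg; apply: (@le_integrable _ _ _ mu _ _ (EFin \o f) (EFin \o g)) => //.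
  exact/measurable_EFinP.
move=> x; rewrite /= in_itv /= => hx; rewrite lee_fin.
by apply: le_trans (fg x hx) _; exact: ler_norm.
Qed.

Lemma cont_bounded f : {within `[0, 1], continuous f} ->
  exists2 M : R, 0 < M & forall x, 0 <= x <= 1 -> `|f x| <= M.
Proof.
move=> cf; have cf' : {within `[0, 1], continuous (fun x => `|f x|)}.
  move=> x; apply: (@continuous_comp _ _ _ (f : subspace _ -> R) Num.norm x (cf x)).
  exact: norm_continuous.
have [c _ Hc] := EVT_max ler01 cf'.
exists (`|f c| + 1); first by rewrite ltr_wpDl.
move=> x hx; apply: (le_trans (Hc x _)); first by rewrite in_itv.
by rewrite lerDl.
Qed.

Lemma intgM f g : {within `[0, 1], continuous f} -> intg g -> intg (fun x => f x * g x).
Proof.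
move=> cf ig; have [M M0 fM] := cont_bounded cf.
apply: (@intg_le _ (fun x => M * `|g x|)).
- apply: measurable_funM; last exact: intg_meas.
  by apply: intg_meas; exact: intg_cont.
- by apply: intgZ; exact: intg_norm.
- by move=> x hx; rewrite normrM ler_wpM2r// fM.
Qed.

Lemma integ_xx f x : integ f x x = 0.
Proof. by rewrite /integ set_itv1 Rintegral_set1. Qed.

Lemma integ_split f x y z : intg f -> 0 <= x -> x <= y -> y <= z -> z <= 1 ->
  integ f x z = integ f x y + integ f y z.
Proof.
move=> fi x0 xy yz z1; have fi' := intg_sub x0 z1 fi.
have := @Rintegral_itvB R f (BLeft x) (BRight z) y fi' _ _.
rewrite !bnd_simp xy yz => /(_ isT isT); rewrite Rintegral_itv_obnd_cbnd.
  by rewrite /integ => <-; ring.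
apply: integrableS (intg_sub (le_trans x0 xy) z1 fi) => //.
by move=> u /=; rewrite !in_itv /= => /andP[/ltW -> ->].
Qed.

Lemma integ_ext f g x y : (forall u, x <= u <= y -> f u = g u) -> integ f x y = integ g x y.
Proof.
by move=> fg; apply: eq_Rintegral => u; rewrite inE /= in_itv /= => /fg.
Qed.

Lemma integ_D f g x y : 0 <= x -> y <= 1 -> intg f -> intg g ->
  integ (fun u => f u + g u) x y = integ f x y + integ g x y.
Proof. by move=> x0 y1 fi gi; apply: RintegralD => //; exact: intg_sub. Qed.

Lemma integ_Z k f x y : 0 <= x -> y <= 1 -> intg f ->
  integ (fun u => k * f u) x y = k * integ f x y.
Proof. by move=> x0 y1 fi; apply: RintegralZl => //; exact: intg_sub. Qed.

Lemma integ_N f x y : 0 <= x -> y <= 1 -> intg f ->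
  integ (fun u => - f u) x y = - integ f x y.
Proof.
move=> x0 y1 fi; rewrite -mulN1r -integ_Z//; apply: integ_ext => u _; ring.
Qed.

Lemma integ_B f g x y : 0 <= x -> y <= 1 -> intg f -> intg g ->
  integ (fun u => f u - g u) x y = integ f x y - integ g x y.
Proof. by move=> x0 y1 fi gi; rewrite integ_D ?integ_N//; exact: intgN. Qed.

Lemma integ_sum (I : Type) (r : seq I) (P : pred I) (F : I -> R -> R) x y : 0 <= x -> y <= 1 ->
  (forall i, P i -> intg (F i)) ->
  integ (fun u => \sum_(i <- r | P i) F i u) x y = \sum_(i <- r | P i) integ (F i) x y.
Proof.
move=> x0 y1 H; elim: r => [|i r IH].
  rewrite big_nil; transitivity (0 * integ (fun=> 0) x y); last by rewrite mul0r.
  rewrite -integ_Z//; last by apply: intg_contT => u; exact: cvg_cst.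
  by apply: integ_ext => u _; rewrite big_nil mul0r.
rewrite big_cons; case: ifP => Pi; last first.
  by rewrite -IH; apply: integ_ext => u _; rewrite big_cons Pi.
rewrite -IH -integ_D//; [|exact: H|exact: intg_sum].
by apply: integ_ext => u _; rewrite big_cons Pi.
Qed.

Lemma integ_le f g x y : 0 <= x -> y <= 1 -> intg f -> intg g ->
  (forall u, x <= u <= y -> f u <= g u) -> integ f x y <= integ g x y.
Proof.
move=> x0 y1 fi gi fg; apply: le_Rintegral => //; try exact: intg_sub.
Qed.

Lemma integ_ge0 f x y : (forall u, x <= u <= y -> 0 <= f u) -> 0 <= integ f x y.
Proof. by move=> H; apply: Rintegral_ge0 => u /=; rewrite in_itv /= => /H. Qed.

Lemma integ_norm f x y : 0 <= x -> y <= 1 -> intg f ->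
  `|integ f x y| <= integ (fun u => `|f u|) x y.
Proof. by move=> x0 y1 fi; apply: le_normr_Rintegral => //; exact: intg_sub. Qed.

Lemma integ_cst k x y : x <= y -> integ (fun=> k) x y = k * (y - x).
Proof.
move=> xy; rewrite /integ Rintegral_cst//.
have := @lebesgue_measure_itv R `[x, y]; rewrite /= lte_fin => ->.
case: ltP => // yx.
by have -> : x = y; [apply/eqP; rewrite eq_le xy|rewrite subrr].
Qed.

Lemma integ_cont f : intg f -> continuous (fun x => integ f 0 (clamp 0 1 x)).
Proof.
move=> fi; apply: (@within_clamp _ _ 0 1 (fun x => integ f 0 x)) => //.
exact: (@parameterized_integral_continuous R 0 1 f).
Qed.

Lemma integ_expR L x : 0 < L -> 0 <= x <= 1 ->
  integ (fun s => expR (L * s)) 0 x <= expR (L * x) / L.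
Proof.
move=> L0 /andP[x0 x1]; have Ln : L != 0 by rewrite gt_eqF.
have [->|xn0] := eqVneq x 0; first by rewrite integ_xx divr_ge0 ?expR_ge0// ltW.
have xp : 0 < x by rewrite lt_neqAle eq_sym xn0.
have dF y : is_derive y (1 : R) (fun s => expR (L * s) / L) (expR (L * y)).
  have h1 : is_derive y (1 : R) (fun s : R => L * s) L.
    by have := @is_deriveZ R R R id L y 1 1 _; rewrite /GRing.scale /= mulr1; apply.
  have h2 := @is_derive1_comp R expR (fun s : R => L * s) y _ _ _ h1.
  have := @is_deriveZ R R R _ L^-1 y 1 _ (h2 _ (is_derive_expR _)).
  rewrite /GRing.scale /= [expR _ * L]mulrC mulKf// => h3.
  by rewrite (_ : (fun s => _) = (fun s => L^-1 * expR (L * s)))//; apply/funext => s; rewrite mulrC.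
have cE : continuous (fun s => expR (L * s)).
  move=> s; apply: (@cvg_comp _ _ _ (fun s => L * s) expR); last exact: continuous_expR.
  by apply: cvgM; [exact: cvg_cst|exact: cvg_id].
have cF : continuous (fun s => expR (L * s) / L).
  by move=> s; apply: cvgM; [exact: cE|exact: cvg_cst].
have := @continuous_FTC2 R (fun s => expR (L * s)) (fun s => expR (L * s) / L) 0 x xp _ _ _.
rewrite /integ /Rintegral => ->.
- rewrite /= mulr0 expR0; have : 0 < L^-1 by rewrite invr_gt0.
  lra.
- by apply: continuous_subspaceT => s; exact: cE.
- split.
  + by move=> y _; have [] := dF y.
  + by apply: cvg_at_right_filter; exact: cF.
  + by apply: cvg_at_left_filter; exact: cF.
- by move=> y _; rewrite derive1E; have [_ ->] := dF y.
Qed.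

End Integral.

Section CIntegral.
Variable R : realType.
Implicit Types (f g : R -> R[i]).

Definition cintg f := intg (fun x => complex.Re (f x)) /\ intg (fun x => complex.Im (f x)).
Definition cinteg f (x : R) : R[i] :=
  integ (fun s => complex.Re (f s)) 0 x +i* integ (fun s => complex.Im (f s)) 0 x.

Lemma cintg_cont f : ccont f -> cintg f.
Proof. by move=> cf; split; apply: intg_contT; [exact: ccontRe|exact: ccontIm]. Qed.

Lemma cintgD f g : cintg f -> cintg g -> cintg (fun x => f x + g x).
Proof.
move=> [f1 f2] [g1 g2]; split.
  by apply: intg_ext (intgD f1 g1) => x _; rewrite cReD.
by apply: intg_ext (intgD f2 g2) => x _; rewrite cImD.
Qed.

Lemma cintgN f : cintg f -> cintg (fun x => - f x).
Proof.
move=> [f1 f2]; split.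
  by apply: intg_ext (intgN f1) => x _; rewrite cReN.
by apply: intg_ext (intgN f2) => x _; rewrite cImN.
Qed.

Lemma cintgM f g : ccont f -> cintg g -> cintg (fun x => f x * g x).
Proof.
move=> cf [g1 g2].
have c1 : {within `[0, 1], continuous (fun x => complex.Re (f x))}.
  by apply: continuous_subspaceT => x; exact: ccontRe.
have c2 : {within `[0, 1], continuous (fun x => complex.Im (f x))}.
  by apply: continuous_subspaceT => x; exact: ccontIm.
split.
  by apply: intg_ext (intgD (intgM c1 g1) (intgN (intgM c2 g2))) => x _; rewrite cReM.
by apply: intg_ext (intgD (intgM c1 g2) (intgM c2 g1)) => x _; rewrite cImM.
Qed.

Lemma cinteg_ext f g x : (forall s, 0 <= s <= x -> f s = g s) -> cinteg f x = cinteg g x.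
Proof.
by move=> fg; rewrite /cinteg; congr (_ +i* _); apply: integ_ext => s hs; rewrite fg.
Qed.

Lemma cinteg_D f g x : 0 <= x <= 1 -> cintg f -> cintg g ->
  cinteg (fun s => f s + g s) x = cinteg f x + cinteg g x.
Proof.
move=> /andP[x0 x1] [f1 f2] [g1 g2]; apply: complexP; rewrite ?cReD ?cImD /= -integ_D//;
  by apply: integ_ext => s _; rewrite ?cReD ?cImD.
Qed.

Lemma cinteg_N f x : 0 <= x <= 1 -> cintg f -> cinteg (fun s => - f s) x = - cinteg f x.
Proof.
move=> /andP[x0 x1] [f1 f2]; apply: complexP; rewrite ?cReN ?cImN /= -integ_N//;
  by apply: integ_ext => s _; rewrite ?cReN ?cImN.
Qed.

Lemma cinteg_Z z f x : 0 <= x <= 1 -> cintg f -> cinteg (fun s => z * f s) x = z * cinteg f x.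
Proof.
move=> /andP[x0 x1] [f1 f2]; apply: complexP; rewrite ?cReM ?cImM /= -!integ_Z//.
  rewrite -integ_B//; [|exact: intgZ|exact: intgZ].
  by apply: integ_ext => s _; rewrite cReM.
rewrite -integ_D//; [|exact: intgZ|exact: intgZ].
by apply: integ_ext => s _; rewrite cImM.
Qed.

Lemma cinteg_sum (I : Type) (r : seq I) (P : pred I) (F : I -> R -> R[i]) x : 0 <= x <= 1 ->
  (forall i, P i -> cintg (F i)) ->
  cinteg (fun s => \sum_(i <- r | P i) F i s) x = \sum_(i <- r | P i) cinteg (F i) x.
Proof.
move=> /andP[x0 x1] H; apply: complexP.
  rewrite cRe_sum /= -integ_sum//; last by move=> i /H[].
  by apply: integ_ext => s _; rewrite cRe_sum.
rewrite cIm_sum /= -integ_sum//; last by move=> i /H[].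
by apply: integ_ext => s _; rewrite cIm_sum.
Qed.

Lemma cinteg_cont f : cintg f -> ccont (fun x => cinteg f (clamp 0 1 x)).
Proof. by move=> [f1 f2]; apply: ccont_ReIm; exact: integ_cont. Qed.

Lemma cinteg_0 f : cinteg f 0 = 0.
Proof. by rewrite /cinteg !integ_xx. Qed.

Lemma cinteg_bound f (b : R -> R) x : 0 <= x <= 1 -> cintg f -> intg b ->
  (forall s, 0 <= s <= x -> norm1 (f s) <= b s) -> norm1 (cinteg f x) <= integ b 0 x.
Proof.
move=> /andP[x0 x1] [f1 f2] ib fb; rewrite /norm1 /=.
apply: (@le_trans _ _ (integ (fun s => `|complex.Re (f s)|) 0 x + integ (fun s => `|complex.Im (f s)|) 0 x)).
  by apply: lerD; apply: integ_norm.
rewrite -integ_D//; [|exact: intg_norm|exact: intg_norm].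
by apply: integ_le => //; apply: intgD; exact: intg_norm.
Qed.

End CIntegral.

(** * Linear Volterra equations *)

Section GeometricLimits.
Variable R : realType.

Lemma half_pow_le (a b c : R) : (forall k, a <= b + c / 2 ^+ k) -> a <= b.
Proof.
move=> H; rewrite leNgt; apply/negP => ba.
have [k hk] : exists k : nat, c / (a - b) < k%:R.
  exists (Num.bound `|c / (a - b)|); apply: le_lt_trans (ler_norm _) _.
  exact: archi_boundP.
have := H k; rewrite -lerBlDl leNgt => /negP; apply.
rewrite ltr_pdivrMr ?exprn_gt0//.
move: hk; rewrite ltr_pdivrMr ?subr_gt0// mulrC => hk; apply: (lt_le_trans hk).
rewrite ler_pM2l ?subr_gt0// -natrX ler_nat.
by elim: (k) => // j IH; rewrite expnS mul2n -addnn -addn1 leq_add// expn_gt0.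
Qed.

Lemma geo_lim (u : nat -> R) c : (forall k, `|u k.+1 - u k| <= c / 2 ^+ k) ->
  exists l, forall k, `|u k - l| <= 2 * c / 2 ^+ k.
Proof.
move=> H; pose a k := u k - 2 * c / 2 ^+ k; pose b k := u k + 2 * c / 2 ^+ k.
have c0 : 0 <= c by have := le_trans (normr_ge0 _) (H 0%N); rewrite expr0 divr1.
have p0 k : 0 <= c / 2 ^+ k by rewrite divr_ge0// exprn_ge0.
have e k : 2 * c / 2 ^+ k.+1 = c / 2 ^+ k.
  by rewrite exprS; field; rewrite expf_neq0.
have as1 k : a k <= a k.+1.
  rewrite /a e; have := H k; rewrite ler_norml => /andP[h1 _].
  have -> : 2 * c / 2 ^+ k = c / 2 ^+ k + c / 2 ^+ k by ring.
  lra.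
have bs1 k : b k.+1 <= b k.
  rewrite /b e; have := H k; rewrite ler_norml => /andP[_ h1].
  have -> : 2 * c / 2 ^+ k = c / 2 ^+ k + c / 2 ^+ k by ring.
  lra.
have as2 k j : (k <= j)%N -> a k <= a j.
  by move/subnK <-; elim: (j - k)%N => // i IH; exact: le_trans IH (as1 _).
have bs2 k j : (k <= j)%N -> b j <= b k.
  by move/subnK <-; elim: (j - k)%N => // i IH; exact: le_trans (bs1 _) IH.
have ab k : a k <= b k by have := p0 k; rewrite /a /b -mulrA; lra.
have ab2 k j : a k <= b j.
  have [kj|/ltnW jk] := leqP k j; first exact: le_trans (as2 _ _ kj) (ab j).
  exact: le_trans (ab k) (bs2 _ _ jk).
have hs : has_sup (range a) by split; [exists (a 0%N), 0%N|exists (b 0%N) => _ [k _ <-]].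
exists (sup (range a)) => k.
have h1 : a k <= sup (range a) by apply: sup_upper_bound => //; exists k.
have h2 : sup (range a) <= b k.
  by apply: sup_le_ub => [|_ [j _ <-]//]; exists (a 0%N), 0%N.
by move: h1 h2; rewrite /a /b => h1 h2; rewrite ler_norml; apply/andP; split; lra.
Qed.

Lemma cgeo_lim (u : nat -> R[i]) c : (forall k, norm1 (u k.+1 - u k) <= c / 2 ^+ k) ->
  exists l, forall k, norm1 (u k - l) <= 4 * c / 2 ^+ k.
Proof.
move=> H.
have [l1 h1] : exists l, forall k, `|complex.Re (u k) - l| <= 2 * c / 2 ^+ k.
  apply: geo_lim => k; apply: le_trans (H k).
  by rewrite /norm1 cReD cReN lerDl.
have [l2 h2] : exists l, forall k, `|complex.Im (u k) - l| <= 2 * c / 2 ^+ k.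
  apply: geo_lim => k; apply: le_trans (H k).
  by rewrite /norm1 cImD cImN lerDr.
exists (l1 +i* l2) => k; rewrite /norm1 cReD cImD /=.
apply: (le_trans (lerD (h1 k) (h2 k))).
by rewrite le_eqVlt; apply/orP; left; apply/eqP; field; rewrite expf_neq0.
Qed.

Lemma ccont_ulim (T : topologicalType) (g : nat -> T -> R[i]) (f : T -> R[i]) c :
  (forall k, ccont (g k)) -> (forall k x, norm1 (g k x - f x) <= c / 2 ^+ k) -> ccont f.
Proof.
move=> cg gf x; apply: norm1_ccvg => e e0.
have [k hk] : exists k, c / 2 ^+ k < e / 3.
  apply: contrapT => /forallNP h.
  have : e / 3 <= 0.
    by apply: (@half_pow_le _ _ c) => k; rewrite add0r leNgt; apply/negP/h.
  by rewrite leNgt divr_gt0.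
apply: filterS (ccvg_norm1 (cg k x) (_ : 0 < e / 3)); last by rewrite divr_gt0.
move=> y hy.
have -> : f y - f x = (g k y - g k x) - (g k y - f y) + (g k x - f x) by ring.
apply: le_lt_trans (norm1D _ _) _.
have := norm1D (g k y - g k x) (- (g k y - f y)); rewrite norm1N.
have := gf k x; have := gf k y; lra.
Qed.

End GeometricLimits.

Section Volterra.
Variable R : realType.

Definition mcont {T : topologicalType} p q (M : T -> 'M[R[i]]_(p, q)) :=
  forall i j, ccont (fun x => M x i j).

Lemma mcont_mul (T : topologicalType) p q r (A : T -> 'M[R[i]]_(p, q)) (B : T -> 'M[R[i]]_(q, r)) :
  mcont A -> mcont B -> mcont (fun s => A s *m B s).
Proof.
move=> cA cB i j; apply: (@ccont_ext _ _ (fun x => \sum_k A x i k * B x k j)).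
  by move=> x; rewrite mxE.
by apply: ccont_sum => k _; apply: ccontM.
Qed.

Lemma mcontD (T : topologicalType) p q (A B : T -> 'M[R[i]]_(p, q)) :
  mcont A -> mcont B -> mcont (fun s => A s + B s).
Proof.
move=> cA cB i j; apply: (@ccont_ext _ _ (fun x => A x i j + B x i j)).
  by move=> x; rewrite mxE.
exact: ccontD.
Qed.

Lemma mcontN (T : topologicalType) p q (A : T -> 'M[R[i]]_(p, q)) :
  mcont A -> mcont (fun s => - A s).
Proof.
move=> cA i j; apply: (@ccont_ext _ _ (fun x => - A x i j)).
  by move=> x; rewrite mxE.
exact: ccontN.
Qed.

Lemma mcont_cst (T : topologicalType) p q (A : 'M[R[i]]_(p, q)) : mcont (fun _ : T => A).
Proof. by move=> i j; exact: ccont_cst. Qed.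

Lemma mcont_comp (T U : topologicalType) p q (h : T -> U) (A : U -> 'M[R[i]]_(p, q)) :
  continuous h -> mcont A -> mcont (fun x => A (h x)).
Proof. by move=> ch cA i j; apply: (ccont_comp ch (cA i j)). Qed.

Lemma norm1_cont (T : topologicalType) (f : T -> R[i]) :
  ccont f -> continuous (fun x => norm1 (f x)).
Proof.
move=> cf x; have [f1 f2] := cf x.
by apply: cvgD; apply: cvg_norm.
Qed.

Lemma sum_cont (T : topologicalType) (I : Type) (r : seq I) (f : I -> T -> R) :
  (forall i, continuous (f i)) -> continuous (fun x => \sum_(i <- r) f i x).
Proof.
move=> H; elim: r => [|i r IH] x.
  rewrite (_ : (fun x => _) = fun=> 0); first exact: cvg_cst.
  by apply/funext => y; rewrite big_nil.
rewrite (_ : (fun x => _) = fun x => f i x + \sum_(j <- r) f j x).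
  by apply: cvgD; [exact: H|exact: IH].
by apply/funext => y; rewrite big_cons.
Qed.

Lemma mx_bounded p q (A : R -> 'M[R[i]]_(p, q)) : mcont A -> exists2 K : R, 0 < K &
  forall s, 0 <= s <= 1 -> forall i, \sum_k norm1 (A s i k) <= K.
Proof.
move=> cA.
have cf : {within `[0, 1], continuous (fun s => \sum_i \sum_k norm1 (A s i k))}.
  apply: continuous_subspaceT; apply: sum_cont => i; apply: sum_cont => k.
  exact: norm1_cont.
have [M M0 HM] := cont_bounded cf; exists M => // s hs i.
apply: le_trans (HM s hs); apply: le_trans (ler_norm _).
rewrite [leRHS](bigD1 i)//= lerDl sumr_ge0// => j _; apply: sumr_ge0 => k _.
exact: norm1_ge0.
Qed.

Lemma mx_bounded_entry p q (A : R -> 'M[R[i]]_(p, q)) : mcont A -> exists2 K : R, 0 < K &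
  forall s, 0 <= s <= 1 -> forall i j, norm1 (A s i j) <= K.
Proof.
move=> /mx_bounded[K K0 H]; exists K => // s hs i j; apply: le_trans (H s hs i).
by rewrite (bigD1 j)//= lerDl sumr_ge0// => k _; exact: norm1_ge0.
Qed.

Lemma norm1_mulmx p q r (A : 'M[R[i]]_(p, q)) (B : 'M[R[i]]_(q, r)) (K b : R) i j :
  \sum_k norm1 (A i k) <= K -> 0 <= b -> (forall k, norm1 (B k j) <= b) ->
  norm1 ((A *m B) i j) <= K * b.
Proof.
move=> AK b0 Bb; rewrite mxE; apply: le_trans (norm1_sum _ _ _) _.
apply: (@le_trans _ _ (\sum_k norm1 (A i k) * b)).
  apply: ler_sum => k _; apply: le_trans (norm1M _ _) _.
  by apply: ler_wpM2l => //; exact: norm1_ge0.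
by rewrite -mulr_suml ler_wpM2r.
Qed.

Variables n m : nat.
Implicit Types (A : R -> 'M[R[i]]_n) (h w : R -> 'M[R[i]]_(n, m)).

(** The integral form of w' = A w + h' with w 0 = h 0. *)
Definition volterra A h w := forall x, 0 <= x <= 1 -> forall i j,
  w x i j = h x i j + cinteg (fun s => (A s *m w s) i j) x.

Lemma intg_expR (c L : R) : intg (fun s => c * expR (L * s)).
Proof.
apply: intg_contT => s; apply: cvgM; first exact: cvg_cst.
apply: (@cvg_comp _ _ _ (fun s => L * s) expR); last exact: continuous_expR.
by apply: cvgM; [exact: cvg_cst|exact: cvg_id].
Qed.

(** In the weighted norm sup exp (- 2 K x) |w x| the integral operator is a
    contraction of ratio 1/2, because int_0^x K exp (2 K s) ds is at most
    exp (2 K x) / 2. *)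
Lemma volterra_step A h w (K c : R) x i j : mcont A -> mcont w -> 0 < K -> 0 <= c ->
  0 <= x <= 1 ->
  (forall s, 0 <= s <= 1 -> forall i, \sum_k norm1 (A s i k) <= K) ->
  (forall s, 0 <= s <= 1 -> forall i j, norm1 (w s i j) <= c * expR (2 * K * s)) ->
  norm1 (cinteg (fun s => (A s *m w s) i j) x) <= c / 2 * expR (2 * K * x).
Proof.
move=> cA cw K0 c0 hx AK wc.
apply: (@le_trans _ _ (integ (fun s => (K * c) * expR (2 * K * s)) 0 x)).
  apply: cinteg_bound => //; [by apply: cintg_cont; exact: mcont_mul|exact: intg_expR|].
  move=> s /andP[s0 sx]; have hs : 0 <= s <= 1 by rewrite s0 (le_trans sx)//; case/andP: hx.
  rewrite -mulrA; apply: norm1_mulmx; [exact: AK|by rewrite mulr_ge0// expR_ge0|].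
  by move=> k; exact: wc.
have K2 : 0 < 2 * K by rewrite mulr_gt0.
case/andP: (hx) => x0 x1; rewrite integ_Z//; last first.
  by apply: intg_ext (intg_expR 1 (2 * K)) => s _; rewrite mul1r.
apply: (@le_trans _ _ (K * c * (expR (2 * K * x) / (2 * K)))).
  by apply: ler_wpM2l; [rewrite mulr_ge0// ltW|exact: integ_expR].
rewrite le_eqVlt; apply/orP; left; apply/eqP; field.
by rewrite gt_eqF.
Qed.

(** Gronwall's inequality, by iterating the contraction. *)
Lemma volterra_bound A h w (K H : R) : mcont A -> mcont w -> 0 < K ->
  (forall s, 0 <= s <= 1 -> forall i, \sum_k norm1 (A s i k) <= K) ->
  volterra A h w -> (forall x, 0 <= x <= 1 -> forall i j, norm1 (h x i j) <= H) ->
  forall x, 0 <= x <= 1 -> forall i j, norm1 (w x i j) <= 2 * H * expR (2 * K * x).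
Proof.
move=> cA cw K0 AK vw hH x hx i j.
have H0 : 0 <= H := le_trans (norm1_ge0 _) (hH x hx i j).
have [B B0 wB] := mx_bounded_entry cw.
have e1 s : 0 <= s <= 1 -> 1 <= expR (2 * K * s).
  by move=> /andP[s0 _]; rewrite -expR0 ler_expR !mulr_ge0// ltW.
have main k s : 0 <= s <= 1 -> forall i j, norm1 (w s i j) <= (2 * H + B / 2 ^+ k) * expR (2 * K * s).
  elim: k s => [|k IH] s hs p q.
    rewrite expr0 divr1; apply: (le_trans (wB s hs p q)).
    apply: (@le_trans _ _ (2 * H + B)); first by rewrite lerDr mulr_ge0.
    by rewrite ler_peMr ?e1// addr_ge0 ?mulr_ge0// ltW.
  rewrite vw//; apply: (le_trans (norm1D _ _)).
  have c0 : 0 <= 2 * H + B / 2 ^+ k by rewrite addr_ge0 ?mulr_ge0 ?invr_ge0 ?exprn_ge0// ltW.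
  have := @volterra_step A h w K (2 * H + B / 2 ^+ k) s p q cA cw K0 c0 hs AK IH.
  have := hH s hs p q.
  have := ler_wpM2l H0 (e1 s hs); rewrite mulr1.
  have -> : (2 * H + B / 2 ^+ k.+1) * expR (2 * K * s) =
    H * expR (2 * K * s) + (2 * H + B / 2 ^+ k) / 2 * expR (2 * K * s).
    by rewrite exprS; field; rewrite expf_neq0.
  lra.
apply: (@half_pow_le R _ _ (B * expR (2 * K * x))) => k.
apply: le_trans (main k x hx i j) _.
by rewrite mulrDl lerD2l mulrAC.
Qed.

Lemma volterra_sub A h w h' w' : mcont A -> mcont w -> mcont w' -> volterra A h w -> volterra A h' w' ->
  volterra A (fun x => h x - h' x) (fun x => w x - w' x).
Proof.
move=> cA cw cw' vw vw' x hx i j; rewrite !mxE vw// vw'//.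
rewrite (@cinteg_ext _ (fun s => (A s *m (w s - w' s)) i j)
   (fun s => (A s *m w s) i j + - (A s *m w' s) i j)); last first.
  by move=> s _; rewrite mulmxBr !mxE.
rewrite cinteg_D// ?cinteg_N//; first ring.
- by apply: cintg_cont; exact: mcont_mul.
- by apply: cintg_cont; exact: mcont_mul.
- by apply: cintgN; apply: cintg_cont; exact: mcont_mul.
Qed.

Lemma volterra_uniq A h w w' : mcont A -> mcont w -> mcont w' -> volterra A h w -> volterra A h w' ->
  forall x, 0 <= x <= 1 -> w x = w' x.
Proof.
move=> cA cw cw' vw vw' x hx; apply/matrixP => i j.
have [K K0 AK] := mx_bounded cA.
have cd : mcont (fun x => w x - w' x) by apply: mcontD => //; exact: mcontN.
have := volterra_bound (H := 0) cA cd K0 AK (volterra_sub cA cw cw' vw vw') _ hx i j.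
rewrite mulr0 mul0r !mxE => H.
apply/eqP; rewrite -subr_eq0 -norm1_eq0; apply/eqP/le_anti; rewrite norm1_ge0 andbT; apply: H.
by move=> s hs p q; rewrite subrr mxE norm1_0.
Qed.

(** Picard iteration: consecutive iterates approach each other geometrically. *)
Lemma volterra_exists A h : mcont A -> mcont h -> exists2 w, mcont w & volterra A h w.
Proof.
move=> cA ch; have [K K0 AK] := mx_bounded cA.
pose cl : R -> R := clamp 0 1.
have ccl : continuous cl by exact: clamp_cont.
pose step w : R -> 'M[R[i]]_(n, m) := fun x => \matrix_(i, j)
  (h (cl x) i j + cinteg (fun s => (A s *m w s) i j) (cl x)).
have stepE w x : 0 <= x <= 1 -> forall i j,
    step w x i j = h x i j + cinteg (fun s => (A s *m w s) i j) x.
  by move=> hx i j; rewrite mxE /cl clamp_id.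
have cstep w : mcont w -> mcont (step w).
  move=> cw i j; apply: (@ccont_ext _ _ (fun x => h (cl x) i j + cinteg (fun s => (A s *m w s) i j) (cl x))).
    by move=> x; rewrite mxE.
  apply: ccontD; first exact: (ccont_comp ccl (ch i j)).
  by apply: cinteg_cont; apply: cintg_cont; exact: mcont_mul.
pose u k := iter k step (fun x => h (cl x)).
have cu k : mcont (u k).
  by elim: k => [|k IH]; [exact: mcont_comp|exact: cstep].
have [B B0 HB] : exists2 B : R, 0 < B & forall s, 0 <= s <= 1 -> forall i j, norm1 ((u 1%N s - u 0%N s) i j) <= B.
  by apply: mx_bounded_entry; apply: mcontD => //; exact: mcontN.
have e1 s : 0 <= s <= 1 -> 1 <= expR (2 * K * s).
  by move=> /andP[s0 _]; rewrite -expR0 ler_expR !mulr_ge0// ltW.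
(* Iterates in the weighted norm; the bound is halved at each step. *)
have d k s : 0 <= s <= 1 -> forall i j, norm1 ((u k.+1 s - u k s) i j) <= B / 2 ^+ k * expR (2 * K * s).
  elim: k s => [|k IH] s hs i j.
    by rewrite expr0 divr1; apply: (le_trans (HB s hs i j)); rewrite ler_peMr ?e1// ltW.
  have c0 : 0 <= B / 2 ^+ k by rewrite divr_ge0 ?exprn_ge0// ltW.
  have cd : mcont (fun x => u k.+1 x - u k x) by apply: mcontD => //; exact: mcontN.
  have := @volterra_step A h _ K (B / 2 ^+ k) s i j cA cd K0 c0 hs AK IH.
  have -> : B / 2 ^+ k / 2 = B / 2 ^+ k.+1.
    by rewrite exprS; field; rewrite expf_neq0.
  apply: le_trans; rewrite le_eqVlt; apply/orP; left; apply/eqP; congr norm1.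
  rewrite [(u k.+2 s - _) i j]mxE [in X in _ + X]mxE /= !stepE//.
  rewrite (@cinteg_ext _ (fun s => (A s *m (u k.+1 s - u k s)) i j)
   (fun s => (A s *m u k.+1 s) i j + - (A s *m u k s) i j)); last first.
    by move=> y _; rewrite mulmxBr !mxE.
  rewrite cinteg_D// ?cinteg_N//; first ring.
  - by apply: cintg_cont; apply: mcont_mul => //; exact: cu.
  - by apply: cintg_cont; apply: mcont_mul => //; exact: cu.
  - by apply: cintgN; apply: cintg_cont; apply: mcont_mul => //; exact: cu.
pose E := expR (2 * K).
have dE k s : 0 <= s <= 1 -> forall i j, norm1 (u k.+1 s i j - u k s i j) <= B * E / 2 ^+ k.
  move=> hs i j; have := d k s hs i j; rewrite !mxE => /le_trans; apply.
  rewrite mulrAC ler_pdivrMr ?exprn_gt0// divfK ?expf_neq0//.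
  rewrite ler_pM2l// ler_expR; case/andP: hs => s0 s1.
  by rewrite ler_piMr// mulr_ge0// ltW.
have ex s i j : exists l, forall k, norm1 (u k (cl s) i j - l) <= 4 * (B * E) / 2 ^+ k.
  by apply: cgeo_lim => k; apply: dE; exact: clampP.
pose w s : 'M[R[i]]_(n, m) := \matrix_(i, j) projT1 (cid (ex s i j)).
have wu k s i j : norm1 (u k (cl s) i j - w s i j) <= 4 * (B * E) / 2 ^+ k.
  by rewrite mxE; exact: projT2 (cid (ex s i j)) k.
have cw : mcont w.
  move=> i j; apply: (@ccont_ulim _ _ (fun k s => u k (cl s) i j) _ (4 * (B * E))) => k.
    exact: (ccont_comp ccl (cu k i j)).
  by move=> s; exact: wu.
exists w => // x hx i j.
apply/eqP; rewrite -subr_eq0 -norm1_eq0; apply/eqP/le_anti; rewrite norm1_ge0 andbT.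
have wu' k s : 0 <= s <= 1 -> forall i j, norm1 (u k s i j - w s i j) <= 4 * (B * E) / 2 ^+ k.
  by move=> hs p q; have := wu k s p q; rewrite /cl clamp_id.
apply: (@half_pow_le R _ _ (4 * (B * E) + K * (4 * (B * E)))) => k; rewrite add0r.
have -> : w x i j - (h x i j + cinteg (fun s => (A s *m w s) i j) x) =
   - (u k.+1 x i j - w x i j) + cinteg (fun s => (A s *m (u k s - w s)) i j) x.
  rewrite [u k.+1]/= -/(u k) stepE//.
  rewrite (@cinteg_ext _ (fun s => (A s *m (u k s - w s)) i j)
   (fun s => (A s *m u k s) i j + - (A s *m w s) i j)); last first.
    by move=> y _; rewrite mulmxBr !mxE.
  rewrite cinteg_D// ?cinteg_N//; first ring.
  - by apply: cintg_cont; apply: mcont_mul => //; exact: cu.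
  - by apply: cintg_cont; apply: mcont_mul.
  - by apply: cintgN; apply: cintg_cont; apply: mcont_mul.
apply: (le_trans (norm1D _ _)); rewrite norm1N mulrDl; apply: lerD.
  apply: (le_trans (wu' k.+1 x hx i j)).
  have -> : 4 * (B * E) / 2 ^+ k.+1 = 4 * (B * E) / 2 ^+ k / 2.
    by rewrite exprS; field; rewrite expf_neq0.
  have : 0 <= 4 * (B * E) / 2 ^+ k.
    by rewrite !mulr_ge0 ?invr_ge0 ?exprn_ge0 ?expR_ge0// ltW.
  lra.
case/andP: (hx) => x0 x1.
apply: (@le_trans _ _ (integ (fun=> K * (4 * (B * E) / 2 ^+ k)) 0 x)).
  apply: cinteg_bound => //.
  - apply: cintg_cont; apply: mcont_mul => //.
    by apply: mcontD; [exact: cu|exact: mcontN].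
  - by apply: intg_contT => s; exact: cvg_cst.
  - move=> s /andP[s0 sx]; have hs : 0 <= s <= 1 by rewrite s0 (le_trans sx).
    apply: norm1_mulmx; [exact: AK| |by move=> p; rewrite mxE [X in _ + X]mxE; exact: wu'].
    by rewrite !mulr_ge0 ?invr_ge0 ?exprn_ge0 ?expR_ge0// ltW.
rewrite integ_cst// subr0 -[leRHS]mulr1 -!mulrA.
rewrite !ler_pM2l ?expR_gt0 ?invr_gt0 ?exprn_gt0//.
Qed.

End Volterra.

(** * One-sided derivatives, C1 and H1 functions *)

Section OneSidedCalculus.
Variable R : realType.
Local Notation mu := (@lebesgue_measure R).
Implicit Types (f g : R -> R).

Definition isD f (x l : R) := diffquot01 f x --> l.

Lemma dq_proper (x : R) : 0 <= x <= 1 ->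
  ProperFilter (within [set h : R | 0 <= x + h <= 1] 0^').
Proof.
move=> /andP[x0 x1]; apply: Build_ProperFilter_ex => A.
rewrite /within /= /dnbhs /within /= => /near_ball1[d d0 H].
have [xh|xh] := ltP x (1 / 2).
  exists (Num.min (d / 2) (1 / 2)).
  have m0 : 0 < Num.min (d / 2) (1 / 2) by rewrite lt_min; apply/andP; split; lra.
  have m1 : Num.min (d / 2) (1 / 2) <= d / 2 by rewrite ge_min lexx.
  have m2 : Num.min (d / 2) (1 / 2) <= 1 / 2 by rewrite ge_min lexx orbT.
  apply: H; [by rewrite subr0 gtr0_norm//; lra|by rewrite gt_eqF|].
  by apply/andP; split; lra.
exists (- Num.min (d / 2) (1 / 2)).
have m0 : 0 < Num.min (d / 2) (1 / 2) by rewrite lt_min; apply/andP; split; lra.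
have m1 : Num.min (d / 2) (1 / 2) <= d / 2 by rewrite ge_min lexx.
have m2 : Num.min (d / 2) (1 / 2) <= 1 / 2 by rewrite ge_min lexx orbT.
apply: H; [by rewrite subr0 normrN gtr0_norm//; lra|by rewrite oppr_eq0 gt_eqF|].
by apply/andP; split; lra.
Qed.

(** The difference quotient cleared of its denominator: this form needs no
    distinction between interior points and endpoints. *)
Lemma isDP f x l : isD f x l <-> forall e : R, 0 < e -> exists2 d : R, 0 < d &
  forall y, 0 <= y <= 1 -> `|y - x| < d -> `|f y - f x - l * (y - x)| <= e * `|y - x|.
Proof.
split.
  move=> /cvgrPdist_le H e e0; have /near_ball1[d d0 Hd] := H e e0.
  exists d => // y hy yd; have [->|yx] := eqVneq y x.
    by rewrite !subrr mulr0 subr0 normr0 mulr0.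
  have yx0 : y - x != 0 by rewrite subr_eq0.
  have := Hd (y - x); rewrite subr0 => /(_ yd yx0).
  rewrite /= (_ : x + (y - x) = y); last by ring.
  move=> /(_ hy) h; rewrite -ler_pdivrMr ?normr_gt0// -normf_div.
  rewrite (_ : (f y - f x - l * (y - x)) / (y - x) = - (l - (y - x)^-1 * (f y - f x))) ?normrN//.
  by field.
move=> H; apply/cvgrPdist_le => e e0; have [d d0 Hd] := H e e0.
apply/nbhs_ballP; exists d => // h; rewrite /ball /= sub0r normrN => hd h0 hx.
have := Hd (x + h) hx; rewrite (_ : x + h - x = h); last by ring.
move=> /(_ hd); rewrite -ler_pdivrMr ?normr_gt0// -normf_div -normrN.
rewrite (_ : - (l - h^-1 * (f (x + h) - f x)) = (f (x + h) - f x - l * h) / h)//.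
by field.
Qed.

Lemma isD_D01 f x l : 0 <= x <= 1 -> isD f x l -> derivable01 f x /\ D01 f x = l.
Proof.
move=> hx H; have pf := dq_proper hx; split; first by apply/cvg_ex; exists l.
by apply: cvg_lim.
Qed.

Lemma D01_isD f x : derivable01 f x -> isD f x (D01 f x).
Proof. by []. Qed.

Lemma isD_ext f g x l : 0 <= x <= 1 -> (forall y, 0 <= y <= 1 -> f y = g y) ->
  isD f x l -> isD g x l.
Proof.
move=> hx fg /isDP H; apply/isDP => e e0; have [d d0 Hd] := H e e0; exists d => // y hy yd.
by rewrite -!fg//; apply: Hd.
Qed.

Lemma isD_cont f x l : isD f x l -> forall e : R, 0 < e -> exists2 d : R, 0 < d &
  forall y, 0 <= y <= 1 -> `|y - x| < d -> `|f y - f x| < e.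
Proof.
move=> /isDP H e e0; have [d d0 Hd] := H 1 ltr01.
have k0 : 0 < 2 + `|l| by rewrite ltr_pwDl.
exists (Num.min d (e / (2 + `|l|))); first by rewrite lt_min d0 divr_gt0.
move=> y hy; rewrite lt_min => /andP[yd]; rewrite ltr_pdivlMr// => ye.
have := Hd y hy yd; rewrite mul1r => h.
have := ler_normD (f y - f x - l * (y - x)) (l * (y - x)); rewrite subrK normrM => h2.
by apply: le_lt_trans ye; have := normr_ge0 (y - x); move: h h2;
  set a := `|f y - f x - _|; set b := `|f y - f x|; set c := `|y - x|; set k := `|l|; nra.
Qed.

Lemma within01P f : {within `[0, 1], continuous f} <->
  forall x, 0 <= x <= 1 -> forall e : R, 0 < e -> exists2 d : R, 0 < d &
  forall y, 0 <= y <= 1 -> `|y - x| < d -> `|f y - f x| < e.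
Proof.
split.
  move=> /subspace_continuousP H x hx e e0.
  have /H/cvgrPdist_lt/(_ e e0) : (`[0, 1]%classic : set R) x by rewrite /= in_itv.
  move=> /near_ball1[d d0 Hd]; exists d => // y hy yd; rewrite distrC; exact: Hd.
move=> H; apply/subspace_continuousP => x; rewrite /= in_itv /= => hx.
apply/cvgrPdist_lt => e e0; have [d d0 Hd] := H x hx e e0.
apply/nbhs_ballP; exists d => // y; rewrite /ball /= distrC => yd; rewrite in_itv /= => hy.
by rewrite distrC; apply: Hd.
Qed.

Lemma isD_within f : (forall x, 0 <= x <= 1 -> exists l, isD f x l) ->
  {within `[0, 1], continuous f}.
Proof. by move=> H; apply/within01P => x hx; have [l hl] := H x hx; exact: isD_cont hl. Qed.

Lemma isD_cst c x : isD (fun=> c) x 0.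
Proof.
apply/isDP => e e0; exists 1 => // y _ _.
by rewrite mul0r subrr subr0 normr0 mulr_ge0// ltW.
Qed.

Lemma isDD f g x l m : isD f x l -> isD g x m -> isD (fun y => f y + g y) x (l + m).
Proof.
move=> /isDP H1 /isDP H2; apply/isDP => e e0.
have e2 : 0 < e / 2 by rewrite divr_gt0.
have [d d0 Hd] := H1 _ e2; have [d' d0' Hd'] := H2 _ e2.
exists (Num.min d d'); first by rewrite lt_min d0.
move=> y hy; rewrite lt_min => /andP[yd yd'].
have -> : f y + g y - (f x + g x) - (l + m) * (y - x) =
  (f y - f x - l * (y - x)) + (g y - g x - m * (y - x)) by ring.
apply: le_trans (ler_normD _ _) _; have := Hd y hy yd; have := Hd' y hy yd'; lra.
Qed.

Lemma isD_quot f x l : isD f x l <->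
  (fun h => h^-1 * (f (x + h) - f x)) @ (within [set h : R | 0 <= x + h <= 1] 0^') --> l.
Proof. by []. Qed.

Lemma isD_cvg f x l : 0 <= x <= 1 -> isD f x l ->
  (fun h => f (x + h)) @ (within [set h : R | 0 <= x + h <= 1] 0^') --> f x.
Proof.
move=> hx H; apply/cvgrPdist_lt => e e0; have [d d0 Hd] := isD_cont H e0.
apply/nbhs_ballP; exists d => // h; rewrite /ball /= sub0r normrN => hd h0 hxh.
by rewrite distrC; apply: Hd => //; rewrite addrAC subrr add0r.
Qed.

Lemma isDM f g x l m : 0 <= x <= 1 -> isD f x l -> isD g x m ->
  isD (fun y => f y * g y) x (l * g x + f x * m).
Proof.
move=> hx H1 H2; apply/isD_quot.
have ff := within_filter [set h : R | 0 <= x + h <= 1] (dnbhs_filter (0 : R)).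
rewrite (_ : (fun h => _) = (fun h => h^-1 * (f (x + h) - f x) * g (x + h) +
  f x * (h^-1 * (g (x + h) - g x)))); last by apply/funext => h; ring.
apply: cvgD; apply: cvgM; [exact: H1|exact: isD_cvg H2|exact: cvg_cst|exact: H2].
Qed.

Lemma isDV f x l : 0 <= x <= 1 -> (forall y, 0 <= y <= 1 -> f y != 0) -> isD f x l ->
  isD (fun y => (f y)^-1) x (- l / (f x ^+ 2)).
Proof.
move=> hx f0 H; apply/isD_quot.
have ff := within_filter [set h : R | 0 <= x + h <= 1] (dnbhs_filter (0 : R)).
have fx0 := f0 x hx.
apply: (@cvg_trans _ ((fun h => - (h^-1 * (f (x + h) - f x)) * (f (x + h))^-1 * (f x)^-1)
    @ (within [set h : R | 0 <= x + h <= 1] 0^'))).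
  apply: near_eq_cvg; apply/nbhs_ballP; exists 1 => //= h _ h0 hxh.
  have := f0 _ hxh => fh; field.
  by rewrite fx0 fh h0.
have -> : - l / f x ^+ 2 = - l * (f x)^-1 * (f x)^-1 by field.
apply: cvgM; last exact: cvg_cst.
apply: cvgM; first by apply: cvgN; exact: H.
by apply: cvgV => //; exact: isD_cvg H.
Qed.

Lemma isD_prim g c x : {within `[0, 1], continuous g} -> 0 <= x <= 1 ->
  isD (fun y => c + integ g 0 y) x (g x).
Proof.
move=> cg hx; apply/isDP => e e0; move/within01P: (cg) => /(_ x hx e e0)[d d0 Hd].
have ig := intg_cont cg; case/andP: (hx) => x0 x1.
exists d => // y /andP[y0 y1] yd.
have main a b : 0 <= a -> a <= b -> b <= 1 -> (forall u, a <= u <= b -> `|g u - g x| <= e) ->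
    `|integ g a b - g x * (b - a)| <= e * (b - a).
  move=> a0 ab b1 H; rewrite -!integ_cst// -integ_B//; last by apply: intg_contT => u; exact: cvg_cst.
  have ic : intg (fun u => g u - g x).
    by apply: intgD => //; apply: intg_contT => u; exact: cvg_cst.
  apply: (le_trans (integ_norm a0 b1 ic)); apply: integ_le => //; first exact: intg_norm.
  by apply: intg_contT => u; exact: cvg_cst.
have hu u : (x <= u <= y) || (y <= u <= x) -> `|g u - g x| <= e.
  move=> hu; apply: ltW; apply: Hd; first by case/orP: hu => /andP[? ?]; apply/andP; split; lra.
  by apply: le_lt_trans yd; case/orP: hu => /andP[? ?];
    [rewrite !ger0_norm ?subr_ge0//; lra|rewrite !ler0_norm ?subr_le0//; lra].
have [xy|/ltW yx] := leP x y.
  rewrite (integ_split ig (lexx 0) x0 xy y1).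
  rewrite (_ : _ - _ - _ = integ g x y - g x * (y - x)); last by ring.
  by rewrite [`|y - x|]ger0_norm ?subr_ge0//; apply: main => // u uu; apply: hu; rewrite uu.
rewrite (integ_split ig (lexx 0) y0 yx x1).
rewrite (_ : _ - _ - _ = - (integ g y x - g x * (x - y))); last by ring.
rewrite normrN (_ : `|y - x| = x - y); last by rewrite ler0_norm ?subr_le0// opprB.
apply: main => // u uu; apply: hu.
by rewrite uu orbT.
Qed.

(** If a function of intervals is additive and, near every point, at most e times
    the integral of m, then it is so globally, and e is arbitrary. This gives the
    uniqueness part of the fundamental theorem of calculus (m = 1) and the product
    rule for absolutely continuous functions. *)
Lemma const_of_small (phi m : R -> R) : intg m -> (forall x, 0 <= x <= 1 -> 0 <= m x) ->
  (forall x, 0 <= x <= 1 -> forall e : R, 0 < e -> exists2 d : R, 0 < d &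
     forall y z, 0 <= y -> y <= x -> x <= z -> z <= 1 -> `|y - x| < d -> `|z - x| < d ->
     `|phi z - phi y| <= e * integ m y z) ->
  forall x, 0 <= x <= 1 -> phi x = phi 0.
Proof.
move=> im m0 H x /andP[x0 x1].
apply/eqP; rewrite -subr_eq0 -normr_le0.
have I0 : 0 <= integ m 0 x by apply: integ_ge0 => u /andP[? ?]; apply: m0; apply/andP; split; lra.
have main e : 0 < e -> `|phi x - phi 0| <= e * integ m 0 x.
  move=> e0; pose P (a b : R) : Prop := `|phi b - phi a| <= e * integ m a b.
  apply: (@additive_tagged R P 0 x) => //.
    move=> a b c a0 ab bc cx; rewrite /P => Pab Pbc.
    rewrite (@integ_split _ m a b c)// ?mulrDr; last exact: le_trans x1.
    rewrite (_ : phi c - phi a = (phi b - phi a) + (phi c - phi b)); last by ring.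
    by apply: le_trans (ler_normD _ _) _; exact: lerD.
  move=> u /andP[u0 ux]; have [|d d0 Hd] := H u _ e e0; first by rewrite u0 (le_trans ux).
  by exists d => // y z ? ? ? ? ? ?; apply: Hd => //; lra.
apply/ler_addgt0Pr => e e0; rewrite add0r.
have k0 : 0 < integ m 0 x + 1 by rewrite ltr_wpDl.
apply: le_trans (main (e / (integ m 0 x + 1)) _) _; first by rewrite divr_gt0.
by rewrite mulrAC ler_pdivrMr// ler_pM2l// lerDl.
Qed.

Lemma isD0_const phi : (forall x, 0 <= x <= 1 -> isD phi x 0) ->
  forall x, 0 <= x <= 1 -> phi x = phi 0.
Proof.
move=> H; apply: (@const_of_small _ (fun=> 1)) => //.
  by apply: intg_contT => u; exact: cvg_cst.
move=> x hx e e0; have /isDP/(_ e e0)[d d0 Hd] := H x hx; exists d => // y z y0 yx xz z1 yd zd.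
rewrite integ_cst ?mul1r; last exact: le_trans xz.
have := Hd y _ yd; have := Hd z _ zd; rewrite !mul0r !subr0 => h1 h2.
have {}h1 : `|phi z - phi x| <= e * (z - x).
  by rewrite -[z - x]ger0_norm ?subr_ge0//; apply: h1; apply/andP; split; lra.
have {}h2 : `|phi y - phi x| <= e * (x - y).
  rewrite (_ : x - y = `|y - x|); last by rewrite ler0_norm ?subr_le0// opprB.
  apply: h2.
  by apply/andP; split; lra.
rewrite (_ : phi z - phi y = (phi z - phi x) - (phi y - phi x)); last by ring.
apply: le_trans (ler_normB _ _) _.
have -> : e * (z - y) = e * (z - x) + e * (x - y) by ring.
exact: lerD.
Qed.

Lemma ftc01 f g : {within `[0, 1], continuous g} ->
  (forall x, 0 <= x <= 1 -> isD f x (g x)) ->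
  forall x, 0 <= x <= 1 -> f x = f 0 + integ g 0 x.
Proof.
move=> cg H x hx; pose phi y := f y + (-1) * (0 + integ g 0 y).
have : phi x = phi 0.
  apply: isD0_const hx => y hy.
  have := isDD (H y hy) (isDM hy (isD_cst (-1) y) (isD_prim 0 cg hy)).
  by rewrite mul0r add0r mulN1r subrr.
by rewrite /phi integ_xx !add0r mulr0 addr0 => <-; ring.
Qed.

Lemma C1_isD f x : C1 f -> 0 <= x <= 1 -> isD f x (D01 f x).
Proof. by move=> [H _] hx; apply: D01_isD; exact: H. Qed.

Lemma isD_C1 f g : {within `[0, 1], continuous g} ->
  (forall x, 0 <= x <= 1 -> isD f x (g x)) -> C1 f /\ forall x, 0 <= x <= 1 -> D01 f x = g x.
Proof.
move=> cg H; have e x : 0 <= x <= 1 -> D01 f x = g x by move=> hx; have [] := isD_D01 hx (H x hx).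
split => //; split; first by move=> x hx; have [] := isD_D01 hx (H x hx).
apply/within01P => x hx e' e0; move/within01P: cg => /(_ x hx e' e0)[d d0 Hd].
by exists d => // y hy yd; rewrite !e//; apply: Hd.
Qed.

Lemma C1_cont f : C1 f -> {within `[0, 1], continuous f}.
Proof. by move=> cf; apply: isD_within => x hx; exists (D01 f x); exact: C1_isD. Qed.

Lemma C1_ftc f x : C1 f -> 0 <= x <= 1 -> f x = f 0 + integ (D01 f) 0 x.
Proof. by move=> cf; apply: ftc01 => [|y hy]; [case: cf|exact: C1_isD]. Qed.

Lemma withinD f g : {within `[0, 1], continuous f} -> {within `[0, 1], continuous g} ->
  {within `[0, 1], continuous (fun x => f x + g x)}.
Proof. by move=> cf cg x; apply: cvgD; [exact: cf|exact: cg]. Qed.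

Lemma withinM f g : {within `[0, 1], continuous f} -> {within `[0, 1], continuous g} ->
  {within `[0, 1], continuous (fun x => f x * g x)}.
Proof. by move=> cf cg x; apply: cvgM; [exact: cf|exact: cg]. Qed.

Lemma within_ext f g : (forall x, 0 <= x <= 1 -> f x = g x) ->
  {within `[0, 1], continuous f} -> {within `[0, 1], continuous g}.
Proof.
move=> fg /within01P H; apply/within01P => x hx e e0; have [d d0 Hd] := H x hx e e0.
by exists d => // y hy yd; rewrite -!fg//; exact: Hd.
Qed.

Lemma within_cst (c : R) : {within `[0, 1], continuous (fun _ : R => c)}.
Proof. by apply: continuous_subspaceT => u; exact: cvg_cst. Qed.

Lemma C1_ext f g : (forall x, 0 <= x <= 1 -> f x = g x) -> C1 f -> C1 g.
Proof.
move=> fg cf; have [_ c] := cf; have [] := @isD_C1 g (D01 f) c; last by [].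
by move=> x hx; apply: isD_ext (C1_isD cf hx).
Qed.

Lemma C1_cst (c : R) : C1 (fun _ : R => c).
Proof.
have [] := @isD_C1 (fun _ : R => c) (fun=> 0); last by [].
  by apply: continuous_subspaceT => x; exact: cvg_cst.
by move=> x _; exact: isD_cst.
Qed.

Lemma C1D f g : C1 f -> C1 g -> C1 (fun x => f x + g x).
Proof.
move=> cf cg; have [_ c] := cf; have [_ c'] := cg.
have [] := @isD_C1 (fun x => f x + g x) _ (withinD c c'); last by [].
by move=> x hx; apply: isDD; exact: C1_isD.
Qed.

Lemma C1M f g : C1 f -> C1 g -> C1 (fun x => f x * g x).
Proof.
move=> cf cg; have [_ c] := cf; have [_ c'] := cg.
have [] := @isD_C1 (fun x => f x * g x) _
   (withinD (withinM c (C1_cont cg)) (withinM (C1_cont cf) c')); last by [].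
by move=> x hx; apply: isDM => //; exact: C1_isD.
Qed.

Lemma withinV f : (forall x, 0 <= x <= 1 -> f x != 0) -> {within `[0, 1], continuous f} ->
  {within `[0, 1], continuous (fun x => (f x)^-1)}.
Proof.
move=> f0 cf; apply/subspace_continuousP => x hx.
apply: cvgV; first by apply: f0; move: hx; rewrite /= in_itv.
by move/subspace_continuousP: cf; exact.
Qed.

Lemma C1V f : (forall x, 0 <= x <= 1 -> f x != 0) -> C1 f -> C1 (fun x => (f x)^-1).
Proof.
move=> f0 cf; have [_ c] := cf; have cc := C1_cont cf.
have c1 : {within `[0, 1], continuous (fun x => -1 * D01 f x * (f x * f x)^-1)}.
  apply: withinM; first by apply: withinM => //; apply: continuous_subspaceT => x; exact: cvg_cst.
  apply: withinV; last exact: withinM.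
  by move=> x hx; rewrite mulf_neq0// f0.
have [] := @isD_C1 (fun x => (f x)^-1) _ c1; last by [].
move=> x hx; have := isDV hx f0 (C1_isD cf hx).
by rewrite mulN1r expr2.
Qed.

Lemma C1_sum (I : Type) (r : seq I) (P : pred I) (F : I -> R -> R) :
  (forall i, P i -> C1 (F i)) -> C1 (fun x => \sum_(i <- r | P i) F i x).
Proof.
move=> H; elim: r => [|i r IH].
  by apply: C1_ext (C1_cst 0) => x _; rewrite big_nil.
case Pi : (P i).
  by apply: C1_ext (C1D (H i Pi) IH) => x _; rewrite big_cons Pi.
by apply: C1_ext IH => x _; rewrite big_cons Pi.
Qed.

Lemma C1_prod (I : Type) (r : seq I) (P : pred I) (F : I -> R -> R) :
  (forall i, P i -> C1 (F i)) -> C1 (fun x => \prod_(i <- r | P i) F i x).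
Proof.
move=> H; elim: r => [|i r IH].
  by apply: C1_ext (C1_cst 1) => x _; rewrite big_nil.
case Pi : (P i).
  by apply: C1_ext (C1M (H i Pi) IH) => x _; rewrite big_cons Pi.
by apply: C1_ext IH => x _; rewrite big_cons Pi.
Qed.

Lemma C1_det n (M : R -> 'M[R]_n) : C1mx M -> C1 (fun x => \det (M x)).
Proof.
move=> H; rewrite /determinant; apply: C1_sum => s _; apply: C1M; first exact: C1_cst.
by apply: C1_prod => i _; exact: H.
Qed.

Lemma C1_invmx n (M : R -> 'M[R]_n) : C1mx M -> (forall x, 0 <= x <= 1 -> M x \in unitmx) ->
  C1mx (fun x => invmx (M x)).
Proof.
move=> H U i j; have d0 x : 0 <= x <= 1 -> \det (M x) != 0.
  by move=> /U; rewrite unitmxE unitfE.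
apply: (@C1_ext (fun x => (\det (M x))^-1 * cofactor (M x) j i)).
  by move=> x /U ux; rewrite /invmx ux !mxE.
apply: C1M; first by apply: C1V => //; exact: C1_det.
rewrite /cofactor; apply: C1M; first exact: C1_cst.
apply: C1_det => a b; apply: C1_ext (H (lift j a) (lift i b)) => x _.
by rewrite !mxE.
Qed.

(** From 2 |g| <= 1 + g^2. *)
Lemma L2_intg g : L2r g -> intg g.
Proof.
move=> [mg ig]; apply: (@intg_le _ _ (fun x => 1 + g x ^+ 2)) => //.
  by apply: intgD; [apply: intg_contT => u; exact: cvg_cst|exact: ig].
move=> x _; have := sqr_ge0 (`|g x| - 1); rewrite -[g x ^+ 2]real_normK ?num_real//.
set a := `|g x|; have : 0 <= a by exact: normr_ge0. nra.
Qed.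

Lemma L2_cont g : {within `[0, 1], continuous g} -> L2r g.
Proof.
move=> cg; split; first by apply: intg_meas; exact: intg_cont.
by apply: (@intg_cont _ (fun x => g x ^+ 2)); apply: withinM.
Qed.

Lemma L2D f g : L2r f -> L2r g -> L2r (fun x => f x + g x).
Proof.
move=> [mf f2] [mg g2]; split; first exact: measurable_funD.
apply: (@intg_le _ _ (fun x => 2 * f x ^+ 2 + 2 * g x ^+ 2)).
- by apply: measurable_funX; exact: measurable_funD.
- by apply: intgD; apply: intgZ.
- move=> x _; rewrite ger0_norm ?sqr_ge0//; have := sqr_ge0 (f x - g x); nra.
Qed.

Lemma L2M f g : {within `[0, 1], continuous f} -> L2r g -> L2r (fun x => f x * g x).
Proof.
move=> cf [mg g2]; split.
  by apply: measurable_funM => //; apply: intg_meas; exact: intg_cont.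
have -> : (fun x => ((f x * g x) ^+ 2)%:E) = EFin \o (fun x => f x ^+ 2 * g x ^+ 2).
  by apply/funext => x /=; rewrite exprMn.
by apply: intgM => //; exact: withinM.
Qed.

Lemma H1_cont f : H1r f -> {within `[0, 1], continuous f}.
Proof.
move=> [g /L2_intg ig H]; apply: (@within_ext (fun x => f 0 + integ g 0 (clamp 0 1 x))).
  by move=> x hx; rewrite clamp_id// -H.
apply: continuous_subspaceT => x; apply: cvgD; first exact: cvg_cst.
exact: integ_cont.
Qed.

Lemma C1_H1 f : C1 f -> H1r f.
Proof.
by move=> cf; exists (D01 f); [apply: L2_cont; case: cf|move=> x hx; exact: C1_ftc].
Qed.

Lemma H1_ext f g : (forall x, 0 <= x <= 1 -> f x = g x) -> H1r f -> H1r g.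
Proof.
move=> fg [h L H]; exists h => // x hx; rewrite -!fg//; first exact: H.
by rewrite lexx ler01.
Qed.

Lemma H1D f g : H1r f -> H1r g -> H1r (fun x => f x + g x).
Proof.
move=> [h L H] [h' L' H']; exists (fun x => h x + h' x); first exact: L2D.
move=> x hx; rewrite H// H'//; case/andP: (hx) => x0 x1.
have := integ_D (lexx 0) x1 (L2_intg L) (L2_intg L'); rewrite /integ => ->; ring.
Qed.

(** The candidate derivative is k = f' g + f h, h being the derivative of g. The
    difference f g - int k changes over a short interval [a, b] by the integral of
    (f b - f) h + (g a - g) f', which is small compared to |h| + |f'|. *)
Lemma H1M f g : C1 f -> H1r g -> H1r (fun x => f x * g x).
Proof.
move=> cf hg; have cg := H1_cont hg; case: hg => h L H.
have [_ cf'] := cf; have ih := L2_intg L; have ccf := C1_cont cf.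
have if' := intg_cont cf'.
pose k x := D01 f x * g x + f x * h x.
have Lk : L2r k by apply: L2D; [apply: L2_cont; exact: withinM|exact: L2M].
have ik := L2_intg Lk.
exists k => // x hx.
pose phi y := f y * g y - integ k 0 y.
have h0 : phi x = phi 0; last first.
  by move: h0; rewrite /phi integ_xx subr0 /integ => <-; ring.
apply: (@const_of_small phi (fun s => `|h s| + `|D01 f s|)) => //.
- by apply: intgD; exact: intg_norm.
move=> y hy e e0.
have e2 : 0 < e / 2 by rewrite divr_gt0.
move/within01P: ccf => /(_ y hy _ e2)[d1 d10 H1].
move/within01P: cg => /(_ y hy _ e2)[d2 d20 H2].
exists (Num.min d1 d2); first by rewrite lt_min d10.
move=> a b a0 ay yb b1; rewrite !lt_min => /andP[ad1 ad2] /andP[bd1 bd2].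
have ab : a <= b by exact: le_trans yb.
have nu u : a <= u <= b -> `|u - y| < d1 /\ `|u - y| < d2.
  move=> /andP[au ub]; move: ad1 ad2 bd1 bd2; rewrite !ltr_norml.
  by move=> /andP[? ?] /andP[? ?] /andP[? ?] /andP[? ?]; split; apply/andP; split; lra.
have in01 u : a <= u <= b -> 0 <= u <= 1 by move=> /andP[? ?]; apply/andP; split; lra.
have ha : a <= a <= b by rewrite lexx.
have hb : a <= b <= b by rewrite lexx andbT.
have df u v : a <= u <= b -> a <= v <= b -> `|f u - f v| <= e.
  move=> hu hv; have := H1 u (in01 u hu) (nu u hu).1; have := H1 v (in01 v hv) (nu v hv).1.
  have := ler_normB (f u - f y) (f v - f y).
  by rewrite (_ : _ - (f v - f y) = f u - f v); [lra|ring].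
have dg u v : a <= u <= b -> a <= v <= b -> `|g u - g v| <= e.
  move=> hu hv; have := H2 u (in01 u hu) (nu u hu).2; have := H2 v (in01 v hv) (nu v hv).2.
  have := ler_normB (g u - g y) (g v - g y).
  by rewrite (_ : _ - (g v - g y) = g u - g v); [lra|ring].
have fba : f b - f a = integ (D01 f) a b.
  rewrite (C1_ftc cf (in01 b hb)) [f a](C1_ftc cf (in01 a ha)).
  by rewrite (integ_split if' (lexx 0) a0 ab b1); ring.
have gba : g b - g a = integ h a b.
  have := H b (in01 b hb); have := H a (in01 a ha); rewrite -!/(integ _ _ _) => -> ->.
  by rewrite (integ_split ih (lexx 0) a0 ab b1); ring.
have cfs : {within `[0, 1], continuous (fun s => f b + -1 * f s)}.
  by apply: withinD; [exact: within_cst|apply: withinM; [exact: within_cst|exact: C1_cont]].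
have cgs : {within `[0, 1], continuous (fun s => g a + -1 * g s)}.
  apply: withinD; first exact: within_cst.
  by apply: withinM; [exact: within_cst|apply: H1_cont; exists h].
have i1 : intg (fun s => (f b + -1 * f s) * h s) by exact: intgM.
have i2 : intg (fun s => (g a + -1 * g s) * D01 f s) by exact: intgM.
(* With f b h + g a f' integrating to f b (g b - g a) + g a (f b - f a), which
   is f b g b - f a g a. *)
have -> : phi b - phi a = integ (fun s => (f b + -1 * f s) * h s + (g a + -1 * g s) * D01 f s) a b.
  rewrite (@integ_ext _ _ (fun s => f b * h s + g a * D01 f s - k s)); last first.
    by move=> s _; rewrite /k; ring.
  have i3 : intg (fun s => f b * h s) by exact: intgZ.
  have i4 : intg (fun s => g a * D01 f s) by exact: intgZ.
  rewrite integ_B//; last exact: intgD.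
  rewrite integ_D// !integ_Z// -fba -gba /phi (integ_split ik (lexx 0) a0 ab b1).
  ring.
apply: (le_trans (integ_norm a0 b1 _)); first exact: intgD.
rewrite -integ_Z//; last by apply: intgD; exact: intg_norm.
apply: integ_le => //; first by apply: intg_norm; exact: intgD.
  by apply: intgZ; apply: intgD; exact: intg_norm.
move=> s hs; apply: le_trans (ler_normD _ _) _; rewrite !normrM mulrDr.
by apply: lerD; apply: ler_wpM2r => //; rewrite mulN1r; [exact: df|exact: dg].
Qed.

Lemma aeS (P Q : R -> Prop) : (forall x, P x -> Q x) ->
  {ae mu, forall x, P x} -> {ae mu, forall x, Q x}.
Proof.
by move=> PQ; apply: filterS; first exact: (ae_filter_ringOfSetsType mu).
Qed.

Lemma aeI (P Q : R -> Prop) : {ae mu, forall x, P x} -> {ae mu, forall x, Q x} ->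
  {ae mu, forall x, P x /\ Q x}.
Proof. by apply: filterI; exact: (ae_filter_ringOfSetsType mu). Qed.

(** Lebesgue's differentiation theorem. *)
Lemma ae_isD f g : intg g -> (forall x, 0 <= x <= 1 -> f x = f 0 + integ g 0 x) ->
  {ae mu, forall x, 0 <= x <= 1 -> isD f x (g x)}.
Proof.
move=> ig H.
have lg : locally_integrable setT (g \_ (`[0, 1]%classic : set R)) by apply: integrable_locally.
have := lebesgue_differentiation lg.
have n01 : mu.-negligible ([set 0] `|` [set 1] : set R).
  have negl1 (a : R) : mu.-negligible ([set a] : set R).
    by exists [set a]; split => //; exact: lebesgue_measure_set1.
  by apply: negligibleU; exact: negl1.
have : {ae mu, forall x, ~ ([set 0] `|` [set 1]) x}.
  by apply: negligibleS n01 => x /= /contrapT.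
move=> h1 h2; apply: aeS (aeI h1 h2) => x [nx lx] /andP[x0 x1].
have x0' : 0 < x by rewrite lt_neqAle x0 andbT; apply/eqP => xx; apply: nx; left.
have x1' : x < 1 by rewrite lt_neqAle x1 andbT; apply/eqP => xx; apply: nx; right.
have ig' : mu.-integrable [set` Interval (BLeft (0 : R)) (BRight 1)] (EFin \o (g \_ (`[0, 1]%classic : set R))).
  by apply: intg_ext ig => y hy; rewrite patchE ifT// inE /= in_itv.
have [|dF F'] := FTC1_lebesgue_pt x1' ig' _ lx; first by rewrite lte_fin.
have gx : (g \_ (`[0, 1]%classic : set R)) x = g x.
  by rewrite patchE ifT// inE /= in_itv /= x0.
rewrite gx derive1E in F'.
apply/isDP => e e0.
have /cvgrPdist_le/(_ e e0) := dF.
rewrite -/('D_1 _ x) F' => /near_ball1[d d0 Hd].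
exists d => // y hy yd; have [->|yx] := eqVneq y x.
  by rewrite !subrr mulr0 subr0 normr0 mulr0.
have yx0 : y - x != 0 by rewrite subr_eq0.
have := Hd (y - x); rewrite subr0 => /(_ yd yx0).
rewrite /= [(y - x) *: _]mulr1 subrK => h.
rewrite -ler_pdivrMr ?normr_gt0// -normf_div.
apply: le_trans h; rewrite le_eqVlt; apply/orP; left; apply/eqP.
have E z : 0 <= z <= 1 -> f z - f 0 = \int[mu]_(t in `[0, z]) (g \_ (`[0, 1]%classic : set R)) t.
  move=> hz; rewrite (H z hz) addrAC subrr add0r; apply: integ_ext => u /andP[u0 uz].
  by rewrite patchE ifT// inE /= in_itv /= u0 (le_trans uz)//; case/andP: hz.
rewrite -!E// ?x0 ?x1//; rewrite /GRing.scale /=.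
by rewrite -[RHS]normrN; congr (`|_|); field.
Qed.

End OneSidedCalculus.

(** * Complex-valued C1, L2 and H1 functions *)

Section ComplexH1.
Variable R : realType.
Local Notation mu := (@lebesgue_measure R).
Implicit Types (f g : R -> R[i]) (a : R -> R).

Definition cC1 f := C1 (fun x => complex.Re (f x)) /\ C1 (fun x => complex.Im (f x)).
Definition cH1 f := H1r (fun x => complex.Re (f x)) /\ H1r (fun x => complex.Im (f x)).
Definition cL2 f := L2r (fun x => complex.Re (f x)) /\ L2r (fun x => complex.Im (f x)).
Definition cwithin f := {within `[0, 1], continuous (fun x => complex.Re (f x))} /\
  {within `[0, 1], continuous (fun x => complex.Im (f x))}.

Lemma cwithin_clamp f : cwithin f -> ccont (fun x => f (clamp 0 1 x)).
Proof.
move=> [c1 c2] x; split.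
  exact: (@within_clamp R _ 0 1 (fun x => complex.Re (f x)) ler01 c1 x).
exact: (@within_clamp R _ 0 1 (fun x => complex.Im (f x)) ler01 c2 x).
Qed.

Lemma ccont_cwithin f : ccont f -> cwithin f.
Proof.
by move=> cf; split; apply: continuous_subspaceT => x; [exact: ccontRe|exact: ccontIm].
Qed.

Lemma cL2_cintg f : cL2 f -> cintg f.
Proof. by move=> [h1 h2]; split; exact: L2_intg. Qed.

Lemma cwithin_cL2 f : cwithin f -> cL2 f.
Proof. by move=> [h1 h2]; split; exact: L2_cont. Qed.

Lemma cL2D f g : cL2 f -> cL2 g -> cL2 (fun x => f x + g x).
Proof.
move=> [f1 f2] [g1 g2]; split.
  by rewrite (_ : (fun x => _) = fun x => complex.Re (f x) + complex.Re (g x));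
    [exact: L2D|apply/funext => x; rewrite cReD].
by rewrite (_ : (fun x => _) = fun x => complex.Im (f x) + complex.Im (g x));
  [exact: L2D|apply/funext => x; rewrite cImD].
Qed.

Lemma cL2M f g : cwithin f -> cL2 g -> cL2 (fun x => f x * g x).
Proof.
move=> [f1 f2] [g1 g2]; split.
  rewrite (_ : (fun x => _) = fun x => complex.Re (f x) * complex.Re (g x) +
     (-1 * complex.Im (f x)) * complex.Im (g x)).
    by apply: L2D; apply: L2M => //; apply: withinM => //; exact: within_cst.
  by apply/funext => x; rewrite cReM; ring.
rewrite (_ : (fun x => _) = fun x => complex.Re (f x) * complex.Im (g x) +
   complex.Im (f x) * complex.Re (g x)).
  by apply: L2D; apply: L2M.
by apply/funext => x; rewrite cImM.
Qed.

Lemma cwithin_cst z : cwithin (fun _ => z).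
Proof. by split; exact: within_cst. Qed.

Lemma cL2N f : cL2 f -> cL2 (fun x => - f x).
Proof.
move=> hf; rewrite (_ : (fun x => _) = fun x => -1 * f x).
  by apply: cL2M => //; exact: cwithin_cst.
by apply/funext => x; rewrite mulN1r.
Qed.

Lemma cH1D f g : cH1 f -> cH1 g -> cH1 (fun x => f x + g x).
Proof.
move=> [f1 f2] [g1 g2]; split.
  by apply: H1_ext (H1D f1 g1) => x _; rewrite cReD.
by apply: H1_ext (H1D f2 g2) => x _; rewrite cImD.
Qed.

Lemma cH1_ext f g : (forall x, 0 <= x <= 1 -> f x = g x) -> cH1 f -> cH1 g.
Proof.
by move=> fg [f1 f2]; split; [apply: H1_ext f1|apply: H1_ext f2] => x hx; rewrite fg.
Qed.

Lemma cH1M a f : C1 a -> cH1 f -> cH1 (fun x => (a x)%:C * f x).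
Proof.
move=> ca [f1 f2]; split.
  by apply: H1_ext (H1M ca f1) => x _; rewrite cReM /= mul0r subr0.
by apply: H1_ext (H1M ca f2) => x _; rewrite cImM /= mul0r addr0.
Qed.

Lemma cH1_sum (I : Type) (r : seq I) (P : pred I) (F : I -> R -> R[i]) :
  (forall i, P i -> cH1 (F i)) -> cH1 (fun x => \sum_(i <- r | P i) F i x).
Proof.
move=> H; elim: r => [|i r IH].
  apply: (@cH1_ext (fun=> 0)); first by move=> x _; rewrite big_nil.
  by split; apply: C1_H1; exact: C1_cst.
case Pi : (P i).
  by apply: cH1_ext (cH1D (H i Pi) IH) => x _; rewrite big_cons Pi.
by apply: cH1_ext IH => x _; rewrite big_cons Pi.
Qed.

Lemma cC1_cH1 f : cC1 f -> cH1 f.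
Proof. by move=> [h1 h2]; split; exact: C1_H1. Qed.

Lemma cH1_cwithin f : cH1 f -> cwithin f.
Proof. by move=> [h1 h2]; split; exact: H1_cont. Qed.

Definition cisD f x l := isD (fun y => complex.Re (f y)) x (complex.Re l) /\
  isD (fun y => complex.Im (f y)) x (complex.Im l).

Lemma cisD_cD01 f x l : 0 <= x <= 1 -> cisD f x l -> cderivable01 f x /\ cD01 f x = l.
Proof.
move=> hx [h1 h2]; have [d1 e1] := isD_D01 hx h1; have [d2 e2] := isD_D01 hx h2.
by split => //; rewrite /cD01 e1 e2; case: l {h1 h2 e1 e2}.
Qed.

Lemma cderivable_cisD f x : cderivable01 f x -> cisD f x (cD01 f x).
Proof. by move=> [h1 h2]; split. Qed.

Lemma cisD_ext f g x l : 0 <= x <= 1 -> (forall y, 0 <= y <= 1 -> f y = g y) ->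
  cisD f x l -> cisD g x l.
Proof.
by move=> hx fg [h1 h2]; split; [apply: isD_ext h1|apply: isD_ext h2] => // y hy; rewrite fg.
Qed.

Lemma cftc f g : cwithin g -> (forall x, 0 <= x <= 1 -> cisD f x (g x)) ->
  forall x, 0 <= x <= 1 -> f x = f 0 + cinteg g x.
Proof.
move=> [g1 g2] H x hx; apply: complexP; rewrite ?cReD ?cImD /=.
  by apply: (@ftc01 R (fun y => complex.Re (f y)) _ g1) => // y hy; case: (H y hy).
by apply: (@ftc01 R (fun y => complex.Im (f y)) _ g2) => // y hy; case: (H y hy).
Qed.

Lemma cisD_prim g z x : cwithin g -> 0 <= x <= 1 -> cisD (fun y => z + cinteg g y) x (g x).
Proof.
move=> [g1 g2] hx; split.
  by apply: isD_ext (isD_prim (complex.Re z) g1 hx) => // y _; rewrite cReD.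
by apply: isD_ext (isD_prim (complex.Im z) g2 hx) => // y _; rewrite cImD.
Qed.

Lemma cisD_cC1 f g : cwithin g -> (forall x, 0 <= x <= 1 -> cisD f x (g x)) -> cC1 f.
Proof.
move=> [g1 g2] H; split.
  by have [] := @isD_C1 _ (fun x => complex.Re (f x)) _ g1 (fun x hx => (H x hx).1).
by have [] := @isD_C1 _ (fun x => complex.Im (f x)) _ g2 (fun x hx => (H x hx).2).
Qed.

Lemma cH1_of_prim f g : cL2 g -> (forall x, 0 <= x <= 1 -> f x = f 0 + cinteg g x) ->
  cH1 f /\ {ae mu, forall x, 0 <= x <= 1 -> cisD f x (g x)}.
Proof.
move=> [g1 g2] H.
have h1 x : 0 <= x <= 1 -> complex.Re (f x) = complex.Re (f 0) + integ (fun s => complex.Re (g s)) 0 x.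
  by move=> hx; rewrite H// cReD.
have h2 x : 0 <= x <= 1 -> complex.Im (f x) = complex.Im (f 0) + integ (fun s => complex.Im (g s)) 0 x.
  by move=> hx; rewrite H// cImD.
split; first by split; [exists (fun s => complex.Re (g s))|exists (fun s => complex.Im (g s))].
have a1 := ae_isD (f := fun y => complex.Re (f y)) (L2_intg g1) h1.
have a2 := ae_isD (f := fun y => complex.Im (f y)) (L2_intg g2) h2.
by apply: aeS (aeI a1 a2) => x [b1 b2] hx; split; [exact: b1|exact: b2].
Qed.

Lemma cH1P f : cH1 f -> exists2 g, cL2 g & forall x, 0 <= x <= 1 -> f x = f 0 + cinteg g x.
Proof.
move=> [[g1 L1 H1] [g2 L2' H2]]; exists (fun x => g1 x +i* g2 x); first by split.
move=> x hx; apply: complexP; rewrite ?cReD ?cImD; [exact: H1|exact: H2].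
Qed.

Lemma integ_ae (f g : R -> R) x : intg f -> intg g -> 0 <= x <= 1 ->
  {ae mu, forall y, 0 <= y <= 1 -> f y = g y} -> integ f 0 x = integ g 0 x.
Proof.
move=> fi gi /andP[x0 x1] fg; rewrite /integ /Rintegral; congr fine.
apply: ae_eq_integral => //.
- by apply: measurable_int; exact: intg_sub x1 fi.
- by apply: measurable_int; exact: intg_sub x1 gi.
- apply: aeS fg => y; rewrite /= in_itv /= => H /andP[y0 yx].
  by rewrite H// y0 (le_trans yx).
Qed.

Lemma cinteg_ae f g x : cintg f -> cintg g -> 0 <= x <= 1 ->
  {ae mu, forall y, 0 <= y <= 1 -> f y = g y} -> cinteg f x = cinteg g x.
Proof.
move=> [f1 f2] [g1 g2] hx fg; apply: complexP; apply: integ_ae => //;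
  by apply: aeS fg => y H hy; rewrite H.
Qed.

(** The integral of f vanishes identically, so its derivative f does. *)
Lemma ae_cont0 f : ccont f -> {ae mu, forall x, 0 <= x <= 1 -> f x = 0} ->
  forall x, 0 <= x <= 1 -> f x = 0.
Proof.
move=> cf f0 x hx.
have z y : 0 <= y <= 1 -> cinteg f y = 0.
  move=> hy; rewrite (@cinteg_ae f (fun=> 0) y)//; try exact: cintg_cont; last first.
    by apply: cintg_cont; exact: ccont_cst.
  by case/andP: hy => y0 y1; rewrite /cinteg !integ_cst//= !mul0r.
have [_ e1] := cisD_cD01 hx (cisD_prim 0 (ccont_cwithin cf) hx).
have c0 y : 0 <= y <= 1 -> 0 + cinteg (fun=> 0) y = 0 + cinteg f y :> R[i].
  by move=> hy; rewrite z//; case/andP: (hy) => y0 y1; rewrite /cinteg !integ_cst//= !mul0r.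
have [_ e2] := cisD_cD01 hx (cisD_ext hx c0 (cisD_prim 0 (cwithin_cst 0) hx)).
by rewrite -e1 e2.
Qed.

End ComplexH1.

(** * A linear pencil of boundary value problems *)

Section Pencil.
Variable R : realType.
Local Notation K := R[i].

(** The form that w' = h takes for an absolutely continuous w. *)
Definition is_prim n (h w : R -> 'cV[K]_n) := forall x, 0 <= x <= 1 ->
  forall i, w x i 0 = w 0 i 0 + cinteg (fun s => h s i 0) x.

Lemma mxDE m n (A B : 'M[K]_(m, n)) i j : (A + B) i j = A i j + B i j.
Proof. by rewrite mxE. Qed.

Lemma mxBE m n (A B : 'M[K]_(m, n)) i j : (A - B) i j = A i j - B i j.
Proof. by rewrite !mxE. Qed.

Lemma mxZE m n c (A : 'M[K]_(m, n)) i j : (c *: A) i j = c * A i j.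
Proof. by rewrite mxE. Qed.

Lemma mulmx_split m n p (a b : 'M[K]_(m, n)) (w v : 'M[K]_(n, p)) :
  a *m w = b *m v + ((a - b) *m v + a *m (w - v)).
Proof.
by rewrite mulmxBl mulmxBr addrA [b *m v + _]addrC subrK [RHS]addrC subrK.
Qed.

Lemma mcontZ (T : topologicalType) m n (f : T -> K) (A : T -> 'M[K]_(m, n)) :
  ccont f -> mcont A -> mcont (fun x => f x *: A x).
Proof.
move=> cf cA i j; apply: ccont_ext (ccontM cf (cA i j)) => x; by rewrite mxE.
Qed.

Lemma mcont_slice (T : topologicalType) m n (A : T -> R -> 'M[K]_(m, n)) q :
  mcont (fun p : T * R => A p.1 p.2) -> mcont (A q).
Proof.
move=> cA; apply: (@mcont_comp R _ (T * R)%type _ _ (fun x => (q, x)) (fun p => A p.1 p.2)) => //.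
move=> x; apply: (cvg_pair (F := nbhs x) (G := nbhs q) (H := nbhs x)).
  exact: cvg_cst.
exact: cvg_id.
Qed.

(** Continuity in the parameter is uniform over the compact interval [0,1]. *)
Lemma unif_near (T : topologicalType) (f : T -> R -> K) q0 (e : R) :
  ccont (fun p : T * R => f p.1 p.2) -> 0 < e ->
  \forall q \near q0, forall x, 0 <= x <= 1 -> norm1 (f q x - f q0 x) < e.
Proof.
move=> cf e0.
have e2 : 0 < e / 2 by rewrite divr_gt0.
have := @segment_compact R 0 1 => /compact_near_coveringP.
move=> /(_ T (nbhs q0) (fun q x => norm1 (f q x - f q0 x) < e) _) HH.
apply: filterS (HH _).
  by move=> q H x hx; apply: H; rewrite /= in_itv.
move=> x _.
have h1 := ccvg_norm1 (cf (q0, x)) e2.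
have [[U V] /= [Uq Vx] UV] := h1.
exists (V, U) => //= -[x' q] [/= Vx' Uq'].
have := UV (q, x') (conj Uq' Vx').
have := UV (q0, x') (conj (nbhs_singleton Uq) Vx').
rewrite /= => a b.
rewrite (_ : _ - _ = (f q x' - f q0 x) + - (f q0 x' - f q0 x)); last by ring.
apply: le_lt_trans (norm1D _ _) _; rewrite norm1N; lra.
Qed.

Lemma half_lt (E e : R) : 0 < E -> 0 < e -> E * (e / (2 * E)) < e.
Proof.
move=> E0 e0; rewrite invfM [2^-1 * _]mulrC mulrA mulrA [E * e]mulrC mulfK ?gt_eqF//.
by rewrite ltr_pdivrMr// ltr_pMr// ltr1n.
Qed.

(** The difference of the solutions for q and q0 solves the equation for q
    with inhomogeneity int (A q - A q0) w_q0, which is uniformly small, and the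
    Gronwall bound applies. *)
Lemma volterra_param n m (T : topologicalType) (A : T -> R -> 'M[K]_n) (h : R -> 'M[K]_(n, m))
    (w : T -> R -> 'M[K]_(n, m)) :
  mcont (fun p : T * R => A p.1 p.2) -> (forall q, mcont (w q)) ->
  (forall q, volterra (A q) h (w q)) ->
  forall q0 i j, ccvg (nbhs q0) (fun q => w q 1 i j) (w q0 1 i j).
Proof.
move=> cA cw vw q0 i0 j0.
have cAq q : mcont (A q) by exact: mcont_slice.
have [B B0 hB] := mx_bounded_entry (cw q0).
have [K0 K00 hK] := mx_bounded (cAq q0).
apply: norm1_ccvg => e e0.
pose K1 := K0 + 1.
have K10 : 0 < K1 by rewrite /K1; lra.
pose n' : R := n%:R + 1.
have n0 : 0 < n' by rewrite /n' ltr_wpDl.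
pose E := 2 * (n' * B) * expR (2 * K1).
have E0 : 0 < E by rewrite /E !mulr_gt0// expR_gt0.
(* The factor n comes from summing a row; the bound 1 / n' keeps the row sums
   of A q below K1 = K0 + 1, so that the exponential is the same for all q. *)
pose dl := Num.min (e / (2 * E)) (1 / n').
have dl0 : 0 < dl by rewrite /dl lt_min !divr_gt0// mulr_gt0.
have H : \forall q \near q0, forall k : 'I_n * 'I_n, forall x, 0 <= x <= 1 ->
    norm1 (A q x k.1 k.2 - A q0 x k.1 k.2) < dl.
  by apply: filter_forall => -[k l]; apply: (unif_near q0 (f := fun q x => A q x k l)).
apply: filterS H => q H.
have rowd s : 0 <= s <= 1 -> forall i, \sum_k norm1 ((A q s - A q0 s) i k) <= n%:R * dl.
  move=> hs i; rewrite -[n in n%:R]card_ord -sum1_card natr_sum mulr_suml.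
  by apply: ler_sum => k _; rewrite mul1r !mxE; apply: ltW; exact: (H (i, k)).
have dl1 : n%:R * dl <= 1.
  apply: (@le_trans _ _ (n' * (1 / n'))); last by rewrite mul1r divff// gt_eqF.
  apply: ler_pM => //; first exact: ltW.
    by rewrite /n' lerDl.
  by rewrite /dl ge_min lexx orbT.
have hK1 s : 0 <= s <= 1 -> forall i, \sum_k norm1 (A q s i k) <= K1.
  move=> hs i; rewrite /K1.
  apply: (@le_trans _ _ (\sum_k norm1 (A q0 s i k) + \sum_k norm1 ((A q s - A q0 s) i k))).
    rewrite -big_split /=; apply: ler_sum => k _.
    have e1 : A q s i k = A q0 s i k + (A q s - A q0 s) i k by rewrite !mxE; ring.
    by rewrite {1}e1; exact: norm1D.
  by apply: lerD; [exact: hK|apply: le_trans (rowd s hs i) _].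
have cD : mcont (fun s => (A q s - A q0 s) *m w q0 s).
  by apply: mcont_mul => //; apply: mcontD => //; exact: mcontN.
pose g x : 'M[K]_(n, m) := \matrix_(i, j) cinteg (fun s => ((A q s - A q0 s) *m w q0 s) i j) x.
have vd : volterra (A q) g (fun x => w q x - w q0 x).
  move=> x hx i j.
  rewrite mxBE (vw q x hx) (vw q0 x hx) /g mxE.
  have c1 : mcont (fun s => A q s *m (w q s - w q0 s)).
    by apply: mcont_mul => //; apply: mcontD => //; exact: mcontN.
  have c2 : mcont (fun s => A q0 s *m w q0 s) by exact: mcont_mul.
  rewrite -cinteg_D//; [|exact: cintg_cont..].
  set a := cinteg _ x; set b := cinteg _ x; set c := cinteg _ x.
  have -> : a = b + c.
    rewrite /a /b /c -cinteg_D//.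
    - apply: cinteg_ext => s _.
      transitivity ((A q s *m w q s) i j) => //.
      by rewrite (mulmx_split _ (A q0 s) _ (w q0 s)) !mxDE.
    - exact: cintg_cont.
    - by apply: cintgD; exact: cintg_cont.
  by ring.
have hg x : 0 <= x <= 1 -> forall i j, norm1 (g x i j) <= n%:R * dl * B.
  move=> hx i j; rewrite /g mxE.
  apply: le_trans (@cinteg_bound R _ (fun=> n%:R * dl * B) x hx _ _ _) _.
  - exact: cintg_cont.
  - by apply: intg_contT => z; exact: cvg_cst.
  - move=> s /andP[s0 sx]; have hs : 0 <= s <= 1 by rewrite s0 (le_trans sx)//; case/andP: hx.
    by apply: norm1_mulmx; [exact: rowd|exact: ltW|move=> k; exact: hB].
  - case/andP: hx => x0 x1; rewrite integ_cst// subr0 ler_piMr//.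
    by rewrite !mulr_ge0// ltW.
have cdd : mcont (fun x => w q x - w q0 x) by apply: mcontD => //; exact: mcontN.
have i1 : 0 <= (1 : R) <= 1 by rewrite lexx ler01.
have := volterra_bound (cAq q) cdd K10 hK1 vd hg i1 i0 j0.
rewrite mxBE mulr1 => /le_lt_trans; apply.
apply: (@le_lt_trans _ _ (E * dl)).
  have -> : E * dl = 2 * (n' * dl * B) * expR (2 * K1) by rewrite /E; ring.
  rewrite ler_pM2r ?expR_gt0// ler_pM2l// ler_pM2r// ler_pM2r//.
  by rewrite /n' lerDl.
apply: (@le_lt_trans _ _ (E * (e / (2 * E)))).
  by rewrite ler_pM2l// /dl ge_min lexx.
exact: half_lt.
Qed.

Variables (n : nat) (A : R -> R -> 'M[K]_n) (E S0 S1 : 'M[K]_n).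
Hypothesis cA : mcont (fun p : R * R => A p.1 p.2).

(** The spectral parameter enters the system linearly, through the constant
    matrix E. *)
Definition pencil t (lam : K) x : 'M[K]_n := A t x + lam *: E.

Lemma pencil_cont (T : topologicalType) (tau : T -> R) (lam : T -> K) :
  continuous tau -> ccont lam ->
  mcont (fun p : T * R => pencil (tau p.1) (lam p.1) p.2).
Proof.
move=> ct cl; apply: mcontD; last first.
  apply: (mcontZ (f := fun p : T * R => lam p.1)); last exact: mcont_cst.
  by apply: (@ccont_comp _ (T * R)%type T fst lam) => // p; exact: cvg_fst.
apply: (@mcont_comp R (T * R)%type (R * R)%type _ _ (fun p => (tau p.1, p.2)) (fun p => A p.1 p.2)) => //.
move=> p; apply: (cvg_pair (F := nbhs p) (G := nbhs (tau p.1)) (H := nbhs p.2)).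
  by apply: (@cvg_comp _ _ _ fst tau); [exact: cvg_fst|exact: ct].
exact: cvg_snd.
Qed.

Lemma pencil_cont1 t lam : mcont (pencil t lam).
Proof.
apply: (@mcont_slice R _ _ (fun _ => pencil t lam) 0).
by apply: (@pencil_cont R (fun=> t) (fun=> lam)); [move=> x; exact: cvg_cst|exact: ccont_cst].
Qed.

Lemma fundmx_sig t lam :
  {w : R -> 'M[K]_n | mcont w & volterra (pencil t lam) (fun=> 1%:M) w}.
Proof. exact: cid2 (volterra_exists (pencil_cont1 t lam) (mcont_cst _)). Qed.

Definition fundmx t lam := s2val (fundmx_sig t lam).

Lemma fundmx_cont t lam : mcont (fundmx t lam).
Proof. exact: s2valP. Qed.

Lemma fundmx_volt t lam : volterra (pencil t lam) (fun=> 1%:M) (fundmx t lam).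
Proof. exact: s2valP'. Qed.

Lemma i01_0 : 0 <= (0 : R) <= 1. Proof. by rewrite lexx ler01. Qed.
Lemma i01_1 : 0 <= (1 : R) <= 1. Proof. by rewrite lexx ler01. Qed.

Lemma fundmx0 t lam : fundmx t lam 0 = 1%:M.
Proof.
by apply/matrixP => i j; rewrite (@fundmx_volt t lam 0 i01_0 i j) cinteg_0 addr0.
Qed.

Lemma volterra_mulr m p (B : R -> 'M[K]_m) (h w : R -> 'M[K]_(m, p)) k (w0 : 'M[K]_(p, k)) :
  mcont B -> mcont w -> volterra B h w -> volterra B (fun x => h x *m w0) (fun x => w x *m w0).
Proof.
move=> cB cw vw x hx i j; rewrite mxE.
under eq_bigr => l _ do rewrite (vw x hx) mulrDl.
rewrite big_split /= mxE; congr (_ + _).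
have cBw : mcont (fun s => B s *m w s) by exact: mcont_mul.
transitivity (\sum_l cinteg (fun s => (w0 l j) * (B s *m w s) i l) x).
  by apply: eq_bigr => l _; rewrite cinteg_Z// 1?mulrC//; exact: cintg_cont.
rewrite -cinteg_sum//; last first.
  by move=> l _; apply: cintgM; [exact: ccont_cst|exact: cintg_cont].
apply: cinteg_ext => s _; rewrite mulmxA mxE; by apply: eq_bigr => l _; rewrite mulrC.
Qed.

Lemma is_prim_volt t lam (w : R -> 'cV[K]_n) :
  is_prim (fun s => pencil t lam s *m w s) w <-> volterra (pencil t lam) (fun=> w 0) w.
Proof.
split => H x hx i; first by move=> j; rewrite ord1; exact: H.
exact: H.
Qed.

Lemma fundmx_mul t lam (w0 : 'cV[K]_n) :
  is_prim (fun s => pencil t lam s *m (fundmx t lam s *m w0)) (fun x => fundmx t lam x *m w0).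
Proof.
have := volterra_mulr w0 (pencil_cont1 t lam) (fundmx_cont t lam) (@fundmx_volt t lam).
by move=> H x hx i; rewrite H// mul1mx fundmx0 mul1mx.
Qed.

Lemma fundmx_sol t lam (w : R -> 'cV[K]_n) : mcont w ->
  is_prim (fun s => pencil t lam s *m w s) w ->
  forall x, 0 <= x <= 1 -> w x = fundmx t lam x *m w 0.
Proof.
move=> cw /is_prim_volt vw; apply: (volterra_uniq (pencil_cont1 t lam) cw _ vw).
  by apply: mcont_mul; [exact: fundmx_cont|exact: mcont_cst].
have := volterra_mulr (w 0) (pencil_cont1 t lam) (fundmx_cont t lam) (@fundmx_volt t lam).
by move=> H x hx i j; rewrite H// mul1mx.
Qed.

Definition bdmx t lam : 'M[K]_n := S0 + S1 *m fundmx t lam 1.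

(** The characteristic determinant in real coordinates of the spectral parameter. *)
Definition chi t (r s : R) : K := \det (bdmx t (r +i* s)).

Lemma bdmx_cont (T : topologicalType) (tau : T -> R) (lam : T -> K) :
  continuous tau -> ccont lam -> mcont (fun q => bdmx (tau q) (lam q)).
Proof.
move=> ct cl; apply: mcontD; first exact: mcont_cst.
apply: mcont_mul; first exact: mcont_cst.
move=> i j q0; apply: (@volterra_param n n T (fun q => pencil (tau q) (lam q)) (fun=> 1%:M)
  (fun q => fundmx (tau q) (lam q))).
- exact: pencil_cont.
- by move=> q; exact: fundmx_cont.
- by move=> q; exact: fundmx_volt.
Qed.

Lemma chi_cont (T : topologicalType) (tau r s : T -> R) :
  continuous tau -> continuous r -> continuous s ->
  ccont (fun q => chi (tau q) (r q) (s q)).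
Proof.
move=> ct cr cs; apply: ccont_det.
by apply: bdmx_cont => //; exact: ccont_ReIm.
Qed.

(** The difference quotient in lambda of the fundamental matrix satisfies the
    Volterra equation at lambda + mu whose inhomogeneity is
    int E Y_lambda. Taking this equation as a definition gives a meaning also
    to the value at mu = 0. *)
Lemma dfundmx_sig t lam mu : {w : R -> 'M[K]_n | mcont w & volterra (pencil t (lam + mu))
  (fun x => \matrix_(i, j) cinteg (fun s => (E *m fundmx t lam s) i j) (clamp 0 1 x)) w}.
Proof.
apply: cid2; apply: volterra_exists; first exact: pencil_cont1.
move=> i j; apply: (@ccont_ext _ _ (fun x => cinteg (fun s => (E *m fundmx t lam s) i j) (clamp 0 1 x))).
  by move=> x; rewrite mxE.
apply: cinteg_cont; apply: cintg_cont; apply: (mcont_mul (A := fun=> E)); first exact: mcont_cst.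
exact: fundmx_cont.
Qed.

Definition dfundmx t lam mu := s2val (dfundmx_sig t lam mu).

Lemma dfundmx_cont t lam mu : mcont (dfundmx t lam mu).
Proof. exact: s2valP. Qed.

Lemma dfundmx_volt t lam mu : volterra (pencil t (lam + mu))
  (fun x => \matrix_(i, j) cinteg (fun s => (E *m fundmx t lam s) i j) (clamp 0 1 x))
  (dfundmx t lam mu).
Proof. exact: s2valP'. Qed.

(** Both sides solve the same Volterra equation. *)
Lemma fundmxD t lam mu x : 0 <= x <= 1 ->
  fundmx t (lam + mu) x = fundmx t lam x + mu *: dfundmx t lam mu x.
Proof.
have cZ : mcont (fun x => mu *: dfundmx t lam mu x).
  by apply: (mcontZ (f := fun=> mu)); [exact: ccont_cst|exact: dfundmx_cont].
apply: (@volterra_uniq R n n (pencil t (lam + mu)) (fun=> 1%:M) (fundmx t (lam + mu))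
  (fun x => fundmx t lam x + mu *: dfundmx t lam mu x)).
- exact: pencil_cont1.
- exact: fundmx_cont.
- by apply: mcontD => //; exact: fundmx_cont.
- exact: fundmx_volt.
move=> {}x hx i j.
rewrite mxDE mxZE (@fundmx_volt t lam x hx i j).
rewrite (@dfundmx_volt t lam mu x hx i j).
rewrite [X in _ + _ * (X + _)]mxE clamp_id//.
rewrite -addrA; congr (_ + _).
have c1 : mcont (fun s => pencil t lam s *m fundmx t lam s).
  by apply: mcont_mul; [exact: pencil_cont1|exact: fundmx_cont].
have c2 : mcont (fun s => E *m fundmx t lam s).
  by apply: mcont_mul; [exact: mcont_cst|exact: fundmx_cont].
have c3 : mcont (fun s => pencil t (lam + mu) s *m dfundmx t lam mu s).
  by apply: mcont_mul; [exact: pencil_cont1|exact: dfundmx_cont].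
rewrite -cinteg_D//; [|exact: cintg_cont..].
rewrite -cinteg_Z//; last by apply: cintgD; exact: cintg_cont.
rewrite -cinteg_D//; [|exact: cintg_cont|]; last first.
  by apply: cintgM; [exact: ccont_cst|apply: cintgD; exact: cintg_cont].
apply: cinteg_ext => s _.
have -> : pencil t (lam + mu) s *m (fundmx t lam s + mu *: dfundmx t lam mu s) =
  pencil t lam s *m fundmx t lam s + mu *: (E *m fundmx t lam s + pencil t (lam + mu) s *m dfundmx t lam mu s).
  rewrite mulmxDr {1}/pencil scalerDl addrA mulmxDl -addrA; congr (_ + _).
  by rewrite scalerDr -scalemxAl -scalemxAr.
by rewrite mxDE mxZE mxDE.
Qed.

Definition dbdmx t lam mu : 'M[K]_n := S1 *m dfundmx t lam mu 1.

Lemma bdmxD t lam mu : bdmx t (lam + mu) = bdmx t lam + mu *: dbdmx t lam mu.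
Proof.
by rewrite /bdmx /dbdmx (fundmxD _ _ _ i01_1) mulmxDr addrA -scalemxAr.
Qed.

Lemma dbdmx_cvg t lam i j : ccvg (nbhs (0 : R * R))
  (fun q => dbdmx t lam (q.1 +i* q.2) i j) (dbdmx t lam 0 i j).
Proof.
have cl : ccont (fun q : R * R => q.1 +i* q.2).
  by apply: ccont_ReIm => q; [exact: cvg_fst|exact: cvg_snd].
have c (q : R * R) k l := @volterra_param n n (R * R)%type (fun q => pencil t (lam + (q.1 +i* q.2)))
  _ (fun q => dfundmx t lam (q.1 +i* q.2))
  (@pencil_cont (R * R)%type (fun=> t) (fun q => lam + (q.1 +i* q.2))
     (fun x => cvg_cst _) (ccontD (ccont_cst _) cl))
  (fun q => dfundmx_cont t lam _) (fun q => @dfundmx_volt t lam _) q k l.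
have : mcont (fun q : R * R => dbdmx t lam (q.1 +i* q.2)).
  apply: mcont_mul; first exact: mcont_cst.
  by move=> k l q; exact: c.
by move=> /(_ i j 0); rewrite /=.
Qed.

(** There are no generalised eigenvectors: an eigenfunction u such that the
    boundary value problem with right-hand side E u is solvable is trivial. *)
Definition nondegen t (r : R) := forall u y : R -> 'cV[K]_n, mcont u -> mcont y ->
  is_prim (fun s => pencil t r%:C s *m u s) u -> S0 *m u 0 + S1 *m u 1 = 0 ->
  is_prim (fun s => pencil t r%:C s *m y s + E *m u s) y -> S0 *m y 0 + S1 *m y 1 = 0 ->
  u 0 = 0.

Lemma is_primD (h w h' w' : R -> 'cV[K]_n) : mcont h -> mcont h' -> is_prim h w -> is_prim h' w' ->
  is_prim (fun s => h s + h' s) (fun s => w s + w' s).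
Proof.
move=> ch ch' H H' x hx i; rewrite mxE (H x hx) (H' x hx) mxE addrACA; congr (_ + _).
rewrite -cinteg_D//; [|exact: cintg_cont..].
by apply: cinteg_ext => s _; rewrite mxE.
Qed.

Lemma is_primN (h w : R -> 'cV[K]_n) : mcont h -> is_prim h w ->
  is_prim (fun s => - h s) (fun s => - w s).
Proof.
move=> ch H x hx i; rewrite mxE (H x hx) mxE opprD; congr (_ + _).
rewrite -cinteg_N//; last exact: cintg_cont.
by apply: cinteg_ext => s _; rewrite mxE.
Qed.

(** The non-degeneracy is what the determinant lemma asks of the first-order
    expansion of the boundary matrix: a vector v in its kernel whose first-order
    image lies in its range gives an eigenfunction u and a solution y of the
    equation with right-hand side E u. *)
Lemma chi_factor t r : nondegen t r -> exists h : R * R -> K, exists2 a, a != 0 &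
  ccvg (nbhs ((r, 0) : R * R)) h a /\
  forall x y, chi t x y = Zc (r, 0) x y ^+ (n - \rank (bdmx t r%:C)) * h (x, y).
Proof.
move=> nd.
have mu0 : ccvg (nbhs (0 : R * R)) (fun q => q.1 +i* q.2) 0.
  by split; [exact: cvg_fst|exact: cvg_snd].
have [|h [a a0 [ha hE]]] := det_order _ mu0 (dbdmx_cvg t r%:C) (M0 := bdmx t r%:C).
  move=> v w Mv Lv.
  pose u x := fundmx t r%:C x *m v.
  have cu : mcont u by apply: mcont_mul; [exact: fundmx_cont|exact: mcont_cst].
  pose z x := dfundmx t r%:C 0 x *m v.
  have cz : mcont z by apply: mcont_mul; [exact: dfundmx_cont|exact: mcont_cst].
  pose y1 x := fundmx t r%:C x *m w.
  have cy1 : mcont y1 by apply: mcont_mul; [exact: fundmx_cont|exact: mcont_cst].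
  have iu : is_prim (fun s => pencil t r%:C s *m u s) u by exact: fundmx_mul.
  have iy1 : is_prim (fun s => pencil t r%:C s *m y1 s) y1 by exact: fundmx_mul.
  have cpen := pencil_cont1 t r%:C.
  have z0 : dfundmx t r%:C 0 0 = 0.
    apply/matrixP => i j; rewrite (@dfundmx_volt t r%:C 0 0 i01_0 i j) mxE clamp_id ?i01_0// !cinteg_0 addr0.
    by rewrite mxE.
  have iz : is_prim (fun s => pencil t r%:C s *m z s + E *m u s) z.
    move=> x hx i.
    have := volterra_mulr v (@pencil_cont1 t (r%:C + 0)) (dfundmx_cont t r%:C 0) (@dfundmx_volt t r%:C 0).
    move=> /(_ x hx i 0); rewrite /z => ->; rewrite z0 mul0mx [X in _ = X + _]mxE add0r.
    rewrite addr0.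
    have c1 : mcont (fun s => pencil t r%:C s *m z s) by exact: mcont_mul.
    have c2 : mcont (fun s => E *m u s) by apply: mcont_mul => //; exact: mcont_cst.
    have -> : cinteg (fun s => (pencil t r%:C s *m (dfundmx t r%:C 0 s *m v) + E *m u s) i 0) x =
      cinteg (fun s => (pencil t r%:C s *m z s) i 0 ) x + cinteg (fun s => (E *m u s) i 0) x.
      rewrite -cinteg_D//; [|exact: cintg_cont..].
      by apply: cinteg_ext => s _; rewrite mxE.
    rewrite addrC; congr (_ + _).
    have c3 : mcont (fun s => E *m fundmx t r%:C s).
      by apply: mcont_mul; [exact: mcont_cst|exact: fundmx_cont].
    rewrite mxE; transitivity (\sum_l cinteg (fun s => v l 0 * (E *m fundmx t r%:C s) i l) x).
      apply: eq_bigr => l _; rewrite mxE clamp_id// cinteg_Z// 1?mulrC//; exact: cintg_cont.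
    rewrite -cinteg_sum//; last first.
      by move=> l _; apply: cintgM; [exact: ccont_cst|exact: cintg_cont].
    apply: cinteg_ext => s _; rewrite /u mulmxA [in RHS]mxE; by apply: eq_bigr => l _; rewrite mulrC.
  have u0 : u 0 = v by rewrite /u fundmx0 mul1mx.
  rewrite -u0; apply: (nd u (fun x => z x - y1 x) cu _ iu).
  - by apply: mcontD => //; exact: mcontN.
  - by rewrite u0 -[RHS]Mv /bdmx mulmxDl mulmxA.
  - have := is_primD _ _ iz (is_primN _ iy1).
    move=> H.
    have H2 : is_prim (fun s => pencil t r%:C s *m z s + E *m u s - pencil t r%:C s *m y1 s) (fun s => z s - y1 s).
      apply: H.
      + by apply: mcontD; apply: mcont_mul => //; exact: mcont_cst.
      + by apply: mcontN; apply: mcont_mul.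
      + by apply: mcont_mul.
    move=> x hx i; rewrite (H2 x hx i); congr (_ + _); apply: cinteg_ext => s _.
    by rewrite mulmxBr addrAC.
  - rewrite !mulmxBr addrACA -opprD /z /y1 z0 fundmx0 mul0mx mulmx0 add0r mul1mx.
    move: Lv; rewrite /dbdmx -mulmxA => ->.
    by rewrite /bdmx mulmxDl mulmxA subrr.
exists (fun p => h (p.1 - r, p.2)), a => //; split.
  apply: (@ccvg_comp _ _ _ _ (nbhs (0 : R * R)) (fun q : R * R => (q.1 - r, q.2)) h a) => //.
  have -> : (0 : R * R) = (r - r, 0) by rewrite subrr.
  apply: (cvg_pair (G := nbhs (r - r)) (H := nbhs 0)).
    apply: (cvgB (f := fst) (g := fun=> r)); first exact: cvg_fst.
    exact: cvg_cst.
  exact: cvg_snd.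
move=> x y; rewrite /chi.
have -> : x +i* y = r%:C + ((x - r) +i* y).
  by apply: complexP; rewrite ?cReD ?cImD /= ?add0r// addrC subrK.
by rewrite bdmxD (hE (x - r, y)) /= /Zc /= subr0.
Qed.

Lemma chi_cont2 t : ccont2 (chi t).
Proof. by apply: chi_cont => q; [exact: cvg_cst|exact: cvg_fst|exact: cvg_snd]. Qed.

Lemma local_index_chi t r : nondegen t r ->
  local_index (chi t) (r, 0) (n - \rank (bdmx t r%:C))%:Z.
Proof.
move=> /chi_factor[h [a a0 [ha hE]]].
apply: (local_index_order (p := (r, 0)) (h := fun x y => h (x, y)) (chi_cont2 t) a0) => //.
by apply: ccvg_ext ha => -[].
Qed.

Lemma chi_isolated t r : nondegen t r ->
  exists2 d : R, 0 < d & forall x, `|x - r| < d -> x != r -> chi t x 0 != 0.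
Proof.
move=> /chi_factor[h [a a0 [ha hE]]].
have [d d0 H] := near_ball2 (ccvg_slit a0 ha).
exists d => // x xr xnr; rewrite hE mulf_neq0//.
  rewrite expf_neq0//; apply/eqP => /(congr1 (@complex.Re R)) /= /eqP.
  by rewrite subr_eq0 (negbTE xnr).
have /slit_neq0 : slit (h (x, 0) / a) by apply: H => //=; rewrite subrr normr0.
by rewrite mulf_eq0 negb_or => /andP[].
Qed.

End Pencil.

(** * The Sturm-Liouville operator as a first-order system *)

Section Operator.
Variables (R : realType) (N : nat) (P Q G : R -> 'M[R]_N) (C : R -> R -> 'M[R]_N)
  (R0 R1 : 'M[R]_(N + N)).
Local Notation mu := (@lebesgue_measure R).
Local Notation K := R[i].
Hypothesis (P_C1 : C1mx P) (Q_C1 : C1mx Q) (G_C1 : C1mx G).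
Hypothesis (P_unit : forall x, 0 <= x <= 1 -> P x \in unitmx).
Hypothesis (C_continuous : forall i j,
     {within (`[0, 1] `*` `[0, 1] : set (R * R)),
       continuous (fun tx : R * R => C tx.1 tx.2 i j)}).

Local Notation cl := (clamp (0 : R) 1).

Definition pm x : 'M[K]_N := cmx (invmx (P (cl x))).
Definition qm x : 'M[K]_N := cmx (Q (cl x)).
Definition gm x : 'M[K]_N := cmx (G (cl x)).
Definition cm t x : 'M[K]_N := cmx (C (cl t) (cl x)).

(** The coefficient matrix for the unknown (P u' + Q u, u), extended from
    [0,1] to the line; it is the product J B for C_z = 0. *)
Definition sysmx0 x : 'M[K]_(N + N) :=
  block_mx ((qm x)^T *m pm x) (gm x - (qm x)^T *m pm x *m qm x)
           (pm x) (- (pm x *m qm x)).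

Definition sysmx t x : 'M[K]_(N + N) := sysmx0 x + block_mx 0 (cm t x) 0 0.
(** Adding lambda to the operator adds lambda u to the derivative of the first
    component. *)
Definition parmx : 'M[K]_(N + N) := block_mx 0 1%:M 0 0.

Lemma ccont_real (T : topologicalType) (f : T -> R) : continuous f -> ccont (fun x => (f x)%:C).
Proof. by move=> cf; apply: ccont_ReIm => // x; exact: cvg_cst. Qed.

Lemma mcont_block (T : topologicalType) m1 m2 q1 q2 (A : T -> 'M[K]_(m1, q1))
  (B : T -> 'M[K]_(m1, q2)) (D : T -> 'M[K]_(m2, q1)) (E : T -> 'M[K]_(m2, q2)) :
  mcont A -> mcont B -> mcont D -> mcont E -> mcont (fun x => block_mx (A x) (B x) (D x) (E x)).
Proof.
move=> cA cB cD cE i j.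
case: (split_ordP i) => i' ->; case: (split_ordP j) => j' ->.
- by apply: ccont_ext (cA i' j') => x; rewrite block_mxEul.
- by apply: ccont_ext (cB i' j') => x; rewrite block_mxEur.
- by apply: ccont_ext (cD i' j') => x; rewrite block_mxEdl.
- by apply: ccont_ext (cE i' j') => x; rewrite block_mxEdr.
Qed.

Lemma mcont_tr (T : topologicalType) m n (A : T -> 'M[K]_(m, n)) :
  mcont A -> mcont (fun x => (A x)^T).
Proof. by move=> cA i j; apply: ccont_ext (cA j i) => x; rewrite mxE. Qed.

Lemma mcont_C1 m n (A : R -> 'M[R]_(m, n)) : C1mx A -> mcont (fun x => cmx (A (cl x))).
Proof.
move=> cA i j; apply: (@ccont_ext _ _ (fun x => (A (cl x) i j)%:C)).
  by move=> x; rewrite mxE.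
apply: ccont_real; apply: (@within_clamp R _ 0 1 (fun x => A x i j)) => //.
exact: C1_cont.
Qed.

Lemma pm_cont : mcont pm.
Proof. exact: (mcont_C1 (C1_invmx P_C1 P_unit)). Qed.

Lemma sysmx0_cont : mcont sysmx0.
Proof.
have cp := pm_cont; have cq : mcont qm by exact: mcont_C1.
have cg : mcont gm by exact: mcont_C1.
apply: mcont_block => //.
- by apply: mcont_mul => //; exact: mcont_tr.
- apply: mcontD => //; apply: mcontN; apply: mcont_mul => //; apply: mcont_mul => //.
  exact: mcont_tr.
- by apply: mcontN; exact: mcont_mul.
Qed.

Lemma cm_cont2 : mcont (fun p : R * R => cm p.1 p.2).
Proof.
move=> i j; apply: (@ccont_ext _ _ (fun p : R * R => (C (cl p.1) (cl p.2) i j)%:C)).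
  by move=> x; rewrite mxE.
apply: ccont_real.
apply: (@within_comp _ _ _ (`[0, 1] `*` `[0, 1] : set (R * R))
  (fun p => (cl p.1, cl p.2)) (fun p => C p.1 p.2 i j)); last exact: C_continuous.
  move=> p; apply: (cvg_pair (F := nbhs p) (G := nbhs (cl p.1)) (H := nbhs (cl p.2))).
    by apply: (@cvg_comp _ _ _ fst cl); [exact: cvg_fst|exact: clamp_cont].
  by apply: (@cvg_comp _ _ _ snd cl); [exact: cvg_snd|exact: clamp_cont].
by move=> p; split; apply: clamp_in.
Qed.

Lemma sysmx_cont : mcont (fun p : R * R => sysmx p.1 p.2).
Proof.
apply: (mcontD (A := fun p : R * R => sysmx0 p.2)).
  apply: (@mcont_comp R (R * R)%type R _ _ snd sysmx0); last exact: sysmx0_cont.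
  by move=> x; exact: cvg_snd.
by apply: mcont_block; [exact: mcont_cst|exact: cm_cont2|exact: mcont_cst|exact: mcont_cst].
Qed.

Lemma cmx_mul m n p (A : 'M[R]_(m, n)) (B : 'M[R]_(n, p)) : cmx (A *m B) = cmx A *m cmx B.
Proof. exact: map_mxM. Qed.

Lemma cmx1 n : cmx (1%:M : 'M[R]_n) = 1%:M.
Proof. exact: map_mx1. Qed.

Lemma pmP x : 0 <= x <= 1 -> pm x *m cmx (P x) = 1%:M.
Proof. by move=> hx; rewrite /pm clamp_id// -cmx_mul mulVmx ?cmx1// P_unit. Qed.

Lemma Ppm x : 0 <= x <= 1 -> cmx (P x) *m pm x = 1%:M.
Proof. by move=> hx; rewrite /pm clamp_id// -cmx_mul mulmxV ?cmx1// P_unit. Qed.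

Lemma qmE x : 0 <= x <= 1 -> qm x = cmx (Q x).
Proof. by move=> hx; rewrite /qm clamp_id. Qed.

Lemma gmE x : 0 <= x <= 1 -> gm x = cmx (G x).
Proof. by move=> hx; rewrite /gm clamp_id. Qed.

Lemma sysmx0_mul x (d u : 'cV[K]_N) : 0 <= x <= 1 ->
  sysmx0 x *m col_mx (cmx (P x) *m d + cmx (Q x) *m u) u =
  col_mx ((cmx (Q x))^T *m d + cmx (G x) *m u) d.
Proof.
move=> hx; rewrite /sysmx0 (qmE hx) (gmE hx); have := pmP hx.
move: (pm x) (cmx (P x)) (cmx (Q x)) (cmx (G x)) => p pp q g pK.
have e : p *m (pp *m d + q *m u) = d + p *m (q *m u).
  by rewrite mulmxDr mulmxA pK mul1mx.
rewrite mul_block_col -!mulmxA e; congr col_mx.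
  by rewrite mulmxBl -!mulmxA mulmxDr addrACA subrr addr0.
by rewrite mulNmx -mulmxA addrK.
Qed.

Lemma AA_mul t lam x (w : 'cV[K]_(N + N)) :
  pencil sysmx parmx t lam x *m w = sysmx0 x *m w + col_mx (cm t x *m dsubmx w + lam *: dsubmx w) 0.
Proof.
rewrite /pencil /sysmx -addrA mulmxDl; congr (_ + _).
rewrite mulmxDl -scalemxAl -{1 2}[w]vsubmxK !mul_block_col !mul0mx !addr0 mul1mx !add0r.
by rewrite scale_col_mx add_col_mx scaler0 addr0.
Qed.

Definition bdry_cond (w : R -> 'cV[K]_(N + N)) := cmx R0 *m w 0 + cmx R1 *m w 1 = 0.

Lemma ae_ord n (S : 'I_n -> R -> Prop) : (forall i, {ae mu, forall x, S i x}) ->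
  {ae mu, forall x, forall i, S i x}.
Proof.
move=> H.
have : {ae mu, forall x, forall k : nat, forall i : 'I_n, k = i -> S i x}.
  apply: ae_foralln => k.
  have [kn|kn] := ltnP k n.
    by apply: aeS (H (Ordinal kn)) => x Sx i ki; rewrite (_ : i = Ordinal kn)//; exact: val_inj.
  by apply: aeW => x i ki; move: (ltn_ord i); rewrite -ki ltnNge kn.
by apply: aeS => x Sx i; exact: (Sx i).
Qed.

Lemma cmx_entry m n p (A : 'M[R]_(m, n)) (v : 'M[K]_(n, p)) i j :
  (cmx A *m v) i j = \sum_k (A i k)%:C * v k j.
Proof. by rewrite mxE; apply: eq_bigr => k _; rewrite mxE. Qed.

Lemma colB_up (a b f : 'cV[K]_N) k : (col_mx a b - col_mx f 0) (lshift N k) 0 = a k 0 - f k 0.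
Proof. by rewrite mxE col_mxEu mxE col_mxEu. Qed.

Lemma colB_dn (a b f : 'cV[K]_N) k : (col_mx a b - col_mx f 0) (rshift N k) 0 = b k 0.
Proof. by rewrite mxE col_mxEd mxE col_mxEd mxE oppr0 addr0. Qed.

Lemma force_cL2 (h : R -> 'cV[K]_(N + N)) f i : mcont h -> L2 f ->
  cL2 (fun s => (h s - col_mx (f s) 0) i 0).
Proof.
move=> ch Lf.
rewrite (_ : (fun s => _) = fun s => h s i 0 + - col_mx (f s) 0 i 0); last first.
  by apply/funext => s; rewrite mxE [X in _ + X]mxE.
apply: cL2D; first by apply: cwithin_cL2; exact: ccont_cwithin.
case: (split_ordP i) => k ->.
  rewrite (_ : (fun s => _) = fun s => - f s k 0); last by apply/funext => s; rewrite col_mxEu.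
  exact/cL2N/Lf.
rewrite (_ : (fun s => _) = fun=> 0); last by apply/funext => s; rewrite col_mxEd mxE oppr0.
by apply: cwithin_cL2; exact: cwithin_cst.
Qed.

(** For u in the domain, w = (P u' + Q u, u) satisfies the first-order system
    in integral form, with g entering the first component. The quasi-derivative is
    a sum of products of C1 and H1 functions, hence the integral of its almost everywhere
    derivative. *)
Lemma opA0_fwd v g : opA0 P Q G R0 R1 v g -> exists w : R -> 'cV[K]_(N + N),
  [/\ mcont w, bdry_cond w, aeeq v (fun x => dsubmx (w x)) &
      is_prim (fun s => sysmx0 s *m w s - col_mx (g s) 0) w].
Proof.
move=> [L2v L2g [u [[H2u bcu] vu gE]]].
pose du x := D01mx u x.
have duE x i : du x i 0 = cD01 (fun y => u y i 0) x by rewrite mxE.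
have cu i : cC1 (fun x => u x i 0) by have [[h1 _] [h2 _]] := H2u i; split.
have cdu i : cH1 (fun x => du x i 0).
  have [[_ h1] [_ h2]] := H2u i; split.
    by apply: H1_ext h1 => x _; rewrite duE.
  by apply: H1_ext h2 => x _; rewrite duE.
have qdE x : quasi_deriv P Q u x = cmx (P x) *m du x + cmx (Q x) *m u x by [].
have cqd i : cH1 (fun x => quasi_deriv P Q u x i 0).
  apply: (@cH1_ext _ (fun x => \sum_k (P x i k)%:C * du x k 0 + \sum_k (Q x i k)%:C * u x k 0)).
    by move=> x _; rewrite qdE mxE !cmx_entry.
  apply: cH1D; apply: cH1_sum => k _; apply: cH1M => //.
  exact: cC1_cH1.
pose w x : 'cV[K]_(N + N) := col_mx (quasi_deriv P Q u (cl x)) (u (cl x)).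
have wE x : 0 <= x <= 1 -> w x = col_mx (quasi_deriv P Q u x) (u x).
  by move=> hx; rewrite /w clamp_id.
have i0 : 0 <= (0 : R) <= 1 by rewrite lexx ler01.
have i1 : 0 <= (1 : R) <= 1 by rewrite lexx ler01.
have cw : mcont w.
  move=> i j; rewrite ord1; case: (split_ordP i) => k ->.
    apply: (@ccont_ext _ _ (fun x => quasi_deriv P Q u (cl x) k 0)).
      by move=> x; rewrite col_mxEu.
    exact: (cwithin_clamp (cH1_cwithin (cqd k))).
  apply: (@ccont_ext _ _ (fun x => u (cl x) k 0)); first by move=> x; rewrite col_mxEd.
  exact: (cwithin_clamp (cH1_cwithin (cC1_cH1 (cu k)))).
have AAw x : 0 <= x <= 1 ->
    sysmx0 x *m w x = col_mx ((cmx (Q x))^T *m du x + cmx (G x) *m u x) (du x).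
  by move=> hx; rewrite wE// qdE sysmx0_mul.
have cAAw : mcont (fun s => sysmx0 s *m w s) by apply: mcont_mul => //; exact: sysmx0_cont.
exists w; split => //.
- by rewrite /bdry_cond !wE.
- by apply: aeS vu => x H hx; rewrite H// wE// col_mxKd.
move=> x hx i; case: (split_ordP i) => k ->; last first.
  rewrite !wE// !col_mxEd.
  rewrite (@cinteg_ext _ _ (fun s => du s k 0)); last first.
    move=> s /andP[s0 sx]; have hs : 0 <= s <= 1 by rewrite s0 (le_trans sx)//; case/andP: hx.
    by rewrite AAw// colB_dn.
  apply: (@cftc R (fun y => u y k 0) (fun y => du y k 0) (cH1_cwithin (cdu k))) => // y hy; rewrite duE.
  by have [h1 h2] := cu k; split; exact: C1_isD.
rewrite !wE// !col_mxEu.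
have [ga Lga gaE] := cH1P (cqd k).
have [_ aega] := cH1_of_prim Lga gaE.
rewrite (gaE x hx); congr (_ + _); apply: cinteg_ae => //.
- exact: cL2_cintg.
- by apply: cL2_cintg; exact: force_cL2.
apply: aeS (aeI aega gE) => y [h1 h2] hy.
have [_ e1] := cisD_cD01 hy (h1 hy).
rewrite AAw// colB_up (h2 hy) !mxE e1 -/(du y).
rewrite [X in _ = _ - X]addrC; ring.
Qed.

(** Conversely u is C1, since its derivative P^-1 (w1 - Q u) is continuous, and
    this derivative is in H1 because w1 and u are. So u is in H2 and its
    quasi-derivative is w1. *)
Lemma opA0_bwd g (w : R -> 'cV[K]_(N + N)) : mcont w -> bdry_cond w -> L2 g ->
  is_prim (fun s => sysmx0 s *m w s - col_mx (g s) 0) w ->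
  opA0 P Q G R0 R1 (fun x => dsubmx (w x)) g.
Proof.
move=> cw bcw Lg Hw.
pose u x := dsubmx (w x); pose w1 x := usubmx (w x).
pose d x := pm x *m (w1 x - qm x *m u x).
have cu : mcont u by move=> i j; apply: ccont_ext (cw (rshift N i) j) => x; rewrite !mxE.
have cw1 : mcont w1 by move=> i j; apply: ccont_ext (cw (lshift N i) j) => x; rewrite !mxE.
have cd : mcont d.
  apply: mcont_mul; first exact: pm_cont.
  by apply: mcontD => //; apply: mcontN; apply: mcont_mul => //; exact: mcont_C1.
have cAAw : mcont (fun s => sysmx0 s *m w s) by apply: mcont_mul => //; exact: sysmx0_cont.
have w1E x : 0 <= x <= 1 -> w1 x = cmx (P x) *m d x + cmx (Q x) *m u x.
  by move=> hx; rewrite /d mulmxA Ppm// mul1mx qmE// subrK.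
have AAw x : 0 <= x <= 1 ->
    sysmx0 x *m w x = col_mx ((cmx (Q x))^T *m d x + cmx (G x) *m u x) (d x).
  by move=> hx; rewrite -[w x]vsubmxK -/(u x) -/(w1 x) w1E// sysmx0_mul.
have i0 : 0 <= (0 : R) <= 1 by rewrite lexx ler01.
have i1 : 0 <= (1 : R) <= 1 by rewrite lexx ler01.
have uD i x : 0 <= x <= 1 -> cisD (fun y => u y i 0) x (d x i 0).
  move=> hx; apply: (@cisD_ext _ (fun y => u 0 i 0 + cinteg (fun s => d s i 0) y)) => //; last first.
    by apply: cisD_prim => //; exact: ccont_cwithin.
  move=> y hy; have := Hw y hy (rshift N i).
  rewrite [u 0 i 0]mxE [u y i 0]mxE => ->; congr (_ + _); apply: cinteg_ext => s /andP[s0 sy].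
  by rewrite AAw ?colB_dn// s0 (le_trans sy)//; case/andP: hy.
have duE x : 0 <= x <= 1 -> D01mx u x = d x.
  move=> hx; apply/matrixP => i j; rewrite ord1 mxE.
  by have [_ ->] := cisD_cD01 hx (uD i x hx).
have qdE x : 0 <= x <= 1 -> quasi_deriv P Q u x = w1 x.
  by move=> hx; rewrite /quasi_deriv duE// -w1E.
have w1D i := @cH1_of_prim _ (fun x => w x (lshift N i) 0) _ (force_cL2 (lshift N i) cAAw Lg)
  (fun x hx => Hw x hx (lshift N i)).
have cH1u i : cH1 (fun x => u x i 0).
  apply: cC1_cH1; apply: cisD_cC1 (fun x hx => uD i x hx).
  exact: ccont_cwithin.
have cH1w1 i : cH1 (fun x => w1 x i 0).
  by apply: cH1_ext (w1D i).1 => x _; rewrite mxE.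
have cH1d i : cH1 (fun x => d x i 0).
  apply: (@cH1_ext _ (fun x => \sum_k (invmx (P x) i k)%:C * (w1 x k 0 +
     \sum_l (- Q x k l)%:C * u x l 0))).
    move=> x hx; rewrite /d qmE// /pm clamp_id// cmx_entry; apply: eq_bigr => k _.
    congr (_ * _); apply/esym; rewrite mxE [X in _ + X]mxE cmx_entry; congr (_ + _).
    by rewrite -sumrN; apply: eq_bigr => l _; rewrite [in RHS]rmorphN mulNr.
  apply: cH1_sum => k _; apply: cH1M; first exact: (C1_invmx P_C1 P_unit).
  apply: cH1D => //; apply: cH1_sum => l _; apply: cH1M => //.
  by apply: C1_ext (C1M (C1_cst (-1)) (Q_C1 k l)) => x _; rewrite mulN1r.
have L2u : L2 u by move=> i; apply: cwithin_cL2; exact: ccont_cwithin.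
split => //; exists u; split.
- split; last first.
    by move: bcw; rewrite /bdry_cond /bc !qdE// !vsubmxK.
  move=> i; have dd x : 0 <= x <= 1 -> cisD (fun y => u y i 0) x (d x i 0) := uD i x.
  have [c1 c2] := cisD_cC1 (ccont_cwithin (cd i 0)) dd.
  have [h1 h2] := cH1d i.
  split; split => //.
    by apply: H1_ext h1 => x hx; have [_ ->] := isD_D01 hx (dd x hx).1.
  by apply: H1_ext h2 => x hx; have [_ ->] := isD_D01 hx (dd x hx).2.
- by apply: aeW.
- have := ae_ord (fun i => (w1D i).2); apply: aeS => x H hx.
  apply/matrixP => i j; rewrite ord1.
  have e : D01mx (quasi_deriv P Q u) x i 0 = ((cmx (Q x))^T *m d x + cmx (G x) *m u x) i 0 - g x i 0.
    rewrite mxE; have := cisD_ext hx _ (H i hx).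
    move=> /(_ (fun y => quasi_deriv P Q u y i 0)); rewrite AAw// colB_up => h.
    have [|_ //] := cisD_cD01 hx (h _).
    by move=> y hy; rewrite qdE// mxE.
  rewrite duE// mxE [X in X + _]mxE [X in X + _ + _]mxE e [X in - (X - _)]mxE.
  ring.
Qed.

End Operator.

(** * Inner products, kernels and the resolvent *)

Section InnerProduct.
Variables (R : realType) (N : nat).
Local Notation mu := (@lebesgue_measure R).
Local Notation K := R[i].
Local Notation vfun := (R -> 'cV[K]_N).
Implicit Types u v f : vfun.

Definition dot u v s : K := \sum_i u s i 0 * (v s i 0)^*.

Lemma innerE u v : inner u v = cinteg (dot u v) 1.
Proof. by []. Qed.

Lemma ccont_conj (T : topologicalType) (f : T -> K) : ccont f -> ccont (fun x => (f x)^*).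
Proof.
move=> cf; apply: (@ccont_ext _ _ (fun x => complex.Re (f x) +i* - complex.Im (f x))).
  by move=> x; apply: complexP; case: (f x).
apply: ccont_ReIm; first exact: ccontRe.
by move=> x; apply: cvgN; exact: ccontIm.
Qed.

Lemma dot_cont u v : mcont u -> mcont v -> ccont (dot u v).
Proof.
move=> cu cv; apply: ccont_sum => i _; apply: ccontM; first exact: cu.
exact/ccont_conj/cv.
Qed.

Lemma inner_ext u v u' v' : (forall x, 0 <= x <= 1 -> u x = u' x) ->
  (forall x, 0 <= x <= 1 -> v x = v' x) -> inner u v = inner u' v'.
Proof.
move=> uE vE; rewrite !innerE; apply: cinteg_ext => s hs; apply: eq_bigr => i _.
by rewrite uE// vE.
Qed.

Lemma innerD u u' v : mcont u -> mcont u' -> mcont v ->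
  inner (fun x => u x + u' x) v = inner u v + inner u' v.
Proof.
move=> cu cu' cv; rewrite !innerE -cinteg_D ?i01_1//; [|exact/cintg_cont/dot_cont..].
by apply: cinteg_ext => s _; rewrite /dot -big_split; apply: eq_bigr => i _ /=; rewrite mxE mulrDl.
Qed.

Lemma innerDr u v v' : mcont u -> mcont v -> mcont v' ->
  inner u (fun x => v x + v' x) = inner u v + inner u v'.
Proof.
move=> cu cv cv'; rewrite !innerE -cinteg_D ?i01_1//; [|exact/cintg_cont/dot_cont..].
apply: cinteg_ext => s _; rewrite /dot -big_split; apply: eq_bigr => i _ /=.
by rewrite mxE rmorphD mulrDr.
Qed.

Lemma innerZ c u v : mcont u -> mcont v -> inner (fun x => c *: u x) v = c * inner u v.
Proof.
move=> cu cv; rewrite !innerE -cinteg_Z ?i01_1//; last exact/cintg_cont/dot_cont.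
by apply: cinteg_ext => s _; rewrite /dot big_distrr; apply: eq_bigr => i _ /=; rewrite mxE mulrA.
Qed.

Lemma innerZr c u v : mcont u -> mcont v -> inner u (fun x => c *: v x) = c^* * inner u v.
Proof.
move=> cu cv; rewrite !innerE -cinteg_Z ?i01_1//; last exact/cintg_cont/dot_cont.
apply: cinteg_ext => s _; rewrite /dot big_distrr; apply: eq_bigr => i _ /=.
by rewrite mxE rmorphM mulrCA.
Qed.

Lemma cinteg0_cont (f : R -> K) : ccont f -> (forall y, 0 <= y <= 1 -> cinteg f y = 0) ->
  forall x, 0 <= x <= 1 -> f x = 0.
Proof.
move=> cf z x hx.
have [_ e1] := cisD_cD01 hx (cisD_prim 0 (ccont_cwithin cf) hx).
have c0 y : 0 <= y <= 1 -> 0 + cinteg (fun _ : R => 0 : K) y = 0 + cinteg f y.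
  by move=> hy; rewrite z//; case/andP: (hy) => y0 y1; rewrite /cinteg !integ_cst//= !mul0r.
have [_ e2] := cisD_cD01 hx (cisD_ext hx c0 (cisD_prim 0 (cwithin_cst 0) hx)).
by rewrite -e1 e2.
Qed.

Lemma mulz_conj (z : K) : z * z^* = (complex.Re z ^+ 2 + complex.Im z ^+ 2)%:C.
Proof. by case: z => a b; apply: complexP; rewrite ?cReM ?cImM /=; ring. Qed.

Definition sqn u s : R := \sum_i (complex.Re (u s i 0) ^+ 2 + complex.Im (u s i 0) ^+ 2).

Lemma dot_self u s : dot u u s = (sqn u s)%:C.
Proof.
rewrite /dot /sqn rmorph_sum; apply: eq_bigr => i _; exact: mulz_conj.
Qed.

Lemma sqn_ge0 u s : 0 <= sqn u s.
Proof. by apply: sumr_ge0 => i _; rewrite addr_ge0// sqr_ge0. Qed.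

Lemma sqn_eq0 u s : sqn u s = 0 -> u s = 0.
Proof.
move=> /eqP; rewrite psumr_eq0 => [/allP H|i _]; last by rewrite addr_ge0// sqr_ge0.
apply/matrixP => i j; rewrite ord1 mxE.
have /= := H i (mem_index_enum i).
by rewrite paddr_eq0 ?sqr_ge0// !sqrf_eq0 => /andP[/eqP a /eqP b]; apply: complexP.
Qed.

(** A continuous function with integral of the square equal to 0 vanishes: the
    integral up to each x is squeezed to 0, and differentiation recovers the
    integrand. *)
Lemma inner_def u : mcont u -> inner u u = 0 -> forall x, 0 <= x <= 1 -> u x = 0.
Proof.
move=> cu; rewrite innerE => /(congr1 (@complex.Re R)) /= H x hx.
have cd := dot_cont cu cu.
apply: sqn_eq0; have : (sqn u x)%:C = 0 :> K; last by move=> [].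
rewrite -dot_self; apply: (cinteg0_cont cd) => // y /[dup] hy /andP[y0 y1].
have [ci _] := cintg_cont cd.
have ge0 s : 0 <= complex.Re (dot u u s) by rewrite dot_self sqn_ge0.
apply: complexP => /=; last first.
  rewrite (@integ_ext _ _ (fun=> 0)) ?integ_cst ?mul0r// => s _.
  by rewrite dot_self.
move: H; rewrite (integ_split ci (lexx 0) y0 y1 (lexx 1)) => /eqP.
rewrite paddr_eq0; first by case/andP => /eqP.
  by apply: integ_ge0.
by apply: integ_ge0.
Qed.

(** The matrix is real, so conjugation leaves it alone, and symmetry moves it
    to the other argument. *)
Lemma inner_real_sym (S : R -> 'M[R]_N) u v :
  (forall x, 0 <= x <= 1 -> (S x)^T = S x) ->
  inner (fun x => cmx (S x) *m u x) v = inner u (fun x => cmx (S x) *m v x).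
Proof.
move=> sS; rewrite !innerE; apply: cinteg_ext => s hs; rewrite /dot.
under eq_bigr => i _ do rewrite cmx_entry mulr_suml.
rewrite exchange_big; apply: eq_bigr => j _ /=.
rewrite cmx_entry rmorph_sum mulr_sumr; apply: eq_bigr => i _ /=.
rewrite rmorphM /= -{1}(sS s hs) mxE.
have -> : ((S s j i)%:C^* = (S s j i)%:C :> K)%R by apply: complexP => //=; rewrite oppr0.
ring.
Qed.

End InnerProduct.

Section Kernel.
Variables (R : realType) (N : nat) (P Q G : R -> 'M[R]_N) (C : R -> R -> 'M[R]_N)
  (R0 R1 : 'M[R]_(N + N)).
Local Notation mu := (@lebesgue_measure R).
Local Notation K := R[i].
Hypothesis (P_C1 : C1mx P) (Q_C1 : C1mx Q) (G_C1 : C1mx G).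
Hypothesis (P_unit : forall x, 0 <= x <= 1 -> P x \in unitmx).
Hypothesis (C_sym : forall t x, 0 <= t <= 1 -> 0 <= x <= 1 -> (C t x)^T = C t x).
Hypothesis (C_continuous : forall i j,
     {within (`[0, 1] `*` `[0, 1] : set (R * R)),
       continuous (fun tx : R * R => C tx.1 tx.2 i j)}).
Hypothesis (A0_sym : forall u gu y gy, opA0 P Q G R0 R1 u gu -> opA0 P Q G R0 R1 y gy ->
  inner gu y = inner u gy).

Local Notation cl := (clamp (0 : R) 1).
Local Notation sysmx := (sysmx P Q G C).
Local Notation parmx := (parmx R N).
Local Notation AA := (pencil sysmx parmx).
Local Notation sysmx0 := (sysmx0 P Q G).
Local Notation cm := (cm C).
Local Notation bdry_cond := (bdry_cond R0 R1).
Local Notation A0 := (opA0 P Q G R0 R1).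
Local Notation A_ t := (opA P Q G C R0 R1 t%:C).

Lemma A_cont : mcont (fun p : R * R => sysmx p.1 p.2).
Proof. exact: sysmx_cont. Qed.

Lemma mcont_dsub (w : R -> 'cV[K]_(N + N)) : mcont w -> mcont (fun x => dsubmx (w x)).
Proof. by move=> cw i j; apply: ccont_ext (cw (rshift N i) j) => x; rewrite !mxE. Qed.

Lemma cm_cont t : mcont (cm t).
Proof. exact: (mcont_slice (A := fun a b => cm a b) t (cm_cont2 C_continuous)). Qed.

Lemma AA_cont1 t lam : mcont (AA t lam).
Proof. exact: (pencil_cont1 _ A_cont). Qed.

Lemma mcont_L2 (v : R -> 'cV[K]_N) : mcont v -> L2 v.
Proof. by move=> cv i; apply: cwithin_cL2; exact: ccont_cwithin. Qed.

Lemma is_prim_ext n (h h' w : R -> 'cV[K]_n) : (forall s, 0 <= s <= 1 -> h s = h' s) ->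
  is_prim h w -> is_prim h' w.
Proof.
move=> hE H x hx i; rewrite (H x hx); congr (_ + _); apply: cinteg_ext => s /andP[s0 sx].
by rewrite hE// s0 (le_trans sx)//; case/andP: hx.
Qed.

Lemma is_prim_opA0 (f : R -> 'cV[K]_N) w : mcont w -> bdry_cond w -> mcont f ->
  is_prim (fun s => sysmx0 s *m w s - col_mx (f s) 0) w -> A0 (fun x => dsubmx (w x)) f.
Proof. by move=> cw bw cf; apply: opA0_bwd => //; exact: mcont_L2. Qed.

(** The equations say that A_0 v = - (C_t + lambda) v and
    A_0 vy = - (C_t + lambda') vy - u; equating (A_0 v, vy) with (v, A_0 vy)
    cancels C_t. *)
Lemma green t lam lam' (q w y : R -> 'cV[K]_(N + N)) : 0 <= t <= 1 ->
  mcont w -> mcont y -> mcont q -> bdry_cond w -> bdry_cond y ->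
  is_prim (fun s => AA t lam s *m w s) w ->
  is_prim (fun s => AA t lam' s *m y s + parmx *m q s) y ->
  let v x := dsubmx (w x) in let vy x := dsubmx (y x) in let u x := dsubmx (q x) in
  lam * inner v vy = lam'^* * inner v vy + inner v u.
Proof.
move=> ht cw cy cq bw by_ iw iy v vy u.
have cv : mcont v := mcont_dsub cw.
have cvy : mcont vy := mcont_dsub cy.
have cu : mcont u := mcont_dsub cq.
have ccm := cm_cont t.
have ccv : mcont (fun x => cm t x *m v x) by exact: mcont_mul.
have ccvy : mcont (fun x => cm t x *m vy x) by exact: mcont_mul.
have cl1 : mcont (fun x => lam *: v x) by apply: (mcontZ (f := fun=> lam)) => //; exact: ccont_cst.
have cl2 : mcont (fun x => lam' *: vy x) by apply: (mcontZ (f := fun=> lam')) => //; exact: ccont_cst.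
pose f x := -1 *: (cm t x *m v x + lam *: v x).
pose h x := -1 *: (cm t x *m vy x + lam' *: vy x + u x).
have cf1 : mcont (fun x => cm t x *m v x + lam *: v x) by exact: mcontD.
have ch0 : mcont (fun x => cm t x *m vy x + lam' *: vy x) by exact: mcontD.
have ch1 : mcont (fun x => cm t x *m vy x + lam' *: vy x + u x) by exact: mcontD.
have cf : mcont f by apply: (mcontZ (f := fun=> -1)) => //; exact: ccont_cst.
have ch : mcont h by apply: (mcontZ (f := fun=> -1)) => //; exact: ccont_cst.
have a1 : A0 v f.
  apply: is_prim_opA0 => //; apply: is_prim_ext iw => s hs.
  by rewrite AA_mul /f -scaleN1r scale_col_mx scalerA mulrNN mulr1 scale1r scaler0.
have a2 : A0 vy h.
  apply: is_prim_opA0 => //; apply: is_prim_ext iy => s hs.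
  rewrite AA_mul /h -scaleN1r scale_col_mx scalerA mulrNN mulr1 scale1r scaler0 -addrA; congr (_ + _).
  rewrite -[q s]vsubmxK /parmx mul_block_col !mul0mx mul1mx add0r addr0 add_col_mx addr0.
  by [].
have := A0_sym a1 a2; rewrite /f /h.
rewrite (innerZ (-1) cf1 cvy) (innerZr (-1) cv ch1) (innerD ccv cl1 cvy) (innerZ lam cv cvy).
rewrite (innerDr cv ch0 cu) (innerDr cv ccvy cl2) (innerZr lam' cv cvy) rmorphN1.
have -> : inner (fun x => cm t x *m v x) vy = inner v (fun x => cm t x *m vy x).
  by apply: inner_real_sym => x hx; rewrite C_sym// clampP.
by move=> e; apply/eqP; move/eqP: e; rewrite !mulN1r eqr_opp -addrA (inj_eq (addrI _)).
Qed.

Lemma green0 t lam lam' (w y : R -> 'cV[K]_(N + N)) : 0 <= t <= 1 ->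
  mcont w -> mcont y -> bdry_cond w -> bdry_cond y ->
  is_prim (fun s => AA t lam s *m w s) w -> is_prim (fun s => AA t lam' s *m y s) y ->
  let v x := dsubmx (w x) in let vy x := dsubmx (y x) in
  lam * inner v vy = lam'^* * inner v vy.
Proof.
move=> ht cw cy bw by_ iw iy v vy.
have iy' : is_prim (fun s => AA t lam' s *m y s + parmx *m (fun=> 0) s) y.
  by apply: is_prim_ext iy => s _; rewrite mulmx0 addr0.
rewrite (green ht cw cy (mcont_cst _) bw by_ iw iy') /= -[RHS]addr0; congr (_ + _).
rewrite innerE (@cinteg_ext _ _ (fun=> 0)); last first.
  by move=> s _; rewrite /dot big1// => i _; rewrite !mxE rmorph0 mulr0.
by rewrite /cinteg !integ_cst//= !mul0r.
Qed.

(** If u = 0, the second half of the system reads P^-1 w1 = 0. *)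
Lemma dsub0_zero t lam (w : R -> 'cV[K]_(N + N)) : mcont w ->
  is_prim (fun s => AA t lam s *m w s) w -> (forall x, 0 <= x <= 1 -> dsubmx (w x) = 0) ->
  w 0 = 0.
Proof.
move=> cw iw d0.
have i00 : 0 <= (0 : R) <= 1 by rewrite lexx ler01.
have cpw : mcont (fun s => pm P s *m usubmx (w s)).
  apply: mcont_mul; first exact: pm_cont.
  by move=> i j; apply: ccont_ext (cw (lshift N i) j) => x; rewrite !mxE.
have e s : 0 <= s <= 1 -> sysmx0 s *m w s = col_mx ((qm Q s)^T *m pm P s *m usubmx (w s)) (pm P s *m usubmx (w s)).
  by move=> hs; rewrite -{1}[w s]vsubmxK d0// mul_block_col !mulmx0 !addr0.
have z i : forall x, 0 <= x <= 1 -> (pm P x *m usubmx (w x)) i 0 = 0.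
  apply: cinteg0_cont; first exact: cpw.
  move=> y hy; have := iw y hy (rshift N i).
  have w0 x : 0 <= x <= 1 -> w x (rshift N i) 0 = 0.
    by move=> hx; have := d0 x hx => /matrixP/(_ i 0); rewrite !mxE.
  rewrite !w0// add0r => ->; apply: cinteg_ext => s /andP[s0 sy].
  have hs : 0 <= s <= 1 by rewrite s0 (le_trans sy)//; case/andP: hy.
  by rewrite AA_mul e// d0// mulmx0 scaler0 addr0 col_mx0 addr0 col_mxEd.
have u0 : usubmx (w 0) = 0.
  have : pm P 0 *m usubmx (w 0) = 0 by apply/matrixP => i j; rewrite ord1 z// mxE.
  move=> /(congr1 (mulmx (cmx (P 0)))); rewrite mulmxA Ppm// mul1mx mulmx0.
  by [].
by rewrite -[w 0]vsubmxK u0 d0// col_mx0.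
Qed.

Lemma ker_dsub t (lam : K) (w : R -> 'cV[K]_(N + N)) : mcont w ->
  is_prim (fun s => AA t lam s *m w s) w ->
  inner (fun x => dsubmx (w x)) (fun x => dsubmx (w x)) = 0 -> w 0 = 0.
Proof.
by move=> cw iw /(inner_def (mcont_dsub cw)) d0; exact: (dsub0_zero cw iw d0).
Qed.

(** Green's formula for w and itself shows that lambda - lambda^* annihilates
    the squared norm of u. *)
Lemma ker_real t lam (w : R -> 'cV[K]_(N + N)) : 0 <= t <= 1 -> mcont w -> bdry_cond w ->
  is_prim (fun s => AA t lam s *m w s) w -> complex.Im lam != 0 -> w 0 = 0.
Proof.
move=> ht cw bw iw lam0; apply: (ker_dsub cw iw).
have := green0 ht cw cw bw bw iw iw => /eqP.
rewrite -subr_eq0 -mulrBl mulf_eq0 => /orP[|/eqP//].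
move=> /eqP/(congr1 (@complex.Im R)); rewrite cImD cImN; case: (lam) lam0 => a b /= b0 /eqP.
by rewrite opprK -mulr2n mulrn_eq0 (negbTE b0).
Qed.

(** Green's formula for w and y, the parameters being real, leaves the factor
    r - r' in front of the inner product. *)
Lemma ker_orth t r r' (w y : R -> 'cV[K]_(N + N)) : 0 <= t <= 1 -> mcont w -> mcont y ->
  bdry_cond w -> bdry_cond y -> is_prim (fun s => AA t r%:C s *m w s) w -> is_prim (fun s => AA t r'%:C s *m y s) y ->
  r != r' -> inner (fun x => dsubmx (w x)) (fun x => dsubmx (y x)) = 0.
Proof.
move=> ht cw cy bw by_ iw iy rr'.
have := green0 ht cw cy bw by_ iw iy.
have -> : (r'%:C^* = r'%:C :> K)%R by apply: complexP => //=; rewrite oppr0.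
move/eqP; rewrite -subr_eq0 -mulrBl mulf_eq0 => /orP[|/eqP//].
by rewrite -rmorphB => /eqP[] /eqP; rewrite subr_eq0 (negbTE rr').
Qed.

(** By Green's formula with lambda = lambda' = r the function u is orthogonal
    to itself: the geometric and algebraic multiplicities agree. *)
Lemma nondegen_sysmx t r : 0 <= t <= 1 -> nondegen sysmx parmx (cmx R0) (cmx R1) t r.
Proof.
move=> ht u y cu cy iu bu iy by_; apply: (ker_dsub cu iu).
have := green ht cu cy cu bu by_ iu iy; rewrite /=.
have -> : (r%:C^* = r%:C :> K)%R by apply: complexP => //=; rewrite oppr0.
by move=> /eqP; rewrite -subr_eq0 opprD addrA subrr sub0r oppr_eq0 => /eqP.
Qed.

Lemma Cz_real t x : 0 <= t <= 1 -> 0 <= x <= 1 -> Cz C t%:C x = cm t x.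
Proof.
move=> ht hx; rewrite /Cz /cm !clamp_id//=.
have -> : (((0 : R) +i* (0 : R))%:M : 'M[K]_N) = 0 by apply: raddf0.
by rewrite addr0.
Qed.

Lemma L2_lin (f v : R -> 'cV[K]_N) : L2 f -> mcont v -> L2 (fun x => f x + v x).
Proof.
move=> Lf cv i.
have h : cL2 (fun x => f x i 0 + v x i 0).
  by apply: cL2D; [exact: Lf|exact: (mcont_L2 cv i)].
rewrite (_ : (fun x => complex.Re ((f x + v x) i 0)) = fun x => complex.Re (f x i 0 + v x i 0)).
  rewrite (_ : (fun x => complex.Im ((f x + v x) i 0)) = fun x => complex.Im (f x i 0 + v x i 0)) //.
  by apply/funext => x; rewrite mxDE.
by apply/funext => x; rewrite mxDE.
Qed.

Lemma zmod_cancel (V : zmodType) (g c l : V) : - g = c - l - (g + c - l).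
Proof. by rewrite opprB addrA subrK opprD [- g - c]addrC addrA subrr add0r. Qed.

(** Note the sign: A_t - lambda corresponds to the pencil at - lambda. *)
Lemma shift_fwd t lam v f : 0 <= t <= 1 -> L2 f -> shift_op (A_ t) lam v f ->
  exists w : R -> 'cV[K]_(N + N), [/\ mcont w, bdry_cond w, aeeq v (fun x => dsubmx (w x)) &
    is_prim (fun s => AA t (- lam) s *m w s - col_mx (f s) 0) w].
Proof.
move=> ht Lf [g [Lg [g0 Ag0 gE]] fE].
have Lg0 : L2 g0 by case: Ag0.
have [w [cw bw vw iw]] := opA0_fwd P_C1 Q_C1 G_C1 P_unit Ag0.
exists w; split; [exact: cw|exact: bw|exact: vw|].
move=> x hx i; rewrite (iw x hx); congr (_ + _).
apply: cinteg_ae => //.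
- apply: cL2_cintg; apply: force_cL2 => //; apply: mcont_mul => //; exact: sysmx0_cont.
- apply: cL2_cintg; apply: force_cL2 => //; apply: mcont_mul => //; exact: AA_cont1.
apply: aeS (aeI (aeI vw gE) fE) => y [[h1 h2] h3] hy.
congr (fun_of_matrix _ i 0); rewrite AA_mul -addrA (h3 hy) (h2 hy) Cz_real// (h1 hy).
congr (_ + _); rewrite !opp_col_mx add_col_mx oppr0 addr0 scaleNr; congr col_mx.
exact: zmod_cancel.
Qed.

Lemma shift_bwd t lam (w : R -> 'cV[K]_(N + N)) f : 0 <= t <= 1 -> L2 f -> mcont w -> bdry_cond w ->
  is_prim (fun s => AA t (- lam) s *m w s - col_mx (f s) 0) w ->
  shift_op (A_ t) lam (fun x => dsubmx (w x)) f.
Proof.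
move=> ht Lf cw bw iw.
pose v x := dsubmx (w x); have cv : mcont v := mcont_dsub cw.
have clv : mcont (fun x => lam *: v x).
  by apply: (mcontZ (f := fun=> lam)) => //; exact: ccont_cst.
have ccv : mcont (fun x => cm t x *m v x) by apply: mcont_mul => //; exact: cm_cont.
exists (fun x => f x + lam *: v x); last first.
  by apply: aeW => x _; rewrite addrK.
split; first exact: L2_lin.
exists (fun x => f x + (lam *: v x - cm t x *m v x)); last first.
  by apply: aeW => x hx; rewrite Cz_real// addrA subrK.
apply: opA0_bwd => //.
  by apply: L2_lin => //; apply: mcontD => //; exact: mcontN.
apply: is_prim_ext iw => s hs; rewrite AA_mul -addrA; congr (_ + _).
rewrite !opp_col_mx add_col_mx !oppr0 addr0 scaleNr; congr col_mx.
by rewrite opprD opprB [RHS]addrC.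
Qed.

Local Notation M t lam := (bdmx parmx (cmx R0) (cmx R1) A_cont t lam).
Local Notation F := (chi parmx (cmx R0) (cmx R1) A_cont).
Local Notation Y := (fundmx parmx A_cont).

Lemma ker_bdry_cond t lam (v : 'cV[K]_(N + N)) : M t lam *m v = 0 <-> bdry_cond (fun x => Y t lam x *m v).
Proof. by rewrite /bdry_cond fundmx0 mul1mx /bdmx mulmxDl mulmxA. Qed.

Lemma Yv_cont t lam (v : 'cV[K]_(N + N)) : mcont (fun x => Y t lam x *m v).
Proof. by apply: mcont_mul; [exact: fundmx_cont|exact: mcont_cst]. Qed.

Lemma det_ker n (A : 'M[K]_n) : \det A = 0 -> exists2 v : 'cV_n, v != 0 & A *m v = 0.
Proof.
move=> /eqP dA; apply: contrapT => H.
have : A \in unitmx.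
  apply: unitmx_inj => v Av; apply: contrapT => /eqP v0; apply: H; by exists v.
by rewrite unitmxE (eqP dA) unitr0.
Qed.

Lemma chi_neq0 t r s : 0 <= t <= 1 -> s != 0 -> F t r s != 0.
Proof.
move=> ht s0; apply/eqP => /det_ker[v v0 Mv].
move/eqP: v0; apply; have /ker_bdry_cond bv := Mv.
by have := ker_real ht (Yv_cont _ _ v) bv (@fundmx_mul _ _ _ parmx A_cont t (r +i* s) v) s0; rewrite fundmx0 mul1mx.
Qed.

Lemma chi_isolated_zero t r : 0 <= t <= 1 ->
  exists2 d : R, 0 < d & forall x, `|x - r| < d -> x != r -> F t x 0 != 0.
Proof. by move=> ht; apply: chi_isolated; exact: nondegen_sysmx. Qed.

(** The dimension of the kernel of A_t + r. *)
Definition mult t r := (N + N - \rank (M t r%:C))%N.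

Lemma chi_local_index t r : 0 <= t <= 1 -> local_index (F t) (r, 0) (mult t r)%:Z.
Proof. by move=> ht; apply: local_index_chi; exact: nondegen_sysmx. Qed.

Lemma eig_fwd t r u : 0 <= t <= 1 -> Defs.eigenspace (A_ t) (- r) u ->
  exists2 v, M t r%:C *m v = 0 & aeeq u (fun x => dsubmx (Y t r%:C x *m v)).
Proof.
move=> ht /(shift_fwd ht (mcont_L2 (mcont_cst _)))[w [cw bw uw iw]].
have iw' : is_prim (fun s => AA t r%:C s *m w s) w.
  by apply: is_prim_ext iw => s _; rewrite rmorphN opprK col_mx0 subr0.
have wE := fundmx_sol A_cont cw iw'.
exists (w 0).
  apply/ker_bdry_cond; move: bw; rewrite /bdry_cond [w 1]wE ?i01_1// => bw.
  by rewrite fundmx0 mul1mx.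
by apply: aeS uw => x H hx; rewrite H// -wE.
Qed.

Lemma eig_bwd t r v : 0 <= t <= 1 -> M t r%:C *m v = 0 ->
  Defs.eigenspace (A_ t) (- r) (fun x => dsubmx (Y t r%:C x *m v)).
Proof.
move=> ht /ker_bdry_cond bv; apply: (shift_bwd ht (mcont_L2 (mcont_cst _)) (Yv_cont _ _ v) bv).
apply: is_prim_ext (@fundmx_mul _ _ _ parmx A_cont t r%:C v) => s _.
by rewrite rmorphN opprK col_mx0 subr0.
Qed.

Lemma eig_zero t r v : M t r%:C *m v = 0 ->
  aeeq (fun x => dsubmx (Y t r%:C x *m v)) (fun=> 0) -> v = 0.
Proof.
move=> Mv z.
have : forall x, 0 <= x <= 1 -> dsubmx (Y t r%:C x *m v) = 0.
  move=> x hx; apply/matrixP => i j; rewrite ord1 mxE [RHS]mxE.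
  have := @ae_cont0 R (fun x => (Y t r%:C x *m v) (rshift N i) 0) (Yv_cont t _ v _ _) _ x hx.
  apply; apply: aeS z => y H hy.
  by have /matrixP/(_ i 0) := H hy; rewrite !mxE.
move=> /(dsub0_zero (Yv_cont t _ v) (@fundmx_mul _ _ _ parmx A_cont t r%:C v)).
by rewrite fundmx0 mul1mx.
Qed.

(** A nonzero vector in the kernel of the boundary matrix gives an
    eigenfunction, against the uniqueness of the solution for the right-hand side 0. *)
Lemma resolvent_chi t c : 0 <= t <= 1 -> resolvent_set (A_ t) c%:C -> F t (- c) 0 != 0.
Proof.
move=> ht [B H]; apply/eqP => /det_ker[v v0 Mv]; move/eqP: v0; apply.
have hE : (- c) +i* 0 = (- c)%:C :> K by [].
rewrite hE in Mv.
apply: (eig_zero Mv).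
have [u [_ uU _]] := H (fun=> 0) (mcont_L2 (mcont_cst _)).
have h1 := eig_bwd ht Mv; rewrite /Defs.eigenspace /= opprK in h1.
have h0 : shift_op (A_ t) c%:C (fun=> 0) (fun=> 0).
  have := @eig_bwd t (- c) 0 ht; rewrite mulmx0 => /(_ erefl).
  rewrite /Defs.eigenspace /= opprK.
  rewrite (_ : (fun x => dsubmx (Y t (- c)%:C x *m 0)) = fun=> 0) //.
  by apply/funext => x; rewrite mulmx0 linear0.
apply: aeS (aeI (uU _ h1) (uU _ h0)) => x [e1 e2] hx.
by rewrite e1// -e2.
Qed.

(** Cauchy-Schwarz against the constant 1, from int (|f| - a)^2 >= 0 with
    a = int |f|. *)
Lemma int_sqr_bound (f : R -> R) x : L2r f -> 0 <= x <= 1 ->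
  integ (fun s => `|f s|) 0 x <= Num.sqrt (integ (fun s => f s ^+ 2) 0 1).
Proof.
move=> Lf hx; have fi := L2_intg Lf; have ai := intg_norm fi.
have qi : intg (fun s => f s ^+ 2) by have [_] := Lf.
case/andP: (hx) => x0 x1.
pose a := integ (fun s => `|f s|) 0 1.
apply: (@le_trans _ _ a).
  rewrite /a (integ_split ai (lexx 0) x0 x1 (lexx 1)) lerDl.
  by apply: integ_ge0.
have a0 : 0 <= a by apply: integ_ge0.
rewrite -[a]ger0_norm// -sqrtr_sqr ler_wsqrtr//.
have i0 : 0 <= integ (fun s => f s ^+ 2 + (- (2 * a) * `|f s| + a ^+ 2)) 0 1.
  apply: integ_ge0 => s _; rewrite -[f s ^+ 2]real_normK ?num_real//.
  have -> : `|f s| ^+ 2 + (- (2 * a) * `|f s| + a ^+ 2) = (`|f s| - a) ^+ 2 by ring.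
  exact: sqr_ge0.
have ci : intg (fun=> a ^+ 2 : R) by apply: intg_contT => z; exact: cvg_cst.
have bi : intg (fun s => - (2 * a) * `|f s|) by exact: intgZ.
move: i0; rewrite integ_D//; last exact: intgD.
rewrite integ_D// integ_Z// integ_cst// -/a subr0 mulr1.
by move: (integ _ 0 1) => I; rewrite (_ : I + _ = I - a ^+ 2); [rewrite subr_ge0|ring].
Qed.

Lemma inner_sqn (u : R -> 'cV[K]_N) : L2 u -> complex.Re (inner u u) = integ (fun s => sqn u s) 0 1.
Proof.
by move=> Lu; rewrite innerE /cinteg /=; apply: integ_ext => s _; rewrite dot_self.
Qed.

Lemma L2_sqr (u : R -> 'cV[K]_N) i : L2 u ->
  intg (fun s => complex.Re (u s i 0) ^+ 2) /\ intg (fun s => complex.Im (u s i 0) ^+ 2).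
Proof. by move=> /(_ i)[[_ h1] [_ h2]]. Qed.

Lemma norm2_cinteg (f : R -> 'cV[K]_N) i x : L2 f -> 0 <= x <= 1 ->
  norm1 (cinteg (fun s => f s i 0) x) <= 2 * norm2 f.
Proof.
move=> Lf hx; have [l1 l2] := Lf i; case/andP: (hx) => x0 x1.
have sqi j := L2_sqr j Lf.
have si : intg (fun s => sqn f s).
  by apply: intg_sum => j _; apply: intgD; apply sqi.
have key g : L2r g -> (forall s, g s ^+ 2 <= sqn f s) -> `|integ g 0 x| <= norm2 f.
  move=> Lg gs; apply: le_trans (integ_norm (lexx 0) x1 (L2_intg Lg)) _.
  apply: le_trans (int_sqr_bound Lg hx) _.
  rewrite /norm2 inner_sqn// ler_wsqrtr//; apply: integ_le => //.
  by have [_] := Lg.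
have le1 s j : complex.Re (f s j 0) ^+ 2 + complex.Im (f s j 0) ^+ 2 <= sqn f s.
  rewrite /sqn (bigD1 j)//= lerDl; apply: sumr_ge0 => k _.
  by rewrite addr_ge0// sqr_ge0.
rewrite /norm1 /= [2 * _]mulr_natl mulr2n; apply: lerD; apply: key => // s; apply: le_trans (le1 s i).
  by rewrite lerDl sqr_ge0.
by rewrite lerDr sqr_ge0.
Qed.

Lemma norm1_sqr (z : K) b : norm1 z <= b ->
  complex.Re z ^+ 2 + complex.Im z ^+ 2 <= b ^+ 2 + b ^+ 2.
Proof.
move=> zb; have b0 : 0 <= b by apply: le_trans zb; exact: norm1_ge0.
apply: lerD; rewrite -real_normK ?num_real// lerXn2r ?nnegrE//;
  by apply: le_trans zb; rewrite ?lerDl ?lerDr normr_ge0.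
Qed.

Lemma sqrt_le (x y : R) : 0 <= y -> x <= y ^+ 2 -> Num.sqrt x <= y.
Proof. by move=> y0 h; rewrite -[y]ger0_norm// -sqrtr_sqr ler_wsqrtr. Qed.

Lemma force_cintg t lam (w : R -> 'cV[K]_(N + N)) f i : mcont w -> L2 f ->
  cintg (fun s => (AA t lam s *m w s - col_mx (f s) 0) i 0).
Proof.
move=> cw Lf; apply: cL2_cintg; apply: (@force_cL2 R N (fun s => AA t lam s *m w s)) => //.
by apply: mcont_mul => //; exact: AA_cont1.
Qed.

Lemma shift_uniq t l (w w' : R -> 'cV[K]_(N + N)) f : M t l \in unitmx -> L2 f ->
  mcont w -> mcont w' -> bdry_cond w -> bdry_cond w' ->
  is_prim (fun s => AA t l s *m w s - col_mx (f s) 0) w ->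
  is_prim (fun s => AA t l s *m w' s - col_mx (f s) 0) w' ->
  forall x, 0 <= x <= 1 -> w x = w' x.
Proof.
move=> Mu Lf cw cw' bw bw' iw iw'.
have iz : is_prim (fun s => AA t l s *m (w s - w' s)) (fun x => w x - w' x).
  move=> x hx i; rewrite !mxBE.
  rewrite [in LHS](iw x hx i) [in LHS](iw' x hx i) opprD addrACA; congr (_ + _).
  have i1 := force_cintg t l i cw Lf; have i2 := force_cintg t l i cw' Lf.
  rewrite -(cinteg_N hx i2) -(cinteg_D hx i1 (cintgN i2)).
  by apply: cinteg_ext => s _; rewrite mulmxBr !mxBE opprB addrA subrK.
have cz : mcont (fun x => w x - w' x) by apply: mcontD => //; exact: mcontN.
have zE := fundmx_sol A_cont cz iz.
have z0 : w 0 - w' 0 = 0.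
  have : M t l *m (w 0 - w' 0) = 0.
    rewrite /bdmx mulmxDl -mulmxA -(zE 1 (i01_1 R)) !mulmxBr addrACA -opprD.
    by move: bw bw'; rewrite /bdry_cond => -> ->; rewrite subrr.
  by move=> /(congr1 (mulmx (invmx (M t l)))); rewrite mulmxA mulVmx// mul1mx mulmx0.
by move=> x hx; apply/eqP; rewrite -subr_eq0 (zE x hx) z0 mulmx0.
Qed.

(** Add to the solution of the inhomogeneous system that starts at 0 the
    homogeneous solution that corrects its boundary values; this is possible
    because the boundary matrix is invertible. Gronwall's inequality and
    Cauchy-Schwarz bound it by the norm of f. *)
Lemma chi_resolvent t c : 0 <= t <= 1 -> F t (- c) 0 != 0 -> resolvent_set (A_ t) c%:C.
Proof.
move=> ht Fc.
set l := - c%:C : K.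
have lE : (- c)%:C = l by rewrite rmorphN.
have Mu : M t l \in unitmx by rewrite unitmxE -lE unitfE.
have cAl := AA_cont1 t l.
have [Kb Kb0 hKb] := mx_bounded cAl.
have [Yb Yb0 hYb] := mx_bounded (fundmx_cont parmx A_cont t l).
pose e := 2 * expR (2 * Kb) : R.
have e0 : 0 < e by rewrite mulr_gt0// expR_gt0.
pose D := invmx (M t l) *m cmx R1.
pose Db := \sum_i \sum_k norm1 (D i k).
have Db0 : 0 <= Db by apply: sumr_ge0 => i _; apply: sumr_ge0 => k _; exact: norm1_ge0.
pose B := (e * 2 + Yb * (Db * (e * 2))) * (N%:R * 2 + 1).
exists B => f Lf.
have Lcol i : cL2 (fun s => col_mx (f s) (0 : 'cV[K]_N) i 0).
  have := force_cL2 i (mcont_cst (0 : 'cV[K]_(N + N))) Lf => /cL2N.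
  rewrite (_ : (fun x => - _) = fun s => col_mx (f s) (0 : 'cV[K]_N) i 0)//.
  by apply/funext => s; rewrite mxBE [X in X - _]mxE sub0r opprK.
pose h x : 'cV[K]_(N + N) := \matrix_(i, j) - cinteg (fun s => col_mx (f s) (0 : 'cV[K]_N) i 0) (cl x).
have ch : mcont h.
  move=> i j; apply: (@ccont_ext _ _ (fun x => - cinteg (fun s => col_mx (f s) (0 : 'cV[K]_N) i 0) (cl x))).
    by move=> x; rewrite mxE.
  by apply: ccontN; apply: cinteg_cont; exact: cL2_cintg.
have [wp cwp vwp] := volterra_exists cAl ch.
have i00 : 0 <= (0 : R) <= 1 by rewrite lexx ler01.
have h0 : h 0 = 0 by apply/matrixP => i j; rewrite !mxE clamp_id// cinteg_0 oppr0.
have wp0 : wp 0 = 0.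
  by apply/matrixP => i j; rewrite (vwp 0 i00) h0 cinteg_0 addr0.
(* The boundary form of wp is R1 wp(1), and v is chosen to cancel it. *)
pose v := - (D *m wp 1).
pose w x := wp x + Y t l x *m v.
have cYv := Yv_cont t l v.
have cw : mcont w by exact: mcontD.
have cAw (z : R -> 'cV[K]_(N + N)) : mcont z -> mcont (fun s => AA t l s *m z s).
  by move=> cz; exact: mcont_mul.
have iw : is_prim (fun s => AA t l s *m w s - col_mx (f s) 0) w.
  have iY := @fundmx_mul _ _ _ parmx A_cont t l v.
  move=> x hx i; rewrite /w mxDE (vwp x hx) (iY x hx) mxDE wp0 [X in _ = X + _ + _]mxE add0r.
  have -> : cinteg (fun s => (AA t l s *m (wp s + Y t l s *m v) - col_mx (f s) 0) i 0) x =
      cinteg (fun s => (AA t l s *m wp s) i 0) x + (cinteg (fun s => (AA t l s *m (Y t l s *m v)) i 0) x +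
       (- cinteg (fun s => col_mx (f s) (0 : 'cV[K]_N) i 0) x)).
    rewrite -cinteg_N//; last exact: cL2_cintg.
    rewrite -cinteg_D//; [|by apply: cintg_cont; exact: cAw|by apply: cL2_cintg; exact: cL2N].
    rewrite -cinteg_D//; [|by apply: cintg_cont; exact: cAw|]; last first.
      apply: cintgD; first by apply: cintg_cont; exact: cAw.
      by apply: cL2_cintg; exact: cL2N.
    by apply: cinteg_ext => s _; rewrite mulmxDr mxBE mxDE addrA.
  rewrite /h mxE clamp_id//; ring.
have bw : bdry_cond w.
  rewrite /bdry_cond /w wp0 add0r fundmx0 mul1mx mulmxDr addrCA mulmxA -mulmxDl -/(M t l).
  by rewrite /v mulmxN /D !mulmxA mulmxV// mul1mx addrN.
have sh : shift_op (A_ t) c%:C (fun x => dsubmx (w x)) f by exact: shift_bwd.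
exists (fun x => dsubmx (w x)); split => //.
  move=> u /(shift_fwd ht Lf)[w' [cw' bw' uw' iw']].
  have iw2 : is_prim (fun s => AA t (- c%:C) s *m w s - col_mx (f s) 0) w by [].
  have wE := shift_uniq Mu Lf cw' cw bw' bw iw' iw2.
  by apply: aeS uw' => x H hx; rewrite H// wE.
set nf := norm2 f.
have nf0 : 0 <= nf by exact: sqrtr_ge0.
have hh x : 0 <= x <= 1 -> forall i j, norm1 (h x i j) <= 2 * nf.
  move=> hx i j; rewrite mxE clamp_id// norm1N; case: (split_ordP i) => k ->.
    rewrite (@cinteg_ext _ _ (fun s => f s k 0)); first exact: norm2_cinteg.
    by move=> s _; rewrite col_mxEu.
  rewrite (@cinteg_ext _ _ (fun=> 0)); last by move=> s _; rewrite col_mxEd mxE.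
  case/andP: hx => x0 _; rewrite /cinteg !integ_cst//= !mul0r norm1_0.
  by rewrite mulr_ge0.
have wpb x : 0 <= x <= 1 -> forall i j, norm1 (wp x i j) <= e * 2 * nf.
  move=> hx i j; apply: le_trans (volterra_bound cAl cwp Kb0 hKb vwp hh hx i j) _.
  rewrite /e (_ : 2 * expR (2 * Kb) * 2 * nf = 2 * (2 * nf) * expR (2 * Kb)); last by ring.
  rewrite ler_wpM2l ?mulr_ge0// ler_expR ler_piMr ?mulr_ge0 ?(ltW Kb0)//.
  by case/andP: hx.
have enf : 0 <= e * 2 * nf by rewrite !mulr_ge0// ltW.
have vb k : norm1 (v k 0) <= Db * (e * 2 * nf).
  rewrite mxE norm1N; apply: norm1_mulmx => //; last by move=> j; exact: wpb (i01_1 R) j 0.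
  rewrite /Db [X in _ <= X](bigD1 k)//= lerDl; apply: sumr_ge0 => j _; apply: sumr_ge0 => m _; exact: norm1_ge0.
have wb x : 0 <= x <= 1 -> forall i, norm1 (w x i 0) <= (e * 2 + Yb * (Db * (e * 2))) * nf.
  move=> hx i; rewrite /w mxDE; apply: le_trans (norm1D _ _) _.
  rewrite mulrDl; apply: lerD; first exact: wpb.
  rewrite (_ : Yb * (Db * (e * 2)) * nf = Yb * (Db * (e * 2 * nf))); last by ring.
  by apply: norm1_mulmx; [exact: hYb|exact: mulr_ge0|exact: vb].
set b := (e * 2 + Yb * (Db * (e * 2))) * nf in wb.
have b0 : 0 <= b.
  by rewrite mulr_ge0// addr_ge0// !mulr_ge0// ltW.
have Lw : L2 (fun x => dsubmx (w x)) by apply: mcont_L2; exact: mcont_dsub.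
have sb s : 0 <= s <= 1 -> sqn (fun x => dsubmx (w x)) s <= N%:R * 2 * b ^+ 2.
  move=> hs; rewrite /sqn -[N in N%:R]card_ord -sum1_card natr_sum -mulrA mulr_suml.
  apply: ler_sum => i _; rewrite mul1r [2 * _]mulr_natl mulr2n.
  have wbi : norm1 (dsubmx (w s) i 0) <= b by rewrite [dsubmx _ _ _]mxE; exact: wb.
  exact: norm1_sqr.
have cs : intg (fun s => sqn (fun x => dsubmx (w x)) s).
  by apply: intg_sum => j _; apply: intgD; apply (L2_sqr j Lw).
rewrite {1}/norm2 inner_sqn//.
rewrite (_ : B * nf = (N%:R * 2 + 1) * b); last by rewrite /B /b; ring.
apply: sqrt_le; first by rewrite mulr_ge0// addr_ge0// mulr_ge0.
apply: (@le_trans _ _ (integ (fun=> N%:R * 2 * b ^+ 2) 0 1)).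
  by apply: integ_le => //; apply: intg_contT => z; exact: cvg_cst.
rewrite integ_cst// subr0 mulr1 [X in _ <= X]exprMn ler_wpM2r ?sqr_ge0//.
have : 0 <= N%:R :> R by [].
move: (N%:R : R) => x x0; rewrite -subr_ge0 (_ : _ - _ = 4 * x ^+ 2 + 2 * x + 1); last by ring.
by rewrite !addr_ge0// mulr_ge0// sqr_ge0.
Qed.

End Kernel.

(** * Dimension of spectral subspaces *)

Section Dimension.
Variables (R : realType) (N : nat).
Local Notation mu := (@lebesgue_measure R).
Local Notation K := R[i].
Local Notation vfun := (R -> 'cV[K]_N).
Implicit Types (u : vfun) (S : set vfun).

Lemma sum_enum (T : finType) (V : nmodType) (f : 'I_#|T| -> V) :
  \sum_i f i = \sum_(p : T) f (enum_rank p).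
Proof. by rewrite (reindex (@enum_rank T))//; exact/onW_bij/enum_rank_bij. Qed.

Lemma ae_fin (T : finType) (Q : T -> R -> Prop) : (forall j, {ae mu, forall x, Q j x}) ->
  {ae mu, forall x, forall j, Q j x}.
Proof.
move=> H; have := ae_ord (fun i : 'I_#|T| => H (enum_val i)).
by apply: aeS => x Hx j; rewrite -(enum_rankK j).
Qed.

Lemma has_dim_fin S (T : finType) (b : T -> vfun) : (forall j, S (b j)) ->
  (forall k : T -> K, aeeq (fun x => \sum_j k j *: b j x) (fun=> 0) -> forall j, k j = 0) ->
  (forall u, S u -> exists k : T -> K, aeeq u (fun x => \sum_j k j *: b j x)) ->
  has_dim S #|T|.
Proof.
move=> h1 h2 h3; exists (fun i => b (enum_val i)); split => //.
- move=> k hk j; rewrite -[j]enum_valK; apply: (h2 (fun p => k (enum_rank p))).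
  apply: aeS hk => x H hx; rewrite -[RHS](H hx).
  by rewrite sum_enum; apply: eq_bigr => p _; rewrite enum_rankK.
- move=> u /h3[k hk]; exists (fun i => k (enum_val i)).
  apply: aeS hk => x H hx; rewrite (H hx).
  by rewrite sum_enum; apply: eq_bigr => p _; rewrite enum_rankK.
Qed.

(** Expanding an independent family in a generating one gives a matrix with
    trivial left kernel. *)
Lemma has_dim_le S n m (b : 'I_n -> vfun) (c : 'I_m -> vfun) : (forall j, S (b j)) ->
  (forall k : 'I_n -> K, aeeq (fun x => \sum_j k j *: b j x) (fun=> 0) -> forall j, k j = 0) ->
  (forall u, S u -> exists k : 'I_m -> K, aeeq u (fun x => \sum_j k j *: c j x)) ->
  (n <= m)%N.
Proof.
move=> Sb indep span.
have [A hA] := choice (fun i => span _ (Sb i)).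
pose M : 'M[K]_(n, m) := \matrix_(i, j) A i j.
suff /eqP <- : row_free M by exact: rank_leq_col.
rewrite -kermx_eq0; apply/eqP/row_matrixP => i; rewrite row0.
apply/rowP => j; rewrite [RHS]mxE.
apply: (indep (fun j => row i (kermx M) 0 j)).
have H := ae_fin hA; apply: aeS H => x H hx.
under eq_bigr => l _ do rewrite (H l hx) scaler_sumr.
rewrite exchange_big big1// => l _.
under eq_bigr => p _ do rewrite scalerA.
rewrite -scaler_suml (_ : \sum_i0 _ = (row i (kermx M) *m M) 0 l).
  by rewrite -row_mul mulmx_ker row0 mxE scale0r.
by rewrite [RHS]mxE; apply: eq_bigr => p _; rewrite [M p l]mxE.
Qed.

Lemma has_dim_uniq S n m : has_dim S n -> has_dim S m -> n = m.
Proof.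
move=> [b [b1 b2 b3]] [c [c1 c2 c3]]; apply/eqP; rewrite eqn_leq.
by rewrite (has_dim_le b1 b2 c3) (has_dim_le c1 c2 b3).
Qed.

Lemma dimE S n : has_dim S n -> Defs.dim S = n.
Proof. by move=> h; apply: xget_unique => // m /has_dim_uniq; apply. Qed.

Lemma ker_basis n (A : 'M[K]_n) : exists e : 'I_(n - \rank A) -> 'cV[K]_n,
  [/\ forall i, A *m e i = 0,
      forall k : 'I_(n - \rank A) -> K, \sum_i k i *: e i = 0 -> forall i, k i = 0
    & forall v : 'cV_n, A *m v = 0 -> exists k : 'I_(n - \rank A) -> K, v = \sum_i k i *: e i].
Proof.
rewrite -[\rank A]mxrank_tr -mxrank_ker.
set B := row_base (kermx A^T).
have Bmul (k : 'rV_(\rank (kermx A^T))) : (k *m B)^T = \sum_i k 0 i *: (row i B)^T.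
  rewrite mulmx_sum_row raddf_sum; apply: eq_bigr => i _; exact: linearZ.
exists (fun i => (row i B)^T); split.
- move=> i; apply: trmx_inj; rewrite trmx_mul trmxK trmx0; apply: sub_kermxP.
  by apply: submx_trans (row_sub _ _) _; rewrite eq_row_base.
- move=> k hk i.
  have : (\row_i k i) *m B = 0.
    apply: trmx_inj; rewrite Bmul trmx0 -[RHS]hk; apply: eq_bigr => j _; by rewrite mxE.
  move=> /eqP; rewrite -(mul0mx _ B) => /eqP/(row_free_inj (row_base_free _)).
  by move=> /rowP/(_ i); rewrite !mxE.
- move=> v Av.
  have : (v^T <= B)%MS by rewrite eq_row_base; apply/sub_kermxP; rewrite -trmx_mul Av trmx0.
  move=> /submxP[k kE]; exists (fun i => k 0 i).
  by rewrite -Bmul -kE trmxK.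
Qed.

Lemma aeeq_cont u : mcont u -> aeeq u (fun=> 0) -> forall x, 0 <= x <= 1 -> u x = 0.
Proof.
move=> cu z x hx; apply/matrixP => i j; rewrite ord1 [RHS]mxE.
apply: (@ae_cont0 R (fun x => u x i 0) (cu i 0)) => //.
by apply: aeS z => y H hy; rewrite H// mxE.
Qed.

Lemma mcont_sum (I : Type) (r : seq I) (b : I -> vfun) : (forall i, mcont (b i)) ->
  mcont (fun x => \sum_(i <- r) b i x).
Proof.
move=> cb i j; apply: (@ccont_ext _ _ (fun x => \sum_(l <- r) b l x i j)).
  by move=> x; rewrite summxE.
by apply: ccont_sum => l _; exact: cb.
Qed.

Lemma inner0 (v : vfun) : inner (fun=> 0) v = 0.
Proof.
rewrite innerE (@cinteg_ext _ _ (fun=> 0)); first by rewrite /cinteg !integ_cst//= !mul0r.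
by move=> s _; rewrite /dot big1// => l _; rewrite mxE mul0r.
Qed.

Lemma inner_sum (I : Type) (r : seq I) (b : I -> vfun) (v : vfun) : (forall i, mcont (b i)) -> mcont v ->
  inner (fun x => \sum_(i <- r) b i x) v = \sum_(i <- r) inner (b i) v.
Proof.
move=> cb cv; elim: r => [|i r IH].
  by rewrite big_nil -[RHS](inner0 v); apply: inner_ext => // x _; rewrite big_nil.
rewrite big_cons -IH -innerD//; last exact: mcont_sum.
by apply: inner_ext => // x _; rewrite big_cons.
Qed.

Lemma aeeq_trans u (v w : vfun) : aeeq u v -> aeeq v w -> aeeq u w.
Proof. by move=> h1 h2; apply: aeS (aeI h1 h2) => x [a b] hx; rewrite a// b. Qed.

Variables (A : operator R N) (n : nat) (M : R -> 'M[K]_n) (phi : R -> 'cV[K]_n -> vfun).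
Hypothesis phi_lin : forall r (I : finType) (k : I -> K) e x,
  phi r (\sum_i k i *: e i) x = \sum_i k i *: phi r (e i) x.
Hypothesis phi_cont : forall r v, mcont (phi r v).
Hypothesis phi_fwd : forall r u, Defs.eigenspace A (- r) u ->
  exists2 v, M r *m v = 0 & aeeq u (phi r v).
Hypothesis phi_bwd : forall r v, M r *m v = 0 -> Defs.eigenspace A (- r) (phi r v).
Hypothesis phi_zero : forall r v, M r *m v = 0 -> aeeq (phi r v) (fun=> 0) -> v = 0.
Hypothesis phi_orth : forall r r' v v', M r *m v = 0 -> M r' *m v' = 0 -> r != r' ->
  inner (phi r v) (phi r' v') = 0.

Lemma phi0 r x : phi r 0 x = 0.
Proof.
have := @phi_lin r 'I_0 (fun=> 0) (fun=> 0) x; rewrite !big_ord0 //.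
Qed.

(** The eigenvalues in [c,d] are the numbers - r for r in s. Bases of the
    kernels of the M r, taken together over all r in s, give a basis of the spectral
    subspace; its independence comes from the orthogonality of eigenfunctions
    for different eigenvalues. *)
Lemma has_dim_spectral (s : seq R) c d : uniq s ->
  (forall r, r \in s <-> - d <= r <= - c /\ \det (M r) = 0) ->
  has_dim (spectral_subspace A c d) (\sum_(r <- s) (n - \rank (M r)))%N.
Proof.
move=> us sP.
pose rr (i : 'I_(size s)) := nth 0 s i.
have rrs i : rr i \in s by rewrite mem_nth.
have rr_inj i j : rr i = rr j -> i = j.
  by move=> /eqP; rewrite nth_uniq// => /eqP/val_inj.
pose e r := sval (cid (ker_basis (M r))).
have he r := svalP (cid (ker_basis (M r))).
(* Index set of the union of the bases. *)
pose T := {i : 'I_(size s) & 'I_(n - \rank (M (rr i)))}.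
have <- : #|{: T}| = (\sum_(r <- s) (n - \rank (M r)))%N.
  rewrite -sum1_card (big_nth 0) big_mkord.
  rewrite (eq_bigr (fun i : 'I_(size s) => \sum_(j < n - \rank (M (rr i))) 1)%N).
    by rewrite sig_big_dep.
  by move=> i _; rewrite sum1_card card_ord.
pose b (p : T) : vfun := phi (rr (tag p)) (e _ (tagged p)).
pose tg i (j : 'I_(n - \rank (M (rr i)))) : T := Tagged (fun i => 'I_(n - \rank (M (rr i)))) j.
have key (k : T -> K) x : \sum_p k p *: b p x =
    \sum_(i < size s) phi (rr i) (\sum_j k (tg i j) *: e (rr i) j) x.
  transitivity (\sum_(i < size s) \sum_j k (tg i j) *:
     phi (rr i) (e (rr i) j) x).
    rewrite sig_big_dep; apply: eq_bigr => -[i j] _ //.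
  by apply: eq_bigr => i _; rewrite phi_lin.
have Mker i (k : T -> K) : M (rr i) *m (\sum_j k (tg i j) *: e (rr i) j) = 0.
  rewrite mulmx_sumr big1// => j _; rewrite -scalemxAr.
  by have [-> _ _] := he (rr i); rewrite scaler0.
apply: (has_dim_fin (b := b)).
- move=> p; exists 1%N, (fun=> - rr (tag p)), (fun=> b p); split; last first.
    by apply: aeW => x _; rewrite big_ord1.
  move=> _; split.
    by have /sP[/andP[h1 h2] _] := rrs (tag p); rewrite lerNr h2 lerNl h1.
  by apply: phi_bwd; have [h _ _] := he (rr (tag p)); exact: h.
- move=> k hk [i0 j0].
  pose vv i := \sum_j k (tg i j) *: e (rr i) j.
  have z : forall x, 0 <= x <= 1 -> \sum_(i < size s) phi (rr i) (vv i) x = 0.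
    apply: aeeq_cont; first by apply: mcont_sum => i; exact: phi_cont.
    by apply: aeS hk => x H hx; rewrite -key H.
  have z0 : inner (phi (rr i0) (vv i0)) (phi (rr i0) (vv i0)) = 0.
    have <- : inner (fun x => \sum_(i < size s) phi (rr i) (vv i) x) (phi (rr i0) (vv i0)) =
       inner (phi (rr i0) (vv i0)) (phi (rr i0) (vv i0)).
      rewrite (@inner_sum _ _ (fun i => phi (rr i) (vv i)) _ (fun i => phi_cont _ _) (phi_cont _ _)).
      rewrite (bigD1 i0)//= big1 ?addr0// => i ii0.
      apply: phi_orth; [exact: Mker|exact: Mker|].
      by apply: contra ii0 => /eqP/rr_inj->.
    rewrite (@inner_ext _ _ _ (phi (rr i0) (vv i0)) (fun=> 0) (phi (rr i0) (vv i0)) z)//.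
    exact: inner0.
  have v0 : vv i0 = 0.
    apply: (phi_zero (Mker i0 k)); apply: aeW => x hx.
    exact: (inner_def (phi_cont _ _) z0).
  by have [_ h _] := he (rr i0); exact: (h _ v0 j0).
- move=> u [m [lam [v [hv uE]]]].
  have hj j : exists k : T -> K, aeeq (v j) (fun x => \sum_p k p *: b p x).
    have [/andP[cl ld] ev] := hv j.
    have [x Mx vx] : exists2 x, M (- lam j) *m x = 0 & aeeq (v j) (phi (- lam j) x).
      by apply: phi_fwd; rewrite opprK.
    have [d0|d0] := eqVneq (\det (M (- lam j))) 0; last first.
      have x0 : x = 0.
        have uM : M (- lam j) \in unitmx by rewrite unitmxE unitfE.
        by rewrite -[x]mul1mx -(mulVmx uM) -mulmxA Mx mulmx0.
      exists (fun=> 0); apply: aeS vx => y H hy; rewrite H// x0 phi0 big1// => p _.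
      by rewrite scale0r.
    have ls : - lam j \in s by apply/sP; split => //; rewrite lerN2 ld lerN2 cl.
    have [i0 i0E] : exists i0, rr i0 = - lam j.
      have ii : (index (- lam j) s < size s)%N by rewrite index_mem.
      by exists (Ordinal ii); rewrite /rr /= nth_index.
    pose x' i := if i == i0 then x else 0.
    have Mx' i : M (rr i) *m x' i = 0.
      by rewrite /x'; case: eqP => [->|_]; rewrite ?i0E ?mulmx0.
    have [kk hkk] : exists kk : forall i, 'I_(n - \rank (M (rr i))) -> K,
        forall i, x' i = \sum_j kk i j *: e (rr i) j.
      have H i : {k : 'I_(n - \rank (M (rr i))) -> K | x' i = \sum_j k j *: e (rr i) j}.
        by apply: cid; have [_ _ h] := he (rr i); exact: h.
      by exists (fun i => sval (H i)) => i; case: (H i).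
    exists (fun p => kk (tag p) (tagged p)); apply: aeS vx => y H hy.
    rewrite key H// (eq_bigr (fun i => phi (rr i) (x' i) y)); last by move=> i _; rewrite hkk.
    rewrite (bigD1 i0)//= big1 ?addr0; first by rewrite /x' eqxx i0E.
    by move=> i ii0; rewrite /x' (negbTE ii0) phi0.
  have [kk hkk] := choice hj.
  exists (fun p => \sum_j kk j p).
  apply: aeS (aeI uE (ae_fin hkk)) => x [h1 h2] hx; rewrite h1//.
  under eq_bigr => j _ do rewrite (h2 j hx).
  by rewrite exchange_big; apply: eq_bigr => p _ /=; rewrite scaler_suml.
Qed.

End Dimension.

(** * Spectral flow as a winding number *)

Section SpectralFlow.
Variables (R : realType) (N : nat) (A : R -> operator R N).
Local Notation K := R[i].
Variables (F : R -> R -> R -> K) (mult : R -> R -> nat).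
Hypothesis F_cont : forall (T : topologicalType) (t r s : T -> R),
  continuous t -> continuous r -> continuous s -> ccont (fun q => F (t q) (r q) (s q)).
Hypothesis F_nz : forall t r s : R, 0 <= t <= 1 -> s != 0 -> F t r s != 0.
Hypothesis F_spec : forall t c : R, 0 <= t <= 1 ->
  ~ spectrum (A t) c%:C <-> F t (- c) 0 != 0.
Hypothesis F_iso : forall t r : R, 0 <= t <= 1 ->
  exists2 d : R, 0 < d & forall x, `|x - r| < d -> x != r -> F t x 0 != 0.
Hypothesis F_lindex : forall t r : R, 0 <= t <= 1 -> local_index (F t) (r, 0) (mult t r)%:Z.
Hypothesis F_dim : forall (t : R) (s : seq R) (c d : R), 0 <= t <= 1 -> uniq s ->
  (forall r, r \in s <-> - d <= r <= - c /\ F t r 0 = 0) ->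
  has_dim (spectral_subspace (A t) c d) (\sum_(r <- s) mult t r)%N.
Hypothesis F_end0 : F 0 0 0 != 0.
Hypothesis F_end1 : F 1 0 0 != 0.

Lemma F_rs t : ccont2 (F t).
Proof. by apply: F_cont => q; [exact: cvg_cst|exact: cvg_fst|exact: cvg_snd]. Qed.

Lemma F_ts r : ccont2 (fun t s => F t r s).
Proof. by apply: F_cont => q; [exact: cvg_fst|exact: cvg_cst|exact: cvg_snd]. Qed.

Lemma F_tr s : ccont2 (fun t r => F t r s).
Proof. by apply: F_cont => q; [exact: cvg_fst|exact: cvg_snd|exact: cvg_cst]. Qed.

Lemma zeros_fin t a b : 0 <= t <= 1 -> a <= b -> exists2 s : seq R, uniq s &
  forall r, r \in s <-> a <= r <= b /\ F t r 0 = 0.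
Proof.
move=> ht ab.
have [s hs] : exists s : seq R, forall r, a <= r <= b -> F t r 0 = 0 -> r \in s.
  apply: (@additive_interval R (fun a b => exists s : seq R, forall r, a <= r <= b ->
    F t r 0 = 0 -> r \in s)) => //.
    move=> x y z ax xy yz zb [s1 h1] [s2 h2]; exists (s1 ++ s2) => r /andP[xr rz] r0.
    rewrite mem_cat; have [ry|yr] := leP r y; first by rewrite h1// xr.
    by rewrite (h2 r)// ?orbT// (ltW yr).
  move=> x _; have [d d0 hd] := F_iso x ht; exists d => // y z ay yz zb yx zx.
  exists [:: x] => r /andP[yr rz] r0; rewrite inE; apply/negPn/negP => rx.
  move: r0; apply/eqP; apply: hd => //.
  move: yx zx; rewrite !ltr_norml => /andP[h1 h2] /andP[h3 h4]; apply/andP; split; lra.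
exists (undup [seq r <- s | (a <= r <= b) && (F t r 0 == 0)]); first exact: undup_uniq.
move=> r; rewrite mem_undup mem_filter; split.
  by case/andP => /andP[h /eqP z] _.
by move=> [h z]; rewrite h z eqxx (hs r).
Qed.

(** The zeros of F t in the rectangle lie on the line s = 0, none of them on
    the boundary, and the local indices are the multiplicities. *)
Lemma winding_zeros t a b s : 0 <= t <= 1 -> a < b -> F t a 0 != 0 -> F t b 0 != 0 -> uniq s ->
  (forall r, r \in s <-> a <= r <= b /\ F t r 0 = 0) ->
  winding (F t) a b (-1) 1 = (\sum_(r <- s) mult t r)%:R * (2 * pi).
Proof.
move=> ht ab Fa Fb us sP.
have n11 : -1 < 1 :> R by rewrite -subr_gt0 opprK.
rewrite (@winding_sum R (F t) (fun p => (mult t p.1)%:Z) [seq (r, 0 : R) | r <- s]) //.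
- by rewrite big_map rmorph_sum natr_sum.
- exact: F_rs.
- by rewrite map_inj_uniq// => x y [].
- move=> p /mapP[r /sP[/andP[ar rb] r0] ->] /=; rewrite ltrN10 ltr01 !lt_neqAle ar rb !andbT.
  split => //; apply/andP; split; apply/eqP => e.
    by move: Fa; rewrite e r0 eqxx.
  by move: Fb; rewrite -e r0 eqxx.
- move=> x y hx hy Fxy; have [y0|/(F_nz x ht)] := eqVneq y 0; last by rewrite Fxy eqxx.
  by apply/mapP; exists x; rewrite ?y0//; apply/sP; split => //; rewrite -y0.
- by move=> p /mapP[r _ ->]; exact: F_lindex.
Qed.

Lemma window_winding t c m : 0 <= t <= 1 -> 0 < c -> F t (- c) 0 != 0 -> F t c 0 != 0 ->
  has_dim (spectral_subspace (A t) (- c) c) m -> winding (F t) (- c) c (-1) 1 = m%:R * (2 * pi).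
Proof.
move=> ht c0 F1 F2 hm.
have cc : - c < c by rewrite -subr_gt0 opprK addr_gt0.
have [s us sP] := zeros_fin ht (ltW cc).
rewrite (winding_zeros ht cc F1 F2 us sP); congr (_%:R * _).
by apply: has_dim_uniq hm; apply: F_dim => // r; rewrite opprK.
Qed.

Lemma window_dim t c : 0 <= t <= 1 -> 0 < c ->
  exists m, has_dim (spectral_subspace (A t) (- c) c) m.
Proof.
move=> ht c0; have cc : - c <= c by rewrite -subr_ge0 opprK addr_ge0// ltW.
have [s us sP] := zeros_fin ht cc.
by exists (\sum_(r <- s) mult t r)%N; apply: F_dim => // r; rewrite opprK.
Qed.

Lemma nz_right t : 0 <= t <= 1 -> exists2 d : R, 0 < d & forall r, 0 < r < d -> F t r 0 != 0.
Proof.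
move=> ht; have [d d0 hd] := F_iso 0 ht; exists d => // r /andP[r0 rd].
by apply: hd; rewrite ?subr0 ?gtr0_norm// gt_eqF.
Qed.

(** The upper bound e > 0 is chosen below the first positive zero, so that the
    rectangle sees r in [-c, 0] only, that is, the eigenvalues in [0, c]. *)
Lemma dim_winding t c : 0 <= t <= 1 -> 0 < c -> F t (- c) 0 != 0 ->
  exists2 d : R, 0 < d & forall e, 0 < e < d ->
    winding (F t) (- c) e (-1) 1 = (Defs.dim (spectral_subspace (A t) 0 c))%:R * (2 * pi).
Proof.
move=> ht c0 Fc; have [d d0 hd] := nz_right ht.
exists d => // e /andP[e0 ed].
have c_e : - c < e by apply: (@lt_trans _ _ 0); rewrite ?oppr_lt0.
have [s us sP] := zeros_fin ht (ltW c_e).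
rewrite (winding_zeros ht c_e Fc (hd _ _) us sP) ?e0//.
congr (_%:R * _); apply/esym/dimE; apply: F_dim => // r; rewrite sP oppr0; split.
  move=> [/andP[h1 h2] z]; split => //; rewrite h1 /=; rewrite leNgt; apply/negP => r0.
  by have := hd r; rewrite r0 (le_lt_trans h2 ed) z eqxx => /(_ erefl).
by move=> [/andP[h1 h2] z]; rewrite h1 (le_trans h2 (ltW e0)).
Qed.

(** The box identity without the faces s = 1 and s = -1, where F has no zeros. *)
Lemma box_winding t0 t1 r0 r1 : 0 <= t0 -> t0 <= t1 -> t1 <= 1 -> r0 <= r1 ->
  winding (fun t s => F t r1 s) t0 t1 (-1) 1 - winding (fun t s => F t r0 s) t0 t1 (-1) 1 =
  winding (F t1) r0 r1 (-1) 1 - winding (F t0) r0 r1 (-1) 1.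
Proof.
move=> t00 t01 t11 r01; rewrite winding_box.
have nz s : s != 0 -> winding (fun t r => F t r s) t0 t1 r0 r1 = 0.
  move=> s0; apply: winding_nonvan => //; first exact: F_tr.
  move=> x y /andP[x0 x1] _; apply: F_nz => //; apply/andP; split; [exact: le_trans x0|exact: le_trans t11].
by rewrite !nz ?subrr ?addr0// ?oppr_eq0 oner_eq0.
Qed.

Lemma side_winding t0 t1 r : 0 <= t0 -> t0 <= t1 -> t1 <= 1 ->
  (forall t, t0 <= t <= t1 -> F t r 0 != 0) -> winding (fun t s => F t r s) t0 t1 (-1) 1 = 0.
Proof.
move=> t00 t01 t11 nz; apply: winding_nonvan => //; first exact: F_ts.
move=> x y hx _; have [->|] := eqVneq y 0; first exact: nz.
case/andP: hx => x0 x1.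
by apply: F_nz; apply/andP; split; [exact: le_trans x0|exact: le_trans t11].
Qed.

Lemma small_forall (Q : nat -> R -> Prop) n :
  (forall i, (i < n)%N -> exists2 d : R, 0 < d & forall e, 0 < e < d -> Q i e) ->
  exists2 d : R, 0 < d & forall e, 0 < e < d -> forall i, (i < n)%N -> Q i e.
Proof.
elim: n => [|n IH] H; first by exists 1.
have [i ii|d1 d10 h1] := IH; first by apply: H; exact: ltnW.
have [d2 d20 h2] := H n (ltnSn n).
exists (Num.min d1 d2); first by rewrite lt_min d10.
move=> e /andP[e0]; rewrite lt_min => /andP[ed1 ed2] i.
rewrite ltnS leq_eqVlt => /orP[/eqP->|ii]; first by apply: h2; rewrite e0.
by apply: h1; rewrite ?e0.
Qed.

Lemma partition_in n (t : nat -> R) : t 0%N = 0 -> t n = 1 ->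
  (forall i, (i < n)%N -> t i < t i.+1) -> forall i, (i <= n)%N -> 0 <= t i <= 1.
Proof.
move=> t0 tn tS i le_in.
have mono i' k : (i' + k <= n)%N -> t i' <= t (i' + k)%N.
  elim: k => [|k IH] h; first by rewrite addn0.
  by rewrite addnS in h *; apply: le_trans (IH (ltnW h)) (ltW (tS _ h)).
apply/andP; split.
  by have := mono 0%N i; rewrite t0; apply.
by have := mono i (n - i)%N; rewrite subnKC// tn; apply.
Qed.

(** Every summand of the spectral flow is a winding of F (., e, .), for one
    e > 0 that is small enough for all points of the partition. These windings add
    up, and the box between r = 0 and r = e, which has no zeros at t = 0 and
    t = 1, moves e to 0. *)
Lemma sf_value k : is_spectral_flow A 0 1 k ->
  k%:~R * (2 * pi) = winding (fun t s => F t 0 s) 0 1 (-1) 1.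
Proof.
move=> [n [t [c [[t0 tn tS] ->]]]].
have tin := partition_in t0 tn (fun i h => let: And4 h1 _ _ _ := tS i h in h1).
pose dm i j := Defs.dim (spectral_subspace (A (t i)) 0 (c j)).
have [d1 d10 h1] : exists2 d : R, 0 < d & forall e, 0 < e < d -> forall i, (i < n)%N ->
    winding (F (t i)) (- c i) e (-1) 1 = (dm i i)%:R * (2 * pi).
  apply: small_forall => i ii; have [tt c0 sp _] := tS i ii.
  have hi := tin i (ltnW ii).
  by apply: dim_winding => //; apply/F_spec => //; have [] := sp (t i); rewrite ?lexx ?(ltW tt).
have [d2 d20 h2] : exists2 d : R, 0 < d & forall e, 0 < e < d -> forall i, (i < n)%N ->
    winding (F (t i.+1)) (- c i) e (-1) 1 = (dm i.+1 i)%:R * (2 * pi).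
  apply: small_forall => i ii; have [tt c0 sp _] := tS i ii.
  have hi := tin i.+1 ii.
  by apply: dim_winding => //; apply/F_spec => //; have [] := sp (t i.+1); rewrite ?lexx ?(ltW tt).
have i0 : 0 <= (0 : R) <= 1 by rewrite lexx ler01.
have i1 : 0 <= (1 : R) <= 1 by rewrite lexx ler01.
(* For r in [0, e], F has no zeros at t = 0 and t = 1. *)
have [d3 d30 h3] := nz_right i0.
have [d4 d40 h4] := nz_right i1.
pose d := Num.min (Num.min d1 d2) (Num.min d3 d4).
have d0 : 0 < d by rewrite !lt_min d10 d20 d30 d40.
pose e := d / 2.
have e0 : 0 < e by rewrite divr_gt0.
have ed : e < d by rewrite ltr_pdivrMr// ltr_pMr// ltr1n.
have := ed; rewrite !lt_min => /andP[/andP[ed1 ed2] /andP[ed3 ed4]].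
have step i : (i < n)%N ->
    ((dm i.+1 i)%:Z - (dm i i)%:Z)%:~R * (2 * pi) = winding (fun t s => F t e s) (t i) (t i.+1) (-1) 1.
  move=> ii; have [tt c0 sp _] := tS i ii.
  have /andP[ti0 _] := tin i (ltnW ii); have /andP[_ ti1] := tin i.+1 ii.
  have ce : - c i <= e by apply: (@le_trans _ _ 0); rewrite ?oppr_le0 ltW.
  have := box_winding ti0 (ltW tt) ti1 ce.
  rewrite h1 ?e0// h2 ?e0// (side_winding (r := - c i)) ?subr0//; last 1 first.
  - move=> x hx; apply/F_spec; last by have [] := sp x hx.
    by case/andP: hx => x0 x1; rewrite (le_trans ti0 x0) (le_trans x1 ti1).
  - by move=> ->; rewrite -mulrBl rmorphB.
  exact: ltW.
have tele m : (m <= n)%N -> (\sum_(i < m) ((dm i.+1 i)%:Z - (dm i i)%:Z))%:~R * (2 * pi) =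
    winding (fun t s => F t e s) 0 (t m) (-1) 1.
  elim: m => [|m IH] mn.
    rewrite big_ord0 mul0r t0; apply/esym.
    have : forall x, 0 <= x <= 0 -> F x e (-1) != 0 /\ F x e 1 != 0.
      move=> x /andP[x0 x1]; have hx : 0 <= x <= 1 by rewrite x0 (le_trans x1 ler01).
      by split; apply: F_nz => //; rewrite ?oppr_eq0 oner_eq0.
    move=> /(winding_splitx (lexx 0) (lexx 0) (F_ts e)) /eqP.
    by rewrite -subr_eq0 opprD addrA subrr sub0r oppr_eq0 => /eqP.
  have := tin m (ltnW mn); have := tin m.+1 mn => /andP[a1 a2] /andP[b1 b2].
  rewrite big_ord_recr /= rmorphD mulrDl IH ?(ltnW mn)// step//.
  rewrite -(winding_splitx b1 _ (F_ts e))//; first by have [/ltW] := tS m mn.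
  move=> x /andP[x0 x1].
  have hx : 0 <= x <= 1 by rewrite x0 (le_trans x1).
  by split; apply: F_nz => //; rewrite ?oppr_eq0 oner_eq0.
have -> : \sum_(i < n) ((Defs.dim (spectral_subspace (A (t i.+1)) 0 (c i)))%:Z -
    (Defs.dim (spectral_subspace (A (t i)) 0 (c i)))%:Z) =
  \sum_(i < n) ((dm i.+1 i)%:Z - (dm i i)%:Z) by [].
rewrite tele// tn; apply/eqP; rewrite -subr_eq0; apply/eqP.
rewrite (box_winding (lexx 0) ler01 (lexx 1) (ltW e0)).
have n11 : -1 <= 1 :> R by rewrite -subr_ge0 opprK.
have z1 : winding (F 1) 0 e (-1) 1 = 0.
  apply: winding_nonvan => //; [exact: ltW|exact: F_rs|].
  move=> x y /andP[x0 xe] _; have [->|] := eqVneq y 0; last exact: F_nz.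
  move: x0; rewrite le_eqVlt => /orP[/eqP<-//|x0]; apply: h4; rewrite x0.
  exact: le_lt_trans ed4.
have z0 : winding (F 0) 0 e (-1) 1 = 0.
  apply: winding_nonvan => //; [exact: ltW|exact: F_rs|].
  move=> x y /andP[x0 xe] _; have [->|] := eqVneq y 0; last exact: F_nz.
  move: x0; rewrite le_eqVlt => /orP[/eqP<-//|x0]; apply: h3; rewrite x0.
  exact: le_lt_trans ed3.
by rewrite z0 z1 subrr.
Qed.

Lemma near_nz x r : F x r 0 != 0 -> exists2 d : R, 0 < d & forall y, `|y - x| < d -> F y r 0 != 0.
Proof.
move=> Fx; have cf : ccont (fun t => F t r 0) by apply: F_cont => q; [exact: cvg_id|exact: cvg_cst|exact: cvg_cst].
have [d d0 H] := near_ball1 (ccvg_slit Fx (cf x)).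
exists d => // y /H/slit_neq0; by rewrite mulf_eq0 negb_or => /andP[].
Qed.

(** Partitions of adjacent intervals are concatenated; at index n both
    descriptions of the partition point agree. *)
Lemma partition_cat a b c n m t1 c1 t2 c2 : sf_partition A a b n t1 c1 ->
  sf_partition A b c m t2 c2 ->
  sf_partition A a c (n + m) (fun i => if (i <= n)%N then t1 i else t2 (i - n)%N)
    (fun i => if (i < n)%N then c1 i else c2 (i - n)%N).
Proof.
move=> [a1 a2 a3] [b1 b2 b3]; split.
- by rewrite leq0n.
- case: leqP => [h|_]; last by rewrite addKn.
  have m0 : m = 0%N by apply/eqP; rewrite -leqn0 -(leq_add2l n) addn0.
  by rewrite m0 addn0 a2 -b1 -b2 m0.
- move=> i im; have [ii|ni] := ltnP i n.
    by rewrite (ltnW ii); exact: a3.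
  have [h1 h2 h3 h4] : [/\ t2 (i - n)%N < t2 (i - n).+1, 0 < c2 (i - n)%N,
     forall s, t2 (i - n)%N <= s <= t2 (i - n).+1 ->
        ~ spectrum (A s) (c2 (i - n)%N)%:C /\ ~ spectrum (A s) (- c2 (i - n)%N)%:C
    & exists m, forall s, t2 (i - n)%N <= s <= t2 (i - n).+1 ->
        has_dim (spectral_subspace (A s) (- c2 (i - n)%N) (c2 (i - n)%N)) m].
    by apply: b3; rewrite ltn_subLR.
  have -> : (if (i <= n)%N then t1 i else t2 (i - n)%N) = t2 (i - n)%N.
    case: leqP => // h; have -> : i = n by apply/eqP; rewrite eqn_leq h ni.
    by rewrite subnn a2 b1.
  by rewrite subSn.
Qed.

(** Around each x choose c such that neither c nor - c is an eigenvalue of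
    A x. This persists nearby, and the dimension for [-c, c] is constant because
    it is a winding, and the box identity without the faces r = c and r = - c equates the
    windings at different t. *)
Lemma sf_exists : exists n t c, sf_partition A 0 1 n t c.
Proof.
apply: (@additive_interval R (fun a b => exists n t c, sf_partition A a b n t c)) => //.
  move=> x y z _ _ _ _ [n [t1 [c1 h1]]] [m [t2 [c2 h2]]].
  do 3 eexists; exact: partition_cat h1 h2.
move=> x hx.
have n11 : -1 <= 1 :> R by rewrite -subr_ge0 opprK.
have [s us sP] := zeros_fin hx n11.
(* The finitely many eigenvalues in [-1, 1] leave room for c. *)
have [c /andP[c0 c1]] := @avoid_seq R (s ++ map -%R s) 0 1 ltr01.
rewrite mem_cat negb_or => /andP[cs ncs].
have cin : -1 <= c <= 1 by rewrite (ltW c1) andbT (le_trans _ (ltW c0))// oppr_le0.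
have Fc : F x c 0 != 0.
  by apply: contra cs => /eqP z; apply/sP.
have Fnc : F x (- c) 0 != 0.
  apply: contra ncs => /eqP z; apply/mapP; exists (- c); rewrite ?opprK//; apply/sP; split => //.
  by rewrite lerN2 (ltW c1) /= (le_trans _ ler01)// oppr_le0 ltW.
have [d1 d10 h1] := near_nz Fc; have [d2 d20 h2] := near_nz Fnc.
exists (Num.min d1 d2); first by rewrite lt_min d10.
move=> y z y0 yz z1; rewrite !lt_min => /andP[yd1 yd2] /andP[zd1 zd2].
move: yz; rewrite le_eqVlt => /orP[/eqP->|yz].
  by exists 0%N, (fun=> z), (fun=> c).
have inn t : y <= t <= z -> [/\ 0 <= t <= 1, F t c 0 != 0 & F t (- c) 0 != 0].
  move=> /andP[yt tz].
  have nb (d : R) : `|y - x| < d -> `|z - x| < d -> `|t - x| < d.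
    rewrite !ltr_norml => /andP[a1 a2] /andP[a3 a4]; apply/andP; split.
      by apply: lt_le_trans a1 _; rewrite lerD2r.
    by apply: le_lt_trans a4; rewrite lerD2r.
  split; [by rewrite (le_trans y0 yt) (le_trans tz z1)|by apply: h1; exact: nb|by apply: h2; exact: nb].
have hy : y <= y <= z by rewrite lexx ltW.
have [iy Fy1 Fy2] := inn y hy.
have [m hm] := window_dim iy c0.
exists 1%N, (fun i => if i == 0%N then y else z), (fun=> c); split => //.
case=> // _ /=; split => //.
  move=> t /inn[it Ft1 Ft2]; split; apply/F_spec => //.
  by rewrite opprK.
exists m => t ht; have [it Ft1 Ft2] := inn t ht.
have [m' hm'] := window_dim it c0.
suff -> : m = m' by [].
have cc : - c <= c by rewrite -subr_ge0 opprK addr_ge0// ltW.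
case/andP: ht => yt tz.
have t1 : t <= 1 by case/andP: it.
have := box_winding y0 yt t1 cc.
rewrite !side_winding ?subrr//; last 2 first.
- by move=> u /andP[yu ut]; have [] := inn u; rewrite ?yu ?(le_trans ut).
- by move=> u /andP[yu ut]; have [] := inn u; rewrite ?yu ?(le_trans ut).
rewrite (window_winding iy c0 Fy2 Fy1 hm) (window_winding it c0 Ft2 Ft1 hm') -mulrBl => /esym/eqP.
rewrite mulf_eq0 => /orP[|]; last by rewrite gt_eqF// mulr_gt0// pi_gt0.
by rewrite subr_eq0 eqr_nat => /eqP.
Qed.

Lemma spectral_flow_winding : (spectral_flow A 0 1)%:~R * (2 * pi) = winding (fun t s => F t 0 s) 0 1 (-1) 1.
Proof.
apply: sf_value; rewrite /spectral_flow; apply: (@xgetPex _ 0 (is_spectral_flow A 0 1)).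
by have [n [t [c h]]] := sf_exists; do 4 eexists; split; [exact: h|].
Qed.

End SpectralFlow.

(** * Brouwer degree as a winding number *)

Section DegreeWinding.
Variable R : realType.
Local Notation K := R[i].
Implicit Types (p q : R * R).

Definition in_rect p := 0 <= p.1 <= 1 /\ -1 <= p.2 <= 1.
Definition in_int_rect p := 0 < p.1 < 1 /\ -1 < p.2 < 1.
Local Notation U := ((plane_set (@Omega R))°).

Lemma plane_OmegaE p : plane_set (@Omega R) p <-> in_rect p.
Proof. by case: p. Qed.

Lemma int_rectP p : U p <-> in_int_rect p.
Proof.
split.
  move=> /near_ball2[d d0 H].
  have d2 : 0 < d / 2 by rewrite divr_gt0.
  have dd : d / 2 < d by rewrite ltr_pdivrMr// ltr_pMr// ltr1n.
  have norm1 : `|p.1 - d / 2 - p.1| < d by rewrite addrAC subrr sub0r normrN gtr0_norm.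
  have n2 : `|p.1 + d / 2 - p.1| < d by rewrite addrAC subrr add0r gtr0_norm.
  have n3 : `|p.2 - d / 2 - p.2| < d by rewrite addrAC subrr sub0r normrN gtr0_norm.
  have n4 : `|p.2 + d / 2 - p.2| < d by rewrite addrAC subrr add0r gtr0_norm.
  have [/andP[a1 _] /andP[a2 _]] := H _ _ norm1 n3.
  have [/andP[_ a3] /andP[_ a4]] := H _ _ n2 n4.
  rewrite /= in a1 a2 a3 a4.
  by split; apply/andP; split; lra.
move=> [/andP[a1 a2] /andP[a3 a4]].
have h1 : \forall x \near p.1, 0 < x < 1.
  near=> x; apply/andP; split; near: x; [exact: lt_nbhsr|exact: lt_nbhsl].
have h2 : \forall x \near p.2, -1 < x < 1.
  near=> x; apply/andP; split; near: x; [exact: lt_nbhsr|exact: lt_nbhsl].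
exists ([set x | 0 < x < 1], [set x | -1 < x < 1]); first by split.
move=> [x y] [/= /andP[/ltW x0 /ltW x1] /andP[/ltW y0 /ltW y1]]; split; exact/andP.
Unshelve. all: by end_near.
Qed.

Lemma nbhs_box p (d : R) : 0 < d -> nbhs p [set q : R * R | `|q.1 - p.1| < d /\ `|q.2 - p.2| < d].
Proof.
move=> d0; exists ([set x | `|x - p.1| < d], [set x | `|x - p.2| < d]); last by move=> [x y] [].
by split; apply/nbhs_ballP; exists d => //= y; rewrite /ball /= distrC.
Qed.

(** Moving a boundary point slightly towards the centre (1/2, 0) leads into
    the open rectangle. *)
Lemma closure_rectP p : closure U p <-> in_rect p.
Proof.
split.
  move=> cp.
  have cp' d : 0 < d -> exists q, [/\ in_int_rect q, `|q.1 - p.1| < d & `|q.2 - p.2| < d].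
    by move=> d0; have [q [/int_rectP Uq [q1 q2]]] := cp _ (nbhs_box p d0); exists q.
  split; apply/andP; split; rewrite leNgt; apply/negP => h.
  - have [q [[/andP[a b] _]]] := cp' (- p.1) ltac:(lra).
    by rewrite ltr_norml => /andP[c e] _; lra.
  - have [q [[/andP[a b] _]]] := cp' (p.1 - 1) ltac:(lra).
    by rewrite ltr_norml => /andP[c e] _; lra.
  - have [q [[_ /andP[a b]]]] := cp' (-1 - p.2) ltac:(lra).
    by move=> _; rewrite ltr_norml => /andP[c e]; lra.
  - have [q [[_ /andP[a b]]]] := cp' (p.2 - 1) ltac:(lra).
    by move=> _; rewrite ltr_norml => /andP[c e]; lra.
move=> [/andP[a1 a2] /andP[a3 a4]] B /near_ball2[d d0 H].
pose th := Num.min (1 / 2) (d / 2) : R.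
have th0 : 0 < th by rewrite lt_min !divr_gt0.
have th1 : th <= 1 / 2 by rewrite ge_min lexx.
have thd : th <= d / 2 by rewrite ge_min lexx orbT.
exists (p.1 + th * (1 / 2 - p.1), p.2 - th * p.2); split.
  move: th th0 th1 {thd} => t t0 t1.
  by apply/int_rectP; split => /=; apply/andP; split; nra.
apply: H; rewrite /= addrAC subrr ?add0r ?sub0r ?normrN normrM gtr0_norm//.
  apply: (@le_lt_trans _ _ (th * 1)); last by lra.
  rewrite ler_pM2l// ler_norml; apply/andP; split; lra.
apply: (@le_lt_trans _ _ (th * 1)); last by lra.
rewrite ler_pM2l// ler_norml; apply/andP; split; lra.
Qed.

Lemma cvg_pairl (T : Type) (FF : set_system T) (h : T -> R * R) (l : R * R) : Filter FF ->
  h @ FF --> l -> (fun x => (h x).1) @ FF --> l.1 /\ (fun x => (h x).2) @ FF --> l.2.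
Proof.
move=> FFF hl; split.
  by apply: (@cvg_comp _ _ _ h fst); [exact: hl|exact: cvg_fst].
by apply: (@cvg_comp _ _ _ h snd); [exact: hl|exact: cvg_snd].
Qed.

Lemma derive_cvg (g : R * R -> R * R) p v : derivable g p v ->
  h^-1 *: ((g \o shift p) (h *: v) - g p) @[h --> 0^'] --> 'D_v g p.
Proof. by []. Qed.

Lemma partial1 (g : R * R -> R * R) x y : derivable g (x, y) (1, 0) ->
  is_derive x 1 (fun t => (g (t, y)).1) ('D_(1, 0) g (x, y)).1 /\
  is_derive x 1 (fun t => (g (t, y)).2) ('D_(1, 0) g (x, y)).2.
Proof.
move=> /derive_cvg/(cvg_pairl _)[c1 c2].
have e h : h *: ((1, 0) : R * R) + (x, y) = (h *: (1 : R) + x, y).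
  by congr (_, _); rewrite /= scaler0 add0r.
have e1 : (fun h => (h^-1 *: ((g \o shift (x, y)) (h *: ((1, 0) : R * R)) - g (x, y))).1) =
  (fun h => h^-1 *: (((fun t => (g (t, y)).1) \o shift x) (h *: (1 : R)) - (g (x, y)).1)).
  by apply/funext => h /=; rewrite e.
have e2 : (fun h => (h^-1 *: ((g \o shift (x, y)) (h *: ((1, 0) : R * R)) - g (x, y))).2) =
  (fun h => h^-1 *: (((fun t => (g (t, y)).2) \o shift x) (h *: (1 : R)) - (g (x, y)).2)).
  by apply/funext => h /=; rewrite e.
rewrite e1 in c1; rewrite e2 in c2.
by split; apply: DeriveDef; [exact: cvgP c1|exact: cvg_lim c1|exact: cvgP c2|exact: cvg_lim c2].
Qed.

Lemma partial2 (g : R * R -> R * R) x y : derivable g (x, y) (0, 1) ->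
  is_derive y 1 (fun t => (g (x, t)).1) ('D_(0, 1) g (x, y)).1 /\
  is_derive y 1 (fun t => (g (x, t)).2) ('D_(0, 1) g (x, y)).2.
Proof.
move=> /derive_cvg/(cvg_pairl _)[c1 c2].
have e h : h *: ((0, 1) : R * R) + (x, y) = (x, h *: (1 : R) + y).
  by congr (_, _); rewrite /= scaler0 add0r.
have e1 : (fun h => (h^-1 *: ((g \o shift (x, y)) (h *: ((0, 1) : R * R)) - g (x, y))).1) =
  (fun h => h^-1 *: (((fun t => (g (x, t)).1) \o shift y) (h *: (1 : R)) - (g (x, y)).1)).
  by apply/funext => h /=; rewrite e.
have e2 : (fun h => (h^-1 *: ((g \o shift (x, y)) (h *: ((0, 1) : R * R)) - g (x, y))).2) =
  (fun h => h^-1 *: (((fun t => (g (x, t)).2) \o shift y) (h *: (1 : R)) - (g (x, y)).2)).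
  by apply/funext => h /=; rewrite e.
rewrite e1 in c1; rewrite e2 in c2.
by split; apply: DeriveDef; [exact: cvgP c1|exact: cvg_lim c1|exact: cvgP c2|exact: cvg_lim c2].
Qed.

(** Mean value theorem for f x - l x. *)
Lemma mvt_near (f df : R -> R) (a r l e : R) : 0 < r ->
  (forall x, `|x - a| < r -> is_derive x 1 f (df x)) ->
  (forall x, `|x - a| < r -> `|df x - l| <= e) ->
  forall x, `|x - a| < r -> `|f x - f a - l * (x - a)| <= e * `|x - a|.
Proof.
move=> r0 fd fl x xa.
have gen u v : u < v -> `|u - a| < r -> `|v - a| < r ->
    `|f v - f u - l * (v - u)| <= e * (v - u).
  move=> uv ua va.
  have inn c : u <= c <= v -> `|c - a| < r.
    move: ua va; rewrite !ltr_norml => /andP[h1 h2] /andP[h3 h4] /andP[h5 h6].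
    by apply/andP; split; lra.
  have [||c] := @MVT R f df u v uv.
  - by move=> c; rewrite in_itv /= => /andP[/ltW h1 /ltW h2]; apply: fd; apply: inn; rewrite h1.
  - apply: derivable_within_continuous => c; rewrite in_itv /= => h.
    by case: (fd _ (inn c h)).
  - rewrite in_itv /= => /andP[/ltW h1 /ltW h2] ->; rewrite -mulrBl normrM.
    rewrite (@gtr0_norm _ (v - u)) ?subr_gt0// ler_pM2r ?subr_gt0//.
    by apply: fl; apply: inn; rewrite h1.
have aa : `|a - a| < r by rewrite subrr normr0.
have [xa'|ax|->] := ltgtP x a; last by rewrite !subrr mulr0 subr0 normr0 mulr0.
  have := gen x a xa' xa aa; rewrite -normrN => h.
  rewrite [`|x - a|]distrC (@gtr0_norm _ (a - x)) ?subr_gt0//.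
  apply: le_trans h; rewrite le_eqVlt; apply/orP; left; apply/eqP; congr `|_|; ring.
by rewrite (@gtr0_norm _ (x - a)) ?subr_gt0//; exact: gen.
Qed.

Lemma near_and5 (T : Type) (F : set_system T) (P1 P2 P3 P4 P5 : T -> Prop) : Filter F ->
  (\forall x \near F, P1 x) -> (\forall x \near F, P2 x) -> (\forall x \near F, P3 x) ->
  (\forall x \near F, P4 x) -> (\forall x \near F, P5 x) ->
  \forall x \near F, [/\ P1 x, P2 x, P3 x, P4 x & P5 x].
Proof.
move=> FF h1 h2 h3 h4 h5.
have h : \forall x \near F, P1 x /\ P2 x by apply: filterS2 h1 h2.
have h' : \forall x \near F, P3 x /\ P4 x by apply: filterS2 h3 h4.
by apply: filterS3 h h' h5 => x [] ? ? [] ? ? ?; split.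
Qed.

Lemma two_step (a b c u v k m : R) : `|a - b - u| <= k -> `|b - c - v| <= m ->
  `|a - c - (u + v)| <= k + m.
Proof.
move=> h1 h2; have -> : a - c - (u + v) = (a - b - u) + (b - c - v) by ring.
by apply: le_trans (ler_normD _ _) _; exact: lerD.
Qed.

Lemma norm1_lin (u1 u2 a1 a2 b1 b2 dx dy k m : R) : `|u1 - (a1 * dx + b1 * dy)| <= k ->
  `|u2 - (a2 * dx + b2 * dy)| <= m ->
  norm1 (u1 +i* u2 - ((a1 +i* a2) * dx%:C + (b1 +i* b2) * dy%:C)) <= k + m.
Proof.
move=> h1 h2; rewrite /norm1 !(cReD, cImD, cReN, cImN, cReM, cImM) /= !mulr0 !subr0 !add0r.
exact: lerD.
Qed.

(** Move from p to (x, y) first vertically and then horizontally, and apply the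
    mean value theorem to each component on each segment. *)
Lemma C1_diff_at (g : R * R -> R * R) p : C1_on U g -> U p ->
  diff_at (fun x y => ((g (x, y)).1 - (g p).1) +i* ((g (x, y)).2 - (g p).2)) p
    (('D_(1, 0) g p).1 +i* ('D_(1, 0) g p).2) (('D_(0, 1) g p).1 +i* ('D_(0, 1) g p).2).
Proof.
move=> gC Up e e0.
have [_ _ c1 c2] := gC p Up.
have e4 : 0 < e / 2 by rewrite divr_gt0.
have [a1 a2] := cvg_pairl _ c1; have [b1 b2] := cvg_pairl _ c2.
have nr (h : R * R -> R) (l : R) : h @ nbhs p --> l -> \forall q \near p, `|h q - l| < e / 2.
  by move=> /cvgr_distC_lt; apply.
have Un : \forall q \near p, U q by exact: nbhs_interior.
have [d d0 H] : exists2 d : R, 0 < d & forall y1 y2, `|y1 - p.1| < d -> `|y2 - p.2| < d ->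
    [/\ U (y1, y2), `|('D_(1, 0) g (y1, y2)).1 - ('D_(1, 0) g p).1| < e / 2,
      `|('D_(1, 0) g (y1, y2)).2 - ('D_(1, 0) g p).2| < e / 2,
      `|('D_(0, 1) g (y1, y2)).1 - ('D_(0, 1) g p).1| < e / 2 &
      `|('D_(0, 1) g (y1, y2)).2 - ('D_(0, 1) g p).2| < e / 2].
  apply: (near_ball2 (Q := fun q => [/\ U q, `|('D_(1, 0) g q).1 - ('D_(1, 0) g p).1| < e / 2,
      `|('D_(1, 0) g q).2 - ('D_(1, 0) g p).2| < e / 2,
      `|('D_(0, 1) g q).1 - ('D_(0, 1) g p).1| < e / 2 &
      `|('D_(0, 1) g q).2 - ('D_(0, 1) g p).2| < e / 2])).
  exact: (near_and5 _ Un (nr _ _ a1) (nr _ _ a2) (nr _ _ b1) (nr _ _ b2)).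
exists d => // x y xp yp.
have p0 (z : R) : `|z - z| < d by rewrite subrr normr0.
have X (s : R * R -> R) : (s = fst \/ s = snd) ->
    `|s (g (x, y)) - s (g (p.1, y)) - s ('D_(1, 0) g p) * (x - p.1)| <= e / 2 * `|x - p.1|.
  move=> hs; apply: (@mvt_near (fun t => s (g (t, y))) (fun t => s ('D_(1, 0) g (t, y))) p.1 d) => //.
    move=> t ht; have [Ut _ _ _ _] := H t y ht yp; have [dg _ _ _] := gC _ Ut.
    by case: hs => ->; have [] := partial1 dg.
  by move=> t ht; have [_ h1 h2 _ _] := H t y ht yp; case: hs => ->; exact: ltW.
have Y (s : R * R -> R) : (s = fst \/ s = snd) ->
    `|s (g (p.1, y)) - s (g (p.1, p.2)) - s ('D_(0, 1) g p) * (y - p.2)| <= e / 2 * `|y - p.2|.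
  move=> hs; apply: (@mvt_near (fun t => s (g (p.1, t))) (fun t => s ('D_(0, 1) g (p.1, t))) p.2 d) => //.
    move=> t ht; have [Ut _ _ _ _] := H p.1 t (p0 _) ht; have [_ dg _ _] := gC _ Ut.
    by case: hs => ->; have [] := partial2 dg.
  by move=> t ht; have [_ _ _ h1 h2] := H p.1 t (p0 _) ht; case: hs => ->; exact: ltW.
have Z s (hs : s = fst \/ s = snd) : `|s (g (x, y)) - s (g p) - (s ('D_(1, 0) g p) * (x - p.1) +
    s ('D_(0, 1) g p) * (y - p.2))| <= e / 2 * (`|x - p.1| + `|y - p.2|).
  have -> : s (g p) = s (g (p.1, p.2)) by case: (p).
  by rewrite [X in _ <= X]mulrDr; exact: two_step (X _ hs) (Y _ hs).
rewrite [X in _ <= X * _]splitr mulrDl.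
exact: norm1_lin (Z fst (or_introl erefl)) (Z snd (or_intror erefl)).
Qed.

(** The map g in the definition of the degree winds like f by Rouche's theorem,
    and the argument principle with the indices of regular zeros evaluates its
    winding as the sum of the signs of the Jacobian. *)
Lemma degree_winding (f : R * R -> R * R) (G : R -> R -> K) k : ccont2 G ->
  (forall x y, in_rect (x, y) -> f (x, y) = (complex.Re (G x y), complex.Im (G x y))) ->
  is_brouwer_degree f U (0, 0) k -> k%:~R * (2 * pi) = winding G 0 1 (-1) 1.
Proof.
move=> cG fG [g [s [[cg gC] close reg [us sP] ->]]].
have n11 : -1 <= 1 :> R by rewrite -subr_ge0 opprK.
have n11' : -1 < 1 :> R by rewrite -subr_gt0 opprK.
(* The values of g on the closed rectangle, extended continuously to the plane. *)
pose H x y : K := (g (clamp 0 1 x, clamp (-1) 1 y)).1 +i* (g (clamp 0 1 x, clamp (-1) 1 y)).2.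
have cH : ccont2 H.
  have cc : continuous (fun p : R * R => g (clamp 0 1 p.1, clamp (-1) 1 p.2)).
    apply: (within_comp (A := closure U) (h := fun p : R * R => (clamp 0 1 p.1, clamp (-1) 1 p.2)) _ _ cg).
      move=> p; apply: (cvg_pair (F := nbhs p) (G := nbhs (clamp 0 1 p.1)) (H := nbhs (clamp (-1) 1 p.2))).
        by apply: (@cvg_comp _ _ _ fst (clamp 0 1)); [exact: cvg_fst|exact: clamp_cont].
      by apply: (@cvg_comp _ _ _ snd (clamp (-1) 1)); [exact: cvg_snd|exact: clamp_cont].
    by move=> p; apply/closure_rectP; split; exact: clampP.
  apply: ccont_ReIm => p; [exact: (cvg_pairl _ (cc p)).1|exact: (cvg_pairl _ (cc p)).2].
have HE x y : in_rect (x, y) -> H x y = (g (x, y)).1 +i* (g (x, y)).2.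
  by move=> [hx hy]; rewrite /H !clamp_id.
have bd p : in_rect p -> ~ in_int_rect p -> G p.1 p.2 != 0 /\ slit (H p.1 p.2 / G p.1 p.2).
  move=> Rp nUp; apply: slit_maxnorm; case: p Rp nUp => x y Rp nUp.
  have h := close (x, y) (x, y) (iffRL (closure_rectP _) Rp) (conj (iffRL (closure_rectP _) Rp) (fun h => nUp (iffLR (int_rectP _) h))).
  by move: h; rewrite subr0 !prod_normE /= fG// HE// !(cReD, cImD, cReN, cImN) /=.
have obd : on_bd (fun x y => G x y != 0 /\ slit (H x y / G x y)) 0 1 (-1) 1.
  split => [x hx|y hy]; split.
  - apply: (bd (x, -1)); first by split; rewrite //= lexx.
    by move=> [_] /=; rewrite ltxx.
  - apply: (bd (x, 1)); first by split; rewrite //= lexx andbT.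
    by move=> [_] /=; rewrite ltxx andbF.
  - apply: (bd (0, y)); first by split; rewrite //= lexx ler01.
    by move=> [] /=; rewrite ltxx.
  - apply: (bd (1, y)); first by split; rewrite //= lexx ler01.
    by move=> [] /=; rewrite ltxx andbF.
rewrite -(winding_rouche ler01 n11 cH cG obd).
apply/esym; apply: winding_sum => //.
- by move=> p /sP[/int_rectP].
- move=> x y hx hy H0; apply/sP; split.
    apply/int_rectP; apply: contrapT => nU; have [_] := bd (x, y) (conj hx hy) nU.
    by move=> /slit_neq0; rewrite /= H0 mul0r eqxx.
  by move: H0; rewrite HE//; case: (g (x, y)) => a b /= [-> ->].
- move=> p /sP[Up gp].
  have -> : jac g p = complex.Re (('D_(1, 0) g p).1 +i* ('D_(1, 0) g p).2) *
      complex.Im (('D_(0, 1) g p).1 +i* ('D_(0, 1) g p).2) -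
      complex.Im (('D_(1, 0) g p).1 +i* ('D_(1, 0) g p).2) *
      complex.Re (('D_(0, 1) g p).1 +i* ('D_(0, 1) g p).2).
    by rewrite /jac /= [X in _ - X]mulrC.
  apply: local_index_regular => //; last first.
    by have := reg p Up gp; rewrite /jac /= [X in _ - X]mulrC.
  move=> e e0; have [d d0 hd] := C1_diff_at gC Up e0.
  have [d1 d10 hd1] := near_ball2 (nbhs_interior Up).
  exists (Num.min d d1); first by rewrite lt_min d0.
  move=> x y; rewrite !lt_min => /andP[xd xd1] /andP[yd yd1].
  have Uxy := hd1 x y xd1 yd1.
  have Rxy : in_rect (x, y) by move: Uxy => /interior_subset/plane_OmegaE.
  by have := hd x y xd yd; rewrite gp /= !subr0 HE.
Qed.

End DegreeWinding.

(** * Smooth approximation by splines *)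

Section Spline.
Variable R : realType.
Implicit Types (a b : R -> R) (u v : R).

Definition pospart (u : R) := Num.max u 0.
Definition pospart2 u := pospart u ^+ 2.

Lemma pospart_cont : continuous pospart.
Proof.
by move=> x; apply: continuous_max; [exact: cvg_id|exact: cvg_cst].
Qed.

Lemma pospart0 u : u <= 0 -> pospart u = 0.
Proof. by move=> h; rewrite /pospart max_r. Qed.

Lemma pospart_id u : 0 <= u -> pospart u = u.
Proof. by move=> h; rewrite /pospart max_l. Qed.

Lemma pospart2_taylor u v : `|pospart2 v - pospart2 u - 2 * pospart u * (v - u)| <= (v - u) ^+ 2.
Proof.
have := sqr_ge0 (v - u); have := sqr_ge0 u; have := sqr_ge0 v.
rewrite /pospart2 ler_norml; have [u0|/ltW u0] := leP u 0; have [v0|/ltW v0] := leP v 0;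
  rewrite ?(pospart0 u0) ?(pospart0 v0) ?(pospart_id u0) ?(pospart_id v0) => h1 h2 h3.
- by apply/andP; split; lra.
- have h4 : 0 <= - u * v by rewrite mulr_ge0// oppr_ge0.
  by apply/andP; split; lra.
- have h4 : 0 <= u * - v by rewrite mulr_ge0// oppr_ge0.
  by apply/andP; split; lra.
- by apply/andP; split; lra.
Qed.

(** The quadratic B-spline with knots -3/2, -1/2, 1/2 and 3/2, as third difference of
    the truncated square; dbspline is its derivative. *)
Definition bspline u := (pospart2 (u + 3 / 2) - 3 * pospart2 (u + 1 / 2) + 3 * pospart2 (u - 1 / 2) - pospart2 (u - 3 / 2)) / 2.
Definition dbspline u := pospart (u + 3 / 2) - 3 * pospart (u + 1 / 2) + 3 * pospart (u - 1 / 2) - pospart (u - 3 / 2).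
(** A smooth step from 0 to 1; its differences are the B-splines, so that
    sums of translates telescope. *)
Definition step u := (pospart2 (u + 1) - 2 * pospart2 u + pospart2 (u - 1)) / 2.

Lemma step0 u : u <= -1 -> step u = 0.
Proof. by move=> h; rewrite /step /pospart2 !pospart0; [ring|lra..]. Qed.

Lemma step1 u : 1 <= u -> step u = 1.
Proof. by move=> h; rewrite /step /pospart2 !pospart_id; [field|lra..]. Qed.

Lemma bspline_step u : bspline u = step (u + 1 / 2) - step (u - 1 / 2).
Proof.
rewrite /bspline /step.
rewrite (_ : u + 1 / 2 + 1 = u + 3 / 2); last by field.
rewrite (_ : u + 1 / 2 - 1 = u - 1 / 2); last by field.
rewrite (_ : u - 1 / 2 + 1 = u + 1 / 2); last by field.
rewrite (_ : u - 1 / 2 - 1 = u - 3 / 2); last by field.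
by field.
Qed.

(** The sum telescopes to the difference of a step that has already reached 1 and
    one that is still 0. *)
Lemma bspline_sum u (m : nat) : 1 / 2 <= u -> u <= m%:R - 3 / 2 -> \sum_(i < m) bspline (u - i%:R) = 1.
Proof.
move=> h1 h2.
have -> : \sum_(i < m) bspline (u - i%:R) = step (u + 1 / 2) - step (u - m%:R + 1 / 2).
  elim: m {h2} => [|m IH]; first by rewrite big_ord0 subr0 subrr.
  rewrite big_ord_recr /= IH bspline_step addrA subrK; congr (_ - step _).
  by rewrite -natr1; field.
by rewrite step1 ?step0 ?subr0//; lra.
Qed.

Lemma bspline_supp u : 3 / 2 <= `|u| -> bspline u = 0.
Proof.
rewrite ler_normr => /orP[h|h]; rewrite /bspline /pospart2.
  by rewrite !pospart_id; [field|lra..].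
by rewrite !pospart0; [ring|lra..].
Qed.

Lemma dbspline_supp u : 3 / 2 <= `|u| -> dbspline u = 0.
Proof.
rewrite ler_normr => /orP[h|h]; rewrite /dbspline.
  by rewrite !pospart_id; [field|lra..].
by rewrite !pospart0; [ring|lra..].
Qed.

Lemma bspline_ge0 u : 0 <= bspline u.
Proof.
rewrite /bspline /pospart2; apply: divr_ge0 => //.
have [h1|/ltW h1] := leP (u + 3 / 2) 0.
  by rewrite !pospart0; [rewrite expr0n/=; lra|lra..].
rewrite (pospart_id h1); have [h2|/ltW h2] := leP (u + 1 / 2) 0.
  by rewrite !pospart0; [rewrite expr0n/=; nra|lra..].
rewrite (pospart_id h2); have [h3|/ltW h3] := leP (u - 1 / 2) 0.
  by rewrite !pospart0; [rewrite expr0n/=; nra|lra..].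
rewrite (pospart_id h3); have [h4|/ltW h4] := leP (u - 3 / 2) 0.
  by rewrite !pospart0; [rewrite expr0n/=; nra|lra..].
rewrite (pospart_id h4); nra.
Qed.

Lemma dbspline_cont : continuous dbspline.
Proof.
have c k : continuous (fun u : R => pospart (u + k)).
  move=> x; apply: (@cvg_comp _ _ _ (fun u : R => u + k) pospart); last exact: pospart_cont.
  by apply: cvgD; [exact: cvg_id|exact: cvg_cst].
move=> x; apply: cvgB; last exact: c.
apply: cvgD; last by apply: cvgM; [exact: cvg_cst|exact: c].
by apply: cvgB; [exact: c|apply: cvgM; [exact: cvg_cst|exact: c]].
Qed.

Lemma abs_sum4 (a b c d k : R) : `|a| <= k -> `|b| <= k -> `|c| <= k -> `|d| <= k ->
  `|a - 3 * b + 3 * c - d| <= 8 * k.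
Proof.
rewrite !ler_norml => /andP[? ?] /andP[? ?] /andP[? ?] /andP[? ?]; apply/andP; split; lra.
Qed.

Lemma pospart_bound u k : u <= k -> 0 <= k -> `|pospart u| <= k.
Proof.
move=> uk k0; have [h|/ltW h] := leP u 0; first by rewrite pospart0// normr0.
by rewrite pospart_id// ger0_norm.
Qed.

Lemma bspline_bound u : `|bspline u| <= 36 /\ `|dbspline u| <= 36.
Proof.
have [h|] := leP (3 / 2) `|u|; first by rewrite bspline_supp// dbspline_supp// normr0.
rewrite ltr_norml => /andP[h1 h2].
have p k : k <= 3 / 2 -> `|pospart (u + k)| <= 3 by move=> hk; apply: pospart_bound; lra.
have p2 k : k <= 3 / 2 -> `|pospart2 (u + k)| <= 9.
  move=> hk; rewrite /pospart2 normrX; have := p k hk; have := normr_ge0 (pospart (u + k)).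
  move: (`|pospart _|) => z z0 z3; nra.
split.
  rewrite /bspline normrM [`|2^-1|]gtr0_norm ?invr_gt0// ler_pdivrMr//.
  apply: (@le_trans _ _ (8 * 9)); last by lra.
  by apply: abs_sum4; apply: p2; lra.
apply: (@le_trans _ _ (8 * 3)); last by lra.
by apply: abs_sum4; apply: p; lra.
Qed.

Lemma bspline_taylor u v : `|bspline v - bspline u - dbspline u * (v - u)| <= 4 * (v - u) ^+ 2.
Proof.
have t k : `|pospart2 (v + k) - pospart2 (u + k) - 2 * pospart (u + k) * (v - u)| <= (v - u) ^+ 2.
  by have := pospart2_taylor (u + k) (v + k); rewrite (_ : v + k - (u + k) = v - u)//; ring.
have t1 := t (3 / 2); have t2 := t (1 / 2); have t3 := t (- (1 / 2)); have t4 := t (- (3 / 2)).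
have := abs_sum4 t1 t2 t3 t4.
rewrite [X in `|X| <= _](_ : _ = 2 * (bspline v - bspline u - dbspline u * (v - u))).
  by rewrite normrM gtr0_norm//; move: `|_| => X; lra.
by rewrite /bspline /dbspline; field.
Qed.

(** a' is a continuous derivative of a, with a global second-order Taylor
    estimate. Quadratic splines have such estimates, and they suffice for Sard's lemma
    without a second derivative. *)
Definition taylor1 a a' := [/\ continuous a', (exists2 L, 0 <= L & forall u v,
    `|a v - a u - a' u * (v - u)| <= L * (v - u) ^+ 2) &
  exists2 M, 0 <= M & forall u, `|a u| <= M /\ `|a' u| <= M].

Lemma taylor1_spl (k c : R) : taylor1 (fun x => bspline (k * x + c)) (fun x => k * dbspline (k * x + c)).
Proof.
have cl : continuous (fun x : R => k * x + c).
  move=> x; apply: cvgD; last exact: cvg_cst.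
  by apply: cvgM; [exact: cvg_cst|exact: cvg_id].
split.
- move=> x; apply: cvgM; first exact: cvg_cst.
  by apply: (@cvg_comp _ _ _ (fun x => k * x + c) dbspline); [exact: cl|exact: dbspline_cont].
- exists (4 * k ^+ 2); first by rewrite mulr_ge0// sqr_ge0.
  move=> u v; have := bspline_taylor (k * u + c) (k * v + c).
  have -> : k * v + c - (k * u + c) = k * (v - u) by ring.
  by rewrite mulrA [dbspline _ * k]mulrC exprMn mulrA.
- exists (36 * (1 + `|k|)); first by rewrite mulr_ge0// addr_ge0.
  move=> u; have [h1 h2] := bspline_bound (k * u + c); split.
    by apply: le_trans h1 _; rewrite ler_peMr// lerDl.
  rewrite normrM mulrC; apply: ler_pM => //.
  by rewrite lerDr.
Qed.

Definition taylor2 (f fx fy : R -> R -> R) := [/\ continuous (fun p : R * R => fx p.1 p.2),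
    continuous (fun p : R * R => fy p.1 p.2) &
  exists2 L, 0 <= L & forall x y,
    [/\ forall x' y', `|f x' y' - f x y - (fx x y * (x' - x) + fy x y * (y' - y))| <=
           L * (`|x' - x| + `|y' - y|) ^+ 2, `|fx x y| <= L & `|fy x y| <= L]].

Lemma taylor1_lip a a' : taylor1 a a' -> exists2 M, 0 <= M & forall u v, `|a v - a u| <= M * `|v - u|.
Proof.
move=> [_ [L L0 hL] [M M0 hM]]; exists (2 * M + L); first by rewrite addr_ge0// mulr_ge0.
move=> u v; have [h|h] := leP `|v - u| 1.
  have := hL u v; have [_ h2] := hM u.
  have h3 : `|a' u * (v - u)| <= M * `|v - u| by rewrite normrM ler_wpM2r.
  have h4 : L * (v - u) ^+ 2 <= L * `|v - u|.
    rewrite ler_wpM2l// -[(v - u) ^+ 2]real_normK ?num_real// expr2 ler_piMr//.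
  move=> h1; have -> : a v - a u = (a v - a u - a' u * (v - u)) + a' u * (v - u) by ring.
  apply: le_trans (ler_normD _ _) _; apply: le_trans (lerD h1 h3) _.
  have := normr_ge0 (v - u); move: `|v - u| h4 => z; move: (L * _ ^+ 2) => w; nra.
have [h1 _] := hM u; have [h2 _] := hM v.
apply: (@le_trans _ _ (2 * M + L)); last by rewrite ler_peMr ?addr_ge0 ?mulr_ge0// ltW.
apply: le_trans (ler_normB _ _) _; lra.
Qed.

Lemma taylor2_mul a a' b b' : taylor1 a a' -> taylor1 b b' ->
  taylor2 (fun x y => a x * b y) (fun x y => a' x * b y) (fun x y => a x * b' y).
Proof.
move=> na nb; have [Ka Ka0 lipa] := taylor1_lip na; have [Kb Kb0 lipb] := taylor1_lip nb.
have lipc (f : R -> R) (k : R) : (forall u v, `|f v - f u| <= k * `|v - u|) -> 0 <= k -> continuous f.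
  move=> lf k0 x; apply/cvgrPdistC_lt => e e0.
  apply/nbhs_ballP; exists (e / (k + 1)) => /=; first by rewrite divr_gt0// ltr_wpDl.
  move=> y; rewrite /ball /= distrC => yx; apply: le_lt_trans (lf _ _) _.
  apply: (@le_lt_trans _ _ ((k + 1) * `|y - x|)); first by rewrite ler_wpM2r// lerDl.
  by rewrite mulrC -ltr_pdivlMr// ltr_wpDl.
have ca := lipc _ _ lipa Ka0; have cb := lipc _ _ lipb Kb0.
case: na => ca' [La La0 hLa] [Ma Ma0 hMa]; case: nb => cb' [Lb Lb0 hLb] [Mb Mb0 hMb].
have cc (f g : R -> R) : continuous f -> continuous g -> continuous (fun p : R * R => f p.1 * g p.2).
  move=> cf cg p; apply: cvgM.
    by apply: (@cvg_comp _ _ _ fst f); [exact: cvg_fst|exact: cf].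
  by apply: (@cvg_comp _ _ _ snd g); [exact: cvg_snd|exact: cg].
split; [exact: cc|exact: cc|].
exists (La * Mb + Ma * Lb + Ma * Kb + Ma * Mb).
  by rewrite !addr_ge0// mulr_ge0.
move=> x y; have [hax ha'x] := hMa x; have [hby hb'y] := hMb y; split; last 2 first.
- rewrite normrM; apply: (@le_trans _ _ (Ma * Mb)); first by apply: ler_pM.
  by rewrite lerDr !addr_ge0// mulr_ge0.
- rewrite normrM; apply: (@le_trans _ _ (Ma * Mb)); first by apply: ler_pM.
  by rewrite lerDr !addr_ge0// mulr_ge0.
move=> x' y'.
have -> : a x' * b y' - a x * b y - (a' x * b y * (x' - x) + a x * b' y * (y' - y)) =
  (a x' - a x - a' x * (x' - x)) * b y' + (a x * (b y' - b y - b' y * (y' - y)) +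
  a' x * ((x' - x) * (b y' - b y))) by ring.
set dx := `|x' - x|; set dy := `|y' - y|.
have dx0 : 0 <= dx by exact: normr_ge0.
have dy0 : 0 <= dy by exact: normr_ge0.
have h1 : `|(a x' - a x - a' x * (x' - x)) * b y'| <= La * Mb * dx ^+ 2.
  rewrite normrM mulrAC; apply: ler_pM => //; last by have [] := hMb y'.
  by rewrite /dx real_normK ?num_real.
have h2 : `|a x * (b y' - b y - b' y * (y' - y))| <= Ma * Lb * dy ^+ 2.
  rewrite normrM -mulrA; apply: ler_pM => //.
  by rewrite /dy real_normK ?num_real.
have h3 : `|a' x * ((x' - x) * (b y' - b y))| <= Ma * Kb * (dx * dy).
  rewrite !normrM -mulrA [Kb * _]mulrCA; apply: ler_pM => //.
  by apply: ler_pM => //; exact: lipb.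
apply: le_trans (ler_normD _ _) _; apply: le_trans (lerD h1 (le_trans (ler_normD _ _) (lerD h2 h3))) _.
have m1 : 0 <= La * Mb by exact: mulr_ge0.
have m2 : 0 <= Ma * Lb by exact: mulr_ge0.
have m3 : 0 <= Ma * Kb by exact: mulr_ge0.
have m4 : 0 <= Ma * Mb by exact: mulr_ge0.
move: (La * Mb) (Ma * Lb) (Ma * Kb) (Ma * Mb) m1 m2 m3 m4 => A B C D A0 B0 C0 D0.
move: dx dy dx0 dy0 {h1 h2 h3} => s t s0 t0.
have h1 : 0 <= s * t by exact: mulr_ge0.
have h2 : s ^+ 2 <= (s + t) ^+ 2 by nra.
have h3 : t ^+ 2 <= (s + t) ^+ 2 by nra.
have h4 : s * t <= (s + t) ^+ 2 by nra.
have h5 : 0 <= (s + t) ^+ 2 by exact: sqr_ge0.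
move: (s * t) (s ^+ 2) (t ^+ 2) ((s + t) ^+ 2) h1 h2 h3 h4 h5 => st ss tt q *.
have := ler_wpM2l A0 (_ : ss <= q); have := ler_wpM2l B0 (_ : tt <= q); have := ler_wpM2l C0 (_ : st <= q).
move=> /(_ ltac:(assumption)) ? /(_ ltac:(assumption)) ? /(_ ltac:(assumption)) ?.
have ? : 0 <= D * q by exact: mulr_ge0.
lra.
Qed.

Lemma taylor2Z c f fx fy : taylor2 f fx fy ->
  taylor2 (fun x y => c * f x y) (fun x y => c * fx x y) (fun x y => c * fy x y).
Proof.
move=> [cx cy [L L0 hL]]; split.
- by move=> p; apply: cvgM; [exact: cvg_cst|exact: cx].
- by move=> p; apply: cvgM; [exact: cvg_cst|exact: cy].
exists (`|c| * L); first exact: mulr_ge0.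
move=> x y; have [h1 h2 h3] := hL x y; split; rewrite ?normrM ?ler_wpM2l// => x' y'.
rewrite -!mulrA -!mulrBr -mulrDr -mulrBr normrM ler_wpM2l//; exact: h1.
Qed.

Lemma taylor2D f fx fy g gx gy : taylor2 f fx fy -> taylor2 g gx gy ->
  taylor2 (fun x y => f x y + g x y) (fun x y => fx x y + gx x y) (fun x y => fy x y + gy x y).
Proof.
move=> [cx cy [L L0 hL]] [dx dy [M M0 hM]]; split.
- by move=> p; apply: cvgD; [exact: cx|exact: dx].
- by move=> p; apply: cvgD; [exact: cy|exact: dy].
exists (L + M); first exact: addr_ge0.
move=> x y; have [h1 h2 h3] := hL x y; have [k1 k2 k3] := hM x y; split.
- move=> x' y'; rewrite [X in _ <= X]mulrDl; apply: le_trans (lerD (h1 x' y') (k1 x' y')).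
  apply: le_trans _ (ler_normD _ _); rewrite le_eqVlt; apply/orP; left; apply/eqP.
  congr `|_|; ring.
- exact: le_trans (ler_normD _ _) (lerD h2 k2).
- exact: le_trans (ler_normD _ _) (lerD h3 k3).
Qed.

Lemma taylor2_cst c : taylor2 (fun _ _ => c) (fun _ _ => 0) (fun _ _ => 0).
Proof.
split; [by move=> p; exact: cvg_cst|by move=> p; exact: cvg_cst|].
exists 0 => // x y; split; rewrite ?normr0// => x' y'.
by rewrite !mul0r addr0 subr0 subrr normr0.
Qed.

Lemma taylor2_sum (I : Type) (r : seq I) (f fx fy : I -> R -> R -> R) :
  (forall i, taylor2 (f i) (fx i) (fy i)) ->
  taylor2 (fun x y => \sum_(i <- r) f i x y) (fun x y => \sum_(i <- r) fx i x y)
    (fun x y => \sum_(i <- r) fy i x y).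
Proof.
move=> H; elim: r => [|i r IH].
  have e (h : I -> R -> R -> R) : (fun x y => \sum_(j <- [::]) h j x y) = fun _ _ => 0.
    by apply/funext => x; apply/funext => y; rewrite big_nil.
  by rewrite !e; exact: taylor2_cst.
have e (h : I -> R -> R -> R) : (fun x y => \sum_(j <- i :: r) h j x y) =
    fun x y => h i x y + \sum_(j <- r) h j x y.
  by apply/funext => x; apply/funext => y; rewrite big_cons.
by rewrite !e; exact: taylor2D.
Qed.

End Spline.

(** * Sard's lemma in the plane *)

Section Sard.
Variable R : realType.
Implicit Types (p q : R * R).

(** The rows of a singular 2 x 2 matrix are dependent, with the larger
    coefficient normalised to 1. The dependence of a nonzero column is that of
    the whole matrix. *)
Lemma row_dependence (a b c d : R) : a * d - b * c = 0 -> exists al be : R,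
  [/\ al * a + be * c = 0, al * b + be * d = 0 &
      al = 1 /\ `|be| <= 1 \/ be = 1 /\ `|al| <= 1].
Proof.
move=> J.
have quot (x y : R) : `|x| <= `|y| -> `|x / y| <= 1.
  move=> xy; have [->|y0] := eqVneq y 0; first by rewrite invr0 mulr0 normr0.
  by rewrite normrM normfV ler_pdivrMr ?normr_gt0// mul1r.
have col x y : exists al be : R, al * x + be * y = 0 /\
    (al = 1 /\ `|be| <= 1 \/ be = 1 /\ `|al| <= 1).
  have [yx|/ltW xy] := leP `|y| `|x|.
    have [x0|x0] := eqVneq x 0.
      have y0 : y = 0 by apply/eqP; rewrite -normr_le0 (le_trans yx)// x0 normr0.
      by exists 1, 0; rewrite x0 y0 !mulr0 addr0 normr0; split => //; left.
    exists (- (y / x)), 1; split; first by field.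
    by right; rewrite normrN; split => //; exact: quot.
  have [y0|y0] := eqVneq y 0.
    have x0 : x = 0 by apply/eqP; rewrite -normr_le0 (le_trans xy)// y0 normr0.
    by exists 1, 0; rewrite x0 y0 !mulr0 addr0 normr0; split => //; left.
  exists 1, (- (x / y)); split; first by field.
  by left; rewrite normrN; split => //; exact: quot.
have [al [be [e h]]] := col a c.
have [a0|a0] := eqVneq a 0; last first.
  exists al, be; split => //; apply: (mulfI a0); rewrite mulr0.
  rewrite (_ : a * _ = b * (al * a + be * c) + be * (a * d - b * c)); last by ring.
  by rewrite e J !mulr0 addr0.
have [c0|c0] := eqVneq c 0; last first.
  exists al, be; split => //; apply: (mulfI c0); rewrite mulr0.
  rewrite (_ : c * _ = d * (al * a + be * c) - al * (a * d - b * c)); last by ring.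
  by rewrite e J !mulr0 subr0.
have [al' [be' [e' h']]] := col b d; exists al', be'; split => //.
by rewrite a0 c0 !mulr0 addr0.
Qed.

(** There are n^4 arguments and at most 6 c1 c2 n^3 values. *)
Lemma pigeon (n c1 c2 : nat) (f : 'I_(n * n) * 'I_(n * n) ->
    'I_n.+1 * 'I_(2 * n).+1 * 'I_(n * c1) * 'I_c2) :
  (6 * c1 * c2 < n)%N -> injective f -> False.
Proof.
move=> hn /leq_card; rewrite !card_prod !card_ord.
have n0 : (0 < n)%N by apply: leq_ltn_trans hn.
have h1 : (n.+1 <= 2 * n)%N by rewrite mul2n -addnn -addn1 leq_add2l.
have h2 : ((2 * n).+1 <= 3 * n)%N by rewrite [(3 * n)%N]mulSn -addn1 addnC leq_add2r.
apply/negP; rewrite -ltnNge.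
apply: (@leq_ltn_trans (2 * n * (3 * n) * (n * c1) * c2)).
  by rewrite !leq_mul.
have -> : (2 * n * (3 * n) * (n * c1) * c2 = n * n * n * (6 * c1 * c2))%N by ring.
have -> : (n * n * (n * n) = n * n * n * n)%N by ring.
by rewrite ltn_pmul2l// !muln_gt0 n0.
Qed.

Lemma trunc_close (x y : R) : 0 <= x -> 0 <= y -> Num.trunc x = Num.trunc y -> `|x - y| < 1.
Proof.
move=> x0 y0 e; have := truncn_itv x0; have := truncn_itv y0; rewrite e -natr1.
move: ((Num.trunc y)%:R : R) => k /andP[a b] /andP[c d].
by rewrite ltr_norml; apply/andP; split; lra.
Qed.

Variables (g1 g1x g1y g2 g2x g2y : R -> R -> R).
Hypothesis (N1 : taylor2 g1 g1x g1y) (N2 : taylor2 g2 g2x g2y).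
Definition jac2 p := g1x p.1 p.2 * g2y p.1 p.2 - g1y p.1 p.2 * g2x p.1 p.2.

Lemma common_bound : exists2 L, 1 <= L & forall x y,
  [/\ forall x' y', `|g1 x' y' - g1 x y - (g1x x y * (x' - x) + g1y x y * (y' - y))| <=
         L * (`|x' - x| + `|y' - y|) ^+ 2,
      forall x' y', `|g2 x' y' - g2 x y - (g2x x y * (x' - x) + g2y x y * (y' - y))| <=
         L * (`|x' - x| + `|y' - y|) ^+ 2,
      `|g1x x y| <= L /\ `|g1y x y| <= L &
      `|g2x x y| <= L /\ `|g2y x y| <= L].
Proof.
case: N1 => _ _ [L1 L10 h1]; case: N2 => _ _ [L2 L20 h2].
exists (1 + L1 + L2); first by rewrite -addrA lerDl addr_ge0.
have l1 : L1 <= 1 + L1 + L2 by lra.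
have l2 : L2 <= 1 + L1 + L2 by lra.
move=> x y; have [a b c] := h1 x y; have [a' b' c'] := h2 x y; split.
- by move=> x' y'; apply: le_trans (a _ _) _; rewrite ler_wpM2r// sqr_ge0.
- by move=> x' y'; apply: le_trans (a' _ _) _; rewrite ler_wpM2r// sqr_ge0.
- by split; [exact: le_trans l1|exact: le_trans l1].
- by split; [exact: le_trans l2|exact: le_trans l2].
Qed.

(** The second-order estimate implies a Lipschitz estimate at distance at most 1. *)
Lemma lip_bound (L a b u dx dy : R) : 1 <= L -> `|a| <= L -> `|b| <= L -> `|dx| + `|dy| <= 1 ->
  `|u - (a * dx + b * dy)| <= L * (`|dx| + `|dy|) ^+ 2 -> `|u| <= 2 * L * (`|dx| + `|dy|).
Proof.
move=> L1 ha hb t1 h.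
have -> : u = (u - (a * dx + b * dy)) + (a * dx + b * dy) by ring.
apply: le_trans (ler_normD _ _) _.
have h2 : `|a * dx + b * dy| <= L * (`|dx| + `|dy|).
  apply: le_trans (ler_normD _ _) _; rewrite !normrM mulrDr.
  by apply: lerD; apply: ler_wpM2r.
apply: le_trans (lerD h h2) _.
have : 0 <= `|dx| + `|dy| by rewrite addr_ge0.
move: (`|dx| + `|dy|) t1 => t t1 t0.
have : t ^+ 2 <= t by rewrite expr2 ler_piMr.
move=> tt; have := ler_wpM2l (le_trans ler01 L1) tt; lra.
Qed.

(** Along the dependence of the rows the first-order terms cancel. *)
Lemma comb_bound (L al be a b c d u1 u2 dx dy : R) : `|al| <= 1 -> `|be| <= 1 -> 0 <= L ->
  al * a + be * c = 0 -> al * b + be * d = 0 ->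
  `|u1 - (a * dx + b * dy)| <= L * (`|dx| + `|dy|) ^+ 2 ->
  `|u2 - (c * dx + d * dy)| <= L * (`|dx| + `|dy|) ^+ 2 ->
  `|al * u1 + be * u2| <= 2 * L * (`|dx| + `|dy|) ^+ 2.
Proof.
move=> ha hb L0 e1 e2 h1 h2.
have -> : al * u1 + be * u2 = al * (u1 - (a * dx + b * dy)) + be * (u2 - (c * dx + d * dy)) +
   ((al * a + be * c) * dx + (al * b + be * d) * dy) by ring.
rewrite e1 e2 !mul0r addr0 addr0 -mulrA [2 * _]mulr_natl mulr2n.
apply: le_trans (ler_normD _ _) _; rewrite !normrM; apply: lerD.
  by apply: le_trans h1; rewrite ler_piMl.
by apply: le_trans h2; rewrite ler_piMl.
Qed.

Lemma code_bound (x k s : R) (c : nat) : 0 < s -> `|x| <= k -> 2 * k * s < c%:R ->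
  0 <= (x + k) * s /\ (Num.trunc ((x + k) * s) < c)%N.
Proof.
rewrite ler_norml => s0 /andP[x1 x2] kc.
have p0 : 0 <= (x + k) * s by apply: mulr_ge0; [lra|exact: ltW].
split => //; rewrite truncn_lt_nat//; apply: le_lt_trans kc; rewrite ler_pM2r//; lra.
Qed.

(** If every value of a grid of n^2 x n^2 points in [0, eta]^2 were critical, choose
    for each of them a critical point and cut the rectangle into about n x 2n cells of side
    1 / n. Near a critical point of the cell the image is contained in a strip of
    length O (1/n) and width O (1/n^2), in the direction in which the differential
    degenerates; it contains O (n) grid points, as the mesh is eta / n^2. So
    there are O (n^3) grid points in all, fewer than n^4 for large n. *)
Lemma sard (eta : R) : 0 < eta -> exists v1 v2 : R,
  [/\ 0 <= v1 <= eta, 0 <= v2 <= eta &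
      forall p, in_rect p -> g1 p.1 p.2 = v1 -> g2 p.1 p.2 = v2 -> jac2 p != 0].
Proof.
move=> eta0; apply: contrapT => H.
have bad v1 v2 : 0 <= v1 <= eta -> 0 <= v2 <= eta ->
    exists p, [/\ in_rect p, g1 p.1 p.2 = v1, g2 p.1 p.2 = v2 & jac2 p = 0].
  move=> h1 h2; apply: contrapT => nb; apply: H; exists v1, v2; split => // p Rp e1 e2.
  by apply/eqP => J; apply: nb; exists p.
have [L L1 hL] := common_bound.
have L0 : 0 < L by exact: lt_le_trans L1.
(* In units of the mesh eta / n^2 a strip has length 2 (4 L / n) (n^2 / eta) =
   n (8 L / eta) and width 2 (8 L / n^2) (n^2 / eta) = 16 L / eta: n c1 boxes
   along it and c2 boxes across it suffice. *)
pose c1 := (Num.bound (8 * L / eta)).+1.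
pose c2 := (Num.bound (16 * L / eta)).+1.
have hc1 : 8 * L / eta < c1%:R.
  apply: (@lt_trans _ _ (Num.bound (8 * L / eta))%:R); last by rewrite ltr_nat.
  by apply: archi_boundP; rewrite divr_ge0 ?mulr_ge0// ltW.
have hc2 : 16 * L / eta < c2%:R.
  apply: (@lt_trans _ _ (Num.bound (16 * L / eta))%:R); last by rewrite ltr_nat.
  by apply: archi_boundP; rewrite divr_ge0 ?mulr_ge0// ltW.
pose n := (6 * c1 * c2).+1.
have n0 : 0 < n%:R :> R by rewrite ltr0n.
have n2 : 2 <= n%:R :> R.
  rewrite ler_nat ltnS !muln_gt0 //.
pose m := (n * n)%N.
have mR : m%:R = n%:R ^+ 2 :> R by rewrite natrM expr2.
have m0 : 0 < m%:R :> R by rewrite mR exprn_gt0.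
pose T := ('I_(n * n) * 'I_(n * n))%type.
pose val1 (k : 'I_(n * n)) : R := eta * k%:R / m%:R.
have val_in k : 0 <= val1 k <= eta.
  rewrite /val1; apply/andP; split; first by rewrite divr_ge0 ?mulr_ge0// ltW.
  by rewrite ler_pdivrMr// ler_pM2l// ler_nat ltnW.
have val_inj k l : `|(val1 k - val1 l) * (m%:R / eta)| < 1 -> k = l.
  rewrite (_ : (val1 k - val1 l) * (m%:R / eta) = k%:R - l%:R); last first.
    by rewrite /val1; field; rewrite !gt_eqF.
  have -> : k%:R - l%:R = (k%:Z - l%:Z)%:~R :> R by rewrite rmorphB.
  rewrite -intr_norm -[1]/(1%:~R) ltr_int => h; apply/val_inj/eqP; rewrite -eqz_nat -subr_eq0 -normr_le0.
  by rewrite -ltzD1.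
have [q hq] := choice (fun t : T => bad _ _ (val_in t.1) (val_in t.2)).
have cellP (a : R) (k : nat) : 0 <= a <= k%:R -> (Num.trunc (n%:R * a) < (k * n).+1)%N.
  move=> /andP[a0 ak]; rewrite ltnS truncn_le_nat.
  apply: (@le_lt_trans _ _ (n%:R * k%:R)); first by rewrite ler_pM2l.
  by rewrite -natrM mulnC ltr_nat.
have qx t : 0 <= (q t).1 <= 1%:R by have [[h _] _ _ _] := hq t.
have qy t : 0 <= (q t).2 + 1 <= 2%:R.
  by have [[_ /andP[h1 h2]] _ _ _] := hq t; apply/andP; split; lra.
pose cell t : 'I_n.+1 * 'I_(2 * n).+1 :=
  (inord (Num.trunc (n%:R * (q t).1)), Ordinal (cellP _ _ (qy t))).
have cellE t t' : cell t = cell t' ->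
    `|(q t).1 - (q t').1| + `|(q t).2 - (q t').2| <= 2 / n%:R.
  have aux (a b : R) : 0 <= a -> 0 <= b -> Num.trunc (n%:R * a) = Num.trunc (n%:R * b) ->
      `|a - b| <= 1 / n%:R.
    move=> a0 b0 e; rewrite ler_pdivlMr// -[X in _ * X]gtr0_norm// -normrM mulrBl ![_ * n%:R]mulrC.
    by apply/ltW/trunc_close; rewrite ?mulr_ge0// ltW.
  move=> [/(congr1 val) e1 e2].
  have {}e1 : Num.trunc (n%:R * (q t).1) = Num.trunc (n%:R * (q t').1).
    by move: e1; rewrite /= !inordK//; have := cellP _ 1%N (qx t); have := cellP _ 1%N (qx t'); rewrite mul1n.
  have /andP[a0 _] := qx t; have /andP[b0 _] := qx t'.
  have /andP[a1 _] := qy t; have /andP[b1 _] := qy t'.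
  have h1 := aux _ _ a0 b0 e1; have h2 := aux _ _ a1 b1 e2.
  have -> : (q t).2 - (q t').2 = (q t).2 + 1 - ((q t').2 + 1) by ring.
  by apply: le_trans (lerD h1 h2) _; rewrite -mulrDl.
have T0 : T by split; exists 0%N; rewrite muln_gt0.
pose rep c := odflt T0 [pick t | cell t == c].
have repE t : cell (rep (cell t)) = cell t.
  by rewrite /rep; case: pickP => [t' /eqP //|/(_ t)]; rewrite eqxx.
have [al hal] := choice (fun t : T => @row_dependence (g1x (q t).1 (q t).2) (g1y (q t).1 (q t).2)
   (g2x (q t).1 (q t).2) (g2y (q t).1 (q t).2) (let: And4 _ _ _ h := hq t in h)).
have [be hbe] := choice hal.
pose r t := rep (cell t).
pose w1 t := val1 t.1 - val1 (r t).1.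
pose w2 t := val1 t.2 - val1 (r t).2.
pose e t := al (r t) * w1 t + be (r t) * w2 t.
pose fl c : bool := al (rep c) == 1.
have flP t : (fl (cell t) /\ al (r t) = 1 /\ `|be (r t)| <= 1) \/
    (~~ fl (cell t) /\ be (r t) = 1 /\ `|al (r t)| <= 1).
  rewrite /fl -/(r t); have [_ _ [[h1 h2]|[h1 h2]]] := hbe (r t).
    by left; rewrite h1 eqxx.
  have [a1|a1] := eqVneq (al (r t)) 1; last by right.
  by left; rewrite a1 h1 normr1.
(* The coordinate that is tracked is the one whose coefficient is not
   normalised; the other one is then recovered from the combination e. *)
pose w t := if fl (cell t) then w2 t else w1 t.
have dist t : let dx := (q t).1 - (q (r t)).1 in let dy := (q t).2 - (q (r t)).2 in
   `|dx| + `|dy| <= 2 / n%:R by apply: cellE; rewrite /r repE.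
have n_ge2 : 2 / n%:R <= 1 :> R by rewrite ler_pdivrMr// mul1r.
have bw t : `|w1 t| <= 4 * L / n%:R /\ `|w2 t| <= 4 * L / n%:R.
  have d := dist t; have d1 := le_trans d n_ge2.
  have [_ e1 e2 _] := hq t; have [_ e1' e2' _] := hq (r t).
  have [h1 h2 [h3 h4] [h5 h6]] := hL (q (r t)).1 (q (r t)).2.
  have l1 := lip_bound L1 h3 h4 d1 (h1 (q t).1 (q t).2).
  have l2 := lip_bound L1 h5 h6 d1 (h2 (q t).1 (q t).2).
  have k : 2 * L * (`|(q t).1 - (q (r t)).1| + `|(q t).2 - (q (r t)).2|) <= 4 * L / n%:R.
    have -> : 4 * L / n%:R = 2 * L * (2 / n%:R) by field; rewrite gt_eqF.
    by rewrite ler_pM2l// mulr_gt0.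
  by rewrite /w1 /w2 -e1 -e1' -e2 -e2'; split; [exact: le_trans l1 k|exact: le_trans l2 k].
have be_ t : `|e t| <= 8 * L / n%:R ^+ 2.
  have d := dist t.
  have [_ e1 e2 _] := hq t; have [_ e1' e2' _] := hq (r t).
  have [h1 h2 _ _] := hL (q (r t)).1 (q (r t)).2.
  have [c_1 c_2 _] := hbe (r t).
  have [ha hb] : `|al (r t)| <= 1 /\ `|be (r t)| <= 1.
    by have [[_ [-> h]]|[_ [-> h]]] := flP t; rewrite normr1.
  have := comb_bound ha hb (ltW L0) c_1 c_2 (h1 (q t).1 (q t).2) (h2 (q t).1 (q t).2).
  rewrite e1 e1' e2 e2' -/(w1 t) -/(w2 t) -/(e t) => h; apply: le_trans h _.
  have -> : 8 * L / n%:R ^+ 2 = 2 * L * (2 / n%:R) ^+ 2 by field; rewrite gt_eqF.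
  rewrite ler_pM2l ?mulr_gt0// lerXn2r// ?nnegrE ?addr_ge0// divr_ge0// ltW.
have me : 0 < m%:R / eta by rewrite divr_gt0.
have codeP (x k : R) (c : nat) := @code_bound x k _ c me.
have wb t : `|w t| <= 4 * L / n%:R by rewrite /w; case: ifP => _; have [] := bw t.
have kc1 : 2 * (4 * L / n%:R) * (m%:R / eta) < (n * c1)%N%:R.
  rewrite mR natrM (_ : 2 * (4 * L / n%:R) * (n%:R ^+ 2 / eta) = n%:R * (8 * L / eta)).
    by rewrite ltr_pM2l.
  by field; rewrite !gt_eqF.
have kc2 : 2 * (8 * L / n%:R ^+ 2) * (m%:R / eta) < c2%:R.
  rewrite mR (_ : 2 * (8 * L / n%:R ^+ 2) * (n%:R ^+ 2 / eta) = 16 * L / eta)//.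
  by field; rewrite !gt_eqF.
pose code t : 'I_n.+1 * 'I_(2 * n).+1 * 'I_(n * c1) * 'I_c2 :=
  (cell t, Ordinal (codeP _ _ _ (wb t) kc1).2, Ordinal (codeP _ _ _ (be_ t) kc2).2).
(* It remains to see that equal codes come from equal grid points. *)
apply: (@pigeon n c1 c2 code) => //.
move=> t t' ct.
have cc : cell t = cell t' := congr1 (fun z => z.1.1) ct.
have rr : r t = r t' by rewrite /r cc.
have cw : Num.trunc ((w t + 4 * L / n%:R) * (m%:R / eta)) = Num.trunc ((w t' + 4 * L / n%:R) * (m%:R / eta)).
  exact: (congr1 (fun z => val z.1.2) ct).
have ce : Num.trunc ((e t + 8 * L / n%:R ^+ 2) * (m%:R / eta)) = Num.trunc ((e t' + 8 * L / n%:R ^+ 2) * (m%:R / eta)).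
  exact: (congr1 (fun z => val z.2) ct).
have := trunc_close (codeP _ _ _ (wb t) kc1).1 (codeP _ _ _ (wb t') kc1).1 cw.
rewrite -mulrBl opprD addrACA subrr addr0 => hw.
have := trunc_close (codeP _ _ _ (be_ t) kc2).1 (codeP _ _ _ (be_ t') kc2).1 ce.
rewrite -mulrBl opprD addrACA subrr addr0 => he.
case: t t' ct cc rr cw ce hw he => [i j] [i' j'] ct cc rr cw ce hw he.
have w1E : w1 (i, j) - w1 (i', j') = val1 i - val1 i' by rewrite /w1 rr /=; ring.
have w2E : w2 (i, j) - w2 (i', j') = val1 j - val1 j' by rewrite /w2 rr /=; ring.
have eE : e (i, j) - e (i', j') = al (r (i', j')) * (val1 i - val1 i') + be (r (i', j')) * (val1 j - val1 j').
  by rewrite -w1E -w2E /e rr; ring.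
move: hw he; rewrite eE /w cc.
have [[f1 [a1 _]]|[f1 [b1 _]]] := flP (i', j').
  rewrite f1 w2E => /val_inj jj; rewrite jj a1 subrr mulr0 addr0 mul1r => /val_inj ->.
  by [].
rewrite (negbTE f1) w1E => /val_inj ii; rewrite ii b1 subrr mulr0 add0r mul1r => /val_inj ->.
by [].
Qed.

End Sard.

(** * Existence of approximations that compute the degree *)

Section DegreeExists.
Variable R : realType.
Local Notation K := R[i].
Implicit Types (p q : R * R).
Local Notation U := ((plane_set (@Omega R))°).

Lemma pair_cont (f1 f2 : R * R -> R) p : f1 @ p --> f1 p -> f2 @ p --> f2 p ->
  (fun q => (f1 q, f2 q)) @ p --> (f1 p, f2 p).
Proof. by move=> c1 c2; apply: (cvg_pair (F := nbhs p) (G := nbhs (f1 p)) (H := nbhs (f2 p))). Qed.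

Lemma taylor2_cont (f fx fy : R -> R -> R) : taylor2 f fx fy -> continuous (fun p : R * R => f p.1 p.2).
Proof.
move=> [_ _ [L L0 hL]] p; apply/cvgrPdistC_lt => e e0.
have [h1 h2 h3] := hL p.1 p.2.
have L1 : 1 <= L + 1 by rewrite lerDr.
pose d := Num.min (1 / 2) (e / (8 * (L + 1))) : R.
have d0 : 0 < d by rewrite lt_min !divr_gt0// mulr_gt0// ltr_wpDl.
apply: filterS (nbhs_box p d0) => -[x y] [/= xd yd].
have t2 : `|x - p.1| + `|y - p.2| < 2 * d by rewrite mulr_natl mulr2n; exact: ltrD.
have d1 : d <= 1 / 2 by rewrite ge_min lexx.
have de : d <= e / (8 * (L + 1)) by rewrite ge_min lexx orbT.
have t1 : `|x - p.1| + `|y - p.2| <= 1 by apply: le_trans (ltW t2) _; lra.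
have LL : L <= L + 1 by rewrite lerDl.
have h : `|f x y - f p.1 p.2 - (fx p.1 p.2 * (x - p.1) + fy p.1 p.2 * (y - p.2))| <=
    (L + 1) * (`|x - p.1| + `|y - p.2|) ^+ 2.
  by apply: le_trans (h1 x y) _; rewrite ler_wpM2r ?sqr_ge0.
apply: le_lt_trans (lip_bound L1 (le_trans h2 LL) (le_trans h3 LL) t1 h) _.
apply: (@lt_le_trans _ _ (2 * (L + 1) * (2 * d))).
  by rewrite ltr_pM2l// mulr_gt0// ltr_wpDl.
apply: (@le_trans _ _ (2 * (L + 1) * (2 * (e / (8 * (L + 1)))))).
  by rewrite ler_pM2l ?ler_pM2l// mulr_gt0// ltr_wpDl.
have -> : 2 * (L + 1) * (2 * (e / (8 * (L + 1)))) = e / 2.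
  by field; rewrite gt_eqF// ltr_wpDl.
by rewrite ler_pdivrMr// ler_peMr ?ltW// ltr1n.
Qed.

Lemma quot_cvg (f : R -> R) (x a L : R) : 0 <= L ->
  (forall y, `|f y - f x - a * (y - x)| <= L * `|y - x| ^+ 2) ->
  h^-1 * (f (h + x) - f x) @[h --> 0^'] --> a.
Proof.
move=> L0 H; apply/cvgrPdistC_lt => e e0.
have L1 : 0 < L + 1 by rewrite ltr_wpDl.
apply/nbhs_ballP; exists (e / (L + 1)) => /=; first by rewrite divr_gt0.
move=> h; rewrite /ball /= sub0r normrN => hd h0.
have hp : 0 < `|h| by rewrite normr_gt0.
have := H (h + x); rewrite addrK => hh.
have -> : h^-1 * (f (h + x) - f x) - a = h^-1 * (f (h + x) - f x - a * h) by field.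
rewrite normrM normfV ltr_pdivrMl//; apply: le_lt_trans hh _.
rewrite expr2 mulrA mulrC ltr_pM2l//.
apply: (@le_lt_trans _ _ ((L + 1) * `|h|)); first by rewrite ler_wpM2r// lerDl.
by rewrite mulrC -ltr_pdivlMr.
Qed.

Variables (g1 g1x g1y g2 g2x g2y : R -> R -> R).
Hypothesis (N1 : taylor2 g1 g1x g1y) (N2 : taylor2 g2 g2x g2y).

Let g p := (g1 p.1 p.2, g2 p.1 p.2).

Lemma taylor2_slices (f fx fy : R -> R -> R) x y : taylor2 f fx fy ->
  h^-1 * (f (h + x) y - f x y) @[h --> 0^'] --> fx x y /\
  h^-1 * (f x (h + y) - f x y) @[h --> 0^'] --> fy x y.
Proof.
move=> [_ _ [L L0 hL]]; have [h _ _] := hL x y; split.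
  apply: (quot_cvg (f := f^~ y) L0) => x'; have := h x' y.
  by rewrite subrr mulr0 addr0 normr0 addr0.
apply: (quot_cvg (f := f x) L0) => y'; have := h x y'.
by rewrite subrr mulr0 add0r normr0 add0r.
Qed.

Lemma taylor2_D1 p : derivable g p (1, 0) /\ 'D_(1, 0) g p = (g1x p.1 p.2, g2x p.1 p.2).
Proof.
have [c1 _] := taylor2_slices p.1 p.2 N1; have [c2 _] := taylor2_slices p.1 p.2 N2.
have c : h^-1 *: ((g \o shift p) (h *: ((1, 0) : R * R)) - g p) @[h --> 0^'] -->
    (g1x p.1 p.2, g2x p.1 p.2).
  rewrite (_ : (fun h : R => _) = fun h => (h^-1 * (g1 (h + p.1) p.2 - g1 p.1 p.2),
     h^-1 * (g2 (h + p.1) p.2 - g2 p.1 p.2))).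
    exact: (cvg_pair c1 c2).
  by apply/funext => h; rewrite /g /= scaler0 add0r /GRing.scale /= mulr1.
by split; [exact: cvgP c|exact: cvg_lim c].
Qed.

Lemma taylor2_D2 p : derivable g p (0, 1) /\ 'D_(0, 1) g p = (g1y p.1 p.2, g2y p.1 p.2).
Proof.
have [_ c1] := taylor2_slices p.1 p.2 N1; have [_ c2] := taylor2_slices p.1 p.2 N2.
have c : h^-1 *: ((g \o shift p) (h *: ((0, 1) : R * R)) - g p) @[h --> 0^'] -->
    (g1y p.1 p.2, g2y p.1 p.2).
  rewrite (_ : (fun h : R => _) = fun h => (h^-1 * (g1 p.1 (h + p.2) - g1 p.1 p.2),
     h^-1 * (g2 p.1 (h + p.2) - g2 p.1 p.2))).
    exact: (cvg_pair c1 c2).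
  by apply/funext => h; rewrite /g /= scaler0 add0r /GRing.scale /= mulr1.
by split; [exact: cvgP c|exact: cvg_lim c].
Qed.

Lemma taylor2_C1 (V : set (R * R)) : C1_on V g.
Proof.
case: N1 => c1 c2 _; case: N2 => d1 d2 _.
move=> p _; have [h1 _] := taylor2_D1 p; have [h2 _] := taylor2_D2 p; split; [exact: h1|exact: h2| |].
  rewrite (_ : (fun q => _) = fun q => (g1x q.1 q.2, g2x q.1 q.2)).
    by apply: (pair_cont (f1 := fun q => g1x q.1 q.2)); [exact: c1|exact: d1].
  by apply/funext => q; have [_ ->] := taylor2_D1 q.
rewrite (_ : (fun q => _) = fun q => (g1y q.1 q.2, g2y q.1 q.2)).
  by apply: (pair_cont (f1 := fun q => g1y q.1 q.2)); [exact: c2|exact: d2].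
by apply/funext => q; have [_ ->] := taylor2_D2 q.
Qed.

Lemma taylor2_jac p : jac g p = jac2 g1x g1y g2x g2y p.
Proof. by rewrite /jac; have [_ ->] := taylor2_D1 p; have [_ ->] := taylor2_D2 p. Qed.

(** If q is another solution near p, the linear part at p of q - p is of second order in
    q - p; by Cramer's rule so is q - p itself, up to the factor 1 / J, which
    forces q = p once q is close to p. *)
Lemma isolated_zero p : jac2 g1x g1y g2x g2y p != 0 -> exists2 d : R, 0 < d &
  forall q, `|q.1 - p.1| < d -> `|q.2 - p.2| < d -> g q = g p -> q = p.
Proof.
move=> J0; have [L L1 hL] := common_bound N1 N2.
have [h1 h2 [b1 b2] [b3 b4]] := hL p.1 p.2.
set J := jac2 _ _ _ _ p in J0.
have L0 : 0 < L by exact: lt_le_trans L1.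
have Jp : 0 < `|J| by rewrite normr_gt0.
exists (`|J| / (8 * L ^+ 2)); first by rewrite divr_gt0// mulr_gt0// exprn_gt0.
case=> x y /= xd yd [e1 e2].
have := h1 x y; have := h2 x y; rewrite e1 e2 !subrr !sub0r !normrN.
set dx := x - p.1; set dy := y - p.2; set t := `|dx| + `|dy| => k2 k1.
have t0 : 0 <= t by rewrite addr_ge0.
have td : t < `|J| / (4 * L ^+ 2).
  have -> : `|J| / (4 * L ^+ 2) = `|J| / (8 * L ^+ 2) + `|J| / (8 * L ^+ 2).
    by field; rewrite gt_eqF.
  exact: ltrD.
have cr (a b u v : R) : `|a| <= L -> `|b| <= L -> `|u| <= L * t ^+ 2 -> `|v| <= L * t ^+ 2 ->
    `|a * u - b * v| <= 2 * L ^+ 2 * t ^+ 2.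
  move=> ha hb hu hv; apply: le_trans (ler_normB _ _) _; rewrite !normrM.
  rewrite (_ : 2 * L ^+ 2 * t ^+ 2 = L * (L * t ^+ 2) + L * (L * t ^+ 2)); last by ring.
  by apply: lerD; apply: ler_pM.
have X : `|J| * `|dx| <= 2 * L ^+ 2 * t ^+ 2.
  rewrite -normrM (_ : J * dx = g2y p.1 p.2 * (g1x p.1 p.2 * dx + g1y p.1 p.2 * dy) -
    g1y p.1 p.2 * (g2x p.1 p.2 * dx + g2y p.1 p.2 * dy)); first exact: cr.
  by rewrite /J /jac2; ring.
have Y : `|J| * `|dy| <= 2 * L ^+ 2 * t ^+ 2.
  rewrite -normrM (_ : J * dy = g1x p.1 p.2 * (g2x p.1 p.2 * dx + g2y p.1 p.2 * dy) -
    g2x p.1 p.2 * (g1x p.1 p.2 * dx + g1y p.1 p.2 * dy)); first exact: cr.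
  by rewrite /J /jac2; ring.
have Z : `|J| * t <= 4 * L ^+ 2 * t * t.
  rewrite /t mulrDr; apply: le_trans (lerD X Y) _; rewrite -/t le_eqVlt; apply/orP; left.
  by apply/eqP; ring.
have tz : t = 0.
  apply/eqP; rewrite eq_le t0 andbT leNgt; apply/negP => tp.
  move: Z; rewrite ler_pM2r// leNgt => /negP; apply.
  by rewrite mulrC -ltr_pdivlMr// mulr_gt0// exprn_gt0.
move: tz => /eqP; rewrite paddr_eq0 ?normr_ge0// !normr_eq0 !subr_eq0 => /andP[/eqP-> /eqP->].
by case: (p).
Qed.

Lemma box_compact : compact [set p : R * R | in_rect p].
Proof.
rewrite (_ : [set p | _] = `[0, 1]%classic `*` `[-1, 1]%classic).
  by apply: compact_setX; exact: segment_compact.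
apply/seteqP; split => -[x y] /=; rewrite !in_itv //=.
Qed.

(** Every point has a neighbourhood with at most one zero. The
    compactness is used through the filter of sets of lists that contain all lists
    extending some given one. *)
Lemma finite_zeros : (forall p, in_rect p -> g p = 0 -> jac2 g1x g1y g2x g2y p != 0) ->
  exists s : seq (R * R), forall p, in_rect p -> g p = 0 -> p \in s.
Proof.
move=> reg.
have H p : exists d : R, 0 < d /\ (in_rect p -> forall q, `|q.1 - p.1| < d -> `|q.2 - p.2| < d ->
    in_rect q -> g q = 0 -> q = p).
  have [g0|g0] := eqVneq (g p) 0.
    have [Rp|nR] := pselect (in_rect p); last by exists 1.
    have [d d0 hd] := isolated_zero (reg p Rp g0).
    by exists d; split => // _ q h1 h2 _ gq; apply: hd => //; rewrite gq g0.
  have cg : {for p, continuous g}.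
    by apply: (pair_cont (f1 := fun q => g1 q.1 q.2)); [exact: (taylor2_cont N1)|exact: (taylor2_cont N2)].
  have : \forall q \near p, g q != 0.
    have gp : 0 < `|g p| by rewrite normr_gt0.
    move: cg => /cvgr_distC_lt /(_ _ gp); apply: filterS => q; rewrite distrC => hq.
    by apply: contraTN hq => /eqP->; rewrite subr0 ltxx.
  move=> /near_ball2[d d0 hd]; exists d; split => // _ [x y] h1 h2 _ gq.
  by have := hd x y h1 h2; rewrite gq eqxx.
have [d hd] := choice H.
(* A list may be enlarged, so that near this filter means for some list and
   all larger ones. *)
pose FF : set_system (seq (R * R)) := 
  [set A | exists s0 : seq (R * R), forall s : seq (R * R), {subset s0 <= s} -> A s].
have fFF : Filter FF.
  split.
  - by exists [::].
  - move=> A B [s hA] [s' hB]; exists (s ++ s') => t st; split.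
      by apply: hA => x xs; apply: st; rewrite mem_cat xs.
    by apply: hB => x xs; apply: st; rewrite mem_cat xs orbT.
  - by move=> A B AB [s hA]; exists s => t st; apply: AB; exact: hA.
have := box_compact => /compact_near_coveringP.
move=> /(_ _ FF (fun s p => in_rect p -> g p = 0 -> p \in s) fFF) HH.
have [|s hs] := HH.
  move=> p Rp; exists ([set q | `|q.1 - p.1| < d p /\ `|q.2 - p.2| < d p], [set s : seq (R * R) | p \in s]).
    split; first exact: nbhs_box (hd p).1.
    by exists [:: p] => s /(_ p); rewrite inE; apply.
  move=> [q s] [/= [h1 h2] ps] Rq gq.
  by rewrite ((hd p).2 Rp q h1 h2 Rq gq).
by exists s => p Rp gp; apply: (hs s).
Qed.

End DegreeExists.

Section Approximation.
Variable R : realType.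
Local Notation K := R[i].
Implicit Types (p q : R * R).
Local Notation U := ((plane_set (@Omega R))°).

Lemma uniform_box (G : R -> R -> K) (e : R) : ccont2 G -> 0 < e ->
  exists2 d : R, 0 < d & forall p q, in_rect p -> in_rect q -> `|q.1 - p.1| < d -> `|q.2 - p.2| < d ->
    norm1 (G q.1 q.2 - G p.1 p.2) < e.
Proof.
move=> cG e0; have e2 : 0 < e / 2 by rewrite divr_gt0.
have := @box_compact R => /compact_near_coveringP.
move=> /(_ R (nbhs (0 : R)) (fun d p => forall q, `|q.1 - p.1| < d -> `|q.2 - p.2| < d ->
  norm1 (G q.1 q.2 - G p.1 p.2) < e) _) HH.
have : \forall d \near (0 : R), [set p | in_rect p] `<=` (fun p => forall q, `|q.1 - p.1| < d ->
    `|q.2 - p.2| < d -> norm1 (G q.1 q.2 - G p.1 p.2) < e).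
  apply: HH => p _.
  have [r r0 hr] := near_ball2 (ccvg_norm1 (cG p) e2).
  have r2 : 0 < r / 2 by rewrite divr_gt0.
  exists ([set q | `|q.1 - p.1| < r / 2 /\ `|q.2 - p.2| < r / 2], [set d : R | `|d - 0| < r / 2]).
    split; first exact: nbhs_box.
    by apply/nbhs_ballP; exists (r / 2) => //= y; rewrite /ball /= distrC.
  move=> [q d] [/= [q1 q2]]; rewrite subr0 ltr_norml => /andP[_ dr] q' h1 h2.
  have tri (a b c : R) : `|b - a| < r / 2 -> `|c - b| < d -> `|c - a| < r.
    move=> u v; rewrite -(subrKA b) addrC; apply: le_lt_trans (ler_normD _ _) _; rewrite distrC in u.
    by rewrite [`|a - b|]distrC in u; lra.
  have rr : r / 2 < r by rewrite ltr_pdivrMr// ltr_pMr// ltr1n.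
  have k1 := hr _ _ (tri _ _ _ q1 h1) (tri _ _ _ q2 h2).
  have k2 := hr _ _ (lt_trans q1 rr) (lt_trans q2 rr).
  rewrite /= in k1 k2.
  rewrite (_ : G q'.1 q'.2 - G q.1 q.2 = (G q'.1 q'.2 - G p.1 p.2) + - (G q.1 q.2 - G p.1 p.2)); last by ring.
  apply: le_lt_trans (norm1D _ _) _; rewrite norm1N; lra.
move=> /near_ball1[d d0 hd]; exists (d / 2); first by rewrite divr_gt0.
move=> p q Rp _ h1 h2; apply: (hd (d / 2) _ p Rp) => //.
by rewrite subr0 gtr0_norm ?divr_gt0// ltr_pdivrMr// ltr_pMr// ltr1n.
Qed.

Lemma clamp_dist (a b x y : R) : a <= x <= b -> `|clamp a b y - x| <= `|y - x|.
Proof.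
move=> /andP[ax xb]; rewrite /clamp; have [yb|/ltW yb] := leP y b.
  have [ya|/ltW ya] := leP a y => //.
  by rewrite ler0_norm ?subr_le0// ler0_norm ?subr_le0 ?(le_trans ya)// lerN2 lerD2r.
rewrite max_r; last by exact: le_trans xb.
by rewrite ger0_norm ?subr_ge0// ger0_norm ?subr_ge0 ?(le_trans xb)// lerD2r.
Qed.

(** Values of h at the nodes of a grid of mesh 1 / n weighted by a partition of
    unity of tensor B-splines. Weights are nonnegative and vanish
    unless the node is within 3 / (2 n) < d of the point. Nodes that fall outside
    the rectangle are clamped to it. *)
Lemma approx (h : R -> R -> R) (e d : R) : 0 <= e -> 0 < d ->
  (forall p q, in_rect p -> in_rect q -> `|q.1 - p.1| < d -> `|q.2 - p.2| < d ->
    `|h q.1 q.2 - h p.1 p.2| <= e) ->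
  exists g gx gy, taylor2 g gx gy /\ forall x y, in_rect (x, y) -> `|g x y - h x y| <= e.
Proof.
move=> e0 d0 unif.
pose n := (Num.bound (2 / d)).+1.
have nd : 2 / d < n%:R.
  apply: (@lt_trans _ _ (Num.bound (2 / d))%:R); last by rewrite ltr_nat.
  by apply: archi_boundP; rewrite divr_ge0// ltW.
have n0 : 0 < n%:R :> R by rewrite ltr0n.
have nz : n%:R != 0 :> R by rewrite gt_eqF.
pose nx (i : nat) : R := clamp 0 1 ((i%:R - 1) / n%:R).
pose ny (j : nat) : R := clamp (-1) 1 ((j%:R - 1) / n%:R - 1).
pose bx (i : nat) (x : R) := bspline (n%:R * x + (1 - i%:R)).
pose by_ (j : nat) (y : R) := bspline (n%:R * y + (n%:R + 1 - j%:R)).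
(* Nodes outside the rectangle are included, because the supports of the
   splines have half-width 3/2 in units of the mesh. *)
pose m1 := (n + 4)%N; pose m2 := (2 * n + 4)%N.
have nice := taylor2_sum (index_enum 'I_m1) (fun i : 'I_m1 => taylor2_sum (index_enum 'I_m2) (fun j : 'I_m2 =>
  taylor2Z (h (nx i) (ny j)) (taylor2_mul (taylor1_spl n%:R (1 - i%:R)) (taylor1_spl n%:R (n%:R + 1 - j%:R))))).
do 3 eexists; split; first exact: nice.
move=> x y [/= hx hy]; have /andP[x0 x1] := hx; have /andP[y0 y1] := hy.
have sx : \sum_(i < m1) bx i x = 1.
  rewrite -[RHS](@bspline_sum R (n%:R * x + 1) m1).
  - by apply: eq_bigr => i _; rewrite /bx addrA.
  - have : 0 <= n%:R * x by rewrite mulr_ge0// ltW. by lra.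
  - have : n%:R * x <= n%:R by rewrite ler_piMr// ltW. by rewrite /m1 natrD; lra.
have sy : \sum_(j < m2) by_ j y = 1.
  rewrite -[RHS](@bspline_sum R (n%:R * y + (n%:R + 1)) m2).
  - by apply: eq_bigr => i _; rewrite /by_ addrA.
  - have : 0 <= n%:R * (y + 1) by apply: mulr_ge0; [exact: ltW|rewrite -lerBlDr sub0r]. by rewrite mulrDr mulr1; lra.
  - have : n%:R * y <= n%:R by rewrite ler_piMr// ltW. by rewrite /m2 natrD natrM; lra.
have one : \sum_(i < m1) \sum_(j < m2) (bx i x * by_ j y) = 1.
  by rewrite -[RHS]mulr1 -{1}sx -sy mulr_suml; apply: eq_bigr => i _; rewrite mulr_sumr.
have wsum c : c = \sum_(i < m1) \sum_(j < m2) c * (bx i x * by_ j y).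
  rewrite -[LHS]mulr1 -[X in _ * X = _]one mulr_sumr; apply: eq_bigr => i _.
  by rewrite mulr_sumr.
have -> : \sum_(i < m1) \sum_(j < m2) h (nx i) (ny j) *
    (bspline (n%:R * x + (1 - i%:R)) * bspline (n%:R * y + (n%:R + 1 - j%:R))) - h x y =
  \sum_(i < m1) \sum_(j < m2) (h (nx i) (ny j) - h x y) * (bx i x * by_ j y).
  rewrite [X in _ - X]wsum -sumrB; apply: eq_bigr => i _.
  by rewrite -sumrB; apply: eq_bigr => j _; rewrite mulrBl.
rewrite [X in _ <= X]wsum; apply: le_trans (ler_norm_sum _ _ _) _.
apply: ler_sum => i _; apply: le_trans (ler_norm_sum _ _ _) _.
apply: ler_sum => j _; have wpos : 0 <= bx i x * by_ j y by exact: mulr_ge0 (bspline_ge0 _) (bspline_ge0 _).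
rewrite normrM (ger0_norm wpos).
have close (u k s c : R) : `|n%:R * (u - s)| < 3 / 2 -> s = c -> `|c - u| < d.
  move=> hu <-; rewrite distrC.
  move: hu; rewrite normrM gtr0_norm// => hu.
  rewrite -(ltr_pM2l n0); apply: lt_trans hu _.
  by move: nd; rewrite ltr_pdivrMr//; lra.
have [bx0|bx0] := eqVneq (bx i x) 0; first by rewrite bx0 mul0r !mulr0.
have [by0|by0] := eqVneq (by_ j y) 0; first by rewrite by0 !mulr0.
apply: ler_wpM2r => //; apply: (unif (x, y) (nx i, ny j)) => /=.
- by split.
- by split; apply: clampP => //; lra.
- apply: le_lt_trans (clamp_dist _ hx) _; apply: (close x 0 _ _ _ erefl).
  rewrite ltNge; apply: contra bx0 => hh; rewrite /bx bspline_supp//.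
  by rewrite (_ : n%:R * x + (1 - i%:R) = n%:R * (x - (i%:R - 1) / n%:R))//; field.
- apply: le_lt_trans (clamp_dist _ hy) _; apply: (close y 0 _ _ _ erefl).
  rewrite ltNge; apply: contra by0 => hh; rewrite /by_ bspline_supp//.
  by rewrite (_ : n%:R * y + (n%:R + 1 - j%:R) = n%:R * (y - ((j%:R - 1) / n%:R - 1)))//; field.
Qed.

Lemma edge_bound (f : R -> K) (a b : R) : a <= b -> ccont f ->
  (forall x, a <= x <= b -> f x != 0) ->
  exists2 e : R, 0 < e & forall x, a <= x <= b -> e <= norm1 (f x).
Proof.
move=> ab cf nz.
have [c cab hc] := EVT_min ab (continuous_subspaceT (norm1_cont cf)).
exists (norm1 (f c)); last by move=> x hx; apply: hc; rewrite in_itv.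
by rewrite lt_neqAle norm1_ge0 andbT eq_sym norm1_eq0 nz// -in_itv.
Qed.

Lemma boundary_bound (G : R -> R -> K) : ccont2 G ->
  (forall x y, in_rect (x, y) -> ~ in_int_rect (x, y) -> G x y != 0) ->
  exists2 e : R, 0 < e & forall x y, in_rect (x, y) -> ~ in_int_rect (x, y) -> e <= norm1 (G x y).
Proof.
move=> cG nz.
have n11 : -1 <= 1 :> R by rewrite -subr_ge0 opprK.
have l0 : 0 <= (0 : R) <= 1 by rewrite lexx ler01.
have l1 : 0 <= (1 : R) <= 1 by rewrite lexx ler01.
have m0 : -1 <= (-1 : R) <= 1 by rewrite lexx n11.
have m1 : -1 <= (1 : R) <= 1 by rewrite lexx n11.
have [e1 e10 h1] := edge_bound n11 (ccont2r 0 cG) (fun y hy => nz 0 y (conj l0 hy)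
  (fun h => let: conj a _ := h in ltac:(by move: a; rewrite /= ltxx))).
have [e2 e20 h2] := edge_bound n11 (ccont2r 1 cG) (fun y hy => nz 1 y (conj l1 hy)
  (fun h => let: conj a _ := h in ltac:(by move: a; rewrite /= ltxx andbF))).
have [e3 e30 h3] := edge_bound ler01 (ccont2l (-1) cG) (fun x hx => nz x (-1) (conj hx m0)
  (fun h => let: conj _ a := h in ltac:(by move: a; rewrite /= ltxx))).
have [e4 e40 h4] := edge_bound ler01 (ccont2l 1 cG) (fun x hx => nz x 1 (conj hx m1)
  (fun h => let: conj _ a := h in ltac:(by move: a; rewrite /= ltxx andbF))).
exists (Num.min (Num.min e1 e2) (Num.min e3 e4)); first by rewrite !lt_min e10 e20 e30 e40.
move=> x y [/= hx hy] nU; rewrite !ge_min.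
have /andP[x0 x1] := hx; have /andP[y0 y1] := hy.
have [z|xn0] := eqVneq x 0; first by rewrite z h1.
have [z|xn1] := eqVneq x 1; first by rewrite z h2 ?orbT.
have [z|yn0] := eqVneq y (-1); first by rewrite z h3 ?orbT.
have [z|yn1] := eqVneq y 1; first by rewrite z h4 ?orbT.
exfalso; apply: nU; split => /=; rewrite !lt_neqAle.
  by rewrite eq_sym xn0 x0 xn1 x1.
by rewrite eq_sym yn0 y0 yn1 y1.
Qed.

(** G is bounded below by e on the boundary. Approximate its components up to e / 8,
    and subtract a regular value of size at most e / 8: the result stays within
    e / 4 of G, is regular at 0, and has finitely many zeros. *)
Lemma degree_exists (f : R * R -> R * R) (G : R -> R -> K) : ccont2 G ->
  (forall x y, in_rect (x, y) -> f (x, y) = (complex.Re (G x y), complex.Im (G x y))) ->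
  (forall x y, in_rect (x, y) -> ~ in_int_rect (x, y) -> G x y != 0) ->
  exists k, is_brouwer_degree f U (0, 0) k.
Proof.
move=> cG fG nz.
have [e e0 he] := boundary_bound cG nz.
have e8 : 0 < e / 8 by rewrite divr_gt0.
have [d d0 hd] := uniform_box cG e8.
have [g1 [g1x [g1y [n1' a1]]]] := @approx (fun x y => complex.Re (G x y)) (e / 8) d (ltW e8) d0
  (fun p q Rp Rq h1 h2 => ltac:(rewrite -cReN -cReD; apply: le_trans (ltW (hd p q Rp Rq h1 h2)); rewrite /norm1 lerDl normr_ge0; exact: isT)).
have [g2 [g2x [g2y [n2' a2]]]] := @approx (fun x y => complex.Im (G x y)) (e / 8) d (ltW e8) d0
  (fun p q Rp Rq h1 h2 => ltac:(rewrite -cImN -cImD; apply: le_trans (ltW (hd p q Rp Rq h1 h2)); rewrite /norm1 lerDr normr_ge0; exact: isT)).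
have [v1 [v2 [/andP[v10 v1e] /andP[v20 v2e] reg]]] := sard n1' n2' e8.
have m1 := taylor2D n1' (taylor2_cst (- v1)); have m2 := taylor2D n2' (taylor2_cst (- v2)).
pose g p := (g1 p.1 p.2 - v1, g2 p.1 p.2 - v2).
have jacE p : jac g p = jac2 g1x g1y g2x g2y p.
  by rewrite (taylor2_jac m1 m2) /jac2 !addr0.
have reg' p : in_rect p -> g p = 0 -> jac2 g1x g1y g2x g2y p != 0.
  by move=> Rp [h1 h2]; apply: reg => //; apply/eqP; rewrite -subr_eq0; apply/eqP.
have [s0 hs0] : exists s : seq (R * R), forall p, in_rect p -> g p = 0 -> p \in s.
  apply: (finite_zeros m1 m2) => p Rp gp; rewrite /jac2 !addr0; exact: reg'.
have UR p : in_int_rect p -> in_rect p.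
  by move=> [/andP[/ltW a /ltW b] /andP[/ltW c' /ltW d']]; split; apply/andP.
pose s := undup [seq p <- s0 | `[< in_int_rect p >] && (g p == 0)].
exists (\sum_(p <- s) sgz (jac g p)), g, s; split => //.
- split; last exact: (taylor2_C1 m1 m2).
  apply: continuous_subspaceT => p.
  by apply: (pair_cont (f1 := fun q => g1 q.1 q.2 - v1)); [exact: (taylor2_cont m1)|exact: (taylor2_cont m2)].
(* In the maximum norm the distance to G is at most e / 4, while the bound e
   on the boundary is for the sum of the components, so e / 2 for the maximum. *)
- move=> [x y] [x' y'] /closure_rectP Rp [/closure_rectP Rq nUq].
  have nU : ~ in_int_rect (x', y') by move=> h; apply: nUq; apply/int_rectP.
  have := he x' y' Rq nU; have := a1 x y Rp; have := a2 x y Rp.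
  rewrite !prod_normE subr0 fG// fG// /g /= /norm1 => b2 b1 hq.
  have A : Num.max `|g1 x y - v1 - complex.Re (G x y)| `|g2 x y - v2 - complex.Im (G x y)| <= e / 4.
    have aux (u v w : R) : `|u - w| <= e / 8 -> 0 <= v -> v <= e / 8 -> `|u - v - w| <= e / 4.
      by rewrite !ler_norml => /andP[? ?] ? ?; apply/andP; split; lra.
    by rewrite ge_max !aux.
  apply: le_lt_trans A _; rewrite lt_max; apply: contrapT => /negP; rewrite negb_or -!leNgt => /andP[l1 l2].
  lra.
- by move=> p /int_rectP/UR Rp gp; rewrite jacE; exact: reg'.
- split; first exact: undup_uniq.
  move=> p; rewrite mem_undup mem_filter; split.
    by case/andP => /andP[/asboolP h /eqP gp] _; split; [apply/int_rectP|].
  move=> [/int_rectP Up gp]; rewrite (asboolT Up) gp eqxx /=; apply: hs0 => //; exact: UR.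
Qed.

End Approximation.

(** * Spectral flow and degree of the determinant map *)

Section Conclusion.
Variables (R : realType) (N : nat) (P Q G : R -> 'M[R]_N) (C : R -> R -> 'M[R]_N)
  (R0 R1 : 'M[R]_(N + N)) (psi : R[i] -> R -> 'M[R[i]]_(N + N)).
Local Notation mu := (@lebesgue_measure R).
Local Notation K := R[i].
Hypothesis (P_C1 : C1mx P) (Q_C1 : C1mx Q) (G_C1 : C1mx G).
Hypothesis (P_unit : forall x, 0 <= x <= 1 -> P x \in unitmx).
Hypothesis (C_sym : forall t x, 0 <= t <= 1 -> 0 <= x <= 1 -> (C t x)^T = C t x).
Hypothesis (C_continuous : forall i j,
     {within (`[0, 1] `*` `[0, 1] : set (R * R)),
       continuous (fun tx : R * R => C tx.1 tx.2 i j)}).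
Hypothesis (A0_self_adjoint : self_adjoint (opA0 P Q G R0 R1)).
Hypothesis (psi_fundamental : forall z, Omega z -> fundamental_solution P Q G C z (psi z)).
Hypothesis (ker_A0 : ker_trivial (opA P Q G C R0 R1 0%:C)).
Hypothesis (ker_A1 : ker_trivial (opA P Q G C R0 R1 1%:C)).

Local Notation sysmx := (sysmx P Q G C).
Local Notation parmx := (parmx R N).
Local Notation A_ t := (opA P Q G C R0 R1 t%:C).
Local Notation Ac := (A_cont P_C1 Q_C1 G_C1 P_unit C_continuous).
Local Notation M t lam := (bdmx parmx (cmx R0) (cmx R1) Ac t lam).
Local Notation F := (chi parmx (cmx R0) (cmx R1) Ac).
Local Notation Y := (fundmx parmx Ac).

Lemma opA0_symmetric u gu y gy : opA0 P Q G R0 R1 u gu -> opA0 P Q G R0 R1 y gy ->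
  inner gu y = inner u gy.
Proof.
move=> Au Ay; have [_ /(_ y gy)[_ h]] := A0_self_adjoint.
by have [_ _] := h Ay; apply.
Qed.

(** The system of the problem at z = t + i s is the pencil with parameter t and
    spectral parameter i s. *)
Lemma JB_pencil t s x : 0 <= t <= 1 -> 0 <= x <= 1 ->
  J R N *m B P Q G C (t +i* s) x = pencil sysmx parmx t (0 +i* s) x.
Proof.
move=> ht hx; rewrite /J /B /pencil /sysmx /sysmx0 /parmx /cm.
rewrite (qmE _ hx) (gmE _ hx) /pm /Cz !clamp_id//=.
move: (cmx (invmx (P x))) (cmx (Q x)) (cmx (G x)) (cmx (C t x)) => p q g c.
rewrite mulmx_block !mul0mx !mulNmx !mul1mx !add0r !addr0 !opprK.
rewrite scale_block_mx !scaler0 scalemx1 !add_block_mx !addr0; congr block_mx.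
by rewrite !opprB addrC addrA.
Qed.

(** Both are the solution of the same Volterra equation. *)
Lemma psi_fundmx t s : 0 <= t <= 1 -> -1 <= s <= 1 -> psi (t +i* s) 1 = Y t (0 +i* s) 1.
Proof.
move=> ht hs; have Oz : Omega (t +i* s) by split.
have [p0 pD] := psi_fundamental Oz.
have pd i j x : 0 <= x <= 1 -> cisD (fun y => psi (t +i* s) y i j) x
    ((pencil sysmx parmx t (0 +i* s) x *m psi (t +i* s) x) i j).
  move=> hx; have [dx Dx] := pD x hx; have := cderivable_cisD (dx i j).
  by have /matrixP/(_ i j) := Dx; rewrite mxE JB_pencil// => ->.
have cw : mcont (fun x => psi (t +i* s) (clamp 0 1 x)).
  move=> i j; apply: (@cwithin_clamp R (fun x => psi (t +i* s) x i j)).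
  by split; apply: isD_within => x hx; [exists (complex.Re (((pencil sysmx parmx t (0 +i* s) x *m psi (t +i* s) x) i j)))|
    exists (complex.Im (((pencil sysmx parmx t (0 +i* s) x *m psi (t +i* s) x) i j)))]; have [] := pd i j x hx.
have cp : mcont (pencil sysmx parmx t (0 +i* s)) := pencil_cont1 parmx Ac t _.
have vw : volterra (pencil sysmx parmx t (0 +i* s)) (fun=> 1%:M) (fun x => psi (t +i* s) (clamp 0 1 x)).
  move=> x hx i j.
  have cg : cwithin (fun x => (pencil sysmx parmx t (0 +i* s) x *m psi (t +i* s) (clamp 0 1 x)) i j).
    by apply: ccont_cwithin; exact: (mcont_mul cp cw).
  rewrite clamp_id// -p0.
  apply: (@cftc R (fun x => psi (t +i* s) x i j) _ cg) => // y hy; rewrite clamp_id//.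
  exact: pd.
have := volterra_uniq cp cw (fundmx_cont parmx Ac t _) vw (@fundmx_volt _ _ _ parmx Ac t _) (i01_1 R).
by rewrite clamp_id// i01_1.
Qed.

Lemma rho_chi t s : 0 <= t <= 1 -> -1 <= s <= 1 -> rho R0 R1 psi (t +i* s) = F t 0 s.
Proof. by move=> ht hs; rewrite /rho psi_fundmx. Qed.

(** A zero of the determinant at 0 would give a nontrivial element of the
    kernel. *)
Lemma chi_ker t : 0 <= t <= 1 -> ker_trivial (A_ t) -> F t 0 0 != 0.
Proof.
move=> ht kt; apply/eqP => /det_ker[v v0 Mv]; move/eqP: v0; apply.
have Mv' : M t (0 : R)%:C *m v = 0 by [].
apply: (eig_zero Mv'); apply: kt.
have [g [Lg [g0 Ag gE]] zE] := eig_bwd ht Mv'.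
split; first by apply: mcont_L2; exact: mcont_cst.
exists g0 => //; apply: aeeq_trans gE; apply: aeeq_trans zE _; apply: aeW => x _.
by rewrite oppr0 scale0r subr0.
Qed.

Lemma spectrum_chi t c : 0 <= t <= 1 -> ~ spectrum (A_ t) c%:C <-> F t (- c) 0 != 0.
Proof.
move=> ht; split => [/contrapT|h].
  exact: (resolvent_chi P_C1 Q_C1 G_C1 P_unit C_continuous ht).
by apply; exact: chi_resolvent h.
Qed.

Lemma spectral_dim t (s : seq R) (c d : R) : 0 <= t <= 1 -> uniq s ->
  (forall r, r \in s <-> - d <= r <= - c /\ F t r 0 = 0) ->
  has_dim (spectral_subspace (A_ t) c d) (\sum_(r <- s) (N + N - \rank (M t r%:C)))%N.
Proof.
move=> ht us sP.
apply: (@has_dim_spectral R N (A_ t) (N + N) (fun r => M t r%:C)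
  (fun r v x => dsubmx (Y t r%:C x *m v))) => //.
- move=> r I k e x; rewrite mulmx_sumr raddf_sum; apply: eq_bigr => i _ /=.
  by rewrite -scalemxAr linearZ.
- by move=> r v; apply: mcont_dsub; exact: Yv_cont.
- by move=> r u; exact: eig_fwd.
- by move=> r v; exact: eig_bwd.
- by move=> r v; exact: eig_zero.
- move=> r r' v v' /ker_bdry_cond bv /ker_bdry_cond bv' rr'.
  apply: (ker_orth P_C1 Q_C1 G_C1 P_unit C_sym C_continuous opA0_symmetric ht _ _ bv bv' _ _ rr').
  + exact: Yv_cont.
  + exact: Yv_cont.
  + exact: fundmx_mul.
  + exact: fundmx_mul.
Qed.

Lemma sf_chi : (spectral_flow (fun t => A_ t) 0 1)%:~R * (2 * pi) = winding (fun t s => F t 0 s) 0 1 (-1) 1.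
Proof.
have i0 : 0 <= (0 : R) <= 1 by rewrite lexx ler01.
have i1 : 0 <= (1 : R) <= 1 by rewrite lexx ler01.
apply: (@spectral_flow_winding R N (fun t => A_ t) F (fun t r => (N + N - \rank (M t r%:C))%N)).
- by move=> T t r s; exact: chi_cont.
- by move=> t r s; exact: (chi_neq0 P_C1 Q_C1 G_C1 P_unit C_sym C_continuous opA0_symmetric).
- by move=> t c; exact: spectrum_chi.
- by move=> t r; exact: (chi_isolated_zero P_C1 Q_C1 G_C1 P_unit C_sym C_continuous opA0_symmetric).
- by move=> t r; exact: (chi_local_index P_C1 Q_C1 G_C1 P_unit C_sym C_continuous opA0_symmetric).
- exact: spectral_dim.
- exact: (chi_ker i0 ker_A0).
- exact: (chi_ker i1 ker_A1).
Qed.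

Lemma degC_chi : (degC (rho R0 R1 psi) (@Omega R))%:~R * (2 * pi) = winding (fun t s => F t 0 s) 0 1 (-1) 1.
Proof.
have i0 : 0 <= (0 : R) <= 1 by rewrite lexx ler01.
have i1 : 0 <= (1 : R) <= 1 by rewrite lexx ler01.
have cG : ccont2 (fun t s => F t 0 s).
  by apply: chi_cont => q; [exact: cvg_fst|exact: cvg_cst|exact: cvg_snd].
have fG x y : in_rect (x, y) -> plane_map (rho R0 R1 psi) (x, y) =
    (complex.Re (F x 0 y), complex.Im (F x 0 y)).
  by move=> [/= hx hy]; rewrite /plane_map /= rho_chi.
apply: (degree_winding cG fG); rewrite /degC /brouwer_degree.
apply: (@xgetPex _ 0 (is_brouwer_degree (plane_map (rho R0 R1 psi)) (plane_set (@Omega R))° (0, 0))).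
apply: (degree_exists cG fG) => x y [/= hx hy] nU.
have [y0|y0] := eqVneq y 0; last exact: (chi_neq0 P_C1 Q_C1 G_C1 P_unit C_sym C_continuous opA0_symmetric).
rewrite y0; have [->|x0] := eqVneq x 0; first exact: (chi_ker i0 ker_A0).
have [->|x1] := eqVneq x 1; first exact: (chi_ker i1 ker_A1).
exfalso; apply: nU; split => /=; last by rewrite y0 ltr01 oppr_lt0 ltr01.
by case/andP: hx => h1 h2; rewrite !lt_neqAle eq_sym x0 h1 x1 h2.
Qed.

Lemma spectral_flow_degC : spectral_flow (fun t => A_ t) 0 1 = degC (rho R0 R1 psi) (@Omega R).
Proof.
have pi2 : 2 * pi != 0 :> R by rewrite gt_eqF// mulr_gt0// pi_gt0.
by have := sf_chi; rewrite -degC_chi => /(mulIf pi2)/intr_inj.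
Qed.

End Conclusion.

Theorem theorem3p11 (R : realType) (N : nat)
  (P Q G : R -> 'M[R]_N) (C : R -> R -> 'M[R]_N) (R0 R1 : 'M[R]_(N + N))
  (psi : R[i] -> R -> 'M[R[i]]_(N + N))
  (P_C1 : C1mx P) (Q_C1 : C1mx Q) (G_C1 : C1mx G)
  (P_sym : forall x, 0 <= x <= 1 -> (P x)^T = P x)
  (G_sym : forall x, 0 <= x <= 1 -> (G x)^T = G x)
  (P_unit : forall x, 0 <= x <= 1 -> P x \in unitmx)
  (C_C1 : forall t, 0 <= t <= 1 -> C1mx (C t))
  (C_sym : forall t x, 0 <= t <= 1 -> 0 <= x <= 1 -> (C t x)^T = C t x)
  (C_0 : forall x, 0 <= x <= 1 -> C 0 x = 0)
  (C_continuous : forall i j,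
     {within (`[0, 1] `*` `[0, 1] : set (R * R)),
       continuous (fun tx : R * R => C tx.1 tx.2 i j)})
  (A0_self_adjoint : self_adjoint (opA0 P Q G R0 R1))
  (psi_fundamental : forall z, Omega z -> fundamental_solution P Q G C z (psi z))
  (ker_A0 : ker_trivial (opA P Q G C R0 R1 0%:C))
  (ker_A1 : ker_trivial (opA P Q G C R0 R1 1%:C)) :
  spectral_flow (fun t => opA P Q G C R0 R1 t%:C) 0 1 = degC (rho R0 R1 psi) (@Omega R).
Proof.
exact: (spectral_flow_degC P_C1 Q_C1 G_C1 P_unit C_sym C_continuous A0_self_adjoint
  psi_fundamental ker_A0 ker_A1).
Qed.
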